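(* The map-germs $(\mathbb R^2,0)\to(\mathrm{Sym}_2,O_2)$ of corank at most $1$ and of $\mathcal G_e$-codimension less than $9$ are classified up to $\mathcal G$-equivalence by the following normal forms, with the indicated $\mathcal G_e$-codimension (''cod'') and corank; ''BN'' is the number of the corresponding normal form in Bruce's complex list (where there is one). 1. $\begin{pmatrix} x_1 & 0 \\ 0 & x_2 \end{pmatrix}$; cod $1$, corank $0$. 2. $\begin{pmatrix} x_1 & x_2 \\ x_2 & -x_1 \end{pmatrix}$; cod $1$, corank $0$. 3. $\begin{pmatrix} x_1 & x_2 \\ x_2 & \pm x_1^\ell \end{pmatrix}$, $\ell\ge2$; cod $\ell$, corank $0$, BN 1. 4. $\begin{pmatrix} x_1 & x_2^\ell \\ x_2^\ell & x_1 \end{pmatrix}$, $\ell\ge2$; cod $2\ell-1$, corank $1$, BN 1. 5. $\begin{pmatrix} \pm x_2^{\ell_1} & x_1 \\ x_1 & \pm x_2^{\ell_2} \end{pmatrix}$, $\ell_1\ge\ell_2\ge2$; cod $\ell_1+\ell_2-1$, corank $1$, BN 1. Here one of the $\pm$ coincides (different choices of that sign give the same class) if $\ell_1$ or $\ell_2$ or both are odd. 6. $\begin{pmatrix} x_1 & x_2^2 \\ x_2^2 & \pm x_1^2 \end{pmatrix}$; cod $6$, corank $1$, BN 5. 7. $\begin{pmatrix} x_1 & 0 \\ 0 & \pm x_2^2\pm x_1^\ell \end{pmatrix}$, $\ell\ge2$; cod $\ell+2$, corank $1$, BN 2. 8. $\begin{pmatrix} x_1 & 0 \\ 0 & x_1x_2\pm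 x_1^\ell \end{pmatrix}$, $\ell\ge3$; cod $2\ell$, corank $1$, BN 3. 9. $\begin{pmatrix} x_1 & x_2^\ell \\ x_2^\ell & x_1x_2 \end{pmatrix}$, $\ell\ge2$; cod $2\ell+1$, corank $1$, BN 4. 10. $\begin{pmatrix} x_1 & 0 \\ 0 & \pm x_1^2+x_2^3 \end{pmatrix}$; cod $7$, corank $1$, BN 6.
   Context: $\mathrm{Sym}_n$ and $\mathrm{GL}_n$ are the real symmetric and the real invertible $n\times n$ matrices, $M_n$ all real $n\times n$ matrices, $O_n$ the $n\times n$ zero matrix; $C^\infty(\mathbb R^r,S)$ is the space of smooth map-germs at $0\in\mathbb R^r$ with values in $S$. $A,B\in C^\infty(\mathbb R^r,\mathrm{Sym}_n)$ are $\mathcal G$-equivalent if $B=X^T(A\circ\Phi)X$ for some diffeomorphism-germ $\Phi:(\mathbb R^r,0)\to(\mathbb R^r,0)$ and some $X\in C^\infty(\mathbb R^r,\mathrm{GL}_n)$. The corank of $A:(\mathbb R^2,0)\to(\mathrm{Sym}_2,O_2)$ is $2-\operatorname{rank}dA(0)$. The $\mathcal G_e$-codimension of $A$ is the real dimension of the quotient of $C^\infty(\mathbb R^r,\mathrm{Sym}_n)$ by the subspace $\{dA(V)+U^TA+AU\}$, where $V$ ranges over all smooth vector field-germs at $0\in\mathbb R^r$ (not necessarily vanishing at $0$) and $U$ over $C^\infty(\mathbb R^r,M_n)$. Bruce's list of $\mathcal G$-simple germs $(\mathbb C^2,0)\to\mathrm{Sym}_2$, with its numbering: (1) $\begin{pmatrix}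 x_2^k & x_1 \\ x_1 & x_2^l \end{pmatrix}$, $k\ge1$, $l\ge2$; (2) $\begin{pmatrix} x_1 & 0 \\ 0 & x_2^2+x_1^k \end{pmatrix}$, $k\ge2$; (3) $\begin{pmatrix} x_1 & 0 \\ 0 & x_1x_2+x_2^k \end{pmatrix}$, $k\ge2$; (4) $\begin{pmatrix} x_1 & x_2^k \\ x_2^k & x_1x_2 \end{pmatrix}$, $k\ge2$; (5) $\begin{pmatrix} x_1 & x_2^2 \\ x_2^2 & x_1^2 \end{pmatrix}$; (6) $\begin{pmatrix} x_1 & 0 \\ 0 & x_1^2+x_2^3 \end{pmatrix}$.
   Formalization: Item 8 is taken as diag(x1, x1x2 ± x2^l): as printed (x1^l) all forms are equivalent to diag(x1, x1x2), of infinite codimension. In item 5 the coincidences are x2→−x2 (flipping both signs if both exponents are odd) and, for l1=l2, exchanging the two signs. *)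

(* Defs.v *)
From HB Require Import structures.
From mathcomp Require Import all_boot all_order all_algebra.
From mathcomp Require Import complex.
From mathcomp Require Import all_classical all_reals all_analysis.

Set Implicit Arguments.
Unset Strict Implicit.
Unset Printing Implicit Defensive.

Import Order.TTheory GRing.Theory Num.Theory.
Import numFieldNormedType.Exports.

Local Open Scope classical_set_scope.
Local Open Scope ring_scope.

(* Germs at 0 are represented by total functions; every property below depends
   only on the values near 0, and equality of germs is equality near 0.  The
   base field [K] is a real field or [R[i]]: over [R[i]], differentiability is
   complex differentiability, so that [smooth_germ] means holomorphic germ. *)
Section Germs.
Variable K : numFieldType.

(* There is one neighbourhood of 0 on which all the iterated directional
   derivatives of [f] exist and are differentiable; on a finite-dimensional
   real space this is smoothness on that neighbourhood. *)
Definition smooth_germ (V W : normedModType K) (f : V -> W) : Prop :=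
  \forall x \near (0 : V), forall vs : seq V,
    differentiable (foldr (fun v (g : V -> W) => 'D_v g) f vs) x.

Definition diffeo_germ r (Phi : 'rV[K]_r -> 'rV[K]_r) : Prop :=
  [/\ smooth_germ Phi, Phi 0 = 0 &
    exists Psi : 'rV[K]_r -> 'rV[K]_r,
      [/\ smooth_germ Psi, Psi 0 = 0,
          \forall x \near (0 : 'rV[K]_r), Psi (Phi x) = x &
          \forall x \near (0 : 'rV[K]_r), Phi (Psi x) = x]].

Definition sym_germ r n (A : 'rV[K]_r -> 'M[K]_n) : Prop :=
  smooth_germ A /\ \forall x \near (0 : 'rV[K]_r), (A x)^T = A x.

Definition GL_germ r n (X : 'rV[K]_r -> 'M[K]_n) : Prop :=
  smooth_germ X /\ \forall x \near (0 : 'rV[K]_r), X x \in unitmx.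

Definition G_equiv r n (A B : 'rV[K]_r -> 'M[K]_n) : Prop :=
  exists (Phi : 'rV[K]_r -> 'rV[K]_r) (X : 'rV[K]_r -> 'M[K]_n),
    [/\ diffeo_germ Phi, GL_germ X &
        \forall x \near (0 : 'rV[K]_r),
          B x = (X x)^T *m A (Phi x) *m X x].

Definition Ge_tangent r n (A C : 'rV[K]_r -> 'M[K]_n) : Prop :=
  exists (V : 'rV[K]_r -> 'rV[K]_r) (U : 'rV[K]_r -> 'M[K]_n),
    [/\ smooth_germ V, smooth_germ U &
        \forall x \near (0 : 'rV[K]_r),
          C x = 'd A x (V x) + (U x)^T *m A x + A x *m U x].

(* The quotient of the symmetric germs by the tangent space has dimension [d]:
   the classes of [B 0, ..., B (d - 1)] form a basis of it. *)
Definition Ge_codim r n (A : 'rV[K]_r -> 'M[K]_n) (d : nat) : Prop :=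
  exists B : 'I_d -> 'rV[K]_r -> 'M[K]_n,
    (forall i, sym_germ (B i)) /\
    forall C : 'rV[K]_r -> 'M[K]_n, sym_germ C ->
      exists! c : 'rV[K]_d,
        Ge_tangent A (fun x => C x - \sum_(i < d) c 0 i *: B i x).

Definition corank (A : 'rV[K]_2 -> 'M[K]_2) : nat :=
  let dA0 : 'rV[K]_2 -> 'M[K]_2 := 'd A (0 : 'rV[K]_2) in
  (2 - \dim (limg (linfun dA0)))%N.

Definition sym2 (a b d : K) : 'M[K]_2 :=
  \matrix_(i, j) (if i != j then b else if i == 0 then a else d).

End Germs.

(* A sign is encoded by a boolean [s], standing for [(-1) ^+ s]. *)
Inductive normal_form : Type :=
  | NF1
  | NF2
  | NF3 of bool & nat
  | NF4 of nat
  | NF5 of bool & bool & nat & nat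
  | NF6 of bool
  | NF7 of bool & bool & nat
  | NF8 of bool & nat
  | NF9 of nat
  | NF10 of bool.

Definition nf_range (f : normal_form) : Prop :=
  match f with
  | NF3 _ l | NF4 l | NF7 _ _ l | NF9 l => (2 <= l)%N
  | NF5 _ _ l1 l2 => (2 <= l2 <= l1)%N
  | NF8 _ l => (3 <= l)%N
  | _ => True
  end.

Definition nf_germ (K : numFieldType) (f : normal_form) (x : 'rV[K]_2) :
    'M[K]_2 :=
  let x1 := x 0 0 in
  let x2 := x 0 1 in
  match f with
  | NF1 => sym2 x1 0 x2
  | NF2 => sym2 x1 x2 (- x1)
  | NF3 s l => sym2 x1 x2 ((-1) ^+ s * x1 ^+ l)
  | NF4 l => sym2 x1 (x2 ^+ l) x1
  | NF5 s1 s2 l1 l2 => sym2 ((-1) ^+ s1 * x2 ^+ l1) x1 ((-1) ^+ s2 * x2 ^+ l2)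
  | NF6 s => sym2 x1 (x2 ^+ 2) ((-1) ^+ s * x1 ^+ 2)
  | NF7 s1 s2 l => sym2 x1 0 ((-1) ^+ s1 * x2 ^+ 2 + (-1) ^+ s2 * x1 ^+ l)
  (* The power is one of [x2]: with a power of [x1] the entry would be
     [x1 * (x2 +- x1 ^+ l.-1)], all [l] would give the germ [diag(x1, x1 x2)]
     up to equivalence, and its codimension is infinite. *)
  | NF8 s l => sym2 x1 0 (x1 * x2 + (-1) ^+ s * x2 ^+ l)
  | NF9 l => sym2 x1 (x2 ^+ l) (x1 * x2)
  | NF10 s => sym2 x1 0 ((-1) ^+ s * x1 ^+ 2 + x2 ^+ 3)
  end.

Arguments nf_germ K f x : clear implicits.

Definition nf_cod (f : normal_form) : nat :=
  match f with
  | NF1 | NF2 => 1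
  | NF3 _ l => l
  | NF4 l => (2 * l - 1)%N
  | NF5 _ _ l1 l2 => (l1 + l2 - 1)%N
  | NF6 _ => 6
  | NF7 _ _ l => (l + 2)%N
  | NF8 _ l => (2 * l)%N
  | NF9 l => (2 * l + 1)%N
  | NF10 _ => 7
  end.

Definition nf_corank (f : normal_form) : nat :=
  match f with
  | NF1 | NF2 | NF3 _ _ => 0
  | _ => 1
  end.

(* The coincidences in the list, all in the fifth family: [x2 |-> - x2] changes
   the sign of the diagonal entries of odd order (so that one sign is
   superfluous as soon as one order is odd), and when both orders are equal
   the two diagonal entries can be exchanged. *)
Definition nf_same_class (f g : normal_form) : Prop :=
  f = g \/
  match f, g with
  | NF5 s1 s2 l1 l2, NF5 t1 t2 m1 m2 =>
      [/\ m1 = l1, m2 = l2 &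
        (t1 = s1 (+) odd l1 /\ t2 = s2 (+) odd l2) \/
        [/\ l1 = l2, t1 = s2 & t2 = s1]]
  | _, _ => False
  end.

Inductive bruce_form : Type :=
  | Bruce1 of nat & nat
  | Bruce2 of nat
  | Bruce3 of nat
  | Bruce4 of nat
  | Bruce5
  | Bruce6.

Definition bruce_range (g : bruce_form) : Prop :=
  match g with
  | Bruce1 k l => (1 <= k)%N /\ (2 <= l)%N
  | Bruce2 k | Bruce3 k | Bruce4 k => (2 <= k)%N
  | Bruce5 | Bruce6 => True
  end.

Definition bruce_number (g : bruce_form) : nat :=
  match g with
  | Bruce1 _ _ => 1
  | Bruce2 _ => 2
  | Bruce3 _ => 3
  | Bruce4 _ => 4
  | Bruce5 => 5
  | Bruce6 => 6
  end.

Definition bruce_germ (K : numFieldType) (g : bruce_form) (x : 'rV[K]_2) :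
    'M[K]_2 :=
  let x1 := x 0 0 in
  let x2 := x 0 1 in
  match g with
  | Bruce1 k l => sym2 (x2 ^+ k) x1 (x2 ^+ l)
  | Bruce2 k => sym2 x1 0 (x2 ^+ 2 + x1 ^+ k)
  | Bruce3 k => sym2 x1 0 (x1 * x2 + x2 ^+ k)
  | Bruce4 k => sym2 x1 (x2 ^+ k) (x1 * x2)
  | Bruce5 => sym2 x1 (x2 ^+ 2) (x1 ^+ 2)
  | Bruce6 => sym2 x1 0 (x1 ^+ 2 + x2 ^+ 3)
  end.

Arguments bruce_germ K g x : clear implicits.

Definition nf_BN (f : normal_form) : option nat :=
  match f with
  | NF1 | NF2 => None
  | NF3 _ _ | NF4 _ | NF5 _ _ _ _ => Some 1%N
  | NF6 _ => Some 5%N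
  | NF7 _ _ _ => Some 2%N
  | NF8 _ _ => Some 3%N
  | NF9 _ => Some 4%N
  | NF10 _ => Some 6%N
  end.

(* The normal forms are polynomial, so the complexification of [nf_germ R f] is
   [nf_germ R[i] f].  Bruce's families overlap (family 2 with [k = 2] is family
   3 with [k = 2]), hence the number is not determined by the class. *)
Definition BN_spec (R : realType) (f : normal_form) : Prop :=
  match nf_BN f with
  | Some b => exists g : bruce_form,
      [/\ bruce_range g, bruce_number g = b &
          G_equiv (nf_germ (R[i] : numFieldType) f)
                  (bruce_germ (R[i] : numFieldType) g)]
  | None => forall g : bruce_form, bruce_range g ->
      ~ G_equiv (nf_germ (R[i] : numFieldType) f)
                (bruce_germ (R[i] : numFieldType) g)
  end.

(* Main.v *)
Require Import Defs.
From HB Require Import structures.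
From mathcomp Require Import all_boot all_order all_algebra.
From mathcomp Require Import complex.
From mathcomp Require Import all_classical all_reals all_analysis.
From mathcomp Require Import ring lra zify.

(** The determinant drives the reduction: a germ with nonzero 1-jet is brought to
    [(x1, b; b, c)] with [b] a function of [x2], and the Morse lemma with
    parameters, Hadamard division and the implicit function theorem, applied to
    [det] or to [c], lead to a normal form, unless so many Taylor coefficients
    vanish that linear functionals killing the tangent space force the
    codimension to be at least 9.  The codimension of a normal form is computed
    by exhibiting functionals on Taylor coefficients whose common kernel is the
    tangent space.  Normal forms are separated by their codimension, by the
    quadratic form [det (dA(0) v)], by the existence of definite values near 0,
    by the 2-jet of [c] once [a = x1], and by orders of vanishing on [x1 = 0].
    Over the complex numbers diagonal linear changes remove all signs, and the
    first two forms are excluded from Bruce's list because [det (dA(0) v)] is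
    invariant under no nonzero translation. *)

Set Implicit Arguments.
Unset Strict Implicit.
Unset Printing Implicit Defensive.

Import Order.TTheory GRing.Theory Num.Theory.
Import numFieldNormedType.Exports.

Local Open Scope classical_set_scope.
Local Open Scope ring_scope.

(** * Smooth germs *)

(** A smooth germ is not determined by its Taylor series, so every reduction has to divide functions
    exactly. Hence the Hadamard quotient is the basic operation; iterated and evaluated at 0 it
    gives Taylor coefficients without factorials, and products of germs become Cauchy products.
    Dividing by powers of a coordinate keeps smoothness because a derivative of [f / x_i^k] is again
    made of such quotients, the Euler operator [x_i d_i - k] supplying the extra order of vanishing.
    The determinant is useful because congruence multiplies it by the square of a unit, and because
    a curve on which it vanishes carries a kernel: a shear along the kernel clears entries there,
    and they become divisible. The bound 9 enters in two ways. Along the families it excludes order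
    at least 10 on an axis, a derivative costing one order. In the two remaining situations, [c]
    without 2-jet, or [c] with 2-jet a multiple of [x1^2] and [b], [c] both too flat on [x1 = 0], it
    is a count: 16 functionals against 7 parameters, and 15 against 6. *)

Section Differentiable.
Variables (K : numFieldType) (V W : normedModType K).
Implicit Types (f g : V -> W) (x : V).

(** Uniqueness of the differential turns an estimate against a candidate [L] into both
    differentiability and the value of ['d f x]; this serves for functions known only through
    estimates. *)
Lemma diff_eps f x (L : {linear V -> W}) : continuous L ->
  (forall e : K, 0 < e ->
     \forall h \near (0 : V), `|f (h + x) - f x - L h| <= e * `|h|) ->
  differentiable f x /\ 'd f x = L :> (V -> W).
Proof.
move=> Lc H.
have E : f \o shift x = cst (f x) + L +o_ (0 : V) id.
  apply/eqaddoP => e e0; near=> h.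
  rewrite /= !fctE /= opprD addrA.
  by near: h; exact: H.
have D : 'd f x = L :> (V -> W) by exact: diff_unique.
split=> //; apply/diff_locallyP; split; first by rewrite D.
by rewrite D.
Unshelve. all: by end_near. Qed.

Lemma differentiable_eps f x : differentiable f x ->
  forall e : K, 0 < e ->
     \forall h \near (0 : V), `|f (h + x) - f x - 'd f x h| <= e * `|h|.
Proof.
move=> /diff_locally /eqaddoP H e e0; near=> h.
have : `|(f \o shift x - (cst (f x) + 'd f x)) h| <= e * `|id h|.
  by near: h; exact: H.
by rewrite /= !fctE /= opprD addrA.
Unshelve. all: by end_near. Qed.

Lemma near_eq_differentiable f g x : (\forall y \near x, f y = g y) ->
  differentiable f x -> differentiable g x /\ 'd g x = 'd f x :> (V -> W).
Proof.
move=> E D; apply: diff_eps; first exact: diff_continuous.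
move=> e e0; near=> h.
have -> : g (h + x) = f (h + x).
  apply/esym; near: h; move: E.
  by rewrite (near_shift 0) subr0.
rewrite -(nbhs_singleton E).
by near: h; exact: differentiable_eps.
Unshelve. all: by end_near. Qed.

End Differentiable.

Section SmoothOn.
Variables (K : numFieldType) (V W : normedModType K).
Implicit Types (f g : V -> W) (x a : V) (U : set V).

(** Fixing the open set once and for all allows derivatives to be taken repeatedly without shrinking
    it. *)
Definition smooth_on U f := forall x, U x -> forall vs : seq V,
  differentiable (foldr (fun v (g : V -> W) => 'D_v g) f vs) x.

(** Base points other than 0 occur in compositions, and whenever smoothness at 0 is exploited at all
    nearby points. *)
Definition smooth_at a f := exists U, [/\ open U, U a & smooth_on U f].

Lemma smooth_germP f : smooth_germ f <-> smooth_at 0 f.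
Proof.
split=> [H|[U [oU U0 H]]].
  exists (interior [set x | forall vs : seq V,
    differentiable (foldr (fun v (g : V -> W) => 'D_v g) f vs) x]).
  split; [exact: open_interior|exact: H|].
  by move=> x /interior_subset.
by rewrite /smooth_germ; near=> x; apply: H; near: x; exact: open_nbhs_nbhs.
Unshelve. all: by end_near. Qed.

Lemma smooth_on_sub U U' f : U' `<=` U -> smooth_on U f -> smooth_on U' f.
Proof. by move=> sU H x /sU /H. Qed.

Lemma smooth_on_differentiable U f x : smooth_on U f -> U x ->
  differentiable f x.
Proof. by move=> H /H /(_ [::]). Qed.

Lemma smooth_on_derive U f v : smooth_on U f -> smooth_on U ('D_v f).
(* The new derivative is the innermost one, hence [rcons]. *)
Proof. by move=> H x Ux vs; have := H x Ux (rcons vs v); rewrite foldr_rcons. Qed.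

Lemma open_near U x (P : V -> Prop) : open U -> U x ->
  (forall y, U y -> P y) -> \forall y \near x, P y.
Proof. by move=> oU Ux H; apply: filterS (open_nbhs_nbhs (conj oU Ux)). Qed.

Lemma derive_eq_open U f g x v : open U -> U x -> (forall y, U y -> f y = g y) ->
  'D_v f x = 'D_v g x.
Proof.
move=> oU Ux E; have [->|v0] := eqVneq v 0; first by rewrite !derive0.
by apply: near_eq_derive => //; exact: open_near E.
Qed.

Lemma differentiable_eq_open U f g x : open U -> U x ->
  (forall y, U y -> f y = g y) -> differentiable f x -> differentiable g x.
Proof. by move=> oU Ux E /(near_eq_differentiable (open_near oU Ux E))[]. Qed.

(* Coinduction: a set of differentiable functions stable under directional
   derivatives consists of smooth functions. *)
Lemma smooth_on_coind U (S : (V -> W) -> Prop) : open U ->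
  (forall g, S g -> forall x, U x -> differentiable g x) ->
  (forall g v, S g -> exists2 g', S g' & forall x, U x -> 'D_v g x = g' x) ->
  forall g, S g -> smooth_on U g.
Proof.
move=> oU dS DS g Sg x Ux vs.
have [g' Sg' E] : exists2 g', S g' & forall x, U x ->
    foldr (fun v (g : V -> W) => 'D_v g) g vs x = g' x.
  elim: vs => [|v vs [g' Sg' IH]] /=; first by exists g.
  have [g2 Sg2 E] := DS g' v Sg'; exists g2 => // y Uy.
  by rewrite (derive_eq_open v oU Uy IH) E.
by apply: (differentiable_eq_open oU Ux _ (dS _ Sg' x Ux)) => y /E.
Qed.

(** The derivatives of [g] agree with those of [f] only on [U]; openness carries this agreement
    through each further derivative. *)
Lemma smooth_on_eq U f g : open U -> (forall x, U x -> f x = g x) ->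
  smooth_on U f -> smooth_on U g.
Proof.
move=> oU E sf.
pose S h := exists2 h', smooth_on U h' & forall x, U x -> h' x = h x.
apply: (@smooth_on_coind U S) => //; last by exists f.
  move=> h [h' sh' Eh] x Ux.
  by apply: differentiable_eq_open Eh _ => //; exact: smooth_on_differentiable Ux.
move=> h v [h' sh' Eh]; exists ('D_v h).
  by exists ('D_v h'); [exact: smooth_on_derive|move=> x Ux; exact: derive_eq_open Eh].
by [].
Qed.

Lemma smooth_on_cst U (c : W) : open U -> smooth_on U (fun=> c).
Proof.
move=> oU; apply: (@smooth_on_coind U (fun g => exists c, g = fun=> c)) => //.
- by move=> _ [c' ->] x _; exact: differentiable_cst.
- move=> _ v [c' ->]; exists (fun=> 0); first by exists 0.
  by move=> x _; exact: derive_cst.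
- by exists c.
Qed.

Lemma smooth_on_linear U (L : {linear V -> W}) : continuous L -> open U ->
  smooth_on U L.
Proof.
move=> cL oU.
apply: (@smooth_on_coind U (fun g => (g = L) \/ exists c, g = fun=> c)) => //.
- move=> _ [->|[c ->]] x _; first exact: linear_differentiable.
  exact: differentiable_cst.
- move=> _ v [->|[c ->]]; last first.
    by exists (fun=> 0); [right; exists 0|move=> x _; exact: derive_cst].
  exists (fun=> L v); first by right; exists (L v).
  move=> x _; rewrite deriveE; last exact: linear_differentiable.
  by rewrite diff_lin.
- by left.
Qed.

Lemma smooth_at_germ f g a : smooth_at a f -> (\forall x \near a, f x = g x) ->
  smooth_at a g.
Proof.
move=> [U [oU Ua sf]] E.
exists (U `&` interior [set x | f x = g x]); split.
- by apply: openI => //; exact: open_interior.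
- by split.
apply: smooth_on_eq (smooth_on_sub _ sf).
- by apply: openI => //; exact: open_interior.
- by move=> x [_ /interior_subset].
- by move=> x [].
Qed.

Lemma smooth_at_derive f v a : smooth_at a f -> smooth_at a ('D_v f).
Proof. by move=> [U [oU Ua sf]]; exists U; split=> //; exact: smooth_on_derive. Qed.

Lemma smooth_at_cst a (c : W) : smooth_at a (fun=> c).
Proof. by exists setT; split=> //; [exact: openT|exact: smooth_on_cst openT]. Qed.

Lemma smooth_at_linear a (L : {linear V -> W}) : continuous L -> smooth_at a L.
Proof. by exists setT; split=> //; [exact: openT|exact: smooth_on_linear openT]. Qed.

Lemma smooth_at_near f a : smooth_at a f -> \forall x \near a, smooth_at x f.
Proof. by move=> [U [oU Ua sf]]; apply: (open_near oU Ua) => y Uy; exists U. Qed.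

Lemma smooth_at_differentiable f a : smooth_at a f -> differentiable f a.
Proof. by move=> [U [oU Ua sf]]; exact: smooth_on_differentiable Ua. Qed.

End SmoothOn.

(** * The algebra of smooth functions *)

Section SmoothScalar.
Variables (K : numFieldType) (V : normedModType K).
Implicit Types (f g : V -> K) (x a : V) (U : set V).

(** Derivatives of products, composites and quotients are polynomials in functions of the original
    shape, so a set meant to be stable under derivatives has to be closed under sums and
    products. *)
Inductive alg_gen (P : (V -> K) -> Prop) : (V -> K) -> Prop :=
| alg_gen_base g : P g -> alg_gen P g
| alg_gen_add f g : alg_gen P f -> alg_gen P g -> alg_gen P (fun x => f x + g x)
| alg_gen_mul f g : alg_gen P f -> alg_gen P g -> alg_gen P (fun x => f x * g x).

Lemma alg_gen_differentiable U (P : (V -> K) -> Prop) :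
  (forall g, P g -> forall x, U x -> differentiable g x) ->
  forall g, alg_gen P g -> forall x, U x -> differentiable g x.
Proof.
move=> dP g; elim=> {g}.
- by move=> g Pg x Ux; exact: dP.
- move=> f g _ IHf _ IHg x Ux; apply: (@differentiableD _ _ _ f g) => //.
  + exact: IHf.
  + exact: IHg.
- move=> f g _ IHf _ IHg x Ux; apply: (@differentiableM _ _ f g) => //.
  + exact: IHf.
  + exact: IHg.
Qed.

(** By the Leibniz rule it is enough that the derivatives of the generators lie in the generated
    algebra; coinduction does the rest. *)
Lemma alg_gen_smooth U (P : (V -> K) -> Prop) : open U ->
  (forall g, P g -> forall x, U x -> differentiable g x) ->
  (forall g v, P g ->
     exists2 g', alg_gen P g' & forall x, U x -> 'D_v g x = g' x) ->
  forall g, alg_gen P g -> smooth_on U g.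
Proof.
move=> oU dP DP; have dG := alg_gen_differentiable dP.
apply: smooth_on_coind => // g v; elim=> {g}.
- by move=> g /DP.
- move=> f g Pf [f' Sf' Ef] Pg [g' Sg' Eg].
  exists (fun x => f' x + g' x); first exact: alg_gen_add.
  move=> x Ux; rewrite -Ef // -Eg //; apply: (@deriveD _ _ _ f g).
    by apply: diff_derivable; exact: dG.
  by apply: diff_derivable; exact: dG.
- move=> f g Pf [f' Sf' Ef] Pg [g' Sg' Eg].
  exists (fun x => f x * g' x + g x * f' x).
    by apply: alg_gen_add; apply: alg_gen_mul.
  move=> x Ux; rewrite -Ef // -Eg //; apply: (@deriveM _ _ f g).
    by apply: diff_derivable; exact: dG.
  by apply: diff_derivable; exact: dG.
Qed.

Lemma alg_gen_smooth_on U : open U -> forall g, alg_gen (smooth_on U) g -> smooth_on U g.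
Proof.
move=> oU; apply: alg_gen_smooth => //.
  by move=> g sg x; exact: smooth_on_differentiable.
move=> g v sg; exists ('D_v g) => //; apply: alg_gen_base.
exact: smooth_on_derive.
Qed.

Lemma smooth_on_add U f g : open U -> smooth_on U f -> smooth_on U g ->
  smooth_on U (fun x => f x + g x).
Proof.
move=> oU sf sg; apply: alg_gen_smooth_on => //.
by apply: alg_gen_add; apply: alg_gen_base.
Qed.

Lemma smooth_on_mul U f g : open U -> smooth_on U f -> smooth_on U g ->
  smooth_on U (fun x => f x * g x).
Proof.
move=> oU sf sg; apply: alg_gen_smooth_on => //.
by apply: alg_gen_mul; apply: alg_gen_base.
Qed.

Lemma smooth_at2 (T1 T2 : normedModType K) (f : V -> T1) (g : V -> T2) a :
  smooth_at a f -> smooth_at a g ->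
  exists U, [/\ open U, U a, smooth_on U f & smooth_on U g].
Proof.
move=> [U [oU Ua sf]] [U' [oU' Ua' sg]]; exists (U `&` U'); split=> //.
- exact: openI.
- by apply: smooth_on_sub sf => x [].
- by apply: smooth_on_sub sg => x [].
Qed.

Lemma smooth_at_add f g a : smooth_at a f -> smooth_at a g ->
  smooth_at a (fun x => f x + g x).
Proof.
move=> sf sg; have [U [oU Ua {}sf {}sg]] := smooth_at2 sf sg.
by exists U; split=> //; exact: smooth_on_add.
Qed.

Lemma smooth_at_mul f g a : smooth_at a f -> smooth_at a g ->
  smooth_at a (fun x => f x * g x).
Proof.
move=> sf sg; have [U [oU Ua {}sf {}sg]] := smooth_at2 sf sg.
by exists U; split=> //; exact: smooth_on_mul.
Qed.

Lemma smooth_at_opp f a : smooth_at a f -> smooth_at a (fun x => - f x).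
Proof.
move=> sf; rewrite (_ : (fun x => - f x) = fun x => (-1) * f x).
  by apply: smooth_at_mul => //; exact: smooth_at_cst.
by apply/funext => x; rewrite mulN1r.
Qed.

Lemma smooth_at_sub f g a : smooth_at a f -> smooth_at a g ->
  smooth_at a (fun x => f x - g x).
Proof. by move=> sf sg; apply: smooth_at_add => //; exact: smooth_at_opp. Qed.

Lemma smooth_at_exp f n a : smooth_at a f -> smooth_at a (fun x => f x ^+ n).
Proof.
move=> sf; elim: n => [|n IH]; first exact: smooth_at_cst.
rewrite (_ : (fun x => f x ^+ n.+1) = fun x => f x * f x ^+ n).
  exact: smooth_at_mul.
by apply/funext => x; rewrite exprS.
Qed.

End SmoothScalar.

Section SmoothVector.
Variables (K : numFieldType) (V : normedModType K).

Lemma smooth_at_coord m n (i : 'I_m) (j : 'I_n) (a : 'M[K]_(m, n)) :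
  smooth_at a (fun M : 'M[K]_(m, n) => M i j).
Proof.
have L : linear (fun M : 'M[K]_(m, n) => M i j : K^o).
  by move=> c M N; rewrite !mxE.
pose l := GRing.isLinear.Build K 'M[K]_(m, n) K^o _ (fun M => M i j) L.
pose l' : {linear 'M[K]_(m, n) -> K^o} := HB.pack (fun M : 'M[K]_(m, n) => M i j : K^o) l.
have := @smooth_at_linear K _ _ a l'; apply; exact: coord_continuous.
Qed.

(** As a sum of scalar functions times the matrices [delta_mx k l], a matrix-valued function is
    differentiated entry by entry, and its derivatives have the same form. *)
Lemma smooth_on_entries m n U (f : 'I_m -> 'I_n -> V -> K) : open U ->
  (forall i j, smooth_on U (f i j)) ->
  smooth_on U (fun x => \matrix_(i, j) f i j x : 'M[K]_(m, n)).
Proof.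
move=> oU sf.
pose S (F : V -> 'M[K]_(m, n)) := exists2 f : 'I_m -> 'I_n -> V -> K,
  (forall i j, smooth_on U (f i j)) & F = fun x => \matrix_(i, j) f i j x.
have E (g : 'I_m -> 'I_n -> V -> K) : (fun x => \matrix_(i, j) g i j x) =
   fun x => \sum_(k < m) (\sum_(l < n) g k l x *: delta_mx k l).
  apply/funext => x; rewrite [LHS]matrix_sum_delta.
  by apply: eq_bigr => k _; apply: eq_bigr => l _; rewrite mxE.
have D (g : 'I_m -> 'I_n -> V -> K) x : (forall i j, differentiable (g i j) x) ->
   is_diff x (fun x => \matrix_(i, j) g i j x : 'M[K]_(m, n)) (fun v => \matrix_(i, j) 'd (g i j) x v).
  move=> dg.
  have Ds (I : finType) (h : I -> V -> 'M[K]_(m, n)) (dh : I -> V -> 'M[K]_(m, n)) :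
      (forall i, is_diff x (h i) (dh i)) ->
      is_diff x (fun x => \sum_i h i x) (fun v => \sum_i dh i v).
    move=> dH; elim: (index_enum I) => [|i r IH].
      rewrite [X in is_diff _ X](_ : _ = cst 0) ?funeqE => [|y]; last first.
        by rewrite big_nil.
      rewrite [X in is_diff _ _ X](_ : _ = 0) ?funeqE => [|y]; last first.
        by rewrite big_nil.
      exact: is_diff_cst.
    rewrite [X in is_diff _ X](_ : _ = h i + fun x => \sum_(i <- r) h i x);
      last by apply/funext => y; rewrite big_cons.
    rewrite [X in is_diff _ _ X](_ : _ = dh i + fun x => \sum_(i <- r) dh i x);
      last by apply/funext => y; rewrite big_cons.
    exact: is_diffD.
  rewrite E; have -> : (fun v => \matrix_(i, j) 'd (g i j) x v) =
     fun v => \sum_(k < m) (\sum_(l < n) 'd (g k l) x v *: delta_mx k l : 'M[K]_(m, n)).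
    apply/funext => v; rewrite [LHS]matrix_sum_delta.
    by apply: eq_bigr => k _; apply: eq_bigr => l _; rewrite mxE.
  apply: (Ds) => k; apply: (Ds) => l; apply: DiffDef.
    by apply: differentiableZl.
  by rewrite diffZl.
apply: (@smooth_on_coind _ _ _ U S) => //; last by exists f.
  move=> _ [g sg ->] x Ux.
  have Dx := D g x (fun i j => smooth_on_differentiable (sg i j) Ux).
  exact: (@ex_diff _ _ _ _ _ _ _ Dx).
move=> _ v [g sg ->]; exists (fun x => \matrix_(i, j) 'D_v (g i j) x).
  exists (fun i j => 'D_v (g i j)) => // i j; exact: smooth_on_derive.
move=> x Ux; have Dx := D g x (fun i j => smooth_on_differentiable (sg i j) Ux).
rewrite deriveE; last exact: ex_diff.
rewrite (@diff_val _ _ _ _ _ _ _ Dx); apply/matrixP => i j; rewrite !mxE.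
by rewrite deriveE //; exact: smooth_on_differentiable Ux.
Qed.

End SmoothVector.

Section SmoothComp.
Variables (K : numFieldType) (V : normedModType K).

Lemma derive_lin_comp (W W' : normedModType K) (L : {linear W -> W'})
    (f : V -> W) x v : continuous L -> differentiable f x ->
  'D_v (fun y => L (f y)) x = L ('D_v f x).
Proof.
move=> cL df; rewrite -[fun y => _]/(L \o f).
rewrite deriveE; last by apply: differentiable_comp => //; exact: linear_differentiable.
rewrite diff_comp //; last exact: linear_differentiable.
by rewrite /= diff_lin // deriveE.
Qed.

Lemma smooth_on_lin_comp (W W' : normedModType K) U (L : {linear W -> W'})
    (f : V -> W) : continuous L -> open U ->
  smooth_on U f -> smooth_on U (fun x => L (f x)).
Proof.
move=> cL oU sf.
apply: (@smooth_on_coind _ _ _ U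
  (fun h => exists2 g, smooth_on U g & h = L \o g)) => //; last by exists f.
  move=> _ [g sg ->] x Ux; apply: differentiable_comp.
    exact: smooth_on_differentiable Ux.
  exact: linear_differentiable.
move=> _ v [g sg ->]; exists (L \o 'D_v g).
  by exists ('D_v g) => //; exact: smooth_on_derive.
move=> x Ux; apply: derive_lin_comp => //; exact: smooth_on_differentiable Ux.
Qed.

Lemma smooth_at_entry m n (f : V -> 'M[K]_(m, n)) i j a :
  smooth_at a f -> smooth_at a (fun x => f x i j).
Proof.
move=> [U [oU Ua sf]]; exists U; split=> //.
have L : linear (fun M : 'M[K]_(m, n) => M i j : K^o).
  by move=> c M N; rewrite !mxE.
pose l := GRing.isLinear.Build K 'M[K]_(m, n) K^o _ (fun M => M i j) L.
pose l' : {linear 'M[K]_(m, n) -> K^o} :=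
  HB.pack (fun M : 'M[K]_(m, n) => M i j : K^o) l.
have := @smooth_on_lin_comp _ _ U l' f; apply=> //; exact: coord_continuous.
Qed.

Lemma smooth_on_entry m n (f : V -> 'M[K]_(m, n)) i j U : open U ->
  smooth_on U f -> smooth_on U (fun x => f x i j).
Proof.
move=> oU sf x Ux; have [] := @smooth_at_entry _ _ f i j x.
  by exists U.
by move=> U' [_ U'x]; apply.
Qed.

(** Finitely many neighbourhoods are intersected, so that all the entries of a matrix become smooth
    on a common one. *)
Lemma finite_open (I : finType) (P : I -> set V -> Prop) a :
  (forall i U U', U' `<=` U -> P i U -> P i U') ->
  (forall i, exists U, [/\ open U, U a & P i U]) ->
  exists U, [/\ open U, U a & forall i, P i U].
Proof.
move=> mP H.
have [U HU] : exists U : I -> set V, forall i, [/\ open (U i), U i a & P i (U i)].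
  exists (fun i => sval (cid (H i))) => i; exact: svalP (cid (H i)).
exists (interior [set x | forall i, U i x]); split; first exact: open_interior.
  have : \forall x \near a, forall i : I, U i x.
    apply: filter_forall => i; have [oU Ua _] := HU i.
    exact: open_nbhs_nbhs.
  by [].
move=> i; have [oU Ua PU] := HU i.
by apply: mP PU => x /interior_subset; apply.
Qed.

Lemma smooth_at_entries m n (f : V -> 'M[K]_(m, n)) a :
  (forall i j, smooth_at a (fun x => f x i j)) -> smooth_at a f.
Proof.
move=> sf.
have [U [oU Ua H]] := @finite_open ('I_m * 'I_n)%type
  (fun ij U => smooth_on U (fun x => f x ij.1 ij.2)) a
  (fun ij U U' sU => @smooth_on_sub _ _ _ _ _ _ sU) (fun ij => sf ij.1 ij.2).
exists U; split=> //.
rewrite (_ : f = fun x => \matrix_(i, j) f x i j).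
  by apply: smooth_on_entries => // i j; exact: (H (i, j)).
by apply/funext => x; apply/matrixP => i j; rewrite mxE.
Qed.

Lemma derive_sum_rV n (h : 'rV[K]_n -> K) p w : differentiable h p ->
  'D_w h p = \sum_(i < n) w 0 i * 'D_(delta_mx 0 i) h p.
Proof.
move=> dh; rewrite deriveE // [in LHS](row_sum_delta w) linear_sum.
by apply: eq_bigr => i _; rewrite linearZ deriveE.
Qed.

Lemma derive_entry m n (f : V -> 'M[K]_(m, n)) x v i j : differentiable f x ->
  ('D_v f x) i j = 'D_v (fun y => f y i j) x.
Proof.
move=> df.
have L : linear (fun M : 'M[K]_(m, n) => M i j : K^o).
  by move=> c M N; rewrite !mxE.
pose l := GRing.isLinear.Build K 'M[K]_(m, n) K^o _ (fun M => M i j) L.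
pose l' : {linear 'M[K]_(m, n) -> K^o} :=
  HB.pack (fun M : 'M[K]_(m, n) => M i j : K^o) l.
have cl : continuous l' by exact: coord_continuous.
exact/esym/(derive_lin_comp (L := l')).
Qed.

Lemma derive_comp n (h : 'rV[K]_n -> K) (Phi : V -> 'rV[K]_n) x v :
  differentiable Phi x -> differentiable h (Phi x) ->
  'D_v (fun x => h (Phi x)) x =
    \sum_(i < n) 'D_v (fun x => Phi x 0 i) x * 'D_(delta_mx 0 i) h (Phi x).
Proof.
move=> dP dh; rewrite -[fun x => h _]/(h \o Phi).
rewrite deriveE; last exact: differentiable_comp.
rewrite diff_comp //= -deriveE // -deriveE // derive_sum_rV //.
by apply: eq_bigr => i _; rewrite derive_entry.
Qed.

(** By the chain rule a derivative of [k] after [Phi] is a sum of products of derivatives of entries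
    of [Phi] with composites of the same kind. Smooth functions and composites together are
    therefore suitable generators. *)
Lemma smooth_on_comp n U U' (h : 'rV[K]_n -> K) (Phi : V -> 'rV[K]_n) :
  open U -> smooth_on U Phi -> (forall x, U x -> U' (Phi x)) ->
  smooth_on U' h -> smooth_on U (fun x => h (Phi x)).
Proof.
move=> oU sP PU sh.
pose P (g : V -> K) := smooth_on U g \/
  exists2 k : 'rV[K]_n -> K, smooth_on U' k & g = k \o Phi.
have dP g : P g -> forall x, U x -> differentiable g x.
  move=> [sg|[k sk ->]] x Ux; first exact: smooth_on_differentiable Ux.
  apply: differentiable_comp; first exact: smooth_on_differentiable Ux.
  apply: smooth_on_differentiable sk _; exact: PU.
apply: (@alg_gen_smooth _ _ U P) => //; last first.
  by apply: alg_gen_base; right; exists h.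
move=> g v [sg|[k sk ->]].
  by exists ('D_v g) => //; apply: alg_gen_base; left; exact: smooth_on_derive.
exists (fun x => \sum_(i < n) 'D_v (fun x => Phi x 0 i) x * 'D_(delta_mx 0 i) k (Phi x)).
  elim: (index_enum _) => [|i r IH].
    rewrite (_ : (fun x => _) = fun=> 0).
      by apply: alg_gen_base; left; exact: smooth_on_cst.
    by apply/funext => x; rewrite big_nil.
  rewrite (_ : (fun x => _) = fun x =>
    'D_v (fun x => Phi x 0 i) x * 'D_(delta_mx 0 i) k (Phi x) +
    \sum_(i <- r) 'D_v (fun x => Phi x 0 i) x * 'D_(delta_mx 0 i) k (Phi x)); last first.
    by apply/funext => x; rewrite big_cons.
  apply: alg_gen_add => //; apply: alg_gen_mul; apply: alg_gen_base.
    by left; apply: smooth_on_derive; exact: smooth_on_entry.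
  by right; exists ('D_(delta_mx 0 i) k) => //; exact: smooth_on_derive.
move=> x Ux; apply: derive_comp; first exact: smooth_on_differentiable Ux.
by apply: smooth_on_differentiable sk _; exact: PU.
Qed.

Lemma smooth_at_comp n (h : 'rV[K]_n -> K) (Phi : V -> 'rV[K]_n) a :
  smooth_at a Phi -> smooth_at (Phi a) h -> smooth_at a (fun x => h (Phi x)).
Proof.
move=> [U [oU Ua sP]] [U' [oU' Ua' sh]].
have cP : {for a, continuous Phi}.
  by apply: differentiable_continuous; exact: smooth_on_differentiable Ua.
exists (U `&` interior (Phi @^-1` U')); split.
- by apply: openI => //; exact: open_interior.
- by split=> //; apply: cP; exact: open_nbhs_nbhs.
apply: smooth_on_comp sh.
- by apply: openI => //; exact: open_interior.
- by apply: smooth_on_sub sP => x [].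
- by move=> x [_ /interior_subset].
Qed.

Lemma smooth_at_continuous (W : normedModType K) (f : V -> W) a :
  smooth_at a f -> {for a, continuous f}.
Proof. by move=> /smooth_at_differentiable /differentiable_continuous. Qed.

End SmoothComp.

Lemma smooth_at_comp_mx (K : numFieldType) (V : normedModType K) n p q (h : 'rV[K]_n -> 'M[K]_(p, q)) (Phi : V -> 'rV[K]_n) a :
  smooth_at a Phi -> smooth_at (Phi a) h -> smooth_at a (fun x => h (Phi x)).
Proof.
move=> sP sh; apply: smooth_at_entries => i j.
apply: (smooth_at_comp (h := fun y => h y i j)) => //; exact: smooth_at_entry.
Qed.

Section SmoothReal.
Variables (R : realType) (V : normedModType R).

Lemma near_pos (f : V -> R) a : smooth_at a f -> 0 < f a ->
  \forall x \near a, 0 < f x.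
Proof. by move=> /smooth_at_continuous cf; exact: (cvgr_gt _ cf). Qed.

Lemma near_neq0 (f : V -> R) a : smooth_at a f -> f a != 0 ->
  \forall x \near a, f x != 0.
Proof. by move=> /smooth_at_continuous cf; exact: (cvgr_neq0 _ cf). Qed.

Lemma diff_powR (f : V -> R) (c : R) x v : differentiable f x -> 0 < f x ->
  differentiable (fun y => f y `^ c) x /\
  'D_v (fun y => f y `^ c) x = c * f x `^ (c - 1) * 'D_v f x.
Proof.
move=> df f0.
have dp : differentiable (fun y : R => y `^ c) (f x).
  apply/derivable1_diffP; apply: derivable_powR.
  by rewrite in_itv /= andbT.
split; first exact: (differentiable_comp (g := fun y : R => y `^ c)).
rewrite -[fun y => _]/((fun y : R => y `^ c) \o f).
rewrite deriveE; last exact: differentiable_comp.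
rewrite diff_comp //= (deriv1E ((derivable1_diffP _ _).2 dp)) powR_derive1.
  by rewrite -[LHS]/(_ * _) mulrC deriveE.
by rewrite in_itv /= andbT.
Qed.

Lemma smooth_at_powR (f : V -> R) (c : R) a : smooth_at a f -> 0 < f a ->
  smooth_at a (fun x => f x `^ c).
Proof.
move=> sf fa.
have [U [oU Ua sfU]] := sf.
pose U' := U `&` interior [set x | 0 < f x].
have oU' : open U' by apply: openI => //; exact: open_interior.
have U'a : U' a.
  by split=> //; exact: near_pos.
have sf' : smooth_on U' f by apply: smooth_on_sub sfU => x [].
have f0 x : U' x -> 0 < f x by move=> [_ /interior_subset].
exists U'; split=> //.
pose P (g : V -> R) := smooth_on U' g \/ exists c, g = fun x => f x `^ c.
apply: (@alg_gen_smooth _ _ U' P) => //; last by apply: alg_gen_base; right; exists c.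
  move=> g [sg|[d ->]] x Ux; first exact: smooth_on_differentiable Ux.
  by have [] := @diff_powR f d x 0 (smooth_on_differentiable sf' Ux) (f0 _ Ux).
move=> g v [sg|[d ->]].
  by exists ('D_v g) => //; apply: alg_gen_base; left; exact: smooth_on_derive.
exists (fun x => d * f x `^ (d - 1) * 'D_v f x).
  apply: alg_gen_mul; last by apply: alg_gen_base; left; exact: smooth_on_derive.
  apply: alg_gen_mul; apply: alg_gen_base; first by left; exact: smooth_on_cst.
  by right; exists (d - 1).
move=> x Ux.
by have [_ ->] := @diff_powR f d x v (smooth_on_differentiable sf' Ux) (f0 _ Ux).
Qed.

Lemma smooth_at_inv (f : V -> R) a : smooth_at a f -> f a != 0 ->
  smooth_at a (fun x => (f x)^-1).
Proof.
move=> sf fa.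
(* A real power needs a positive base; squaring first covers both signs of [f a]. *)
apply: (@smooth_at_germ _ _ _ (fun x => f x * (f x ^+ 2) `^ (-1))).
  apply: smooth_at_mul => //; apply: smooth_at_powR; first exact: smooth_at_exp.
  by rewrite exprn_even_gt0.
near=> x; rewrite powR_inv1 ?sqr_ge0 //.
have fx : f x != 0.
  by near: x; exact: near_neq0.
by rewrite expr2 invfM mulrA divff // mul1r.
Unshelve. all: by end_near. Qed.

Lemma smooth_at_div (f g : V -> R) a : smooth_at a f -> smooth_at a g -> g a != 0 ->
  smooth_at a (fun x => f x / g x).
Proof. by move=> sf sg ga; apply: smooth_at_mul => //; exact: smooth_at_inv. Qed.

Lemma smooth_at_sqrt (f : V -> R) a : smooth_at a f -> 0 < f a ->
  smooth_at a (fun x => Num.sqrt (f x)).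
Proof.
move=> sf fa.
apply: (@smooth_at_germ _ _ _ (fun x => (f x) `^ (2^-1))).
  exact: smooth_at_powR.
near=> x; rewrite powR12_sqrt //; apply: ltW; near: x.
exact: near_pos.
Unshelve. all: by end_near. Qed.

End SmoothReal.

Lemma MVT01 (R : realType) (g dg : R -> R) :
  (forall t : R, 0 <= t <= 1 -> is_derive t 1 g (dg t)) ->
  exists2 t, 0 <= t <= 1 & g 1 - g 0 = dg t.
Proof.
move=> H; have [|||t] := @MVT_segment R g dg 0 1.
- exact: ler01.
- by move=> t; rewrite in_itv /= => /andP[t0 t1]; apply: H; rewrite !ltW.
- apply: derivable_within_continuous => t; rewrite in_itv /= => /H Ht.
  exact: ex_derive.
by rewrite in_itv /= subr0 mulr1 => ? ?; exists t.
Qed.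

Lemma near_dist (R : realType) (V : normedModType R) (f : V -> R) a (e : R) :
  {for a, continuous f} -> 0 < e -> \forall x \near a, `|f a - f x| <= e.
Proof. by move=> cf e0; exact: (pseudometric_normed_Zmodule.cvgrPdist_le _ _).1 cf _ e0. Qed.

(** * Symmetry of second derivatives and Taylor's formula *)

Section SecondDerivatives.
Variables (R : realType) (V : normedModType R).

Lemma derive_along (f : V -> R) (a v : V) (t : R) : differentiable f (a + t *: v) ->
  is_derive t 1 (fun s : R => f (a + s *: v)) ('D_v f (a + t *: v)).
Proof.
move=> df.
have E : (fun h : R => h^-1 *: (((fun s : R => f (a + s *: v)) \o shift t) (h *: 1) -
      f (a + t *: v))) =
    (fun h => h^-1 *: ((f \o shift (a + t *: v)) (h *: v) - f (a + t *: v))).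
  apply/funext => h /=; congr (_ *: (f _ - _)).
  by rewrite -[h *: 1]/(h * 1) mulr1 scalerDl addrCA.
have H : derivable f (a + t *: v) v by exact: diff_derivable.
apply: DeriveDef; first by rewrite /derivable E.
by rewrite /derive E.
Qed.

Lemma MVT_along (f : V -> R) (a v : V) :
  (forall t : R, 0 <= t <= 1 -> differentiable f (a + t *: v)) ->
  exists2 t, 0 <= t <= 1 & f (a + v) - f a = 'D_v f (a + t *: v).
Proof.
move=> df; have [t t01] := @MVT01 R (fun t => f (a + t *: v)) _
  (fun t t01 => derive_along (df t t01)).
by rewrite scale1r scale0r addr0 => E; exists t.
Qed.

Lemma deriveZv (f : V -> R) (a v : V) (s : R) : differentiable f a ->
  'D_(s *: v) f a = s * 'D_v f a.
Proof. by move=> df; rewrite !deriveE // linearZ. Qed.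

Lemma deriveDv (f : V -> R) (a v w : V) : differentiable f a ->
  'D_(v + w) f a = 'D_v f a + 'D_w f a.
Proof. by move=> df; rewrite !deriveE // linearD. Qed.

(* Both mixed derivatives are limits of the same second difference. *)
Lemma derive_comm U (f : V -> R) (a v w : V) : open U -> smooth_on U f -> U a ->
  'D_v ('D_w f) a = 'D_w ('D_v f) a.
Proof.
move=> oU sf Ua.
have sv := smooth_on_derive v sf; have sw := smooth_on_derive w sf.
have svw := smooth_on_derive w sv; have swv := smooth_on_derive v sw.
apply/eqP; rewrite -subr_eq0 -normr_le0; apply/ler_addgt0Pr => e e0; rewrite add0r.
have cvw := smooth_at_continuous (ex_intro _ U (And3 oU Ua svw)).
have cwv := smooth_at_continuous (ex_intro _ U (And3 oU Ua swv)).
have e2 : 0 < e / 2 by rewrite divr_gt0.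
have Hvw := near_dist cvw e2.
have Hwv := near_dist cwv e2.
have /nbhs_ballP[d /= d0 Hd] : \forall x \near a, [/\ U x,
    `|'D_w ('D_v f) a - 'D_w ('D_v f) x| <= e / 2 &
    `|'D_v ('D_w f) a - 'D_v ('D_w f) x| <= e / 2].
  have nU : \forall x \near a, U x by exact: open_nbhs_nbhs.
  apply: filter_app nU; apply: filter_app Hvw; apply: filterS Hwv.
  by move=> x H1 H2 H3; split; [exact: H3|exact: H2|exact: H1].
(* This side length keeps the parallelogram spanned by [s v] and [s w] inside the ball where both
   mixed derivatives are within [e / 2] of their values at [a]. *)
have [s s0 sd] : exists2 s : R, 0 < s & s * (`|v| + `|w|) < d.
  have c0 : 0 < 1 + `|v| + `|w| by rewrite -addrA ltr_pwDl // addr_ge0.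
  exists (d / (1 + `|v| + `|w|)); first by rewrite divr_gt0.
  by rewrite mulrAC ltr_pdivrMr // ltr_pM2l // -addrA ltrDr.
have B t u : 0 <= t <= 1 -> 0 <= u <= 1 -> ball a d (a + t *: (s *: v) + u *: (s *: w)).
  move=> /andP[t0 t1] /andP[u0 u1]; rewrite -ball_normE /ball_ /=.
  rewrite -addrA opprD addrA subrr sub0r normrN.
  apply: (le_lt_trans (ler_normD _ _)).
  rewrite !normrZ (gtr0_norm s0) (ger0_norm t0) (ger0_norm u0).
  apply: le_lt_trans sd; rewrite mulrDr.
  by apply: lerD; apply: ler_piMl => //; rewrite mulr_ge0 // ltW.
have UB t u : 0 <= t <= 1 -> 0 <= u <= 1 -> U (a + t *: (s *: v) + u *: (s *: w)).
  by move=> ht hu; have [] := Hd _ (B t u ht hu).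
have one : 0 <= (1 : R) <= 1 by rewrite ler01 lexx.
have zero : 0 <= (0 : R) <= 1 by rewrite ler01 lexx.
have dif (g : V -> R) x : smooth_on U g -> U x -> differentiable g x.
  by move=> sg Ux; exact: smooth_on_differentiable Ux.
have U1 t : 0 <= t <= 1 -> U (a + t *: (s *: v)).
  by move=> ht; have := UB t 0 ht zero; rewrite scale0r addr0.
have U2 u : 0 <= u <= 1 -> U (a + u *: (s *: w)).
  by move=> hu; have := UB 0 u zero hu; rewrite scale0r addr0.
have derive_shift (g : V -> R) x b u : differentiable g (x + b) ->
   differentiable (fun y => g (y + b)) x /\
   'D_u (fun y => g (y + b)) x = 'D_u g (x + b).
  move=> dg.
  have dsh : is_diff x (fun y : V => y + b) id.
    have := is_diffD (is_diff_id x) (is_diff_cst b x).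
    by rewrite (_ : (id : V -> V) + 0 = id) // funeqE => y; rewrite /= addr0.
  have dsh' := @ex_diff _ _ _ _ _ _ _ dsh.
  have dgs : differentiable (g \o (fun y => y + b)) x by exact: differentiable_comp.
  split=> //; rewrite -[fun y => _]/(g \o (fun y => y + b)) deriveE // diff_comp //=.
  by rewrite (@diff_val _ _ _ _ _ _ _ dsh) deriveE.
(* Two mean value steps, along [v] and then along [w], write the second difference as [s * s] times
   a mixed derivative. The opposite order follows, and [swap] identifies the two groupings of the
   difference. *)
have [t1 ht1 E1] : exists2 t, 0 <= t <= 1 &
   (f (a + s *: v + s *: w) - f (a + s *: v)) - (f (a + s *: w) - f a) =
   'D_(s *: v) f (a + t *: (s *: v) + s *: w) - 'D_(s *: v) f (a + t *: (s *: v)).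
  have dd t : 0 <= t <= 1 ->
     [/\ differentiable f (a + t *: (s *: v) + s *: w) & differentiable f (a + t *: (s *: v))].
    move=> ht; split; apply: dif => //; last exact: U1.
    by have := UB t 1 ht one; rewrite scale1r.
  have [|t ht E] := @MVT_along (fun y => f (y + s *: w) - f y) a (s *: v).
    move=> t ht; have [d1 d2] := dd t ht.
    apply: (@differentiableB _ _ _ (fun y => f (y + s *: w)) f) => //.
    exact: (derive_shift f _ _ 0 d1).1.
  exists t; first exact: ht.
  rewrite E; have [d1 d2] := dd t ht.
  have [d3 d4] := derive_shift f _ _ (s *: v) d1.
  have e3 := diff_derivable (v := s *: v) d3; have e4 := diff_derivable (v := s *: v) d2.
  by rewrite -d4; exact: (deriveB e3 e4).
have [u1 hu1 E2] : exists2 u, 0 <= u <= 1 &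
   'D_(s *: v) f (a + t1 *: (s *: v) + s *: w) - 'D_(s *: v) f (a + t1 *: (s *: v)) =
   s * s * 'D_w ('D_v f) (a + t1 *: (s *: v) + u *: (s *: w)).
  have [|u hu E] := @MVT_along ('D_v f) (a + t1 *: (s *: v)) (s *: w).
    by move=> u hu; apply: dif => //; exact: UB.
  exists u; first exact: hu.
  rewrite !deriveZv; last 2 first.
  - by apply: dif => //; exact: U1.
  - by apply: dif => //; have := UB t1 1 ht1 one; rewrite scale1r.
  rewrite -mulrBr E (deriveZv _ _ (dif _ _ sv (UB _ _ ht1 hu))).
  exact: mulrA.
have [u2 hu2 E3] : exists2 u, 0 <= u <= 1 &
   (f (a + s *: v + s *: w) - f (a + s *: w)) - (f (a + s *: v) - f a) =
   'D_(s *: w) f (a + u *: (s *: w) + s *: v) - 'D_(s *: w) f (a + u *: (s *: w)).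
  have dd t : 0 <= t <= 1 ->
     [/\ differentiable f (a + t *: (s *: w) + s *: v) & differentiable f (a + t *: (s *: w))].
    move=> ht; split; apply: dif => //; last exact: U2.
    by have := UB 1 t one ht; rewrite scale1r addrAC.
  have [|t ht E] := @MVT_along (fun y => f (y + s *: v) - f y) a (s *: w).
    move=> t ht; have [d1 d2] := dd t ht.
    apply: (@differentiableB _ _ _ (fun y => f (y + s *: v)) f) => //.
    exact: (derive_shift f _ _ 0 d1).1.
  exists t; first exact: ht.
  rewrite (addrAC a (s *: v)) E; have [d1 d2] := dd t ht.
  have [d3 d4] := derive_shift f _ _ (s *: w) d1.
  have e3 := diff_derivable (v := s *: w) d3; have e4 := diff_derivable (v := s *: w) d2.
  by rewrite -d4; exact: (deriveB e3 e4).
have [t2 ht2 E4] : exists2 u, 0 <= u <= 1 &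
   'D_(s *: w) f (a + u2 *: (s *: w) + s *: v) - 'D_(s *: w) f (a + u2 *: (s *: w)) =
   s * s * 'D_v ('D_w f) (a + u *: (s *: v) + u2 *: (s *: w)).
  have [|u hu E] := @MVT_along ('D_w f) (a + u2 *: (s *: w)) (s *: v).
    by move=> u hu; apply: dif => //; rewrite addrAC; exact: UB.
  exists u; first exact: hu.
  rewrite !deriveZv; last 2 first.
  - by apply: dif => //; exact: U2.
  - by apply: dif => //; have := UB 1 u2 one hu2; rewrite scale1r addrAC.
  have Uu := UB u u2 hu hu2.
  rewrite -mulrBr E [a + _ + _]addrAC (deriveZv _ _ (dif _ _ sw Uu)).
  exact: mulrA.
have E : 'D_w ('D_v f) (a + t1 *: (s *: v) + u1 *: (s *: w)) =
         'D_v ('D_w f) (a + t2 *: (s *: v) + u2 *: (s *: w)).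
  have ss : s * s != 0 by rewrite mulf_neq0 ?gt_eqF.
  have swap (p q r z : R) : p - q - (r - z) = p - r - (q - z) by ring.
  apply: (mulfI ss).
  exact: (etrans (esym E2) (etrans (esym E1) (etrans (swap _ _ _ _) (etrans E3 E4)))).
have [_ H1 _] := Hd _ (B t1 u1 ht1 hu1).
have [_ _ H2] := Hd _ (B t2 u2 ht2 hu2).
have fin (p q r z : R) : r = z -> `|p - r| <= e / 2 -> `|q - z| <= e / 2 ->
    `|q - p| <= e.
  move=> <-; rewrite (distrC p) => h1 h2; rewrite (splitr e) -(subrKA r).
  exact: le_trans (ler_normD _ _) (lerD h2 h1).
exact: (fin _ _ _ _ E H1 H2).
Qed.

End SecondDerivatives.

(** The sequence [G] plays the role of the successive derivatives. Rolle's theorem for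
    [G 0 (t X) - G 0 X * t^(m+1)] expresses [G 0 X] through [G 1] at the smaller argument [c X],
    where the induction hypothesis applies. *)
Lemma taylor_lagrange (R : realType) m (G : nat -> R -> R) (X : R) :
  (forall j (t : R), `|t| <= `|X| -> is_derive t 1 (G j) (G j.+1 t)) ->
  (forall j, (j < m)%N -> G j 0 = 0) ->
  exists2 s : R, `|s| <= `|X| & G 0%N X = X ^+ m / m`!%:R * G m s.
Proof.
elim: m G X => [|m IH] G X dG G0.
  by exists X => //; rewrite expr0 fact0 divr1 mul1r.
have [->|X0] := eqVneq X 0.
  by exists 0 => //; rewrite G0 // expr0n /= !mul0r.
have tX (t : R) : 0 <= t <= 1 -> `|t * X| <= `|X|.
  move=> /andP[t0 t1]; rewrite normrM ger0_norm //; exact: ler_piMl.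
pose h (t : R) := G 0%N (0 + t *: X) - G 0%N X * t ^+ m.+1.
have dh (t : R) : 0 <= t <= 1 ->
    is_derive t 1 h (X * G 1%N (t * X) - G 0%N X * (m.+1%:R * t ^+ m)).
  move=> ht; have dGt := dG 0%N (t * X) (tX t ht).
  have dG0 : differentiable (G 0%N) (0 + t *: X).
    by rewrite add0r; apply/derivable1_diffP; exact: ex_derive.
  have EX : 'D_X (G 0%N) (0 + t *: X) = X * G 1%N (t * X).
    have := deriveZv (1 : R) X dG0; rewrite (_ : X *: 1 = X); last exact: mulr1.
    by move=> ->; rewrite add0r (@derive_val _ _ _ _ _ _ _ dGt).
  have D1 := derive_along dG0; rewrite EX in D1.
  have D2 : is_derive t 1 (fun t : R => t ^+ m.+1) (m.+1%:R * t ^+ m).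
    apply: DeriveDef; first exact: exprn_derivable.
    rewrite exp_derive /=; exact: mulr1.
  have D3 : is_derive t 1 (fun t : R => G 0%N X * t ^+ m.+1) (G 0%N X * (m.+1%:R * t ^+ m)).
    exact: (is_deriveZ (G 0%N X) D2).
  exact: (is_deriveB D1 D3).
have [|||c] := @Rolle R h 0 1 ltr01.
- move=> t; rewrite in_itv /= => /andP[t0 t1].
  have ht : 0 <= t <= 1 by rewrite !ltW.
  by have Dt := dh t ht; exact: ex_derive.
- apply: derivable_within_continuous => t; rewrite in_itv /= => /dh Ht; exact: ex_derive.
- rewrite /h scale0r addr0 scale1r add0r expr1n mulr1 subrr G0 //.
  by rewrite expr0n /= mulr0 subr0.
rewrite in_itv /= => /andP[c0 c1] Hc.
have hc : 0 <= c <= 1 by rewrite !ltW.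
have := @derive_val _ _ _ _ _ _ _ Hc; rewrite (@derive_val _ _ _ _ _ _ _ (dh c hc)) => /eqP.
rewrite subr_eq0 => /eqP E.
have [||s sX Es] := IH (fun j => G j.+1) (c * X).
- by move=> j t ht; apply: dG; apply: le_trans ht (tX _ hc).
- by move=> j jm; apply: G0.
exists s; first exact: le_trans sX (tX _ hc).
move: E; rewrite Es; move: (G m.+1 s) (G 0%N X) => u w.
have cm : c ^+ m != 0 by rewrite expf_neq0 // gt_eqF.
have m1 : m.+1%:R != 0 :> R by rewrite pnatr_eq0.
have mf : m`!%:R != 0 :> R by rewrite pnatr_eq0 -lt0n fact_gt0.
rewrite factS natrM exprMn exprS.
move: (m.+1%:R) (m`!%:R) (c ^+ m) (X ^+ m) m1 mf cm => p q a b p0 q0 a0 E.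
rewrite -[LHS](mulfK (x := p * a)) ?mulf_neq0 // -E; field.
by rewrite p0 q0 a0.
Qed.

Section Coordinates.
Variables (R : realType) (n : nat) (i : 'I_n).
Implicit Types (x v : 'rV[R]_n) (f g : 'rV[R]_n -> R).

Definition setc (t : R) x : 'rV[R]_n := \row_j (if j == i then t else x 0 j).
Local Notation e := (delta_mx 0 i : 'rV[R]_n).

Lemma setcE t x : setc t x = setc 0 x + t *: e.
Proof.
apply/rowP => j; rewrite !mxE eqxx /=.
by case: (j == i) => /=; rewrite ?mulr1 ?add0r // mulr0 addr0.
Qed.

Lemma setc_id x : setc (x 0 i) x = x.
Proof. by apply/rowP => j; rewrite mxE; case: eqP => [->|]. Qed.

Lemma setc_i t x : setc t x 0 i = t.
Proof. by rewrite mxE eqxx. Qed.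

Lemma setcK s t x : setc s (setc t x) = setc s x.
Proof. by apply/rowP => j; rewrite !mxE; case: eqP. Qed.

Lemma normr_rV_le x (c : R) : 0 <= c -> (forall j, `|x 0 j| <= c) -> `|x| <= c.
Proof.
move=> c0 H; rewrite [`|x|]/Num.norm /= mx_normrE (bigmax_le _ c0) // => -[k j] _ /=.
by rewrite (ord1 k).
Qed.

Lemma coord_norm x j : `|x 0 j| <= `|x|.
Proof.
rewrite [leRHS]/Num.norm /= mx_normrE.
exact: (le_bigmax _ (fun ij : 'I_1 * 'I_n => `|x ij.1 ij.2|) (0, j)).
Qed.

Lemma norm_setc t x : `|t| <= `|x| -> `|setc t x| <= `|x|.
Proof.
move=> tx; apply: normr_rV_le => // j; rewrite mxE.
by case: eqP => // _; exact: coord_norm.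
Qed.

Lemma norm_setc_coord t x : `|t| <= `|x 0 i| -> `|setc t x| <= `|x|.
Proof. by move=> tx; apply: norm_setc; apply: le_trans tx (coord_norm _ _). Qed.

Lemma derive_coord x v j : 'D_v (fun y : 'rV[R]_n => y 0 j) x = v 0 j.
Proof.
have d := @ex_diff _ _ _ _ _ _ _ (is_diff_id x).
by have := @derive_entry R 'rV[R]_n 1 n id x v 0 j d; rewrite derive_id => ->.
Qed.

Lemma differentiable_coord_rV x j : differentiable (fun y : 'rV[R]_n => y 0 j) x.
Proof. exact: smooth_at_differentiable (smooth_at_coord _ _ _). Qed.

Lemma smooth_at_setc t x : smooth_at x (setc t).
Proof.
apply: smooth_at_entries => k j; rewrite (ord1 k).
rewrite (_ : (fun y => _) = fun y : 'rV[R]_n => if j == i then t else y 0 j).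
  by case: eqP => _; [exact: smooth_at_cst|exact: smooth_at_coord].
by apply/funext => y; rewrite mxE.
Qed.

Definition dn k f := iter k (fun g => 'D_e g) f.

Lemma smooth_on_dn U k f : smooth_on U f -> smooth_on U (dn k f).
Proof. by move=> sf; elim: k => //= k; exact: smooth_on_derive. Qed.

Lemma dn_comm U k f v x : open U -> smooth_on U f -> U x ->
  'D_v (dn k f) x = dn k ('D_v f) x.
Proof.
move=> oU sf; elim: k x => //= k IH x Ux.
rewrite (derive_comm _ _ oU (smooth_on_dn k sf) Ux).
by apply: derive_eq_open oU Ux _ => y; exact: IH.
Qed.

(** The operator [x_i d_i - k] multiplies [x_i^j] by [j - k]; on [x_i = 0] it therefore destroys
    exactly the coefficient of order [k]. *)
Lemma dn_euler U j k f x : open U -> smooth_on U f -> U x ->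
  dn j (fun x => x 0 i * 'D_e f x - k%:R * f x) x =
  x 0 i * dn j.+1 f x + (j%:R - k%:R) * dn j f x.
Proof.
move=> oU sf; elim: j x => [|j IH] x Ux.
  by rewrite /= sub0r mulNr.
rewrite [LHS]/= (derive_eq_open _ oU Ux IH).
have sF := smooth_on_dn j.+1 sf; have sG := smooth_on_dn j sf.
have dF := smooth_on_differentiable sF Ux; have dG := smooth_on_differentiable sG Ux.
have dc := differentiable_coord_rV x i.
have d1 := differentiableM dc dF.
have d2 : differentiable (fun x => (j%:R - k%:R) * dn j f x) x.
  exact: (differentiableZ (j%:R - k%:R) dG).
have E : 'D_e (fun x => x 0 i * dn j.+1 f x + (j%:R - k%:R) * dn j f x) x =
    'D_e (fun x => x 0 i * dn j.+1 f x) x + 'D_e (fun x => (j%:R - k%:R) * dn j f x) x.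
  exact: (deriveD (diff_derivable d1) (diff_derivable d2)).
rewrite E.
have -> : 'D_e (fun x => x 0 i * dn j.+1 f x) x =
    x 0 i * dn j.+2 f x + dn j.+1 f x * e 0 i.
  rewrite -(derive_coord x e i).
  exact: (deriveM (diff_derivable dc) (diff_derivable dF)).
have -> : 'D_e (fun x => (j%:R - k%:R) * dn j f x) x = (j%:R - k%:R) * dn j.+1 f x.
  exact: (deriveZ (j%:R - k%:R) (diff_derivable dG)).
rewrite mxE !eqxx mulr1 -[j.+1%:R]natr1.
move: (x 0 i) (dn j.+2 f x) (dn j.+1 f x) => a b c; ring.
Qed.

End Coordinates.

(** Functions tangent to first order share their differential. The quotient on the axis and the
    implicit function are treated by comparison with an explicit tangent function. *)
Lemma differentiable_close (R : realType) (V : normedModType R) (f g : V -> R) a :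
  differentiable f a -> g a = f a ->
  (forall e : R, 0 < e ->
     \forall h \near (0 : V), `|g (h + a) - f (h + a)| <= e * `|h|) ->
  differentiable g a /\ 'd g a = 'd f a :> (V -> R).
Proof.
move=> df E H; apply: diff_eps; first exact: diff_continuous.
move=> e e0; have e2 : 0 < e / 2 by rewrite divr_gt0.
have H1 := H _ e2; have H2 := differentiable_eps df e2.
apply: filter_app H1; apply: filterS H2 => h H2 H1.
rewrite E (splitr e) mulrDl.
have -> : g (h + a) - f a - 'd f a h =
  (g (h + a) - f (h + a)) + (f (h + a) - f a - 'd f a h).
  move: (g _) (f (h + a)) (f a) ('d f a h) => p q r s; ring.
exact: le_trans (ler_normD _ _) (lerD H1 H2).
Qed.

(** * Hadamard division by powers of a coordinate *)

Section Hadamard.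
Variables (R : realType) (n : nat) (i : 'I_n).
Implicit Types (x v : 'rV[R]_n) (f g : 'rV[R]_n -> R) (U : set 'rV[R]_n).
Local Notation e := (delta_mx 0 i : 'rV[R]_n).

Definition nball (r : R) : set 'rV[R]_n := [set x | `|x| < r].

Lemma open_nball r : open (nball r).
Proof.
rewrite (_ : nball r = ball (0 : 'rV[R]_n) r); first exact: ball_open.
by rewrite -ball_normE; apply/seteqP; split=> x /=; rewrite sub0r normrN.
Qed.

Lemma nball_nbhs U : open U -> U 0 -> exists2 r, 0 < r & nball r `<=` U.
Proof.
move=> oU U0; have /nbhs_ballP[r /= r0 H] : nbhs (0 : 'rV[R]_n) U by exact: open_nbhs_nbhs.
exists r => // x xr; apply: H; rewrite -ball_normE /ball_ /= sub0r normrN.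
exact: xr.
Qed.

Lemma smooth_at0_nball f : smooth_at 0 f -> exists2 r, 0 < r & smooth_on (nball r) f.
Proof.
move=> [U [oU U0 sf]]; have [r r0 rU] := nball_nbhs oU U0.
by exists r => //; exact: smooth_on_sub sf.
Qed.

Definition vanish U k f := forall j x, (j < k)%N -> U x -> x 0 i = 0 -> dn i j f x = 0.

(** The quotient [f / x_i^k], extended over [x_i = 0] by the limit that Taylor's formula predicts
    when [f] vanishes there to order [k]. *)
Definition qdiv k f x : R :=
  if x 0 i == 0 then dn i k f x / k`!%:R else f x / x 0 i ^+ k.

Local Notation eu k f := (fun x => x 0 i * 'D_e f x - k%:R * f x).

Lemma smooth_on_eu U k f : open U -> smooth_on U f -> smooth_on U (eu k f).
Proof.
move=> oU sf; apply: smooth_on_add => //.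
  apply: smooth_on_mul => //; last exact: smooth_on_derive.
  move=> x Ux vs; have [U' [oU' U'x]] := smooth_at_coord 0 i x; exact.
rewrite (_ : (fun _ => _) = fun x => (- k%:R) * f x).
  by apply: smooth_on_mul => //; exact: smooth_on_cst.
by apply/funext => x; rewrite mulNr.
Qed.

(** The factor [j - k] in [dn_euler] is zero at the one new order [j = k], so the Euler operator
    gains an order of vanishing. *)
Lemma vanish_eu U k f : open U -> smooth_on U f -> vanish U k f ->
  vanish U k.+1 (eu k f).
Proof.
move=> oU sf vf j x; rewrite ltnS => jk Ux x0; rewrite (dn_euler _ _ _ oU sf Ux) x0 mul0r add0r.
by move: jk; rewrite leq_eqVlt => /orP[/eqP ->|jk]; [rewrite subrr mul0r|rewrite vf ?mulr0].
Qed.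

Lemma derive_axis0 U f x v : open U -> U x -> x 0 i = 0 -> v 0 i = 0 ->
  (forall y, U y -> y 0 i = 0 -> f y = 0) -> 'D_v f x = 0.
Proof.
move=> oU Ux x0 v0 f0.
have H : \forall h \near (0 : R), U (h *: v + x).
  have c : {for (0 : R), continuous (fun h : R => h *: v + x)}.
    apply: cvgD; last exact: cvg_cst.
    exact: scalel_continuous.
  apply: c; rewrite scale0r add0r; exact: open_nbhs_nbhs.
apply/lim_near_cst => //=; near=> h.
have -> : f (h *: v + x) = 0.
  apply: f0; last by rewrite !mxE v0 mulr0 add0r.
  near: h; exact: (nbhs_dnbhs H).
by rewrite f0 // subrr scaler0.
Unshelve. all: by end_near. Qed.

Lemma vanish_derive U k f v : open U -> smooth_on U f -> v 0 i = 0 ->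
  vanish U k f -> vanish U k ('D_v f).
Proof.
move=> oU sf v0 vf j x jk Ux x0; rewrite -(dn_comm _ _ _ oU sf Ux).
by apply: (derive_axis0 oU Ux x0 v0) => y Uy y0; exact: vf.
Qed.

(** Expanding one order beyond the vanishing gives the value on the axis and a term linear in [x_i]
    with Lagrange remainder, which is what a first derivative of the quotient requires. *)
Lemma qdiv_taylor r k f x : smooth_on (nball r) f -> vanish (nball r) k f -> nball r x ->
  exists2 s, `|s| <= `|x 0 i| &
    qdiv k f x = dn i k f (setc i 0 x) / k`!%:R +
                 x 0 i * (dn i k.+1 f (setc i s x) / k.+1`!%:R).
Proof.
move=> sf vf xr; rewrite /qdiv; case: eqP => [x0|/eqP x0].
  by exists 0; rewrite ?normr0 // x0 mul0r addr0 -[in LHS](setc_id i x) x0.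
have inb t : `|t| <= `|x 0 i| -> nball r (setc i t x).
  move=> tx; exact: le_lt_trans (norm_setc_coord tx) xr.
have in0 : nball r (setc i 0 x) by apply: inb; rewrite normr0.
pose c := dn i k f (setc i 0 x) / k`!%:R.
(* The monomial [c t^k] is subtracted together with its derivatives, whose coefficients are the
   falling factorials [k ^_ j]; at [j = k + 1] the correction is zero. *)
pose G j (t : R) := dn i j f (setc i 0 x + t *: e) - (k ^_ j)%:R * c * t ^+ (k - j).
have dG j (t : R) : `|t| <= `|x 0 i| -> is_derive t 1 (G j) (G j.+1 t).
  move=> tx.
  have inbt : nball r (setc i 0 x + t *: e) by rewrite -setcE; exact: inb.
  have D1 := derive_along (smooth_on_differentiable (smooth_on_dn i j sf) inbt).
  have D2 : is_derive t 1 (fun t : R => t ^+ (k - j)) ((k - j)%:R * t ^+ (k - j).-1).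
    apply: DeriveDef; first exact: exprn_derivable.
    rewrite exp_derive /=; exact: mulr1.
  have D3 : is_derive t 1 (fun t : R => (k ^_ j)%:R * c * t ^+ (k - j))
      ((k ^_ j)%:R * c * ((k - j)%:R * t ^+ (k - j).-1)).
    exact: (is_deriveZ _ D2).
  have D4 := is_deriveB D1 D3.
  rewrite /G (_ : _ - _ = 'D_e (dn i j f) (setc i 0 x + t *: e) -
     (k ^_ j)%:R * c * ((k - j)%:R * t ^+ (k - j).-1)); first exact: D4.
  congr (_ - _); rewrite ffactnSr natrM -subnS.
  move: ((k ^_ j)%:R) ((k - j)%:R) (t ^+ _) => p q u; ring.
have G0 j : (j < k.+1)%N -> G j 0 = 0.
  rewrite ltnS leq_eqVlt => /orP[/eqP ->|jk].
    rewrite /G scale0r addr0 subnn expr0 mulr1 ffactnn /c.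
    by rewrite [k`!%:R * _]mulrC divfK ?subrr // pnatr_eq0 -lt0n fact_gt0.
  rewrite /G scale0r addr0 vf ?setc_i // expr0n subn_eq0 leqNgt jk /= mulr0 subr0 //.
have [s sx E] := taylor_lagrange dG G0.
have EG : G k.+1 s = dn i k.+1 f (setc i s x).
  by rewrite /G ffact_small // mulr0n !mul0r subr0 -setcE.
have EG0 : G 0%N (x 0 i) = f x - c * x 0 i ^+ k.
  by rewrite /G -setcE setc_id /= ffactn0 mul1r subn0.
exists s => //; move: E; rewrite EG EG0 /c => /eqP; rewrite subr_eq => /eqP ->.
have xk : x 0 i ^+ k != 0 by rewrite expf_neq0.
rewrite mulrDl addrC exprS.
have f1 : (k.+1)`!%:R != 0 :> R by rewrite pnatr_eq0 -lt0n fact_gt0.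
have f2 : k`!%:R != 0 :> R by rewrite pnatr_eq0 -lt0n fact_gt0.
move: (dn _ _ _ _) (dn _ _ _ _) (x 0 i) ((k.+1)`!%:R) f1 (k`!%:R) f2 (x 0 i ^+ k) xk.
by move=> p' q p u u0 u' u0' w w0; field; rewrite w0 u0 u0'.
Qed.

End Hadamard.

Section HadamardSmooth.
Variables (R : realType) (n : nat) (i : 'I_n).
Implicit Types (x v : 'rV[R]_n) (f g : 'rV[R]_n -> R) (U : set 'rV[R]_n).
Local Notation e := (delta_mx 0 i : 'rV[R]_n).
Local Notation eu k f := (fun x : 'rV[R]_n => x 0 i * 'D_e f x - k%:R * f x).

Lemma derive_split f x v : differentiable f x ->
  'D_v f x = 'D_(setc i 0 v) f x + v 0 i * 'D_e f x.
Proof.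
move=> df; have {1}-> : v = setc i 0 v + v 0 i *: e by rewrite -setcE setc_id.
by rewrite deriveDv // deriveZv.
Qed.

Lemma open_off_axis : open [set x : 'rV[R]_n | x 0 i != 0].
Proof.
apply: (@open_comp _ _ (fun x : 'rV[R]_n => x 0 i) [set y | y != 0]) => //.
by move=> x _; exact: coord_continuous.
Qed.

(** The quotient rule in a form that still makes sense on the axis: along [e], the derivatives of
    [f] and of [x_i^(-k)] combine into the Euler operator divided by [x_i^(k+1)], while directions
    tangent to the axis only touch [f]. *)
Lemma qdiv_off r k f a v : smooth_on (nball r) f -> nball r a -> a 0 i != 0 ->
  differentiable (qdiv i k f) a /\
  'D_v (qdiv i k f) a = qdiv i k ('D_(setc i 0 v) f) a + v 0 i * qdiv i k.+1 (eu k f) a.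
Proof.
move=> sf ar a0.
pose U := nball r `&` [set x : 'rV[R]_n | x 0 i != 0].
have oU : open U by apply: openI; [exact: open_nball|exact: open_off_axis].
have Ua : U a by split.
have df := smooth_on_differentiable sf ar.
have dc := differentiable_coord_rV a i.
pose p : 'rV[R]_n -> R := fun x => x 0 i ^+ k.
have dp : differentiable p a by exact: smooth_at_differentiable (smooth_at_exp _ (smooth_at_coord _ _ _)).
have p0 : p a != 0 by rewrite expf_neq0.
have dQ : differentiable (qdiv i k f) a.
  apply: (@differentiable_eq_open _ _ _ U (fun x => f x * (p x)^-1)) => //.
    by move=> y [_ /= y0]; rewrite /qdiv (negbTE y0).
  apply: differentiableM => //; exact: differentiableV.
split=> //.
have E : 'D_v f a = qdiv i k f a * 'D_v p a + p a * 'D_v (qdiv i k f) a.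
  rewrite -(deriveM (diff_derivable dQ) (diff_derivable dp)).
  apply: (derive_eq_open v oU Ua) => y [_ /= y0].
  by rewrite fctE /qdiv (negbTE y0) /p divfK // expf_neq0.
have Dp : 'D_v p a = k%:R * a 0 i ^+ k.-1 * v 0 i.
  have := @deriveX _ _ (fun x : 'rV[R]_n => x 0 i) k a v (diff_derivable dc).
  rewrite derive_coord (_ : _ ^+ k = p) ?exprfctE // => ->.
move: E; rewrite Dp derive_split // {2}/qdiv /qdiv (negbTE a0) /p.
move: ('D_v _ a) ('D_(setc i 0 v) f a) ('D_e f a) (f a) (v 0 i) => Q F1 F2 F w.
rewrite exprS; case: k p p0 dp dQ Dp => [|k] p p0 dp dQ Dp /=.
  rewrite !expr0 => E.
  have -> : Q = F1 + w * F2 by rewrite E; ring.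
  by field.
have ak : a 0 i ^+ k != 0 by rewrite expf_neq0.
move: (a 0 i) (k.+1%:R) a0 (ak) => x q x0; rewrite exprS; move: (x ^+ k) => y y0 E.
have -> : Q = (F1 + w * F2 - F / (x * y) * (q * y * w)) / (x * y).
  by rewrite E; field; rewrite x0 y0.
by field; rewrite x0 y0.
Qed.

(** On the axis the quotient is tangent to [F], which is [qdiv_taylor] with the coefficient of [x_i]
    frozen at [a]; continuity of the derivative of order [k + 1] makes the error small compared with
    the norm of [h]. *)
Lemma qdiv_on r k f a v : smooth_on (nball r) f -> vanish i (nball r) k f ->
  nball r a -> a 0 i = 0 ->
  differentiable (qdiv i k f) a /\
  'D_v (qdiv i k f) a = qdiv i k ('D_(setc i 0 v) f) a + v 0 i * qdiv i k.+1 (eu k f) a.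
Proof.
move=> sf vf ar a0.
have oU := @open_nball R n r.
pose c := dn i k f; pose d := dn i k.+1 f.
have sc : smooth_on (nball r) c by exact: smooth_on_dn.
have sd : smooth_on (nball r) d by exact: smooth_on_dn.
have dc := smooth_on_differentiable sc ar.
have Ea : setc i 0 a = a by rewrite -[in RHS](setc_id i a) a0.
have dset : differentiable (setc i 0) a.
  exact: smooth_at_differentiable (smooth_at_setc _ _ _).
pose F1 x := c (setc i 0 x).
have dF1 : differentiable F1 a by apply: differentiable_comp => //; rewrite Ea.
have dci := differentiable_coord_rV a i.
pose F x : R := F1 x * (k`!%:R)^-1 + x 0 i * (d a / k.+1`!%:R).
have dFa : differentiable (fun x => F1 x * (k`!%:R)^-1) a.
  by apply: differentiableM => //; exact: differentiable_cst.
have dFb : differentiable (fun x : 'rV[R]_n => x 0 i * (d a / k.+1`!%:R)) a.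
  by apply: differentiableM => //; exact: differentiable_cst.
have dF : differentiable F a by exact: differentiableD.
have QF : qdiv i k f a = F a.
  by rewrite /qdiv a0 eqxx /F /F1 Ea a0 mul0r addr0.
have [dQ EQ] : differentiable (qdiv i k f) a /\ 'd (qdiv i k f) a = 'd F a :> (_ -> _).
  apply: (differentiable_close dF QF) => eps e0.
  have cd := smooth_at_continuous (ex_intro _ _ (And3 oU ar sd)).
  have q0 : 0 < k.+1`!%:R :> R by rewrite ltr0n fact_gt0.
  have H1 := near_dist cd (mulr_gt0 e0 q0).
  have /nbhs_ballP[d1 /= d10 Hd] : nbhs a [set x | nball r x /\ `|d a - d x| <= eps * k.+1`!%:R].
    by apply: filterS (filterI (open_nbhs_nbhs (conj oU ar)) H1) => x [].
  apply/nbhs_ballP; exists d1 => //= h; rewrite -ball_normE /ball_ /= sub0r normrN => hd.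
  have inb y : `|y - a| <= `|h| -> nball r y /\ `|d a - d y| <= eps * k.+1`!%:R.
    move=> ya; apply: Hd; rewrite -ball_normE /ball_ /= distrC; exact: le_lt_trans hd.
  have ha : `|h + a - a| <= `|h| by rewrite addrK.
  have [s sx ->] := qdiv_taylor sf vf (inb (h + a) ha).1.
  move: sx; rewrite /F /F1 mxE a0 addr0 => sh.
  have ny : `|setc i s (h + a) - a| <= `|h|.
    apply: normr_rV_le => // j; rewrite !mxE; case: eqP => [->|_].
      by rewrite a0 subr0; apply: le_trans sh (coord_norm _ _).
    rewrite addrK; exact: coord_norm.
  have [_ H] := inb _ ny.
  rewrite -/c -/d; move: (d (setc i s (h + a))) (d a) (c _) H => p q u H.
  have -> : u / k`!%:R + h 0 i * (p / (k.+1)`!%:R) -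
     (u * (k`!%:R)^-1 + h 0 i * (q / (k.+1)`!%:R)) = h 0 i * ((p - q) / k.+1`!%:R).
    move: (u / _) (k.+1`!%:R^-1) => u' w; ring.
  rewrite normrM mulrC; apply: ler_pM => //; last exact: coord_norm.
  by rewrite normrM normfV (gtr0_norm q0) ler_pdivrMr // distrC.
split=> //.
have -> : 'D_v (qdiv i k f) a = 'D_v F a by rewrite (deriveE _ dQ) (deriveE _ dF) EQ.
have -> : 'D_v F a = 'D_v (fun x => F1 x * (k`!%:R)^-1) a +
    'D_v (fun x : 'rV[R]_n => x 0 i * (d a / k.+1`!%:R)) a.
  exact: (deriveD (diff_derivable dFa) (diff_derivable dFb)).
have -> : 'D_v (fun x => F1 x * (k`!%:R)^-1) a = 'D_v F1 a * (k`!%:R)^-1.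
  rewrite mulrC; exact: deriveMr (diff_derivable dF1).
have -> : 'D_v (fun x : 'rV[R]_n => x 0 i * (d a / k.+1`!%:R)) a = v 0 i * (d a / k.+1`!%:R).
  have := deriveMr (d a / k.+1`!%:R) (diff_derivable (v := v) dci).
  move=> E; apply: etrans E _; rewrite derive_coord; exact: mulrC.
rewrite /qdiv a0 eqxx -(dn_comm i k (setc i 0 v) oU sf ar).
rewrite (dn_euler i k.+1 k oU sf ar) a0 mul0r add0r -natrB // subSnn mul1r -/d.
congr (_ / _ + _).
rewrite /F1 derive_comp ?Ea // (derive_sum_rV (setc i 0 v) dc).
apply: eq_bigr => j _; congr (_ * _).
rewrite (_ : (fun x => _) = fun x : 'rV[R]_n => if j == i then 0 else x 0 j).
  by rewrite mxE; case: eqP => _; [exact: derive_cst|exact: derive_coord].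
by apply/funext => x; rewrite mxE.
Qed.

(** Both terms of the derivative formula are quotients of functions vanishing to the matching order,
    by [vanish_derive] and [vanish_eu]. Smooth functions and quotients of all orders thus generate
    an algebra stable under derivatives. *)
Lemma qdiv_smooth r k f : smooth_on (nball r) f -> vanish i (nball r) k f ->
  smooth_on (nball r) (qdiv i k f).
Proof.
move=> sf vf; have oU := @open_nball R n r.
pose P (g : 'rV[R]_n -> R) := smooth_on (nball r) g \/ exists k f,
  [/\ smooth_on (nball r) f, vanish i (nball r) k f & g = qdiv i k f].
have qd k' f' a v : smooth_on (nball r) f' -> vanish i (nball r) k' f' -> nball r a ->
  differentiable (qdiv i k' f') a /\
  'D_v (qdiv i k' f') a = qdiv i k' ('D_(setc i 0 v) f') a + v 0 i * qdiv i k'.+1 (eu k' f') a.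
  move=> sf' vf' ar; have [a0|a0] := eqVneq (a 0 i) 0; first exact: qdiv_on sf' vf' ar a0.
  exact: qdiv_off sf' ar a0.
apply: (@alg_gen_smooth _ _ _ P) => //; last by apply: alg_gen_base; right; exists k, f.
  move=> g [sg|[k' [f' [sf' vf' ->]]]] x Ux; first exact: smooth_on_differentiable Ux.
  exact: (qd k' f' x 0 sf' vf' Ux).1.
move=> g v [sg|[k' [f' [sf' vf' ->]]]].
  by exists ('D_v g) => //; apply: alg_gen_base; left; exact: smooth_on_derive.
exists (fun x => qdiv i k' ('D_(setc i 0 v) f') x + v 0 i * qdiv i k'.+1 (eu k' f') x).
  apply: alg_gen_add.
    apply: alg_gen_base; right; exists k', ('D_(setc i 0 v) f'); split=> //.
      exact: smooth_on_derive.
    by apply: vanish_derive => //; rewrite setc_i.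
  apply: alg_gen_mul; apply: alg_gen_base; first by left; exact: smooth_on_cst.
  right; exists k'.+1, (eu k' f'); split=> //; first exact: smooth_on_eu.
  exact: vanish_eu.
by move=> x Ux; have [_] := qd k' f' x v sf' vf' Ux.
Qed.

(* Hadamard quotient along the [i]-th coordinate. *)
Definition hq f x : R :=
  if x 0 i == 0 then 'D_e f x else (f x - f (setc i 0 x)) / x 0 i.

Lemma hqE f x : f x = f (setc i 0 x) + x 0 i * hq f x.
Proof.
rewrite /hq; have [x0|x0] := eqVneq (x 0 i) 0.
  by rewrite x0 mul0r addr0 -[in LHS](setc_id i x) x0.
by rewrite mulrC divfK // addrC subrK.
Qed.

Lemma nball_setc0 r x : nball r x -> nball r (setc i 0 x).
Proof. by move=> xr; apply: le_lt_trans xr; apply: norm_setc; rewrite normr0. Qed.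

Lemma smooth_on_hq r f : smooth_on (nball r) f -> smooth_on (nball r) (hq f).
Proof.
move=> sf; have oU := @open_nball R n r.
have s0 : smooth_on (nball r) (fun x => f (setc i 0 x)).
  apply: (@smooth_on_comp _ _ n (nball r) (nball r) f (setc i 0)) => //.
    by move=> x Ux vs; have [U' [oU' U'x]] := smooth_at_setc i 0 x; exact.
  exact: nball_setc0.
pose g x := f x + (-1) * f (setc i 0 x).
have sg : smooth_on (nball r) g.
  apply: smooth_on_add => //; apply: smooth_on_mul => //; exact: smooth_on_cst.
have g0 x : x 0 i = 0 -> g x = 0.
  by move=> x0; rewrite /g -[in f x](setc_id i x) x0 mulN1r subrr.
have vg : vanish i (nball r) 1 g by move=> [|j] x // _ Ux x0; exact: g0.
apply: smooth_on_eq (qdiv_smooth sg vg) => // x Ux.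
rewrite /qdiv /hq; case: eqP => [x0|x0]; last by rewrite expr1 /g mulN1r.
rewrite (_ : 1`!%:R = 1 :> R) ?divr1 /= ; last by [].
have df := smooth_on_differentiable sf Ux.
have ds := smooth_on_differentiable s0 Ux.
have dns : differentiable (fun x => (-1) * f (setc i 0 x)) x.
  exact: (differentiableZ (-1) ds).
have -> : 'D_e g x = 'D_e f x + 'D_e (fun x => (-1) * f (setc i 0 x)) x.
  exact: (deriveD (diff_derivable df) (diff_derivable dns)).
have -> : 'D_e (fun x => (-1) * f (setc i 0 x)) x = (-1) * 'D_e (fun x => f (setc i 0 x)) x.
  exact: (deriveZ (-1) (diff_derivable ds)).
have -> : 'D_e (fun x => f (setc i 0 x)) x = 0.
  apply/lim_near_cst => //=; near=> h.
  have -> : setc i 0 (h *: e + x) = setc i 0 x.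
    apply/rowP => j; rewrite !mxE eqxx /=; case: eqP => //= _.
    by rewrite mulr0 add0r.
  by rewrite subrr scaler0.
by rewrite mulr0 addr0.
Unshelve. all: by end_near. Qed.

Lemma smooth_at_hq f : smooth_at 0 f -> smooth_at 0 (hq f).
Proof.
move=> /smooth_at0_nball[r r0 sf]; exists (nball r); split.
- exact: open_nball.
- by rewrite /nball /= normr0.
- exact: smooth_on_hq.
Qed.

End HadamardSmooth.

(** * The implicit function theorem *)

Section ImplicitFunction.
Variables (R : realType) (n : nat) (i : 'I_n).
Implicit Types (x y v h : 'rV[R]_n) (f F H : 'rV[R]_n -> R) (U : set 'rV[R]_n).
Local Notation e := (delta_mx 0 i : 'rV[R]_n).

Lemma smooth_onP U f : open U -> (forall x, U x -> smooth_at x f) -> smooth_on U f.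
Proof. by move=> oU sf x Ux vs; have [U' [_ U'x]] := sf x Ux; exact. Qed.

Lemma smooth_on_at U f x : open U -> smooth_on U f -> U x -> smooth_at x f.
Proof. by move=> oU sf Ux; exists U. Qed.

Lemma norm_setc_le t x : `|setc i t x| <= Num.max `|t| `|x|.
Proof.
apply: normr_rV_le => [|j]; first by rewrite le_max normr_ge0.
by rewrite mxE le_max; case: eqP => _; rewrite ?lexx // coord_norm orbT.
Qed.

Lemma derive_setc F t x v : differentiable F (setc i t x) ->
  'D_v (fun y => F (setc i t y)) x = 'D_(setc i 0 v) F (setc i t x).
Proof.
move=> dF; rewrite derive_comp //; last first.
  exact: smooth_at_differentiable (smooth_at_setc _ _ _).
rewrite (derive_sum_rV _ dF); apply: eq_bigr => j _; congr (_ * _).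
rewrite (_ : (fun x => _) = fun x : 'rV[R]_n => if j == i then t else x 0 j).
  by rewrite mxE; case: eqP => _; [exact: derive_cst|exact: derive_coord].
by apply/funext => z; rewrite mxE.
Qed.

Lemma MVT_setc F r z (t t' : R) : smooth_on (nball r) F ->
    nball r (setc i t z) -> nball r (setc i t' z) ->
    exists2 th : R, 0 <= th <= 1 &
      F (setc i t' z) - F (setc i t z) = (t' - t) * 'D_e F (setc i (t + th * (t' - t)) z) /\
      nball r (setc i (t + th * (t' - t)) z).
Proof.
move=> sF.
have H (u w : R) : setc i u z + w *: ((t' - t) *: e) = setc i (u + w * (t' - t)) z.
  by rewrite (setcE i (u + _)) (setcE i u) scalerA scalerDl addrA.
move=> B B'.
have inB (th : R) : 0 <= th <= 1 -> nball r (setc i (t + th * (t' - t)) z).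
  move=> /andP[t0 t1]; apply: le_lt_trans (_ : Num.max `|setc i t z| `|setc i t' z| < r).
    apply: normr_rV_le => [|j]; first by rewrite le_max normr_ge0.
    rewrite mxE; case: eqP => [_|/eqP ji]; last first.
      by rewrite le_max -[z 0 j](_ : setc i t z 0 j = _) ?coord_norm // mxE (negbTE ji).
    rewrite (_ : t + _ = (1 - th) * t + th * t'); last by ring.
    apply: le_trans (ler_normD _ _) _; rewrite !normrM (ger0_norm t0).
    rewrite (ger0_norm (_ : 0 <= 1 - th)) ?subr_ge0 //.
    set M := Num.max _ _.
    have M1 : `|t| <= M by rewrite le_max -[t in `|t|](setc_i i t z) coord_norm.
    have M2 : `|t'| <= M by rewrite le_max -[t' in `|t'|](setc_i i t' z) coord_norm orbT.
    have -> : M = (1 - th) * M + th * M by ring.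
    by apply: lerD; apply: ler_wpM2l => //; rewrite subr_ge0.
  by rewrite gt_max; apply/andP; split.
have [|th th01] := @MVT_along R _ F (setc i t z) ((t' - t) *: e).
  by move=> th th01; rewrite H; exact: smooth_on_differentiable sF (inB _ th01).
rewrite H -[_ *: e]scale1r H mul1r subrKC scale1r => E.
exists th; first exact: th01.
split; last exact: inB.
rewrite E; exact: (deriveZv _ _ (smooth_on_differentiable sF (inB _ th01))).
Qed.

Variables (F : 'rV[R]_n -> R) (r m rho delta : R) (s : 'rV[R]_n -> R).
Hypotheses (m0 : 0 < m) (rhor : rho < r) (dr : delta <= rho).
Hypothesis sF : smooth_on (nball r) F.
Hypothesis DF : forall x, nball r x -> m <= 'D_e F x.
Hypothesis sP : forall y, nball delta y -> `|s y| <= rho /\ F (setc i (s y) y) = 0.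

Let sg y := setc i (s y) y.

Let sg_in y : nball delta y -> nball r (sg y).
Proof.
move=> yd; have [sy _] := sP yd; apply: le_lt_trans (norm_setc_le _ _) _.
rewrite gt_max (le_lt_trans sy rhor) /=; apply: lt_trans rhor; exact: lt_le_trans yd dr.
Qed.

(** [s] is compared with one Newton step [G], in which the slope [D] is frozen. The lower bound [m]
    on the slope makes [s] Lipschitz at [y]; hence the mean value point [xi] tends to [p], and the
    slope there differs from [D] by arbitrarily little. *)
Lemma implicit_diff y v : nball delta y ->
  differentiable s y /\
  'D_v s y = - ('D_(setc i 0 v) F (sg y) / 'D_e F (sg y)).
Proof.
move=> yd; have oB := @open_nball R n; have pr := sg_in yd; set p := sg y in pr *.
have dF := smooth_on_differentiable sF pr.
have De0 : 0 < 'D_e F p by apply: lt_le_trans m0 (DF pr).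
set D := 'D_e F p in De0 *.
pose G x : R := s y - F (setc i (s y) x) * D^-1.
have dset : differentiable (setc i (s y)) y.
  exact: smooth_at_differentiable (smooth_at_setc _ _ _).
have dG1 : differentiable (fun x => F (setc i (s y) x)) y.
  exact: (differentiable_comp (g := F)).
have dG2 : differentiable (fun x => F (setc i (s y) x) * D^-1) y.
  by apply: differentiableM => //; exact: differentiable_cst.
have dG : differentiable G y.
  by apply: differentiableB => //; exact: differentiable_cst.
have Gy : s y = G y by rewrite /G (sP yd).2 mul0r subr0.
have cdF := diff_continuous dF.
have [k k0 Hk] := linear_lipschitz cdF.
(* The Lipschitz constant of [s]: [k] bounds the differential of [F] at [p], the [1] absorbs the
   remainder of the expansion, and [m] is the least slope. *)
pose C := (k + 1) / m.
have C0 : 0 < C by rewrite divr_gt0 // addr_gt0.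
have [ds Es] : differentiable s y /\ 'd s y = 'd G y :> (_ -> R).
  apply: (differentiable_close dG Gy) => eps e0.
  have sDF := smooth_on_derive e sF.
  have cD := smooth_at_continuous (smooth_on_at (oB r) sDF pr).
  have H1 := near_dist cD (mulr_gt0 (mulr_gt0 e0 De0) (_ : 0 < C^-1)).
  have {}H1 := H1 (ltac:(by rewrite invr_gt0)).
  have H2 := open_nbhs_nbhs (conj (oB r) pr).
  have [d1 /= d10 Hd1] := (nbhs_ballP _ _).1 (filterI H1 H2).
  have H3 : nbhs (0 : 'rV[R]_n) [set h | `|F (h + p) - F p - 'd F p h| <= 1 * `|h|].
    exact: (differentiable_eps dF ltr01).
  have [d2 /= d20 Hd2] := (nbhs_ballP _ _).1 H3.
  have H4 := open_nbhs_nbhs (conj (oB delta) yd).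
  have [d3 /= d30 Hd3] := (nbhs_ballP _ _).1 H4.
  have q0 : 0 < d1 / (C + 1) by apply: divr_gt0; [exact: d10|exact: addr_gt0 C0 ltr01].
  have H5 : nbhs (0 : 'rV[R]_n) (nball (Num.min (Num.min (d1 / (C + 1)) d2) (Num.min d3 d1))).
    apply: open_nbhs_nbhs; split; first exact: oB.
    by rewrite /nball /= normr0 !lt_min q0 d20 d30 d10.
  apply: filterS H5 => h; rewrite /nball /= !lt_min => /andP[/andP[h1 h2] /andP[h3 h4]].
  have yh : nball delta (h + y).
    by apply: Hd3; rewrite -ball_normE /ball_ /= opprD addrCA subrr addr0 normrN.
  have [shb Fsh] := sP yh.
  have Ep : setc i (s y) (h + y) = p + setc i 0 h.
    by apply/rowP => j; rewrite !mxE; case: eqP => _; rewrite ?addr0 // addrC.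
  have n0h : `|setc i 0 h| <= `|h| by apply: norm_setc; rewrite normr0.
  have B1 : nball r (setc i (s y) (h + y)).
    rewrite Ep; apply: (Hd1 _ _).2; rewrite -ball_normE /ball_ /= opprD addrA subrr sub0r normrN.
    exact: le_lt_trans n0h h4.
  have B2 : nball r (setc i (s (h + y)) (h + y)) by exact: sg_in.
  have [th th01 [E _]] := MVT_setc sF B1 B2.
  move: E; rewrite Fsh sub0r; set Dl := s (h + y) - s y; set xi := setc i (s y + _) _ => E.
  have sD : `|Dl| <= C * `|h|.
    have F1 : `|F (p + setc i 0 h)| <= (k + 1) * `|h|.
      have := Hd2 (setc i 0 h); rewrite -ball_normE /ball_ /= sub0r normrN => /(_ (le_lt_trans n0h h2)).
      have Fp : F p = 0 := (sP yd).2.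
      rewrite Fp subr0 mul1r (addrC (setc i 0 h) p) => A1.
      have A2 := Hk (setc i 0 h).
      rewrite -[F _](subrK ('d F p (setc i 0 h))).
      apply: le_trans (ler_normD _ _) _; rewrite mulrDl mul1r addrC.
      apply: lerD; last exact: le_trans A1 n0h.
      by apply: le_trans A2 _; rewrite ler_pM2l.
    have xir : nball r xi.
      rewrite /xi -/Dl; case/andP: th01 => t0 t1.
      apply: le_lt_trans (norm_setc_le _ _) _.
      rewrite gt_max; apply/andP; split; last first.
        by apply: lt_trans rhor; apply: lt_le_trans dr.
      apply: le_lt_trans rhor.
      rewrite /Dl (_ : s y + _ = (1 - th) * s y + th * s (h + y)); last by ring.
      apply: le_trans (ler_normD _ _) _; rewrite !normrM (ger0_norm t0).
      rewrite (ger0_norm (_ : 0 <= 1 - th)) ?subr_ge0 //.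
      have -> : rho = (1 - th) * rho + th * rho by ring.
      have [syb _] := sP yd.
      by apply: lerD; apply: ler_wpM2l => //; rewrite subr_ge0.
    have mD : m * `|Dl| <= `|F (p + setc i 0 h)|.
      have -> : `|F (p + setc i 0 h)| = `|Dl| * `|'D_e F xi|.
        by rewrite -Ep -[F _]opprK E normrN normrM.
      rewrite mulrC; apply: ler_wpM2l; first exact: normr_ge0.
      exact: le_trans (DF xir) (ler_norm _).
    rewrite /C mulrAC ler_pdivlMr // mulrC; exact: le_trans mD F1.
  have xid : ball p d1 xi.
    rewrite -ball_normE /ball_ /=.
    apply: (@le_lt_trans _ _ ((C + 1) * `|h|)); last first.
      by rewrite mulrC -ltr_pdivlMr // addr_gt0.
    have Ch : `|h| <= (C + 1) * `|h| by rewrite mulrDl mul1r lerDr mulr_ge0 // ltW.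
    apply: normr_rV_le => [|j].
      by rewrite mulr_ge0 // addr_ge0 // ltW.
    rewrite !mxE; case: eqP => _; last first.
      by rewrite opprD addrCA subrr addr0 normrN; apply: le_trans (coord_norm _ _) Ch.
    rewrite opprD addrA subrr sub0r normrN normrM; case/andP: th01 => t0 t1.
    rewrite (ger0_norm t0); apply: (@le_trans _ _ `|Dl|); first exact: ler_piMl.
    by apply: le_trans sD _; rewrite mulrDl lerDl mul1r.
  have Hxi := (Hd1 _ xid).1.
  have -> : s (h + y) - G (h + y) = Dl * ((D - 'D_e F xi) / D).
    rewrite /G; have -> : F (setc i (s y) (h + y)) = - (Dl * 'D_e F xi).
      by rewrite -E opprK.
    have key (a b c q : R) : 0 < q ->
        a - (b - (- ((a - b) * c)) * q^-1) = (a - b) * ((q - c) / q).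
      by move=> q0'; field; rewrite gt_eqF.
    exact: key.
  rewrite normrM; apply: le_trans (ler_wpM2r (normr_ge0 _) sD) _.
  rewrite normrM normfV (gtr0_norm De0).
  apply: (@le_trans _ _ (C * `|h| * (eps * D * C^-1 / D))).
    apply: ler_wpM2l; first by rewrite mulr_ge0 // ltW.
    by apply: ler_wpM2r => //; rewrite invr_ge0 ltW.
  have -> : C * `|h| * (eps * D * C^-1 / D) = eps * `|h|.
    have key (a b c q : R) : 0 < q -> 0 < c ->
        c * a * (b * q * c^-1 / q) = b * a.
      by move=> q0' c0; field; rewrite !gt_eqF.
    exact: key.
  exact: lexx.
split=> //.
have -> : 'D_v s y = 'D_v G y by rewrite (deriveE _ ds) (deriveE _ dG) Es.
have -> : 'D_v G y = - 'D_v (fun x => F (setc i (s y) x) * D^-1) y.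
  have := deriveB (derivable_cst (s y) y v) (diff_derivable (v := v) dG2).
  by rewrite derive_cst sub0r.
have -> : 'D_v (fun x => F (setc i (s y) x) * D^-1) y =
   D^-1 * 'D_v (fun x => F (setc i (s y) x)) y.
  exact: deriveMr (diff_derivable dG1).
by rewrite derive_setc // mulrC.
Qed.

End ImplicitFunction.

Section ImplicitSmooth.
Variables (R : realType) (n : nat) (i : 'I_n).
Implicit Types (x y v h : 'rV[R]_n) (f F H : 'rV[R]_n -> R) (U : set 'rV[R]_n).
Local Notation e := (delta_mx 0 i : 'rV[R]_n).

Section Regular.
Variables (F : 'rV[R]_n -> R) (r m rho delta : R) (s : 'rV[R]_n -> R).
Hypotheses (m0 : 0 < m) (rhor : rho < r) (dr : delta <= rho).
Hypothesis sF : smooth_on (nball r) F.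
Hypothesis DF : forall x, nball r x -> m <= 'D_e F x.
Hypothesis sP : forall y, nball delta y -> `|s y| <= rho /\ F (setc i (s y) y) = 0.

(** The derivative of [s] is a quotient of partial derivatives of [F] on the graph, so restrictions
    of smooth functions to the graph are stable under derivatives; [s] itself is the restriction of
    a coordinate. *)
Lemma implicit_smooth_on : smooth_on (nball delta) s.
Proof.
have oB := @open_nball R n.
pose sg y := setc i (s y) y.
have sg_in y : nball delta y -> nball r (sg y).
  move=> yd; have [sy _] := sP yd; apply: le_lt_trans (norm_setc_le _ _ _) _.
  rewrite gt_max (le_lt_trans sy rhor) /=; apply: lt_trans rhor; exact: lt_le_trans yd dr.
have sdiff y v (yd : nball delta y) := implicit_diff m0 rhor dr sF DF sP v yd.
have dsg y : nball delta y -> differentiable sg y.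
  move=> yd; have [ds _] := sdiff y 0 yd.
  have E : sg = fun x => x + (s x - x 0 i) *: e.
    apply/funext => x; apply/rowP => j; rewrite !mxE eqxx /=.
    by case: eqP => [->|_]; rewrite ?mulr1 ?mulr0 ?addr0 // subrKC.
  rewrite E; apply: (@differentiableD _ _ _ id).
    exact: (@ex_diff _ _ _ _ _ _ _ (is_diff_id y)).
  apply: (differentiableZl (k := fun x => s x - x 0 i)); apply: differentiableB => //.
  exact: differentiable_coord_rV.
have De x : nball r x -> 'D_e F x != 0.
  by move=> xr; rewrite gt_eqF //; exact: lt_le_trans m0 (DF xr).
pose P (g : 'rV[R]_n -> R) := exists2 H, smooth_on (nball r) H & g = fun x => H (sg x).
suff HP g : P g -> smooth_on (nball delta) g.
  apply: HP; exists (fun x => x 0 i); last by apply/funext => x; rewrite /sg setc_i.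
  by apply: (smooth_onP (oB r)) => x _; exact: smooth_at_coord.
apply: smooth_on_coind => // {}g.
  move=> [H sH ->] x xd; apply: (differentiable_comp (g := H)); first exact: dsg.
  exact: smooth_on_differentiable sH (sg_in _ xd).
move=> v [H sH ->].
exists (fun x => 'D_(setc i 0 v) H (sg x) -
   'D_(setc i 0 v) F (sg x) / 'D_e F (sg x) * 'D_e H (sg x)).
  exists (fun x => 'D_(setc i 0 v) H x - 'D_(setc i 0 v) F x / 'D_e F x * 'D_e H x) => //.
  apply: (smooth_onP (oB r)) => x xr.
  have sm (G : 'rV[R]_n -> R) w : smooth_on (nball r) G -> smooth_at x ('D_w G).
    by move=> sG; apply: smooth_on_at (oB r) _ xr; exact: smooth_on_derive.
  apply: smooth_at_sub; first exact: sm.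
  apply: smooth_at_mul; last exact: sm.
  apply: smooth_at_div; [exact: sm|exact: sm|exact: De].
move=> x xd; have dH := smooth_on_differentiable sH (sg_in _ xd).
have [ds Ds] := sdiff x v xd.
rewrite (derive_comp v (dsg _ xd) dH).
have -> : \sum_(j < n) 'D_v (fun x => sg x 0 j) x * 'D_(delta_mx 0 j) H (sg x) =
   'D_(setc i ('D_v s x) v) H (sg x).
  rewrite (derive_sum_rV _ dH); apply: eq_bigr => j _; congr (_ * _).
  rewrite (_ : (fun x => _) = fun x : 'rV[R]_n => if j == i then s x else x 0 j).
    by rewrite mxE; case: eqP => _ //; exact: derive_coord.
  by apply/funext => z; rewrite mxE.
rewrite (setcE i ('D_v s x)) (deriveDv _ _ dH) (deriveZv _ _ dH) Ds.
by rewrite mulNr.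
Qed.

End Regular.

Lemma nball0 (r : R) : 0 < r -> nball r (0 : 'rV[R]_n).
Proof. by move=> r0; rewrite /nball /= normr0. Qed.

(** Along the [i]-th coordinate [F] increases with slope at least [m]: the intermediate value
    theorem between [- rho] and [rho] gives a root, and monotonicity makes it unique. *)
Lemma implicit_pos F : smooth_at 0 F -> F 0 = 0 -> 0 < 'D_e F 0 ->
  exists s : 'rV[R]_n -> R, [/\ smooth_at 0 s, s 0 = 0,
    (forall y, s (setc i 0 y) = s y) &
    \forall y \near (0 : 'rV[R]_n), F y = 0 <-> y 0 i = s y].
Proof.
move=> sF F0 D0; have oB := @open_nball R n.
have [r0 r00 sF0] := smooth_at0_nball sF.
pose m := 'D_e F 0 / 2.
have m0 : 0 < m by rewrite divr_gt0.
have mD : 0 < 'D_e F 0 - m by rewrite /m; move: ('D_e F 0) D0 => d d0; lra.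
have sDm : smooth_at 0 (fun x => 'D_e F x - m).
  by apply: smooth_at_sub; [exact: smooth_at_derive|exact: smooth_at_cst].
have /nbhs_ballP[r1 /= r10 Hr1] := near_pos sDm mD.
pose r := Num.min r0 r1.
have rP : 0 < r by rewrite lt_min r00.
have sFr : smooth_on (nball r) F.
  by apply: smooth_on_sub sF0 => x /=; rewrite /nball /= lt_min => /andP[].
have DF x : nball r x -> m <= 'D_e F x.
  rewrite /nball /= lt_min => /andP[_ xr].
  have := Hr1 x; rewrite -ball_normE /ball_ /= sub0r normrN => /(_ xr).
  by rewrite subr_gt0 => /ltW.
pose rho := r / 2.
have rho0 : 0 < rho by rewrite divr_gt0.
have rhor : rho < r by rewrite /rho ltr_pdivrMr // ltr_pMr // ltr1n.
have mono y (t t' : R) : nball r y -> `|t| <= rho -> `|t'| <= rho -> t <= t' ->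
    m * (t' - t) <= F (setc i t' y) - F (setc i t y).
  move=> yr tr tr' tt'.
  have inB u : `|u| <= rho -> nball r (setc i u y).
    move=> ur; apply: le_lt_trans (norm_setc_le _ _ _) _.
    by rewrite gt_max (le_lt_trans ur rhor).
  have [th _ [-> xi]] := MVT_setc sFr (inB _ tr) (inB _ tr').
  rewrite mulrC; apply: ler_wpM2l; first by rewrite subr_ge0.
  exact: DF.
have z_r : nball r (0 : 'rV[R]_n) := nball0 rP.
have s00 : setc i 0 (0 : 'rV[R]_n) = 0 by apply/rowP => j; rewrite !mxE if_same.
have n00 : `|0 : R| <= rho by rewrite (normr0 R); exact: ltW.
have n0r : `|rho| <= rho by rewrite gtr0_norm.
have n0m : `|- rho| <= rho by rewrite normrN.
have mr : 0 < m * rho by exact: mulr_gt0.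
have up : 0 < F (setc i rho 0).
  by have := mono 0 _ _ z_r n00 n0r (ltW rho0); rewrite s00 F0 !subr0; exact: lt_le_trans.
have dn : 0 < - F (setc i (- rho) 0).
  have := mono 0 _ _ z_r n0m n00 (ltW (_ : - rho < 0)); rewrite oppr_lt0 s00 F0 opprK !sub0r add0r.
  by move=> /(_ rho0); exact: lt_le_trans.
have inr (u : R) : `|u| <= rho -> nball r (setc i u 0).
  move=> ur; apply: le_lt_trans (norm_setc_le _ _ _) _.
  by rewrite gt_max (le_lt_trans ur rhor) /=; exact: z_r.
have sc (u : R) : `|u| <= rho -> smooth_at 0 (fun y => F (setc i u y)).
  move=> ur; apply: (@smooth_at_comp _ _ _ F (setc i u)); first exact: smooth_at_setc.
  exact: smooth_on_at (oB r) sFr (inr _ ur).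
have /nbhs_ballP[d1 /= d10 H1] := near_pos (sc _ n0r) up.
have /nbhs_ballP[d2 /= d20 H2] := near_pos (smooth_at_opp (sc _ n0m)) dn.
pose delta := Num.min rho (Num.min d1 d2).
have del0 : 0 < delta by rewrite !lt_min rho0 d10 d20.
have dr : delta <= rho by rewrite ge_min lexx.
(* The root set depends on [y] only through its other coordinates, so choosing with [xget] makes [s]
   independent of the [i]-th coordinate everywhere, not only near 0. *)
pose S y := [set t : R | `|t| <= rho /\ F (setc i t y) = 0].
pose s y : R := xget 0 (S y).
have exS y : nball delta y -> exists t, S y t.
  rewrite /nball /= !lt_min => /and3P[y1 y2 y3].
  have b1 : 0 < F (setc i rho y) by apply: H1; rewrite -ball_normE /ball_ /= sub0r normrN.
  have b2 : 0 < - F (setc i (- rho) y) by apply: H2; rewrite -ball_normE /ball_ /= sub0r normrN.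
  have yr : nball r y by exact: lt_trans rhor.
  have ab : - rho <= rho by apply: ltW; exact: gtrN rho0.
  have c : {within `[(- rho), rho], continuous (fun t : R => F (setc i 0 y + t *: e))}.
    apply: derivable_within_continuous => t; rewrite in_itv /= => tr.
    have tin : nball r (setc i 0 y + t *: e).
      rewrite -setcE; apply: le_lt_trans (norm_setc_le _ _ _) _.
      by rewrite gt_max yr andbT; apply: le_lt_trans rhor; rewrite ler_norml.
    have := derive_along (smooth_on_differentiable sFr tin) => Dt; exact: ex_derive.
  have [|t] := @IVT R _ _ _ 0 ab c.
    rewrite -!setcE ge_min le_max (ltW b1) orbT andbT.
    by apply/orP; left; rewrite -oppr_ge0 ltW.
  rewrite in_itv /= -setcE => tr E; exists t; split=> //.
  by rewrite ler_norml.
have sP y : nball delta y -> `|s y| <= rho /\ F (setc i (s y) y) = 0.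
  by move=> yd; exact: (xgetPex 0 (exS y yd)).
have uniq y t : nball delta y -> `|t| <= rho -> F (setc i t y) = 0 -> t = s y.
  move=> yd tr Ft; have [sr Fs] := sP y yd.
  have yr : nball r y by apply: lt_trans rhor; exact: lt_le_trans yd dr.
  have E (u w : R) : `|u| <= rho -> `|w| <= rho -> F (setc i u y) = 0 ->
     F (setc i w y) = 0 -> u <= w -> w <= u.
    move=> ur wr Fu Fw uw; have := mono y u w yr ur wr uw.
    by rewrite Fu Fw subrr pmulr_rle0 // subr_le0.
  have [ts|ts] := leP t (s y); apply/eqP; rewrite eq_le.
    by rewrite ts /=; apply: (E t (s y)).
  by rewrite (ltW ts) andbT; apply: (E (s y) t) => //; exact: ltW.
have z_d : nball delta (0 : 'rV[R]_n) := nball0 del0.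
exists s; split.
- exists (nball delta); split=> //.
  exact: (implicit_smooth_on m0 rhor dr sFr DF sP).
- by apply/esym/uniq => //; rewrite s00.
- move=> y; rewrite /s; congr xget; apply/funext => t; rewrite /S /=.
  by rewrite setcK.
- have : nbhs (0 : 'rV[R]_n) (nball delta) by exact: (open_nbhs_nbhs (conj (oB delta) z_d)).
  apply: filterS => y yd; split=> [Fy|ys].
    apply: (uniq _ _ yd); last by rewrite setc_id.
    apply: le_trans (coord_norm _ _) _; apply: ltW; exact: lt_le_trans yd dr.
  by have [_] := sP y yd; rewrite -ys setc_id.
Qed.

Theorem implicit_function F : smooth_at 0 F -> F 0 = 0 -> 'D_e F 0 != 0 ->
  exists s : 'rV[R]_n -> R, [/\ smooth_at 0 s, s 0 = 0,
    (forall y, s (setc i 0 y) = s y) &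
    \forall y \near (0 : 'rV[R]_n), F y = 0 <-> y 0 i = s y].
Proof.
move=> sF F0; rewrite neq_lt => /orP[D0|]; last exact: implicit_pos.
have dF := smooth_at_differentiable sF.
have [||s [ss s0 sc H]] := @implicit_pos (fun x => - F x) (smooth_at_opp sF).
- by rewrite F0 oppr0.
- rewrite (_ : 'D_e _ 0 = - 'D_e F 0) ?oppr_gt0 //.
  exact: (deriveN (diff_derivable dF)).
exists s; split=> //; apply: filterS H => y [H1 H2]; split=> [Fy|/H2 /eqP].
  by apply: H1; rewrite Fy oppr0.
by rewrite oppr_eq0 => /eqP.
Qed.

End ImplicitSmooth.

(** * Calculus of Hadamard quotients and the Morse lemma *)

Section HadamardCalculus.
Variables (R : realType) (n : nat) (i : 'I_n).
Implicit Types (x y v h : 'rV[R]_n) (f g c F : 'rV[R]_n -> R).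
Local Notation e := (delta_mx 0 i : 'rV[R]_n).

Lemma near_ball (P : 'rV[R]_n -> Prop) : (\forall x \near (0 : 'rV[R]_n), P x) ->
  exists2 r, 0 < r & forall x, nball r x -> P x.
Proof.
move=> /nbhs_ballP[r /= r0 H]; exists r => // x xr; apply: H.
by rewrite -ball_normE /ball_ /= sub0r normrN.
Qed.

Lemma ball_near (P : 'rV[R]_n -> Prop) r : 0 < r -> (forall x, nball r x -> P x) ->
  \forall x \near (0 : 'rV[R]_n), P x.
Proof.
by move=> r0; apply: open_near; [exact: open_nball|exact: nball0].
Qed.

Lemma near_all (P : 'rV[R]_n -> Prop) : (forall x, P x) ->
  \forall x \near (0 : 'rV[R]_n), P x.
Proof. by move=> H; apply: (ball_near ltr01) => x _; exact: H. Qed.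

Lemma near_setc0 (P : 'rV[R]_n -> Prop) : (\forall x \near (0 : 'rV[R]_n), P x) ->
  \forall x \near (0 : 'rV[R]_n), P (setc i 0 x).
Proof.
by move=> /near_ball[r r0 H]; apply: (ball_near r0) => x xr; apply: H; exact: nball_setc0.
Qed.

Lemma hq0 f : hq i f 0 = 'D_e f 0.
Proof. by rewrite /hq mxE eqxx. Qed.

(** Off the axis the decomposition can be solved for [g]; on the axis the difference quotient tends
    to [g x] by continuity. Quotients are computed from here on by exhibiting a decomposition. *)
Lemma hq_unique f c g : smooth_at 0 g ->
  (\forall x \near (0 : 'rV[R]_n), f x = c (setc i 0 x) + x 0 i * g x) ->
  \forall x \near (0 : 'rV[R]_n), hq i f x = g x.
Proof.
move=> /smooth_at0_nball[r1 r10 sg] /near_ball[r2 r20 H].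
pose r := Num.min r1 r2.
have r0 : 0 < r by rewrite lt_min r10.
apply: (ball_near r0) => x; rewrite /nball /= lt_min => /andP[x1 x2].
rewrite /hq; case: eqP => [x0|/eqP x0]; last first.
  rewrite (H _ x2) (H (setc i 0 x)); last exact: nball_setc0.
  by rewrite setcK setc_i mul0r addr0 addrAC subrr add0r mulrC mulKf.
have ct : {for (0 : R), continuous (fun t : R => t *: e + x)}.
  apply: cvgD; last exact: cvg_cst.
  exact: scalel_continuous.
have inr : \forall t \near (0 : R), nball r2 (t *: e + x).
  apply: ct; rewrite scale0r add0r; apply: open_nbhs_nbhs.
  by split; [exact: open_nball|exact: x2].
have cg : {for x, continuous g}.
  by apply: (@smooth_at_continuous _ _ _ g x); exact: smooth_on_at (@open_nball R n r1) sg x1.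
have L : (fun t : R => g (t *: e + x)) @ 0^' --> g x.
  apply: cvg_trans (_ : (fun t : R => g (t *: e + x)) @ (0 : R) --> g x).
    by apply: cvg_app; exact: nbhs_dnbhs.
  have ct' : (fun t : R => t *: e + x) @ (0 : R) --> 0 *: e + x := ct.
  by rewrite scale0r add0r in ct'; exact: (cvg_comp _ _ ct' cg).
apply: (@cvg_lim _ _ _ _ _ _ (g x)) => //; apply: cvg_trans L.
apply: near_eq_cvg; near=> t.
have t0 : t != 0 by near: t; exact: nbhs_dnbhs_neq.
have tb : nball r2 (t *: e + x) by near: t; exact: (nbhs_dnbhs inr).
rewrite /= (H _ tb) (H _ x2) x0 mul0r addr0.
have -> : setc i 0 (t *: e + x) = setc i 0 x.
  apply/rowP => j; rewrite !mxE eqxx /=; case: eqP => //= _.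
  by rewrite mulr0 add0r.
rewrite !mxE !eqxx mulr1 x0 addr0 addrAC subrr add0r.
by first [exact: mulKf|apply/esym; exact: mulKf].
Unshelve. all: by end_near. Qed.

Lemma hq_ext f g : smooth_at 0 g -> (\forall x \near (0 : 'rV[R]_n), f x = g x) ->
  \forall x \near (0 : 'rV[R]_n), hq i f x = hq i g x.
Proof.
move=> sg E; apply: (@hq_unique f g); first exact: smooth_at_hq.
by apply: filterS E => x ->; exact: hqE.
Qed.

Lemma hq_add f g : smooth_at 0 f -> smooth_at 0 g ->
  \forall x \near (0 : 'rV[R]_n), hq i (fun x => f x + g x) x = hq i f x + hq i g x.
Proof.
move=> sf sg; apply: (@hq_unique _ (fun x => f x + g x)).
  by apply: smooth_at_add; exact: smooth_at_hq.
by apply: near_all => x; rewrite {1}(hqE i f x) {1}(hqE i g x) mulrDr addrACA.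
Qed.

Lemma hq_mull f g : smooth_at 0 f -> smooth_at 0 g -> (forall x, f (setc i 0 x) = f x) ->
  \forall x \near (0 : 'rV[R]_n), hq i (fun x => f x * g x) x = f x * hq i g x.
Proof.
move=> sf sg fi; apply: (@hq_unique _ (fun x => f x * g x)).
  by apply: smooth_at_mul => //; exact: smooth_at_hq.
by apply: near_all => x; rewrite {1}(hqE i g x) fi mulrDr mulrCA.
Qed.

Lemma hq_mulX g : smooth_at 0 g ->
  \forall x \near (0 : 'rV[R]_n), hq i (fun x : 'rV[R]_n => x 0 i * g x) x = g x.
Proof.
move=> sg; apply: (@hq_unique _ (fun=> 0)) => //.
by apply: near_all => x; rewrite add0r.
Qed.

(** Both sides are the Hadamard quotient of the same function, so the coordinate can be cancelled
    even where it vanishes. *)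
Lemma coord_cancel f g : smooth_at 0 f -> smooth_at 0 g ->
  (\forall x \near (0 : 'rV[R]_n), (x : 'rV[R]_n) 0 i * f x = x 0 i * g x) ->
  \forall x \near (0 : 'rV[R]_n), f x = g x.
Proof.
move=> sf sg E; have H1 := hq_mulX sf; have H2 := hq_mulX sg.
have H3 : \forall x \near (0 : 'rV[R]_n),
    hq i (fun x : 'rV[R]_n => x 0 i * f x) x = hq i (fun x : 'rV[R]_n => x 0 i * g x) x.
  by apply: hq_ext E; apply: smooth_at_mul => //; exact: smooth_at_coord.
apply: filter_app H1; apply: filter_app H2; apply: filterS H3 => x h3 h2 h1.
by rewrite -h1 -h2 h3.
Qed.

Lemma near_comp (m : nat) (Phi : 'rV[R]_m -> 'rV[R]_n) (P : 'rV[R]_n -> Prop) :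
  smooth_at 0 Phi -> Phi 0 = 0 -> (\forall x \near (0 : 'rV[R]_n), P x) ->
  \forall x \near (0 : 'rV[R]_m), P (Phi x).
Proof.
move=> /smooth_at_continuous cP P0 H.
have cP' : Phi @ (0 : 'rV[R]_m) --> Phi 0 := cP.
by rewrite P0 in cP'; exact: cP' _ H.
Qed.

Lemma implicit_hq F c g : smooth_at 0 F -> F 0 = 0 -> smooth_at 0 g -> g 0 != 0 ->
  (\forall x \near (0 : 'rV[R]_n), F x = c (setc i 0 x) + x 0 i * g x) ->
  exists s : 'rV[R]_n -> R, [/\ smooth_at 0 s, s 0 = 0,
    (forall y, s (setc i 0 y) = s y) &
    \forall y \near (0 : 'rV[R]_n), F (setc i (s y) y) = 0].
Proof.
move=> sF F0 sg g0 E.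
have D0 : 'D_e F 0 != 0 by rewrite -hq0 (nbhs_singleton (hq_unique sg E)).
have [s [ss s0 si H]] := implicit_function sF F0 D0.
exists s; split=> //.
have sP : smooth_at 0 (fun y : 'rV[R]_n => setc i (s y) y).
  apply: smooth_at_entries => k j; rewrite (ord1 k).
  rewrite (_ : (fun y => _) = fun y : 'rV[R]_n => if j == i then s y else y 0 j).
    by case: eqP => _ //; exact: smooth_at_coord.
  by apply/funext => y; rewrite mxE.
have P0 : setc i (s 0) 0 = 0 :> 'rV[R]_n.
  by apply/rowP => j; rewrite s0 !mxE if_same.
apply: filterS (near_comp sP P0 H) => y [_]; apply.
by rewrite setc_i -[RHS]si setcK si.
Qed.

Definition shiftc (xi : 'rV[R]_n -> R) x : 'rV[R]_n := setc i (x 0 i + xi x) x.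

Lemma smooth_at_shiftc xi a : smooth_at a xi -> smooth_at a (shiftc xi).
Proof.
move=> sx; apply: smooth_at_entries => k j; rewrite (ord1 k).
rewrite (_ : (fun y => _) = fun y : 'rV[R]_n => if j == i then y 0 i + xi y else y 0 j).
  case: eqP => _; last exact: smooth_at_coord.
  by apply: smooth_at_add => //; exact: smooth_at_coord.
by apply/funext => y; rewrite mxE.
Qed.

Lemma shiftc0 xi : xi 0 = 0 -> shiftc xi 0 = 0.
Proof. by move=> x0; apply/rowP => j; rewrite /shiftc x0 !mxE addr0 if_same. Qed.

Lemma shiftcK xi x : (forall x, xi (setc i 0 x) = xi x) ->
  shiftc xi (shiftc (fun x => - xi x) x) = x.
Proof.
move=> xi0; rewrite /shiftc setc_i setcK.
have -> : xi (setc i (x 0 i - xi x) x) = xi x by rewrite -xi0 setcK xi0.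
by rewrite subrK setc_id.
Qed.

(** [shiftc] straightens the graph [x_i = xi] to [x_i = 0], where Hadamard division applies;
    shifting back gives the cofactor. *)
Lemma factor_graph f xi : smooth_at 0 f -> smooth_at 0 xi -> xi 0 = 0 ->
  (forall x, xi (setc i 0 x) = xi x) ->
  (\forall x \near (0 : 'rV[R]_n), f (setc i (xi x) x) = 0) ->
  exists g, [/\ smooth_at 0 g, g 0 = hq i f 0 &
     \forall x \near (0 : 'rV[R]_n), f x = (x 0 i - xi x) * g x].
Proof.
move=> sf sx x0 xi0 Z.
pose Psi := shiftc xi; pose Phi := shiftc (fun x => - xi x).
have sPsi : smooth_at 0 Psi by exact: smooth_at_shiftc.
have sPhi : smooth_at 0 Phi by apply: smooth_at_shiftc; exact: smooth_at_opp.
have Psi0 : Psi 0 = 0 by exact: shiftc0.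
have Phi0 : Phi 0 = 0 by apply: shiftc0; rewrite x0 oppr0.
pose ft x := f (Psi x).
have sft : smooth_at 0 ft by apply: smooth_at_comp => //; rewrite Psi0.
pose g x := hq i ft (Phi x).
have sg : smooth_at 0 g.
  by apply: smooth_at_comp => //; rewrite Phi0; exact: smooth_at_hq.
have Eg : \forall x \near (0 : 'rV[R]_n), f x = (x 0 i - xi x) * g x.
  have Zs : \forall x \near (0 : 'rV[R]_n), f (setc i (xi (Phi x)) (Phi x)) = 0.
    exact: (near_comp sPhi Phi0 Z).
  apply: filterS Zs => x Zs; rewrite -[in LHS](shiftcK x xi0) -/(ft _) (hqE i ft).
  rewrite -/Phi -/(g x) {2}/Phi /shiftc setc_i.
  rewrite (_ : ft (setc i 0 (Phi x)) = 0) ?add0r // /ft /Psi /shiftc setc_i add0r setcK xi0.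
  exact: Zs.
exists g; split=> //.
have sg1 := smooth_at_hq i sg.
have := @hq_unique f (fun x => - xi x * g x) (fun x => g x - xi x * hq i g x) _ _.
move=> /(_ (smooth_at_sub sg (smooth_at_mul sx sg1))) H.
suff /H/nbhs_singleton -> : \forall x \near (0 : 'rV[R]_n),
  f x = - xi (setc i 0 x) * g (setc i 0 x) + x 0 i * (g x - xi x * hq i g x).
  by rewrite x0 mul0r subr0.
apply: filterS Eg => x ->; rewrite xi0.
have := hqE i g x; move: (g x) (g _) (hq i g x) (xi x) (x 0 i) => a b c d p ->; ring.
Qed.

(** For fixed other coordinates, [xi] is the critical point of [D] in [x_i], found by the implicit
    function theorem for the partial derivative. Translated to it, [D] has no linear term in [x_i],
    and two Hadamard divisions leave the critical value [delta] and a square times [q]. *)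
Lemma morse D : smooth_at 0 D -> hq i D 0 = 0 -> hq i (hq i D) 0 != 0 ->
  exists xi delta q : 'rV[R]_n -> R,
    [/\ [/\ smooth_at 0 xi, smooth_at 0 delta & smooth_at 0 q],
        xi 0 = 0, (forall x, xi (setc i 0 x) = xi x) /\
                  (forall x, delta (setc i 0 x) = delta x),
        q 0 = hq i (hq i D) 0 &
        \forall x \near (0 : 'rV[R]_n), D x = delta x + (x 0 i - xi x) ^+ 2 * q x].
Proof.
move=> sD D1 D2; set k := hq i (hq i D) 0 in D2 *.
pose h1 x := hq i D x; pose h2 x := hq i (hq i D) x.
have s1 : smooth_at 0 h1 by exact: smooth_at_hq.
have s2 : smooth_at 0 h2 by exact: smooth_at_hq.
have s3 := smooth_at_derive e s2.
have ED x : D x = D (setc i 0 x) + x 0 i * (h1 (setc i 0 x) + x 0 i * h2 x).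
  by rewrite [LHS](hqE i) -[hq i D x]/(h1 x) [h1 x](hqE i).
pose F := 'D_e D; have sF : smooth_at 0 F by exact: smooth_at_derive.
have F0 : F 0 = 0 by rewrite /F -hq0.
(* The factor of [x_i] that appears when the second-order expansion [ED] is differentiated in [x_i];
   its value at 0 is [2 k]. *)
pose G x := 2 * h2 x + x 0 i * 'D_e h2 x.
have sc : smooth_at 0 (fun x : 'rV[R]_n => x 0 i) by exact: smooth_at_coord.
have sG : smooth_at 0 G.
  apply: smooth_at_add; apply: smooth_at_mul => //; exact: smooth_at_cst.
have dcs (c : 'rV[R]_n -> R) (x : 'rV[R]_n) : 'D_e (fun x => c (setc i 0 x)) x = 0.
  apply/lim_near_cst => //=; near=> t.
  have -> : setc i 0 (t *: e + x) = setc i 0 x.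
    apply/rowP => j; rewrite !mxE eqxx /=; case: eqP => //= _.
    by rewrite mulr0 add0r.
  by rewrite subrr scaler0.
have ss (c : 'rV[R]_n -> R) : smooth_at 0 c -> smooth_at 0 (fun x => c (setc i 0 x)).
  move=> sc'; apply: (@smooth_at_comp _ _ _ c (setc i 0)); first exact: smooth_at_setc.
  rewrite (_ : setc i 0 0 = 0) //; apply/rowP => j; by rewrite !mxE if_same.
have EF : \forall x \near (0 : 'rV[R]_n), F x = h1 (setc i 0 x) + x 0 i * G x.
  have nD := smooth_at_near (ss _ sD); have n1 := smooth_at_near (ss _ s1).
  have n2 := smooth_at_near s2.
  apply: filter_app nD; apply: filter_app n1; apply: filterS n2.
  move=> x /smooth_at_differentiable d3 /smooth_at_differentiable d2 /smooth_at_differentiable d1.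
  have dx := differentiable_coord_rV x i.
  rewrite /F (_ : D = fun x => D (setc i 0 x) + x 0 i * (h1 (setc i 0 x) + x 0 i * h2 x)); last exact/funext.
  have d4 := differentiableM dx d3.
  have d5 := differentiableD d2 d4.
  have d6 := differentiableM dx d5.
  have A1 := deriveD (diff_derivable (v := e) d1) (diff_derivable (v := e) d6).
  have A2 := deriveM (diff_derivable (v := e) dx) (diff_derivable (v := e) d5).
  have A3 := deriveD (diff_derivable (v := e) d2) (diff_derivable (v := e) d4).
  have A4 := deriveM (diff_derivable (v := e) dx) (diff_derivable (v := e) d3).
  rewrite A3 in A2; rewrite A4 in A2; rewrite A2 in A1.
  apply: etrans A1 _; rewrite !dcs !derive_coord mxE !eqxx /=.
  rewrite -![_ *: _]/(_ * _) /G.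
  rewrite [X in _ * _ + X * _]/=.
  rewrite !fctE.
  move: (h1 _) (h2 x) ('D_e h2 x) (x 0 i) => a b c d; ring.
have G0 : G 0 != 0 by rewrite /G mxE mul0r addr0 mulf_neq0 // pnatr_eq0.
have [xi [sx x0 xi0 Hx]] := implicit_hq sF F0 sG G0 EF.
pose Psi := shiftc xi; pose Phi := shiftc (fun x => - xi x).
have sPsi : smooth_at 0 Psi by exact: smooth_at_shiftc.
have sPhi : smooth_at 0 Phi by apply: smooth_at_shiftc; exact: smooth_at_opp.
have Psi0 : Psi 0 = 0 by exact: shiftc0.
have Phi0 : Phi 0 = 0 by apply: shiftc0; rewrite x0 oppr0.
pose Dt x := D (Psi x).
have sDt : smooth_at 0 Dt by apply: smooth_at_comp => //; rewrite Psi0.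
have PsiE x : Psi (setc i 0 x) = setc i (xi x) x.
  by rewrite /Psi /shiftc setc_i add0r setcK xi0.
have Z : \forall x \near (0 : 'rV[R]_n), hq i Dt (setc i 0 x) = 0.
  apply: filterS Hx => x Hx; rewrite /hq setc_i eqxx.
  transitivity (F (setc i (xi x) x)); last exact: Hx.
  rewrite /F /derive; set a := setc i 0 x; set b := setc i (xi x) x.
  suff -> : (fun t : R => t^-1 *: ((Dt \o shift a) (t *: e) - Dt a)) =
    (fun t : R => t^-1 *: ((D \o shift b) (t *: e) - D b)) by [].
  apply/funext => t; rewrite /a /b /= /Dt PsiE; congr (_ *: (D _ - D _)).
  have xt : xi (t *: e + setc i 0 x) = xi x.
    rewrite -xi0 -[RHS]xi0; congr xi; apply/rowP => j; rewrite !mxE eqxx /=.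
    by case: eqP => //= _; rewrite mulr0 add0r.
  rewrite /Psi /shiftc xt; apply/rowP => j; rewrite !mxE eqxx /=.
  by rewrite eqxx; case: eqP => [_|_] /=; rewrite ?mulr1 ?mulr0 ?addr0 ?add0r.
pose q x := hq i (hq i Dt) (Phi x).
have sq : smooth_at 0 q.
  by apply: smooth_at_comp => //; rewrite Phi0; do 2!apply: smooth_at_hq.
pose delta x := Dt (setc i 0 x).
have E : \forall x \near (0 : 'rV[R]_n), D x = delta x + (x 0 i - xi x) ^+ 2 * q x.
  have Zs := near_comp sPhi Phi0 Z.
  apply: filterS Zs => x Zs; rewrite -[in LHS](shiftcK x xi0) -/(Dt _).
  rewrite -/Phi (hqE i Dt) (hqE i (hq i Dt)) Zs add0r -/(q x).
  have -> : setc i 0 (Phi x) = setc i 0 x by rewrite /Phi /shiftc setcK.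
  by rewrite {1 2}/Phi /shiftc setc_i -/(delta x) mulrA expr2.
have di x : delta (setc i 0 x) = delta x by rewrite /delta setcK.
exists xi, delta, q; split=> //.
  by split=> //; exact: ss.
(* The value [q 0] is recovered by dividing the final decomposition twice. *)
have sq1 := smooth_at_hq i sq; have sq2 := smooth_at_hq i sq1.
pose u x := xi x ^+ 2 * hq i q x - 2 * xi x * q x + x 0 i * q x.
have su : smooth_at 0 u.
  apply: smooth_at_add; last exact: smooth_at_mul.
  apply: smooth_at_sub; first by apply: smooth_at_mul => //; exact: smooth_at_exp.
  by do 2!apply: smooth_at_mul => //; exact: smooth_at_cst.
have H1 : \forall x \near (0 : 'rV[R]_n), h1 x = u x.
  apply: (@hq_unique D (fun x => delta x + xi x ^+ 2 * q x)) => //.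
  apply: filterS E => x ->; rewrite di xi0 /u.
  have := hqE i q x; move: (q x) (q _) (hq i q x) (xi x) (x 0 i) => a b c d p ->; ring.
pose w x := xi x ^+ 2 * hq i (hq i q) x - 2 * xi x * hq i q x + q x.
have sw : smooth_at 0 w.
  apply: smooth_at_add => //.
  apply: smooth_at_sub; first by apply: smooth_at_mul => //; exact: smooth_at_exp.
  by do 2!apply: smooth_at_mul => //; exact: smooth_at_cst.
have H2 : \forall x \near (0 : 'rV[R]_n), hq i h1 x = w x.
  apply: (@hq_unique h1 (fun x => xi x ^+ 2 * hq i q x - 2 * xi x * q x)) => //.
  apply: filterS H1 => x ->; rewrite xi0 /u /w.
  have := hqE i q x; have := hqE i (hq i q) x.
  move: (q x) (q _) (hq i q x) (hq i q _) (hq i (hq i q) x) (xi x) (x 0 i) => a b c d p r s' -> ->; ring.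
by rewrite /k (nbhs_singleton H2) /w x0 expr2 !mul0r mulr0 !mul0r subr0 add0r.
Unshelve. all: by end_near. Qed.

End HadamardCalculus.

Lemma derive_quot (R : realType) (V : normedModType R) (f g : V -> R) (a b v : V) :
  (forall t : R, f (t *: v + a) - f a = g (t *: v + b) - g b) -> 'D_v f a = 'D_v g b.
Proof.
move=> H; rewrite /derive.
suff -> : (fun h : R => h^-1 *: ((f \o shift a) (h *: v) - f a)) =
  (fun h : R => h^-1 *: ((g \o shift b) (h *: v) - g b)) by [].
by apply/funext => h /=; rewrite H.
Qed.

Notation "\near0 x , P" := {near (0 : 'rV[_]_2), forall x : 'rV[_]_2, P}
  (at level 200, x name, P at level 200).

(** * Taylor coefficients in two variables *)

Section TaylorCoefficients.
Variable R : realType.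
Implicit Types (x y : 'rV[R]_2) (f g h : 'rV[R]_2 -> R).

Definition vec2 (a b : R) : 'rV[R]_2 := \row_j (if j == 0 then a else b).

Lemma vec2_1 a b : vec2 a b 0 0 = a. Proof. by rewrite mxE. Qed.
Lemma vec2_2 a b : vec2 a b 0 1 = b. Proof. by rewrite mxE. Qed.

Lemma rV2P x y : x 0 0 = y 0 0 -> x 0 1 = y 0 1 -> x = y.
Proof.
move=> E1 E2; apply/rowP => j; case: (unliftP 0 j) => [k|] ->; last exact: E1.
by rewrite (ord1 k) (_ : lift 0 0 = 1) //; apply/val_inj.
Qed.

Lemma vec2E x : vec2 (x 0 0) (x 0 1) = x.
Proof. by apply: rV2P; rewrite ?vec2_1 ?vec2_2. Qed.

Lemma setc_vec2_1 t x : setc 0 t x = vec2 t (x 0 1).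
Proof. by apply: rV2P; rewrite ?vec2_1 ?vec2_2 mxE. Qed.

Lemma setc_vec2_2 t x : setc 1 t x = vec2 (x 0 0) t.
Proof. by apply: rV2P; rewrite ?vec2_1 ?vec2_2 mxE. Qed.

Lemma vec200 : vec2 0 0 = 0.
Proof. by apply: rV2P; rewrite ?vec2_1 ?vec2_2 mxE. Qed.

Lemma smooth_at_vec2 (V : normedModType R) (u v : V -> R) a :
  smooth_at a u -> smooth_at a v -> smooth_at a (fun t : V => vec2 (u t) (v t)).
Proof.
move=> su sv; apply: smooth_at_entries => k j; rewrite (ord1 k).
rewrite (_ : (fun t : V => _) = fun t : V => if j == 0 then u t else v t).
  by case: eqP.
by apply/funext => t; rewrite mxE.
Qed.

Lemma smooth_at_comp2 (V : normedModType R) (u v : V -> R) f a :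
  smooth_at a u -> smooth_at a v -> smooth_at (vec2 (u a) (v a)) f ->
  smooth_at a (fun t : V => f (vec2 (u t) (v t))).
Proof. move=> su sv sf.
exact: (@smooth_at_comp _ _ _ f (fun t : V => vec2 (u t) (v t)) a (smooth_at_vec2 su sv) sf). Qed.

Lemma smooth_at_comp0 (V : normedModType R) (u v : V -> R) f (a : V) :
  smooth_at 0 f -> u a = 0 -> v a = 0 -> smooth_at a u -> smooth_at a v ->
  smooth_at a (fun t : V => f (vec2 (u t) (v t))).
Proof. by move=> sf u0 v0 su sv; apply: smooth_at_comp2 => //; rewrite u0 v0 vec200. Qed.

Lemma setc00 (i : 'I_2) : setc i 0 (0 : 'rV[R]_2) = 0.
Proof. by apply/rowP => j; rewrite !mxE if_same. Qed.

Lemma smooth_at_axis (i : 'I_2) f : smooth_at 0 f -> smooth_at 0 (fun x => f (setc i 0 x)).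
Proof.
move=> sf; apply: (@smooth_at_comp _ _ _ f (setc i 0)); first exact: smooth_at_setc.
by rewrite setc00.
Qed.

Lemma smooth_at_X (i : 'I_2) a : smooth_at a (fun x : 'rV[R]_2 => x 0 i).
Proof. exact: smooth_at_coord. Qed.

Lemma smooth_iter_hq (i : 'I_2) k f : smooth_at 0 f -> smooth_at 0 (iter k (hq i) f).
Proof. by move=> sf; elim: k => //= k; exact: smooth_at_hq. Qed.

Lemma setc_comm (i j : 'I_2) x : setc i 0 (setc j 0 x) = setc j 0 (setc i 0 x).
Proof. by apply/rowP => k; rewrite !mxE; case: (k == i); case: (k == j). Qed.

Lemma hq_axis (i j : 'I_2) f x : i != j ->
  hq i (fun x => f (setc j 0 x)) x = hq i f (setc j 0 x).
Proof.
move=> ij; rewrite /hq [(setc j 0 x) 0 i]mxE (negbTE ij).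
case: ifP => _; last by rewrite setc_comm.
apply: derive_quot => t; congr (f _ - _); apply/rowP => k; rewrite !mxE.
by case: eqP => [->|_] //; rewrite eq_sym (negbTE ij) mulr0 add0r.
Qed.

Lemma iter_hq_axis (i j : 'I_2) k f x : i != j ->
  iter k (hq i) (fun x => f (setc j 0 x)) x = iter k (hq i) f (setc j 0 x).
Proof.
move=> ij; suff -> : iter k (hq i) (fun x => f (setc j 0 x)) =
  fun x => iter k (hq i) f (setc j 0 x) by [].
elim: k => //= k ->; apply/funext => y; exact: hq_axis.
Qed.

Lemma iter_hq_ext (i : 'I_2) k f g : smooth_at 0 f -> smooth_at 0 g ->
  (\near0 x, f x = g x) ->
  \near0 x, iter k (hq i) f x = iter k (hq i) g x.
Proof.
move=> sf sg E; elim: k => //= k IH; apply: hq_ext IH; exact: smooth_iter_hq.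
Qed.

Lemma iter_hq_add (i : 'I_2) k f g : smooth_at 0 f -> smooth_at 0 g ->
  \near0 x,
    iter k (hq i) (fun x => f x + g x) x = iter k (hq i) f x + iter k (hq i) g x.
Proof.
move=> sf sg; elim: k => [|k IH]; first exact: near_all.
have sfk := smooth_iter_hq i k sf; have sgk := smooth_iter_hq i k sg.
have H1 : \near0 x, iter k.+1 (hq i) (fun x => f x + g x) x =
    hq i (fun x => iter k (hq i) f x + iter k (hq i) g x) x.
  by apply: hq_ext IH; exact: smooth_at_add.
by apply: filter_app H1; apply: filterS (hq_add i sfk sgk) => x /= -> ->.
Qed.

Lemma iter_hq_mull (i : 'I_2) k f g : smooth_at 0 f -> smooth_at 0 g ->
  (forall x, f (setc i 0 x) = f x) ->
  \near0 x,
    iter k (hq i) (fun x => f x * g x) x = f x * iter k (hq i) g x.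
Proof.
move=> sf sg fi; elim: k => [|k IH]; first exact: near_all.
have sgk := smooth_iter_hq i k sg.
have H1 : \near0 x, iter k.+1 (hq i) (fun x => f x * g x) x =
    hq i (fun x => f x * iter k (hq i) g x) x.
  by apply: hq_ext IH; exact: smooth_at_mul.
by apply: filter_app H1; apply: filterS (hq_mull sf sgk fi) => x /= -> ->.
Qed.

(** Splitting [f] along [x1] gives a part without [x1] and a multiple of [x1], and dividing by [x2]
    respects both parts. *)
Lemma hq_comm f : smooth_at 0 f ->
  \near0 x, hq 0 (hq 1 f) x = hq 1 (hq 0 f) x.
Proof.
move=> sf; have s0 := smooth_at_hq 0 sf.
apply: (@hq_unique R 2 0 _ (hq 1 f)); first exact: smooth_at_hq.
pose f0 x := f (setc 0 0 x); pose f1 x := (x : 'rV[R]_2) 0 0 * hq 0 f x.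
have sf0 : smooth_at 0 f0 by exact: smooth_at_axis.
have sX := smooth_at_X 0 0.
have sf1 : smooth_at 0 f1 by exact: smooth_at_mul.
have H1 : \near0 x, hq 1 f x = hq 1 (fun x => f0 x + f1 x) x.
  apply: hq_ext; first exact: smooth_at_add.
  by apply: near_all => x; rewrite [LHS](hqE 0).
have H3 : \near0 x, hq 1 f1 x = x 0 0 * hq 1 (hq 0 f) x.
  by apply: hq_mull => // x; rewrite mxE.
apply: filter_app H1; apply: filter_app H3; apply: filterS (hq_add 1 sf0 sf1) => x -> -> ->.
by rewrite /f0 hq_axis.
Qed.

Lemma near_eq0 f g : (\near0 x, f x = g x) -> f 0 = g 0.
Proof. by move=> /nbhs_singleton. Qed.

(* Coefficient of [x1 ^ i * x2 ^ j] in the Taylor expansion of [f] at 0. *)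
Definition tc (i j : nat) f : R := iter i (hq 0) (iter j (hq 1) f) 0.

Lemma tc_ext i j f g : smooth_at 0 f -> smooth_at 0 g ->
  (\near0 x, f x = g x) -> tc i j f = tc i j g.
Proof.
move=> sf sg E; rewrite /tc; apply: near_eq0.
apply: iter_hq_ext; [exact: smooth_iter_hq|exact: smooth_iter_hq|exact: iter_hq_ext].
Qed.

Lemma tc00 f : tc 0 0 f = f 0. Proof. by []. Qed.

Lemma tcD i j f g : smooth_at 0 f -> smooth_at 0 g ->
  tc i j (fun x => f x + g x) = tc i j f + tc i j g.
Proof.
move=> sf sg; have sfk := smooth_iter_hq 1 j sf; have sgk := smooth_iter_hq 1 j sg.
have := nbhs_singleton (iter_hq_add 0 i sfk sgk) => <-.
rewrite /tc; apply: near_eq0.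
apply: iter_hq_ext; first by apply: smooth_iter_hq; exact: smooth_at_add.
  exact: smooth_at_add.
exact: iter_hq_add.
Qed.

Lemma tcZ i j (c : R) f : smooth_at 0 f -> tc i j (fun x => c * f x) = c * tc i j f.
Proof.
move=> sf; have sfk := smooth_iter_hq 1 j sf; have sc := @smooth_at_cst R 'rV[R]_2 R 0 c.
have := nbhs_singleton (@iter_hq_mull 0 i (fun=> c) _ sc sfk (fun=> erefl)) => <-.
rewrite /tc; apply: near_eq0.
apply: iter_hq_ext; first by apply: smooth_iter_hq; exact: smooth_at_mul.
  exact: smooth_at_mul.
exact: (@iter_hq_mull 1 j (fun=> c) _ sc sf).
Qed.

Lemma tcN i j f : smooth_at 0 f -> tc i j (fun x => - f x) = - tc i j f.
Proof.
move=> sf; rewrite -mulN1r -tcZ //; congr tc; apply/funext => x; by rewrite mulN1r.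
Qed.

Lemma tc_swap i j f : smooth_at 0 f -> tc i j f = iter j (hq 1) (iter i (hq 0) f) 0.
Proof.
move=> sf.
have H1 g : smooth_at 0 g -> \near0 x,
    hq 0 (iter j (hq 1) g) x = iter j (hq 1) (hq 0 g) x.
  move=> sg; elim: j => [|k IH]; first exact: near_all.
  have sgk := smooth_iter_hq 1 k sg.
  have E : \near0 x, hq 1 (hq 0 (iter k (hq 1) g)) x =
      hq 1 (iter k (hq 1) (hq 0 g)) x.
    by apply: hq_ext IH; apply: smooth_iter_hq; exact: smooth_at_hq.
  by apply: filter_app E; apply: filterS (hq_comm sgk) => x /= -> ->.
have H2 : \near0 x,
    iter i (hq 0) (iter j (hq 1) f) x = iter j (hq 1) (iter i (hq 0) f) x.
  elim: i => [|k IH]; first exact: near_all.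
  have sfk := smooth_iter_hq 0 k sf.
  have E : \near0 x, hq 0 (iter k (hq 0) (iter j (hq 1) f)) x =
      hq 0 (iter j (hq 1) (iter k (hq 0) f)) x.
    by apply: hq_ext IH; exact: smooth_iter_hq.
  by apply: filter_app E; apply: filterS (H1 _ sfk) => x /= -> ->.
exact: nbhs_singleton H2.
Qed.

Lemma tc_hq1 i j f : smooth_at 0 f -> tc i j (hq 0 f) = tc i.+1 j f.
Proof. by move=> sf; rewrite tc_swap ?tc_swap //; [rewrite -iterSr|exact: smooth_at_hq]. Qed.

Lemma tc_hq2 i j f : tc i j (hq 1 f) = tc i j.+1 f.
Proof. by rewrite /tc -iterSr. Qed.

Lemma tc_axis1 j f : tc 0 j f = tc 0 j (fun x => f (setc 0 0 x)).
Proof. by rewrite /tc /= iter_hq_axis // setc00. Qed.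

Lemma tc_axis2 i f : smooth_at 0 f -> tc i 0 f = tc i 0 (fun x => f (setc 1 0 x)).
Proof. by move=> sf; rewrite /tc /= iter_hq_axis // setc00. Qed.

Lemma hq_const (i : 'I_2) f : (forall x, f (setc i 0 x) = f x) ->
  \near0 x, hq i f x = 0.
Proof.
move=> fi; apply: (@hq_unique R 2 i f f (fun=> 0)); first exact: smooth_at_cst.
by apply: near_all => x; rewrite fi mulr0 addr0.
Qed.

Lemma tc_indep1 i j f : smooth_at 0 f -> (forall x, f (setc 0 0 x) = f x) ->
  tc i.+1 j f = 0.
Proof.
move=> sf fi; rewrite -tc_hq1 //.
rewrite (@tc_ext _ _ _ (fun=> 0)) //; last 3 first.
- exact: smooth_at_hq.
- exact: smooth_at_cst.
- exact: hq_const.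
have E := tcZ i j 0 sf; rewrite mul0r in E.
by rewrite -[RHS]E; congr tc; apply/funext => x; rewrite mul0r.
Qed.

Lemma tc_cst i j (c : R) : tc i j (fun=> c) = if (i == 0%N) && (j == 0%N) then c else 0.
Proof.
have sc := @smooth_at_cst R 'rV[R]_2 R 0 c.
case: i => [|i] /=; last by rewrite tc_indep1.
case: j => [|j] //=; rewrite -tc_hq2.
rewrite (@tc_ext _ _ _ (fun=> 0)) //; last 3 first.
- exact: smooth_at_hq.
- exact: smooth_at_cst.
- exact: hq_const.
by have := tcZ 0 j 0 sc; rewrite !mul0r.
Qed.

Lemma hqM (i : 'I_2) f g : smooth_at 0 f -> smooth_at 0 g ->
  \near0 x,
   hq i (fun x => f x * g x) x = f (setc i 0 x) * hq i g x + hq i f x * g x.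
Proof.
move=> sf sg; apply: (@hq_unique _ _ _ _ (fun x => f x * g x)).
  apply: smooth_at_add; apply: smooth_at_mul => //; try exact: smooth_at_hq.
  exact: smooth_at_axis.
apply: near_all => x; have := hqE i f x; have := hqE i g x.
move: (f x) (f _) (g x) (g _) (hq i f x) (hq i g x) (x 0 i) => a b c d p q r -> ->; ring.
Qed.

(** Without factorials the Leibniz rule is the Cauchy product. The induction uses the product rule
    [hqM], where one factor is restricted to the axis and so contributes only its terms of order 0
    in that variable. *)
Lemma tcM i j f g : smooth_at 0 f -> smooth_at 0 g ->
  tc i j (fun x => f x * g x) =
  \sum_(a < i.+1) \sum_(b < j.+1) tc a b f * tc (i - a) (j - b) g.
Proof.
elim: j i f g => [|j IHj] i f g sf sg.
  elim: i f g sf sg => [|i IHi] f g sf sg; first by rewrite !big_ord1.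
  rewrite -tc_hq1; last exact: smooth_at_mul.
  have s1 := smooth_at_hq 0 sf; have s2 := smooth_at_hq 0 sg; have s3 := smooth_at_axis 0 sf.
  rewrite (@tc_ext _ _ _ (fun x => f (setc 0 0 x) * hq 0 g x + hq 0 f x * g x)); last 3 first.
  - by apply: smooth_at_hq; exact: smooth_at_mul.
  - by apply: smooth_at_add; exact: smooth_at_mul.
  - exact: hqM.
  rewrite tcD; last 2 first.
  - exact: smooth_at_mul.
  - exact: smooth_at_mul.
  rewrite !IHi // [RHS]big_ord_recl; congr (_ + _).
    rewrite big_ord_recl [X in _ + X]big1 ?addr0 => [|k _].
      rewrite !big_ord1 subn0 -tc_axis1 subn0 tc_hq1 //.
    by rewrite big_ord1 tc_indep1 ?mul0r // => x; rewrite setcK.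
  by apply: eq_bigr => k _; rewrite !big_ord1 tc_hq1.
rewrite -tc_hq2.
have s1 := smooth_at_hq 1 sf; have s2 := smooth_at_hq 1 sg; have s3 := smooth_at_axis 1 sf.
rewrite (@tc_ext _ _ _ (fun x => f (setc 1 0 x) * hq 1 g x + hq 1 f x * g x)); last 3 first.
- by apply: smooth_at_hq; exact: smooth_at_mul.
- by apply: smooth_at_add; exact: smooth_at_mul.
- exact: hqM.
rewrite tcD; last 2 first.
- exact: smooth_at_mul.
- exact: smooth_at_mul.
rewrite !IHj // -big_split /=; apply: eq_bigr => k _.
rewrite [RHS]big_ord_recl; congr (_ + _).
  rewrite big_ord_recl [X in _ + X]big1 ?addr0 => [|l _].
    by rewrite !subn0 tc_hq2 -tc_axis2.
  rewrite -tc_hq2 (@tc_ext _ _ _ (fun=> 0)) ?tc_cst ?if_same ?mul0r //.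
  - exact: smooth_at_hq.
  - exact: smooth_at_cst.
  - by apply: hq_const => x; rewrite setcK.
by apply: eq_bigr => l _; rewrite tc_hq2.
Qed.

Lemma tc_mulX1 i j g : smooth_at 0 g ->
  tc i j (fun x : 'rV[R]_2 => x 0 0 * g x) = if i is i'.+1 then tc i' j g else 0.
Proof.
move=> sg; have sX := smooth_at_X 0 0; have sXg := smooth_at_mul sX sg.
case: i => [|i]; last first.
  rewrite -tc_hq1 //; apply: tc_ext => //; first exact: smooth_at_hq.
  exact: hq_mulX.
rewrite tc_axis1 (_ : (fun x => _) = fun=> 0); first by rewrite tc_cst if_same.
by apply/funext => x; rewrite mxE eqxx mul0r.
Qed.

Lemma tc_mulX2 i j g : smooth_at 0 g ->
  tc i j (fun x : 'rV[R]_2 => x 0 1 * g x) = if j is j'.+1 then tc i j' g else 0.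
Proof.
move=> sg; have sX := smooth_at_X 1 0; have sXg := smooth_at_mul sX sg.
case: j => [|j]; last first.
  rewrite -tc_hq2 //; apply: tc_ext => //; first exact: smooth_at_hq.
  exact: hq_mulX.
rewrite tc_axis2 // (_ : (fun x => _) = fun=> 0); first by rewrite tc_cst if_same.
by apply/funext => x; rewrite mxE eqxx mul0r.
Qed.

Lemma tc_mulX1n l i j g : smooth_at 0 g ->
  tc i j (fun x : 'rV[R]_2 => x 0 0 ^+ l * g x) = if (l <= i)%N then tc (i - l) j g else 0.
Proof.
move=> sg; elim: l i => [|l IH] i.
  by rewrite subn0; congr tc; apply/funext => x; rewrite expr0 mul1r.
rewrite (_ : (fun x => _) = fun x : 'rV[R]_2 => x 0 0 * (x 0 0 ^+ l * g x)); last first.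
  by apply/funext => x; rewrite exprS mulrA.
rewrite tc_mulX1; last by apply: smooth_at_mul => //; apply: smooth_at_exp; exact: smooth_at_X.
by case: i => [|i] //; rewrite IH.
Qed.

Lemma tc_mulX2n l i j g : smooth_at 0 g ->
  tc i j (fun x : 'rV[R]_2 => x 0 1 ^+ l * g x) = if (l <= j)%N then tc i (j - l) g else 0.
Proof.
move=> sg; elim: l j => [|l IH] j.
  by rewrite subn0; congr tc; apply/funext => x; rewrite expr0 mul1r.
rewrite (_ : (fun x => _) = fun x : 'rV[R]_2 => x 0 1 * (x 0 1 ^+ l * g x)); last first.
  by apply/funext => x; rewrite exprS mulrA.
rewrite tc_mulX2; last by apply: smooth_at_mul => //; apply: smooth_at_exp; exact: smooth_at_X.
by case: j => [|j] //; rewrite IH.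
Qed.

(** Vanishing coefficients make each successive quotient along [x2] exact on the axis. Restricting
    the last quotient to the axis makes [h] a function of [x2] alone. *)
Lemma axis1_div l f : smooth_at 0 f -> (forall j, (j < l)%N -> tc 0 j f = 0) ->
  exists h, [/\ smooth_at 0 h, (forall x, h (setc 0 0 x) = h x), h 0 = tc 0 l f &
    forall x, f (setc 0 0 x) = x 0 1 ^+ l * h x].
Proof.
move=> sf H; exists (fun x => iter l (hq 1) f (setc 0 0 x)); split=> //.
- by apply: smooth_at_axis; exact: smooth_iter_hq.
- by move=> x; rewrite setcK.
- by rewrite setc00.
move=> x; elim: l H => [|l IH] H; first by rewrite expr0 mul1r.
rewrite IH; last by move=> j jl; apply: H; exact: ltnW.
rewrite [iter l _ f _](hqE 1) exprSr -mulrA; congr (_ * _).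
rewrite mxE /= [X in X + _](_ : _ = 0) ?add0r // setc_vec2_2 setc_vec2_1 vec2_1 vec200.
exact: H.
Qed.

Lemma axis2_div l f : smooth_at 0 f -> (forall i, (i < l)%N -> tc i 0 f = 0) ->
  exists h, [/\ smooth_at 0 h, (forall x, h (setc 1 0 x) = h x), h 0 = tc l 0 f &
    forall x, f (setc 1 0 x) = x 0 0 ^+ l * h x].
Proof.
move=> sf H; exists (fun x => iter l (hq 0) f (setc 1 0 x)); split=> //.
- by apply: smooth_at_axis; exact: smooth_iter_hq.
- by move=> x; rewrite setcK.
- by rewrite setc00.
move=> x; elim: l H => [|l IH] H; first by rewrite expr0 mul1r.
rewrite IH; last by move=> j jl; apply: H; exact: ltnW.
rewrite [iter l _ f _](hqE 0) exprSr -mulrA; congr (_ * _).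
rewrite mxE /= [X in X + _](_ : _ = 0) ?add0r // setc_vec2_1 setc_vec2_2 vec2_2 vec200.
exact: (H l).
Qed.

End TaylorCoefficients.

Ltac smooth_step :=
  match goal with
  | |- smooth_at _ (fun _ => ?c) => exact: smooth_at_cst
  | |- smooth_at _ (fun x => fun_of_matrix x _ _) => exact: smooth_at_X
  | |- smooth_at _ (fun x => - (@?f x)) => apply: smooth_at_opp
  | |- smooth_at _ (fun x => @?f x - @?g x) => apply: smooth_at_sub
  | |- smooth_at _ (fun x => @?f x + @?g x) => apply: smooth_at_add
  | |- smooth_at _ (fun x => @?f x ^+ _) => apply: smooth_at_exp
  | |- smooth_at _ (fun x => @?f x * @?g x) => apply: smooth_at_mul
  | |- smooth_at _ (fun x => vec2 (@?f x) (@?g x)) => apply: smooth_at_vec2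
  | H : smooth_at ?a ?f |- smooth_at ?a ?f => exact H
  | |- smooth_at _ _ =>
      first [ assumption
            | exact: smooth_at_cst
            | exact: smooth_at_coord
            | exact: smooth_at_X
            | apply: smooth_at_inv
            | apply: smooth_at_axis
            | apply: smooth_at_hq
            | apply: smooth_at_opp
            | apply: smooth_at_sub
            | apply: smooth_at_add
            | apply: smooth_at_exp
            | apply: smooth_at_mul
            | apply: smooth_at_vec2 ]
  end.
Ltac smooth := repeat smooth_step.

(** * Diffeomorphism germs of the plane *)

Section Diffeos.
Variable R : realType.
Implicit Types (x y : 'rV[R]_2) (f g u v : 'rV[R]_2 -> R) (Phi Psi : 'rV[R]_2 -> 'rV[R]_2).

Lemma tc_X1 i j : tc i j (fun x : 'rV[R]_2 => x 0 0) = if (i == 1%N) && (j == 0%N) then 1 else 0.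
Proof.
rewrite (_ : (fun x => _) = fun x : 'rV[R]_2 => x 0 0 * 1); last first.
  by apply/funext => x; rewrite mulr1.
rewrite tc_mulX1; last exact: smooth_at_cst.
by case: i => [|i] //; rewrite tc_cst.
Qed.

Lemma tc_X2 i j : tc i j (fun x : 'rV[R]_2 => x 0 1) = if (i == 0%N) && (j == 1%N) then 1 else 0.
Proof.
rewrite (_ : (fun x => _) = fun x : 'rV[R]_2 => x 0 1 * 1); last first.
  by apply/funext => x; rewrite mulr1.
rewrite tc_mulX2; last exact: smooth_at_cst.
by case: j => [|j] //; rewrite ?andbF // tc_cst eqSS.
Qed.

Lemma hadamard2 f : smooth_at 0 f -> exists g h, [/\ smooth_at 0 g, smooth_at 0 h,
  g 0 = tc 1 0 f, h 0 = tc 0 1 f & forall x, f x = f 0 + x 0 0 * g x + x 0 1 * h x].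
Proof.
move=> sf; exists (hq 0 f), (fun x => hq 1 f (setc 0 0 x)); split; [smooth|smooth|by []| |].
  by rewrite setc00.
move=> x; rewrite [LHS](hqE 0) addrAC; congr (_ + _).
by rewrite [LHS](hqE 1) setc_vec2_1 setc_vec2_2 vec2_1 vec200 vec2_2.
Qed.

Lemma tc_comp1 f u v : smooth_at 0 f -> smooth_at 0 u -> smooth_at 0 v -> u 0 = 0 -> v 0 = 0 ->
  tc 1 0 (fun x => f (vec2 (u x) (v x))) = tc 1 0 f * tc 1 0 u + tc 0 1 f * tc 1 0 v /\
  tc 0 1 (fun x => f (vec2 (u x) (v x))) = tc 1 0 f * tc 0 1 u + tc 0 1 f * tc 0 1 v.
Proof.
move=> sf su sv u0 v0; have [g [h [sg sh g0 h0 E]]] := hadamard2 sf.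
have sgc : smooth_at 0 (fun x => g (vec2 (u x) (v x))) by exact: smooth_at_comp0.
have shc : smooth_at 0 (fun x => h (vec2 (u x) (v x))) by exact: smooth_at_comp0.
have -> : (fun x => f (vec2 (u x) (v x))) =
   fun x => f 0 + u x * g (vec2 (u x) (v x)) + v x * h (vec2 (u x) (v x)).
  by apply/funext => x; rewrite [LHS]E vec2_1 vec2_2.
rewrite !tcD; try by smooth.
rewrite !tcM // !tc_cst /= !(big_ord_recl, big_ord0) /= !tc00 u0 v0 vec200 g0 h0.
by split; ring.
Qed.

Lemma near0_comp2 u v (P : 'rV[R]_2 -> Prop) : smooth_at 0 u -> smooth_at 0 v ->
  u 0 = 0 -> v 0 = 0 -> (\near0 x, P x) ->
  \near0 x, P (vec2 (u x) (v x)).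
Proof.
move=> su sv u0 v0; apply: (near_comp (Phi := fun x => vec2 (u x) (v x))); first by smooth.
by rewrite u0 v0 vec200.
Qed.

Lemma diffeo_germ_comp Phi Psi : diffeo_germ Phi -> diffeo_germ Psi ->
  diffeo_germ (fun x => Phi (Psi x)).
Proof.
move=> [/smooth_germP sP P0 [P' [/smooth_germP sP' P'0 K1 K2]]].
move=> [/smooth_germP sQ Q0 [Q' [/smooth_germP sQ' Q'0 L1 L2]]].
split; first by apply/smooth_germP; apply: smooth_at_comp_mx => //; rewrite Q0.
  by rewrite Q0.
exists (fun x => Q' (P' x)); split.
- by apply/smooth_germP; apply: smooth_at_comp_mx => //; rewrite P'0.
- by rewrite P'0.
- by apply: filter_app L1; apply: filterS (near_comp sQ Q0 K1) => x -> ->.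
- by apply: filter_app K2; apply: filterS (near_comp sP' P'0 L2) => x -> ->.
Qed.

Lemma diffeo_germ_near Phi Psi : diffeo_germ Phi ->
  (\near0 x, Phi x = Psi x) -> diffeo_germ Psi.
Proof.
move=> [/smooth_germP sP P0 [P' [/smooth_germP sP' P'0 K1 K2]]] E.
split.
- by apply/smooth_germP; exact: smooth_at_germ E.
- by rewrite -(nbhs_singleton E).
exists P'; split=> //; first exact/smooth_germP.
- by apply: filter_app E; apply: filterS K1 => x K1 <-.
- by apply: filter_app K2; apply: filterS (near_comp sP' P'0 E) => x ->.
Qed.

Definition vec3 (a b c : R) : 'rV[R]_3 := \row_j (if j == 0 then a else if j == 1 then b else c).

Lemma smooth_at_vec3 (V : normedModType R) (u v w : V -> R) a :
  smooth_at a u -> smooth_at a v -> smooth_at a w ->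
  smooth_at a (fun t : V => vec3 (u t) (v t) (w t)).
Proof.
move=> su sv sw; apply: smooth_at_entries => k j; rewrite (ord1 k).
rewrite (_ : (fun t : V => _) = fun t : V => if j == 0 then u t else if j == 1 then v t else w t).
  by case: eqP => // _; case: eqP.
by apply/funext => t; rewrite mxE.
Qed.

Lemma vec3_1 a b c : vec3 a b c 0 0 = a. Proof. by rewrite mxE. Qed.
Lemma vec3_2 a b c : vec3 a b c 0 1 = b. Proof. by rewrite mxE. Qed.
Lemma vec3_3 a b c : vec3 a b c 0 (inord 2) = c.
Proof. by rewrite mxE -!val_eqE /= inordK. Qed.

Lemma vec3000 : vec3 0 0 0 = 0.
Proof. by apply/rowP => j; rewrite !mxE; do !case: eqP. Qed.

Lemma setc_vec3 t a b c : setc (inord 2) t (vec3 a b c) = vec3 a b t.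
Proof.
apply/rowP => j; rewrite !mxE -!val_eqE /= inordK //.
by case: j => [[|[|[|]]]].
Qed.

Lemma setc3E t (y : 'rV[R]_3) : setc (inord 2) t y = vec3 (y 0 0) (y 0 1) t.
Proof.
apply/rowP => j; rewrite !mxE -!val_eqE /= inordK //.
by case: j => [[|[|[|]]]] //= p; congr (y 0 _); apply/val_inj.
Qed.

(** The inverse solves [u(t, x2) = x1] for [t]. The equation lives in three variables, with [x1] and
    [x2] as parameters and [t] as third coordinate; the solution does not depend on that coordinate,
    which is therefore set to 0. *)
Lemma diffeo_first u : smooth_at 0 u -> u 0 = 0 -> tc 1 0 u != 0 ->
  diffeo_germ (fun x => vec2 (u x) (x 0 1)).
Proof.
move=> su u0 u1.
pose F (y : 'rV[R]_3) := u (vec2 (y 0 (inord 2)) (y 0 1)) - y 0 0.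
have sF : smooth_at 0 F.
  apply: smooth_at_sub; last by smooth.
  by apply: smooth_at_comp0 => //; try smooth; rewrite mxE.
have F0 : F 0 = 0 by rewrite /F !mxE vec200 u0 subr0.
have DF : 'D_(delta_mx 0 (inord 2)) F 0 != 0.
  have sg : smooth_at 0 (fun y : 'rV[R]_3 => hq 0 u (vec2 (y 0 (inord 2)) (y 0 1))).
    by apply: smooth_at_comp0; try smooth; rewrite mxE.
  have := @hq_unique R 3 (inord 2) F F _ sg.
  rewrite -hq0 => H; have /H/nbhs_singleton -> : \forall y \near (0 : 'rV[R]_3),
    F y = F (setc (inord 2) 0 y) + (y : 'rV[R]_3) 0 (inord 2) *
       hq 0 u (vec2 (y 0 (inord 2)) (y 0 1)).
    apply: near_all => y; rewrite /F setc3E vec3_1 vec3_2 vec3_3 [u _](hqE 0) setc_vec2_1 vec2_1 vec2_2.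
    by rewrite addrAC.
  by rewrite !mxE vec200.
have [s [ss s0 si H]] := implicit_function sF F0 DF.
pose Psi x := vec2 (s (vec3 (x 0 0) (x 0 1) 0)) (x 0 1).
have sv3 : smooth_at 0 (fun x : 'rV[R]_2 => vec3 (x 0 0) (x 0 1) 0).
  by apply: smooth_at_vec3; smooth.
have v30 : vec3 ((0 : 'rV[R]_2) 0 0) ((0 : 'rV[R]_2) 0 1) 0 = 0 by rewrite !mxE vec3000.
have ss3 : smooth_at 0 (fun x : 'rV[R]_2 => s (vec3 (x 0 0) (x 0 1) 0)).
  by apply: (smooth_at_comp (h := s)) => //; rewrite v30.
have su2 : smooth_at 0 (fun x : 'rV[R]_2 => vec3 (u x) (x 0 1) (x 0 0)).
  by apply: smooth_at_vec3; smooth.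
have su20 : vec3 (u 0) ((0 : 'rV[R]_2) 0 1) ((0 : 'rV[R]_2) 0 0) = 0 by rewrite u0 !mxE vec3000.
have ss4 : smooth_at 0 (fun x : 'rV[R]_2 => vec3 (x 0 0) (x 0 1) (s (vec3 (x 0 0) (x 0 1) 0))).
  by apply: smooth_at_vec3; smooth.
have ss40 : vec3 ((0 : 'rV[R]_2) 0 0) ((0 : 'rV[R]_2) 0 1) (s (vec3 ((0 : 'rV[R]_2) 0 0) ((0 : 'rV[R]_2) 0 1) 0)) = 0.
  by rewrite v30 s0 !mxE vec3000.
split; first by apply/smooth_germP; smooth.
  by rewrite u0 mxE vec200.
exists Psi; split.
- by apply/smooth_germP; smooth.
- by rewrite /Psi v30 s0 mxE vec200.
- apply: filterS (near_comp su2 su20 H) => x; rewrite /F vec3_1 vec3_2 vec3_3 vec2E subrr.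
  move=> [/(_ erefl) E _]; rewrite /Psi vec2_1 vec2_2.
  rewrite (_ : s _ = x 0 0) ?vec2E // E -[RHS]si; congr s; rewrite setc_vec3 //.
- apply: filterS (near_comp ss4 ss40 H) => x; rewrite /F vec3_1 vec3_2 vec3_3 => -[_ E].
  have /eqP : u (vec2 (s (vec3 (x 0 0) (x 0 1) 0)) (x 0 1)) - x 0 0 = 0.
    by apply: E; rewrite -[RHS]si setc_vec3.
  by rewrite subr_eq0 => /eqP E'; rewrite /Psi vec2_2 E' vec2E.
Qed.

Definition swap2 x : 'rV[R]_2 := vec2 (x 0 1) (x 0 0).

Lemma diffeo_swap : diffeo_germ swap2.
Proof.
have S : smooth_germ swap2 by apply/smooth_germP; rewrite /swap2; smooth.
have S0 : swap2 0 = 0 by rewrite /swap2 !mxE vec200.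
split=> //; exists swap2; split=> //;
  by apply: near_all => x; rewrite /swap2 vec2_1 vec2_2 vec2E.
Qed.

Lemma diffeo_second v : smooth_at 0 v -> v 0 = 0 -> tc 0 1 v != 0 ->
  diffeo_germ (fun x => vec2 (x 0 0) (v x)).
Proof.
move=> sv v0 v1; pose u x := v (vec2 (x 0 1) (x 0 0)).
have su : smooth_at 0 u by apply: smooth_at_comp0 => //; try smooth; rewrite mxE.
have sX1 := @smooth_at_X R 0 0; have sX2 := @smooth_at_X R 1 0.
have X10 : (0 : 'rV[R]_2) 0 0 = 0 by rewrite mxE.
have X20 : (0 : 'rV[R]_2) 0 1 = 0 by rewrite mxE.
have D : diffeo_germ (fun x => vec2 (u x) (x 0 1)).
  apply: diffeo_first => //; first by rewrite /u !mxE vec200.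
  rewrite /u (tc_comp1 sv sX2 sX1 X20 X10).1 tc_X1 tc_X2 /= mulr0 add0r mulr1 //.
have := diffeo_germ_comp diffeo_swap (diffeo_germ_comp D diffeo_swap).
move=> /diffeo_germ_near; apply; apply: near_all => x.
by rewrite /swap2 /u !vec2_1 !vec2_2 vec2E.
Qed.

(** The map changes one coordinate at a time: it is [(x1, w)] after [(u, x2)], where [w] is [v] in
    the new coordinates. If [u] has no [x1] term, exchanging the coordinates reduces to this
    case. *)
Theorem diffeo2 u v : smooth_at 0 u -> smooth_at 0 v -> u 0 = 0 -> v 0 = 0 ->
  tc 1 0 u * tc 0 1 v - tc 0 1 u * tc 1 0 v != 0 ->
  diffeo_germ (fun x => vec2 (u x) (v x)).
Proof.
move=> su sv u0 v0 J.
have X10 : (0 : 'rV[R]_2) 0 0 = 0 by rewrite mxE.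
have X20 : (0 : 'rV[R]_2) 0 1 = 0 by rewrite mxE.
wlog u1 : u v su sv u0 v0 J / tc 1 0 u != 0.
  move=> W; have [u1|] := eqVneq (tc 1 0 u) 0; last exact: W.
  have sX1 := @smooth_at_X R 0 0; have sX2 := @smooth_at_X R 1 0.
  have D : diffeo_germ (fun x => vec2 (u (swap2 x)) (v (swap2 x))).
    have [E1 E2] := tc_comp1 su sX2 sX1 X20 X10.
    have [E3 E4] := tc_comp1 sv sX2 sX1 X20 X10.
    move: E1 E2 E3 E4; rewrite !tc_X1 !tc_X2 /= !mulr0 !add0r !mulr1 !addr0 => E1 E2 E3 E4.
    apply: W; rewrite /swap2 ?X10 ?X20 ?vec200 //.
    - by apply: smooth_at_comp0.
    - by apply: smooth_at_comp0.
    - by rewrite E1 E2 E3 E4 -oppr_eq0 opprB.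
    - by rewrite E1; apply: contraNneq J => u2; rewrite u1 u2 !mul0r subr0.
  apply: diffeo_germ_near (diffeo_germ_comp D diffeo_swap) _.
  by apply: near_all => x; rewrite /swap2 vec2_1 vec2_2 vec2E.
have D1 := diffeo_first su u0 u1.
have [/smooth_germP sP P0 [Q [/smooth_germP sQ Q0 K1 K2]]] := D1.
pose w x := v (Q x).
have sw : smooth_at 0 w by apply: smooth_at_comp => //; rewrite Q0.
have w0 : w 0 = 0 by rewrite /w Q0.
have sX2 := @smooth_at_X R 1 0.
have Ev : \near0 x, w (vec2 (u x) (x 0 1)) = v x.
  by apply: filterS K1 => x; rewrite /w => ->.
have sc : smooth_at 0 (fun x => w (vec2 (u x) (x 0 1))) by exact: smooth_at_comp0.
have [E1 E2] := tc_comp1 sw su sX2 u0 X20.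
have w1 : tc 0 1 w != 0.
  apply: contraNneq J => w1.
  rewrite -(tc_ext 1 0 sc sv Ev) -(tc_ext 0 1 sc sv Ev) E1 E2 w1.
  by apply/eqP; ring.
have D2 := diffeo_second sw w0 w1.
apply: diffeo_germ_near (diffeo_germ_comp D2 D1) _.
by apply: filterS Ev => x E; rewrite vec2_1 E.
Qed.

End Diffeos.

(** * Equivalence of germs of matrices *)

Section TwoByTwo.
Variable K : numFieldType.

Definition mx2 (p q r s : K) : 'M[K]_2 :=
  \matrix_(i, j) (if i == 0 then if j == 0 then p else q else if j == 0 then r else s).

Lemma I2P (P : 'I_2 -> Prop) : P 0 -> P 1 -> forall i, P i.
Proof.
move=> P0 P1 i; case: (unliftP 0 i) => [k|] -> //.
by rewrite (ord1 k) (_ : lift 0 0 = 1) //; apply/val_inj.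
Qed.

Lemma mx2P (M N : 'M[K]_2) : M 0 0 = N 0 0 -> M 0 1 = N 0 1 -> M 1 0 = N 1 0 ->
  M 1 1 = N 1 1 -> M = N.
Proof.
by move=> E1 E2 E3 E4; apply/matrixP; apply: I2P; apply: I2P.
Qed.

Lemma mx2E p q r s : ((mx2 p q r s 0 0 = p) * (mx2 p q r s 0 1 = q) *
  (mx2 p q r s 1 0 = r) * (mx2 p q r s 1 1 = s))%type.
Proof. by rewrite !mxE. Qed.

Lemma sym2E (a b d : K) : ((sym2 a b d 0 0 = a) * (sym2 a b d 0 1 = b) *
  (sym2 a b d 1 0 = b) * (sym2 a b d 1 1 = d))%type.
Proof. by rewrite !mxE. Qed.

Lemma mx2_eta (M : 'M[K]_2) : M = mx2 (M 0 0) (M 0 1) (M 1 0) (M 1 1).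
Proof. by apply: mx2P; rewrite mxE. Qed.

Lemma sym2_eta (M : 'M[K]_2) : M^T = M -> M = sym2 (M 0 0) (M 0 1) (M 1 1).
Proof. by move=> sM; apply: mx2P; rewrite mxE //= -{1}sM mxE. Qed.

Lemma sum2 (F : 'I_2 -> K) : \sum_i F i = F 0 + F 1.
Proof.
rewrite big_ord_recl big_ord1; congr (_ + F _); exact/val_inj.
Qed.

Lemma mul2E (M N : 'M[K]_2) i j : (M *m N) i j = M i 0 * N 0 j + M i 1 * N 1 j.
Proof. by rewrite mxE sum2. Qed.

Lemma congr_sym2 p q r s a b d :
  (mx2 p q r s)^T *m sym2 a b d *m mx2 p q r s =
  sym2 (p ^+ 2 * a + 2 * p * r * b + r ^+ 2 * d)
       (p * q * a + (p * s + q * r) * b + r * s * d)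
       (q ^+ 2 * a + 2 * q * s * b + s ^+ 2 * d).
Proof.
by apply: mx2P; rewrite !mul2E !sym2E ![_^T _ _]mxE !mx2E; ring.
Qed.

Lemma det_mx2 p q r s : \det (mx2 p q r s) = p * s - q * r.
Proof.
rewrite (expand_det_row _ 0) sum2 /cofactor !det_mx11 !mxE /=.
rewrite expr0 expr1 mul1r mulN1r mulrN; congr (_ - _).
Qed.

Lemma mx2_unit p q r s : (mx2 p q r s \in unitmx) = (p * s - q * r != 0).
Proof. by rewrite unitmxE det_mx2 unitfE. Qed.

Lemma sym2_sym (a b d : K) : (sym2 a b d)^T = sym2 a b d.
Proof. by apply: mx2P; rewrite !mxE. Qed.

Lemma smooth_at_mx2 (V : normedModType K) (p q r s : V -> K) a :
  smooth_at a p -> smooth_at a q -> smooth_at a r -> smooth_at a s ->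
  smooth_at a (fun x => mx2 (p x) (q x) (r x) (s x)).
Proof.
move=> sp sq sr ss; apply: smooth_at_entries => i j.
rewrite (_ : (fun x => _) = fun x =>
  if i == 0 then if j == 0 then p x else q x else if j == 0 then r x else s x).
  by case: eqP => _; case: eqP.
by apply/funext => x; rewrite mxE.
Qed.

Lemma smooth_at_sym2 (V : normedModType K) (p q r : V -> K) a :
  smooth_at a p -> smooth_at a q -> smooth_at a r ->
  smooth_at a (fun x => sym2 (p x) (q x) (r x)).
Proof.
move=> sp sq sr; apply: smooth_at_entries => i j.
rewrite (_ : (fun x => _) = fun x =>
  if i != j then q x else if i == 0 then p x else r x).
  by case: eqP => _ //; case: eqP.
by apply/funext => x; rewrite mxE.
Qed.

Lemma smooth_at_mulmx (V : normedModType K) (M N : V -> 'M[K]_2) (t : V) :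
  smooth_at t M -> smooth_at t N -> smooth_at t (fun z => M z *m N z).
Proof.
move=> sM sN; apply: smooth_at_entries => i j.
rewrite (_ : (fun z => _) = fun z => M z i 0 * N z 0 j + M z i 1 * N z 1 j).
  by apply: smooth_at_add; apply: smooth_at_mul; exact: smooth_at_entry.
by apply/funext => z; rewrite mul2E.
Qed.

End TwoByTwo.

Section GEquivalence.
Variable R : realType.
Implicit Types (x y : 'rV[R]_2) (a b c p q r s u v w : 'rV[R]_2 -> R)
  (A B C : 'rV[R]_2 -> 'M[R]_2).

Definition germ3 a b c x : 'M[R]_2 := sym2 (a x) (b x) (c x).

Lemma sym_germ3 a b c : smooth_at 0 a -> smooth_at 0 b -> smooth_at 0 c ->
  sym_germ (germ3 a b c).
Proof.
move=> sa sb sc; split; first by apply/smooth_germP; exact: smooth_at_sym2.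
by apply: near_all => x; exact: sym2_sym.
Qed.

Lemma sym_germ_entries A : sym_germ A ->
  [/\ smooth_at 0 (fun x => A x 0 0), smooth_at 0 (fun x => A x 0 1),
      smooth_at 0 (fun x => A x 1 1) &
      \near0 x,
        A x = germ3 (fun x => A x 0 0) (fun x => A x 0 1) (fun x => A x 1 1) x].
Proof.
move=> [/smooth_germP sA symA]; split; try exact: smooth_at_entry.
by apply: filterS symA => x; exact: sym2_eta.
Qed.

Lemma diffeo_id : diffeo_germ (fun x => x).
Proof.
have S : smooth_germ (fun x : 'rV[R]_2 => x).
  by apply/smooth_germP; apply: smooth_at_entries => i j; exact: smooth_at_coord.
by split=> //; exists (fun x => x); split=> //; exact: near_all.
Qed.

Lemma GL_mx2 p q r s : smooth_at 0 p -> smooth_at 0 q -> smooth_at 0 r -> smooth_at 0 s ->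
  p 0 * s 0 - q 0 * r 0 != 0 -> GL_germ (fun x => mx2 (p x) (q x) (r x) (s x)).
Proof.
move=> sp sq sr ss d0; split; first by apply/smooth_germP; exact: smooth_at_mx2.
have sd : smooth_at 0 (fun x => p x * s x - q x * r x) by smooth.
by apply: filterS (near_neq0 sd d0) => x; rewrite mx2_unit.
Qed.

Lemma GL_1 : GL_germ (fun _ : 'rV[R]_2 => 1%:M : 'M[R]_2).
Proof.
split; first by apply/smooth_germP; exact: smooth_at_cst.
by apply: near_all => x; exact: unitmx1.
Qed.

Lemma G_equiv_near A B : (\near0 x, A x = B x) -> G_equiv A B.
Proof.
move=> E; exists (fun x => x), (fun=> 1%:M); split; [exact: diffeo_id|exact: GL_1|].
by apply: filterS E => x ->; rewrite trmx1 mul1mx mulmx1.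
Qed.

Lemma G_equiv_refl A : G_equiv A A.
Proof. by apply: G_equiv_near; exact: near_all. Qed.

Lemma G_equiv_trans A B C : G_equiv A B -> G_equiv B C -> G_equiv A C.
Proof.
move=> [P [X [dP [sX uX] E1]]] [Q [Y [dQ [sY uY] E2]]].
have [/smooth_germP sQ Q0 _] := dQ.
move: sX sY => /smooth_germP sX /smooth_germP sY.
exists (fun x => P (Q x)), (fun x => X (Q x) *m Y x); split.
- exact: diffeo_germ_comp.
- split.
    by apply/smooth_germP; apply: smooth_at_mulmx => //; apply: smooth_at_comp_mx => //; rewrite Q0.
  apply: filter_app uY; apply: filterS (near_comp sQ Q0 uX) => x.
  by rewrite unitmx_mul => -> ->.
- apply: filter_app E2; apply: filterS (near_comp sQ Q0 E1) => x -> ->.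
  by rewrite trmx_mul !mulmxA.
Qed.

Lemma G_equiv_sym A B : G_equiv A B -> G_equiv B A.
Proof.
move=> [P [X [dP [sX uX] E]]].
have [/smooth_germP sP P0 [Q [sQ Q0 K1 K2]]] := dP.
move: (sX) (sQ) => /smooth_germP sX' /smooth_germP sQ'.
pose Y x := X (Q x); have sY : smooth_at 0 Y by apply: smooth_at_comp_mx => //; rewrite Q0.
have uY := near_comp sQ' Q0 uX.
have s00 := smooth_at_entry 0 0 sY; have s01 := smooth_at_entry 0 1 sY.
have s10 := smooth_at_entry 1 0 sY; have s11 := smooth_at_entry 1 1 sY.
pose d x := Y x 0 0 * Y x 1 1 - Y x 0 1 * Y x 1 0.
have sd : smooth_at 0 d by rewrite /d; smooth.
have d0 : d 0 != 0.
  by have := nbhs_singleton uY; rewrite [X in X \in _]mx2_eta mx2_unit.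
(* Cramer's formula keeps the inverse smooth. *)
pose Z x := mx2 (Y x 1 1 / d x) (- Y x 0 1 / d x) (- Y x 1 0 / d x) (Y x 0 0 / d x).
have YZ : \near0 x, Y x *m Z x = 1%:M.
  apply: filterS (near_neq0 sd d0) => x; rewrite /d => dx.
  by apply: mx2P; rewrite !mul2E !mx2E [RHS]mxE /= /d; field.
exists Q, Z; split.
- by split=> //; exists P; split=> //; exact/smooth_germP.
- split; first by apply/smooth_germP; apply: smooth_at_mx2; smooth.
  by apply: filterS YZ => x /mulmx1_unit[].
- apply: filter_app K2; apply: filter_app YZ; apply: filterS (near_comp sQ' Q0 E) => x -> YZ K2.
  rewrite -/(Y x) K2 !mulmxA -trmx_mul YZ trmx1 mul1mx -mulmxA YZ mulmx1 //.
Qed.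

Lemma G_equiv_congr a b c p q r s : smooth_at 0 p -> smooth_at 0 q -> smooth_at 0 r ->
  smooth_at 0 s -> p 0 * s 0 - q 0 * r 0 != 0 ->
  G_equiv (germ3 a b c) (germ3
     (fun x => p x ^+ 2 * a x + 2 * p x * r x * b x + r x ^+ 2 * c x)
     (fun x => p x * q x * a x + (p x * s x + q x * r x) * b x + r x * s x * c x)
     (fun x => q x ^+ 2 * a x + 2 * q x * s x * b x + s x ^+ 2 * c x)).
Proof.
move=> sp sq sr ss d0.
exists (fun x => x), (fun x => mx2 (p x) (q x) (r x) (s x)); split.
- exact: diffeo_id.
- exact: GL_mx2.
- by apply: near_all => x; rewrite /germ3 congr_sym2.
Qed.

Lemma G_equiv_diffeo A Phi : diffeo_germ Phi -> G_equiv A (fun x => A (Phi x)).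
Proof.
move=> dP; exists Phi, (fun=> 1%:M); split=> //; first exact: GL_1.
by apply: near_all => x; rewrite trmx1 mul1mx mulmx1.
Qed.

Lemma germ3_near a b c a' b' c' :
  (\near0 x, a x = a' x) ->
  (\near0 x, b x = b' x) ->
  (\near0 x, c x = c' x) ->
  \near0 x, germ3 a b c x = germ3 a' b' c' x.
Proof.
move=> Ea Eb Ec; apply: filter_app Ea; apply: filter_app Eb; apply: filterS Ec.
by move=> x Ec Eb Ea; rewrite /germ3 Ea Eb Ec.
Qed.

(** A simultaneous row and column operation: [p] times the first basis vector is added to the
    second. *)
Lemma G_equiv_shear a b c p : smooth_at 0 p ->
  G_equiv (germ3 a b c) (germ3 a (fun x => b x + p x * a x)
    (fun x => c x + 2 * p x * b x + p x ^+ 2 * a x)).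
Proof.
move=> sp.
have s1 := @smooth_at_cst R 'rV[R]_2 R 0 1; have s0 := @smooth_at_cst R 'rV[R]_2 R 0 0.
have := @G_equiv_congr a b c (fun=> 1) p (fun=> 0) (fun=> 1) s1 sp s0 s1.
rewrite mulr1 mulr0 subr0 oner_eq0 => /(_ isT) H.
apply: G_equiv_trans H _; apply: G_equiv_near; apply: near_all => x.
by rewrite /germ3; congr sym2; ring.
Qed.

Lemma G_equiv_lshear a b c p : smooth_at 0 p ->
  G_equiv (germ3 a b c) (germ3 (fun x => a x + 2 * p x * b x + p x ^+ 2 * c x)
    (fun x => b x + p x * c x) c).
Proof.
move=> sp.
have s1 := @smooth_at_cst R 'rV[R]_2 R 0 1; have s0 := @smooth_at_cst R 'rV[R]_2 R 0 0.
have := @G_equiv_congr a b c (fun=> 1) (fun=> 0) p (fun=> 1) s1 s0 sp s1.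
rewrite mulr1 mul0r subr0 oner_eq0 => /(_ isT) H.
apply: G_equiv_trans H _; apply: G_equiv_near; apply: near_all => x.
by rewrite /germ3; congr sym2; ring.
Qed.

Lemma G_equiv_scale a b c p s : smooth_at 0 p -> smooth_at 0 s -> p 0 != 0 -> s 0 != 0 ->
  G_equiv (germ3 a b c) (germ3 (fun x => p x ^+ 2 * a x)
    (fun x => p x * s x * b x) (fun x => s x ^+ 2 * c x)).
Proof.
move=> sp ss p0 s0; have z0 := @smooth_at_cst R 'rV[R]_2 R 0 0.
have := @G_equiv_congr a b c p (fun=> 0) (fun=> 0) s sp z0 z0 ss.
rewrite mulr0 subr0 mulf_neq0 // => /(_ isT) H.
apply: G_equiv_trans H _; apply: G_equiv_near; apply: near_all => x.
by rewrite /germ3; congr sym2; ring.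
Qed.

Lemma G_equiv_swap a b c : G_equiv (germ3 a b c) (germ3 c b a).
Proof.
have s1 := @smooth_at_cst R 'rV[R]_2 R 0 1; have s0 := @smooth_at_cst R 'rV[R]_2 R 0 0.
have := @G_equiv_congr a b c (fun=> 0) (fun=> 1) (fun=> 1) (fun=> 0) s0 s1 s1 s0.
rewrite mulr0 mulr1 sub0r oppr_eq0 oner_eq0 => /(_ isT) H.
apply: G_equiv_trans H _; apply: G_equiv_near; apply: near_all => x.
by rewrite /germ3; congr sym2; ring.
Qed.

Lemma G_equiv_coord A u v : smooth_at 0 u -> smooth_at 0 v -> u 0 = 0 -> v 0 = 0 ->
  tc 1 0 u * tc 0 1 v - tc 0 1 u * tc 1 0 v != 0 ->
  G_equiv (fun x => A (vec2 (u x) (v x))) A.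
Proof.
by move=> su sv u0 v0 J; apply: G_equiv_sym; apply: G_equiv_diffeo; exact: diffeo2.
Qed.

(** [g] is [f] read in the coordinates [(u, v)]; the identity holds near 0 only, as the inverse
    does. *)
Lemma change_coord u v : smooth_at 0 u -> smooth_at 0 v -> u 0 = 0 -> v 0 = 0 ->
  tc 1 0 u * tc 0 1 v - tc 0 1 u * tc 1 0 v != 0 ->
  forall f : 'rV[R]_2 -> R, smooth_at 0 f -> exists g, [/\ smooth_at 0 g, g 0 = f 0 &
    \near0 x, g (vec2 (u x) (v x)) = f x].
Proof.
move=> su sv u0 v0 J f sf; have [_ _ [Q [/smooth_germP sQ Q0 K1 K2]]] := diffeo2 su sv u0 v0 J.
exists (fun x => f (Q x)); split.
- by apply: smooth_at_comp => //; rewrite Q0.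
- by rewrite Q0.
- by apply: filterS K1 => x ->.
Qed.

End GEquivalence.

(** * Tangent space and codimension *)

Section Tangent.
Variable R : realType.
Implicit Types (x y : 'rV[R]_2) (A B C T : 'rV[R]_2 -> 'M[R]_2).

Lemma smooth_at_matD (V : normedModType R) (M N : V -> 'M[R]_2) (t : V) :
  smooth_at t M -> smooth_at t N -> smooth_at t (fun z => M z + N z).
Proof.
move=> sM sN; apply: smooth_at_entries => i j.
rewrite (_ : (fun z => _) = fun z => M z i j + N z i j).
  by apply: smooth_at_add; exact: smooth_at_entry.
by apply/funext => z; rewrite mxE.
Qed.

Lemma smooth_at_matZ (V : normedModType R) (M : V -> 'M[R]_2) (f : V -> R) (t : V) :
  smooth_at t f -> smooth_at t M -> smooth_at t (fun z => f z *: M z).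
Proof.
move=> sf sM; apply: smooth_at_entries => i j.
rewrite (_ : (fun z => _) = fun z => f z * M z i j).
  by apply: smooth_at_mul => //; exact: smooth_at_entry.
by apply/funext => z; rewrite mxE.
Qed.

Lemma tangent_near A C T : (\near0 x, C x = T x) ->
  Ge_tangent A C -> Ge_tangent A T.
Proof.
move=> E [V [U [sV sU H]]]; exists V, U; split=> //.
by apply: filter_app E; apply: filterS H => x H <-.
Qed.

Lemma smooth_at_rvD (M N : 'rV[R]_2 -> 'rV[R]_2) : smooth_at 0 M -> smooth_at 0 N ->
  forall c : R, smooth_at 0 (fun z => M z + c *: N z).
Proof.
move=> sM sN c; apply: smooth_at_entries => i j.
rewrite (_ : (fun z => _) = fun z => M z i j + c * N z i j).
  apply: smooth_at_add; first exact: smooth_at_entry.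
  by apply: smooth_at_mul; [exact: smooth_at_cst|exact: smooth_at_entry].
by apply/funext => z; rewrite !mxE.
Qed.

Lemma tangent_lin A C T (c : R) : Ge_tangent A C -> Ge_tangent A T ->
  Ge_tangent A (fun x => C x + c *: T x).
Proof.
move=> [V [U [/smooth_germP sV /smooth_germP sU H]]] [V' [U' [/smooth_germP sV' /smooth_germP sU' H']]].
exists (fun x => V x + c *: V' x), (fun x => U x + c *: U' x); split.
- by apply/smooth_germP; exact: smooth_at_rvD.
- apply/smooth_germP; apply: smooth_at_matD => //; apply: smooth_at_matZ => //.
  exact: smooth_at_cst.
- apply: filter_app H; apply: filterS H' => x -> ->.
  have -> : 'd A x (V x + c *: V' x) = 'd A x (V x) + c *: 'd A x (V' x).
    by rewrite linearD linearZ.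
  have -> : (U x + c *: U' x)^T = (U x)^T + c *: (U' x)^T by rewrite linearD linearZ.
  rewrite mulmxDl mulmxDr -scalemxAl -scalemxAr.
  move: ('d A x (V x)) ('d A x (V' x)) (_ *m A x) (_ *m A x) (A x *m _) (A x *m _).
  by move=> p q r s t u; apply/matrixP => k l; rewrite !mxE; ring.
Qed.

Lemma tangent0 A : Ge_tangent A (fun=> 0).
Proof.
exists (fun=> 0), (fun=> 0); split.
- by apply/smooth_germP; exact: smooth_at_cst.
- by apply/smooth_germP; exact: smooth_at_cst.
- by apply: near_all => x; rewrite linear0 trmx0 mul0mx mulmx0 !addr0.
Qed.

Lemma tangent_sum A (I : Type) (r : seq I) (c : I -> R) (T : I -> 'rV[R]_2 -> 'M[R]_2) :
  (forall i, Ge_tangent A (T i)) -> Ge_tangent A (fun x => \sum_(i <- r) c i *: T i x).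
Proof.
move=> tT; elim: r => [|i r IH].
  by apply: tangent_near (tangent0 A); apply: near_all => x; rewrite big_nil.
apply: tangent_near (tangent_lin (c i) IH (tT i)); apply: near_all => x.
by rewrite big_cons addrC.
Qed.

(** Each basis is expressed in the other modulo the tangent space. Uniqueness of coordinates gives
    [Qm *m Pm = 1], and the rank bounds one size by the other. *)
Lemma codim_unique A d e : Ge_codim A d -> Ge_codim A e -> d = e.
Proof.
have half d' e' : Ge_codim A d' -> Ge_codim A e' -> (d' <= e')%N; last first.
  by move=> Hd He; apply/eqP; rewrite eqn_leq !half.
move=> {d e} [B [sB HB]] [E [sE HE]].
have [P HP] : exists P : 'I_e' -> 'rV[R]_d', forall j,
    Ge_tangent A (fun x => E j x - \sum_i P j 0 i *: B i x).
  exists (fun j => sval (cid (HB _ (sE j)))) => j.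
  by case: (svalP (cid (HB _ (sE j)))).
have [Q HQ] : exists Q : 'I_d' -> 'rV[R]_e', forall i,
    Ge_tangent A (fun x => B i x - \sum_j Q i 0 j *: E j x).
  exists (fun j => sval (cid (HE _ (sB j)))) => j.
  by case: (svalP (cid (HE _ (sB j)))).
pose Pm : 'M[R]_(e', d') := \matrix_(j, i) P j 0 i.
pose Qm : 'M[R]_(d', e') := \matrix_(i, j) Q i 0 j.
have QP : Qm *m Pm = 1%:M.
  apply/row_matrixP => i; rewrite row_mul.
  have [c [_ uc]] := HB _ (sB i).
  have u1 := uc (row i 1%:M); have u2 := uc (row i Qm *m Pm).
  rewrite -u2 ?u1 //.
    apply: tangent_near (tangent0 A); apply: near_all => x.
    rewrite (bigD1 i) //= big1 => [|k ki]; first by rewrite !mxE eqxx scale1r addr0 subrr.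
    by rewrite !mxE eq_sym (negbTE ki) scale0r.
  apply: tangent_near (tangent_lin 1 (HQ i) (tangent_sum (index_enum _) (Q i 0) HP)).
  apply: near_all => x; rewrite scale1r -addrA; congr (_ + _).
  have -> : \sum_j Q i 0 j *: (E j x - \sum_k P j 0 k *: B k x) =
      \sum_j Q i 0 j *: E j x - \sum_k (row i Qm *m Pm) 0 k *: B k x.
    under eq_bigr do rewrite scalerBr scaler_sumr.
    rewrite sumrB; congr (_ - _); rewrite exchange_big; apply: eq_bigr => k _.
    rewrite mxE scaler_suml; apply: eq_bigr => j _.
    by rewrite scalerA !mxE.
  by rewrite addrA addNr add0r.
have := mxrankM_maxl Qm Pm; rewrite QP mxrank1 => H.
exact: leq_trans H (rank_leq_col _).
Qed.

(** Germs are represented by total functions, so compatibility with equality near 0 is a separate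
    requirement; both conditions together define a linear map on germs. *)
Definition germ_linear N (L : ('rV[R]_2 -> 'M[R]_2) -> 'rV[R]_N) :=
  (forall C T (c : R), smooth_at 0 C -> smooth_at 0 T ->
     L (fun x => C x + c *: T x) = L C + c *: L T) /\
  (forall C T, smooth_at 0 C -> smooth_at 0 T ->
     (\near0 x, C x = T x) -> L C = L T).

Lemma germ_linear_sum N (L : ('rV[R]_2 -> 'M[R]_2) -> 'rV[R]_N) (I : Type) (r : seq I)
    (c : I -> R) (T : I -> 'rV[R]_2 -> 'M[R]_2) C :
  germ_linear L -> smooth_at 0 C -> (forall i, smooth_at 0 (T i)) ->
  smooth_at 0 (fun x => C x - \sum_(i <- r) c i *: T i x) /\
  L (fun x => C x - \sum_(i <- r) c i *: T i x) = L C - \sum_(i <- r) c i *: L (T i).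
Proof.
move=> [lL eL] sC sT; elim: r => [|i r [IHs IH]].
  have E : (fun x => C x - \sum_(i <- [::]) c i *: T i x) = C.
    by apply/funext => x; rewrite big_nil subr0.
  by rewrite E big_nil subr0.
have E : (fun x => C x - \sum_(i <- i :: r) c i *: T i x) =
    fun x => (C x - \sum_(i <- r) c i *: T i x) + (- c i) *: T i x.
  by apply/funext => x; rewrite big_cons opprD addrA addrAC scaleNr.
rewrite E; split.
  apply: smooth_at_matD => //; apply: smooth_at_matZ => //; exact: smooth_at_cst.
by rewrite lL // IH big_cons scaleNr opprD addrA addrAC.
Qed.

(** [L] kills the tangent space, is dual to [B], and has no larger kernel on symmetric germs; it
    therefore identifies the quotient with row vectors, and [L C] is the coordinate vector of
    [C]. *)
Lemma codim_dual A d (B : 'I_d -> 'rV[R]_2 -> 'M[R]_2)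
    (L : ('rV[R]_2 -> 'M[R]_2) -> 'rV[R]_d) :
  (forall i, sym_germ (B i)) -> germ_linear L ->
  (forall T, smooth_at 0 T -> Ge_tangent A T -> L T = 0) ->
  (forall i, L (B i) = delta_mx 0 i) ->
  (forall C, sym_germ C -> L C = 0 -> Ge_tangent A C) ->
  Ge_codim A d.
Proof.
move=> sB lL LT LB LC; exists B; split=> // C sC.
have sC' : smooth_at 0 C by apply/smooth_germP; case: sC.
have sB' i : smooth_at 0 (B i) by apply/smooth_germP; case: (sB i).
have LE (c : 'rV[R]_d) :
    smooth_at 0 (fun x => C x - \sum_i c 0 i *: B i x) /\
    L (fun x => C x - \sum_i c 0 i *: B i x) = L C - c.
  have [s ->] := germ_linear_sum (index_enum 'I_d) (fun i => c 0 i) lL sC' sB'.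
  split=> //; congr (_ - _); rewrite [RHS]row_sum_delta.
  by apply: eq_bigr => i _; rewrite LB.
exists (L C); split.
  apply: LC; last by rewrite (LE _).2 subrr.
  split; first by apply/smooth_germP; exact: (LE _).1.
  have H : \near0 x, forall i, (B i x)^T = B i x.
    apply: (@filter_forall _ _ (fun i x => (B i x)^T = B i x) (nbhs (0 : 'rV[R]_2)) _) => i.
    by case: (sB i).
  apply: filter_app H; apply: filterS (sC.2) => x EC EB.
  rewrite linearB /= EC; congr (_ - _); rewrite linear_sum; apply: eq_bigr => i _.
  by rewrite linearZ /= EB.
move=> c /(LT _ (LE c).1); rewrite (LE c).2 => /eqP; rewrite subr_eq0 => /eqP //.
Qed.

(** [L] reaches a space of dimension [N], while the tangent space goes into the row space of [M], of
    dimension at most [m]. The other [N - m] dimensions must come from the quotient. *)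
Lemma codim_ge A d m N (L : ('rV[R]_2 -> 'M[R]_2) -> 'rV[R]_N) (M : 'M[R]_(m, N))
    (E : 'I_N -> 'rV[R]_2 -> 'M[R]_2) :
  Ge_codim A d -> germ_linear L ->
  (forall T, smooth_at 0 T -> Ge_tangent A T -> exists P : 'rV[R]_m, L T = P *m M) ->
  (forall i, sym_germ (E i)) -> (forall i, L (E i) = delta_mx 0 i) ->
  (N <= m + d)%N.
Proof.
move=> [B [sB HB]] lL LT sE LE.
have sB' i : smooth_at 0 (B i) by apply/smooth_germP; case: (sB i).
have sE' i : smooth_at 0 (E i) by apply/smooth_germP; case: (sE i).
have [P HP] : exists P : 'I_N -> 'rV[R]_m * 'rV[R]_d, forall i,
    delta_mx 0 i = (P i).1 *m M + \sum_j (P i).2 0 j *: L (B j).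
  have H i : exists p : 'rV[R]_m * 'rV[R]_d,
      delta_mx 0 i = p.1 *m M + \sum_j p.2 0 j *: L (B j).
    have [c [tc _]] := HB _ (sE i).
    have [s Ls] := germ_linear_sum (index_enum 'I_d) (fun i => c 0 i) lL (sE' i) sB'.
    have [p Ep] := LT _ s tc; exists (p, c); rewrite /= -Ep Ls LE subrK //.
  exists (fun i => sval (cid (H i))) => i; exact: svalP (cid (H i)).
pose Q1 : 'M[R]_(N, m) := \matrix_(i, j) (P i).1 0 j.
pose Q2 : 'M[R]_(N, d) := \matrix_(i, j) (P i).2 0 j.
pose LB : 'M[R]_(d, N) := \matrix_(i, j) L (B i) 0 j.
have I1 : 1%:M = Q1 *m M + Q2 *m LB.
  apply/row_matrixP => i; rewrite row1 HP linearD /= !row_mul; congr (_ *m _ + _).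
    by apply/rowP => j; rewrite !mxE.
  rewrite mulmx_sum_row; apply: eq_bigr => j _; rewrite !mxE; congr (_ *: _).
  by apply/rowP => k; rewrite !mxE.
have := mxrank_add (Q1 *m M) (Q2 *m LB); rewrite -I1 mxrank1 => H.
apply: leq_trans H (leq_add _ _).
  exact: leq_trans (mxrankM_maxl _ _) (rank_leq_col _).
exact: leq_trans (mxrankM_maxl _ _) (rank_leq_col _).
Qed.

End Tangent.

Section DeriveMatrix.
Variable K : numFieldType.
Implicit Types (x w : 'rV[K]_2).

Lemma derive_mulmx (M N : 'rV[K]_2 -> 'M[K]_2) x w : smooth_at x M -> smooth_at x N ->
  'D_w (fun y => M y *m N y) x = 'D_w M x *m N x + M x *m 'D_w N x.
Proof.
move=> sM sN; have dM := smooth_at_differentiable sM; have dN := smooth_at_differentiable sN.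
have dMe i j := smooth_at_differentiable (smooth_at_entry i j sM).
have dNe i j := smooth_at_differentiable (smooth_at_entry i j sN).
have dMN := smooth_at_differentiable (smooth_at_mulmx sM sN).
apply/matrixP => i j; rewrite derive_entry //.
rewrite (_ : (fun y => _) = fun y => M y i 0 * N y 0 j + M y i 1 * N y 1 j); last first.
  by apply/funext => y; rewrite mul2E.
have dv (f : 'rV[K]_2 -> K) : differentiable f x -> derivable f x w by move=> ?; exact: diff_derivable.
have A1 := deriveM (dv _ (dMe i 0)) (dv _ (dNe 0 j)).
have A2 := deriveM (dv _ (dMe i 1)) (dv _ (dNe 1 j)).
have A3 := deriveD (dv _ (differentiableM (dMe i 0) (dNe 0 j))) (dv _ (differentiableM (dMe i 1) (dNe 1 j))).
rewrite A1 A2 in A3; apply: etrans A3 _.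
rewrite [RHS]mxE !mul2E !derive_entry // -![_ *: _]/(_ * _).
move: (M x i 0) (M x i 1) (N x 0 j) (N x 1 j) ('D_w _ x) ('D_w _ x) ('D_w _ x) ('D_w _ x).
move=> a b c d p q r s; ring.
Qed.

Lemma derive_trmx (M : 'rV[K]_2 -> 'M[K]_2) x w : smooth_at x M ->
  'D_w (fun y => (M y)^T) x = ('D_w M x)^T.
Proof.
move=> sM; have dM := smooth_at_differentiable sM.
have sMT : smooth_at x (fun y => (M y)^T).
  apply: smooth_at_entries => i j; rewrite (_ : (fun y => _) = fun y => M y j i).
    exact: smooth_at_entry.
  by apply/funext => y; rewrite mxE.
have dMT := smooth_at_differentiable sMT.
apply/matrixP => i j; rewrite derive_entry // mxE derive_entry //; congr ('D_w _ x).
by apply/funext => y; rewrite mxE.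
Qed.

End DeriveMatrix.

(** The infinitesimal form of a congruence: [P], [S] and [Q] stand for the values of [A], of its
    derivative and of [U], and [D] for the derivative of [X]. The summand [- Y D] in the new [U]
    compensates the differentiation of [X]. *)
Lemma congr_tangent_identity (R : realType) (X Y P D Q S : 'M[R]_2) : X *m Y = 1%:M ->
  X^T *m (S + Q^T *m P + P *m Q) *m X =
  (D^T *m P *m X + X^T *m S *m X + X^T *m P *m D) +
  (Y *m Q *m X + (-1) *: (Y *m D))^T *m (X^T *m P *m X) +
  (X^T *m P *m X) *m (Y *m Q *m X + (-1) *: (Y *m D)).
Proof.
move=> XY.
have YTX : Y^T *m X^T = 1%:M by rewrite -trmx_mul XY trmx1.
have -> : (Y *m Q *m X + (-1) *: (Y *m D))^T = X^T *m (Q^T *m Y^T) + (-1) *: (D^T *m Y^T).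
  by rewrite linearD linearZ /= !trmx_mul.
rewrite mulmxDl mulmxDr -scalemxAl -scalemxAr.
have -> : X^T *m (Q^T *m Y^T) *m (X^T *m P *m X) = X^T *m Q^T *m P *m X.
  by rewrite !mulmxA -(mulmxA _ Y^T) YTX mulmx1.
have -> : D^T *m Y^T *m (X^T *m P *m X) = D^T *m P *m X.
  by rewrite !mulmxA -(mulmxA _ Y^T) YTX mulmx1.
have -> : X^T *m P *m X *m (Y *m Q *m X) = X^T *m P *m Q *m X.
  by rewrite !mulmxA -(mulmxA _ X Y) XY mulmx1.
have -> : X^T *m P *m X *m (Y *m D) = X^T *m P *m D.
  by rewrite !mulmxA -(mulmxA _ X Y) XY mulmx1.
rewrite !mulmxDr !mulmxDl !mulmxA.
move: (_ *m S *m _) (_ *m Q^T *m P *m _) (_ *m P *m Q *m _) (D^T *m _ *m _) (_ *m _ *m D).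
by move=> m1 m2 m3 m4 m5; apply/matrixP => k l; rewrite !mxE; ring.
Qed.

Lemma derive_comp_dir (R : numFieldType) (V W Z : normedModType R) (f : W -> Z) (g : V -> W)
    (x w : V) : differentiable g x -> differentiable f (g x) ->
  'D_w (fun y => f (g y)) x = 'd f (g x) ('d g x w).
Proof.
move=> dg df; have dfg := differentiable_comp dg df.
by rewrite -[fun y => _]/(f \o g) (deriveE _ dfg) (diff_comp dg df).
Qed.

Lemma diff_right_inverse (R : numFieldType) (V W : normedModType R) (f : V -> W) (g : W -> V)
    (y v : W) : differentiable g y -> differentiable f (g y) ->
  (\forall z \near y, f (g z) = z) -> 'd f (g y) ('d g y v) = v.
Proof.
move=> dg df H; have dfg := differentiable_comp dg df.
transitivity ('d (f \o g) y v); first by rewrite (diff_comp dg df).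
rewrite -(deriveE _ dfg) (@near_eq_derive _ _ _ (f \o g) id y v H).
exact: derive_id.
Qed.

(** * Invariance of the codimension *)

Section Invariance.
Variable R : realType.
Implicit Types (x y : 'rV[R]_2) (A B C T X : 'rV[R]_2 -> 'M[R]_2) (f g : 'rV[R]_2 -> R).

Lemma smooth_at_dir m n (F : 'rV[R]_2 -> 'M[R]_(m, n)) (W : 'rV[R]_2 -> 'rV[R]_2) :
  smooth_at 0 F -> smooth_at 0 W -> smooth_at 0 (fun x => 'd F x (W x)).
Proof.
move=> sF sW; apply: (@smooth_at_germ _ _ _ (fun x => \matrix_(k, l)
   (W x 0 0 * 'D_(delta_mx 0 0) F x k l + W x 0 1 * 'D_(delta_mx 0 1) F x k l))).
  apply: smooth_at_entries => k l.
  rewrite (_ : (fun x => _) = fun x => W x 0 0 * 'D_(delta_mx 0 0) F x k l +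
      W x 0 1 * 'D_(delta_mx 0 1) F x k l); last by apply/funext => x; rewrite mxE.
  apply: smooth_at_add; apply: smooth_at_mul; try exact: smooth_at_entry.
    exact: smooth_at_entry (smooth_at_derive _ sF).
  exact: smooth_at_entry (smooth_at_derive _ sF).
apply: filterS (smooth_at_near sF) => x /smooth_at_differentiable dF.
apply/matrixP => k l; rewrite mxE.
have EW : W x = W x 0 0 *: delta_mx 0 0 + W x 0 1 *: delta_mx 0 1.
  by apply: rV2P; rewrite !mxE /= ?mulr1 ?mulr0 ?addr0 ?add0r.
rewrite [in RHS]EW linearD !linearZ /= !(deriveE _ dF).
by apply/esym; rewrite [LHS]mxE; congr (_ + _); rewrite [LHS]mxE.
Qed.

Lemma GL_inv X : GL_germ X -> exists Y, [/\ smooth_at 0 Y,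
  \near0 x, X x *m Y x = 1%:M &
  \near0 x, Y x *m X x = 1%:M].
Proof.
move=> [/smooth_germP sX uX].
have s00 := smooth_at_entry 0 0 sX; have s01 := smooth_at_entry 0 1 sX.
have s10 := smooth_at_entry 1 0 sX; have s11 := smooth_at_entry 1 1 sX.
pose d x := X x 0 0 * X x 1 1 - X x 0 1 * X x 1 0.
have sd : smooth_at 0 d by rewrite /d; smooth.
have d0 : d 0 != 0.
  by have := nbhs_singleton uX; rewrite [X in X \in _]mx2_eta mx2_unit.
pose Z x := mx2 (X x 1 1 / d x) (- X x 0 1 / d x) (- X x 1 0 / d x) (X x 0 0 / d x).
have XZ : \near0 x, X x *m Z x = 1%:M.
  apply: filterS (near_neq0 sd d0) => x; rewrite /d => dx.
  by apply: mx2P; rewrite !mul2E !mx2E [RHS]mxE /= /d; field.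
exists Z; split=> //; first by apply: smooth_at_mx2; smooth.
by apply: filterS XZ => x /mulmx1C.
Qed.

(** The vector field is pulled back by the diffeomorphism, and the matrix part is conjugated by [X]
    and corrected by the derivative of [X] along the new field. *)
Lemma tangent_pull A B C Phi X : smooth_at 0 A -> diffeo_germ Phi -> GL_germ X ->
  (\near0 x, B x = (X x)^T *m A (Phi x) *m X x) ->
  Ge_tangent A C -> Ge_tangent B (fun x => (X x)^T *m C (Phi x) *m X x).
Proof.
move=> sA dP GX E [V [U [/smooth_germP sV /smooth_germP sU H]]].
have [/smooth_germP sP P0 [Psi [/smooth_germP sPsi Psi0 K1 K2]]] := dP.
have [Y [sY XY YX]] := GL_inv GX.
have sX : smooth_at 0 X by apply/smooth_germP; case: GX.
(* The field that [Phi] carries to [V], written with the differential of the inverse. *)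
pose W x := 'd Psi (Phi x) (V (Phi x)).
have sW : smooth_at 0 W.
  apply: (smooth_at_comp_mx (h := fun y => 'd Psi y (V y))) => //.
  by rewrite P0; exact: smooth_at_dir.
have sUP : smooth_at 0 (fun x => U (Phi x)) by apply: smooth_at_comp_mx => //; rewrite P0.
exists W, (fun x => Y x *m U (Phi x) *m X x + (-1) *: (Y x *m 'd X x (W x))); split.
- exact/smooth_germP.
- apply/smooth_germP; apply: smooth_at_matD.
    by do 2!apply: smooth_at_mulmx => //.
  apply: smooth_at_matZ; first exact: smooth_at_cst.
  by apply: smooth_at_mulmx => //; exact: smooth_at_dir.
have nA := near_comp sP P0 (smooth_at_near sA).
have nPsi := near_comp sP P0 (smooth_at_near sPsi).
have nP := smooth_at_near sP; have nX := smooth_at_near sX.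
have H' := near_comp sP P0 H.
have K2' : \near0 x, \forall y \near Phi x, Phi (Psi y) = y.
  have /nbhs_ballP[r /= r0 Hr] := K2.
  have Hr' y : nball r y -> Phi (Psi y) = y.
    by move=> yr; apply: Hr; rewrite -ball_normE /ball_ /= sub0r normrN.
  have : \forall y \near (0 : 'rV[R]_2), nball r y by apply: (ball_near r0).
  move=> /(near_comp sP P0); apply: filterS => x xr.
  exact: (open_near (@open_nball R 2 r) xr Hr').
have K1s : \near0 x, Psi (Phi x) = x := K1.
have E' : \near0 x, \forall y \near x, B y = (X y)^T *m A (Phi y) *m X y.
  have /nbhs_ballP[r /= r0 Hr] := E.
  apply: (ball_near r0) => x xr; apply: (open_near (@open_nball R 2 r) xr) => y yr.
  by apply: Hr; rewrite -ball_normE /ball_ /= sub0r normrN.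
apply: filter_app E'; apply: filter_app K2'; apply: filter_app K1s.
apply: filter_app XY; apply: filter_app YX.
apply: filter_app nA; apply: filter_app nPsi; apply: filter_app nP; apply: filter_app nX.
apply: filterS H' => x H' sXx sPx sPsix sAx YXx XYx K1x K2x Ex.
have dAx := smooth_at_differentiable sAx; have dPx := smooth_at_differentiable sPx.
have dPsix := smooth_at_differentiable sPsix; have dXx := smooth_at_differentiable sXx.
set w := W x.
have sAP : smooth_at x (fun y => A (Phi y)) by exact: smooth_at_comp_mx.
have sXT : smooth_at x (fun y => (X y)^T).
  apply: smooth_at_entries => i j; rewrite (_ : (fun y => _) = fun y => X y j i).
    exact: smooth_at_entry.
  by apply/funext => y; rewrite mxE.
have dXAX : differentiable (fun y => (X y)^T *m A (Phi y) *m X y) x.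
  by apply: smooth_at_differentiable; do 2!apply: smooth_at_mulmx => //.
have [dB EB] := near_eq_differentiable (filterS (fun y (e : B y = _) => esym e) Ex) dXAX.
have dPw : 'd Phi x w = V (Phi x).
  have dd' : differentiable Phi (Psi (Phi x)) by rewrite K1x; exact: dPx.
  have E3 := diff_right_inverse (V (Phi x)) dPsix dd' K2x.
  by rewrite K1x in E3; exact: E3.
have DB : 'd B x w = ('D_w X x)^T *m A (Phi x) *m X x +
   (X x)^T *m 'd A (Phi x) (V (Phi x)) *m X x + (X x)^T *m A (Phi x) *m 'D_w X x.
  have D1 := derive_mulmx w (smooth_at_mulmx sXT sAP) sXx.
  have D2 := derive_mulmx w sXT sAP.
  have D3 := derive_trmx w sXx.
  have D4 := derive_comp_dir w dPx dAx; rewrite dPw in D4.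
  have D5 := etrans D2 (congr2 (fun p q => p *m A (Phi x) + (X x)^T *m q) D3 D4).
  have D6 := etrans D1 (congr1 (fun p => p *m X x + (X x)^T *m A (Phi x) *m 'D_w X x) D5).
  have D7 : 'd B x w = 'D_w (fun y => (X y)^T *m A (Phi y) *m X y) x.
    by rewrite EB (deriveE _ dXAX).
  apply: etrans D7 (etrans D6 _).
  exact: (congr1 (fun p => p + _) (mulmxDl _ _ _)).
apply: etrans (congr1 (fun c => (X x)^T *m c *m X x) H') _.
pose F (d b D : 'M[R]_2) := d + (Y x *m U (Phi x) *m X x + (-1) *: (Y x *m D))^T *m b +
  b *m (Y x *m U (Phi x) *m X x + (-1) *: (Y x *m D)).
have Bx := nbhs_singleton Ex.
have EF := f_equal3 F DB Bx (esym (deriveE w dXx)).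
exact: etrans (congr_tangent_identity _ _ _ _ XYx) (esym EF).
Qed.

Lemma sym_germ_pull C Phi X : diffeo_germ Phi -> GL_germ X -> sym_germ C ->
  sym_germ (fun x => (X x)^T *m C (Phi x) *m X x).
Proof.
move=> [/smooth_germP sP P0 _] [/smooth_germP sX _] [/smooth_germP sC symC].
split.
  apply/smooth_germP; apply: smooth_at_mulmx => //; apply: smooth_at_mulmx.
    apply: smooth_at_entries => i j; rewrite (_ : (fun y => _) = fun y => X y j i).
      exact: smooth_at_entry.
    by apply/funext => y; rewrite mxE.
  by apply: smooth_at_comp_mx => //; rewrite P0.
apply: filterS (near_comp sP P0 symC) => x E.
by rewrite !trmx_mul trmxK E mulmxA.
Qed.

(** [pull] and [push] are inverse to each other on germs and carry one tangent space into the other,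
    so they transport a basis of the quotient. *)
Theorem codim_inv A B d : sym_germ A -> G_equiv A B -> Ge_codim A d -> Ge_codim B d.
Proof.
move=> sA [P [X [dP GX E]]] [Bs [sB HB]].
have sA' : smooth_at 0 A by apply/smooth_germP; case: sA.
have [/smooth_germP sP P0 [Q [sQ Q0 K1 K2]]] := dP.
have sQ' : smooth_at 0 Q by apply/smooth_germP.
have [Y [sY XY YX]] := GL_inv GX.
pose Z x := Y (Q x).
have sZ : smooth_at 0 Z by apply: smooth_at_comp_mx => //; rewrite Q0.
have dQ : diffeo_germ Q by split=> //; exists P; split=> //; apply/smooth_germP.
have XZ := near_comp sQ' Q0 XY.
have GZ : GL_germ Z.
  split; first exact/smooth_germP.
  by apply: filterS XZ => x /mulmx1_unit[].
pose pull (C : 'rV[R]_2 -> 'M[R]_2) x := (X x)^T *m C (P x) *m X x.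
pose push (C : 'rV[R]_2 -> 'M[R]_2) x := (Z x)^T *m C (Q x) *m Z x.
have pushK C : \near0 x, push (pull C) x = C x.
  apply: filter_app XZ; apply: filterS K2 => x K2x XZx.
  by rewrite /push /pull K2x !mulmxA -trmx_mul XZx trmx1 mul1mx -mulmxA XZx mulmx1.
have pullK C : \near0 x, pull (push C) x = C x.
  have ZX := near_comp sP P0 XZ.
  apply: filter_app ZX; apply: filter_app YX; apply: filterS K1 => x K1x YXx XZx.
  rewrite /push /pull K1x /Z K1x !mulmxA -trmx_mul YXx trmx1 mul1mx -mulmxA YXx mulmx1 //.
have EA : \near0 x, A x = push B x.
  have E2 := near_comp sQ' Q0 E; have E3 := pushK A.
  by apply: filter_app E2; apply: filterS E3 => x <-; rewrite /push /pull => ->.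
have sBm : smooth_at 0 (pull A) by apply/smooth_germP; case: (sym_germ_pull dP GX sA).
have sB' : smooth_at 0 B.
  by apply: (smooth_at_germ sBm); apply: filterS E => x ->.
exists (fun i => pull (Bs i)); split=> [i|C sC]; first exact: sym_germ_pull.
have pullB (C' : 'rV[R]_2 -> 'M[R]_2) (c : 'rV[R]_d) x :
    pull (fun x => C' x - \sum_(i < d) c 0 i *: Bs i x) x =
    pull C' x - \sum_(i < d) c 0 i *: pull (Bs i) x.
  rewrite /pull mulmxBr mulmxBl; congr (_ - _); rewrite mulmx_sumr mulmx_suml.
  by apply: eq_bigr => i _; rewrite -scalemxAr -scalemxAl.
have pushB (C' : 'rV[R]_2 -> 'M[R]_2) (c : 'rV[R]_d) :
    \near0 x,
    push (fun x => C' x - \sum_(i < d) c 0 i *: pull (Bs i) x) x =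
    push C' x - \sum_(i < d) c 0 i *: Bs i x.
  have H : \near0 x, forall i, push (pull (Bs i)) x = Bs i x.
    apply: (@filter_forall _ _ (fun i x => push (pull (Bs i)) x = Bs i x) (nbhs (0 : 'rV[R]_2)) _) => i.
    exact: pushK.
  apply: filterS H => x H; rewrite /push mulmxBr mulmxBl; congr (_ - _).
  rewrite mulmx_sumr mulmx_suml.
  by apply: eq_bigr => i _; rewrite -scalemxAr -scalemxAl -[in RHS]H.
have [c [tc uc]] := HB _ (sym_germ_pull dQ GZ sC); exists c; split.
  have := tangent_pull sA' dP GX E tc.
  apply: tangent_near; apply: filterS (pullK C) => x EC.
  by apply: etrans (pullB (push C) c x) _; rewrite EC.
move=> c' tc'; apply: uc; have := tangent_pull sB' dQ GZ EA tc'.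
exact: tangent_near (pushB C c').
Qed.

End Invariance.

Section ScalarTangent.
Variable R : realType.
Implicit Types (x y v : 'rV[R]_2) (C T : 'rV[R]_2 -> 'M[R]_2)
  (a b c f g h : 'rV[R]_2 -> R).

(** A relation instead of the partial derivatives themselves, so that explicit formulas can stand
    for them near 0. *)
Definition pd f (f1 f2 : 'rV[R]_2 -> R) := [/\ smooth_at 0 f, smooth_at 0 f1, smooth_at 0 f2 &
  \near0 x, forall v, 'D_v f x = f1 x * v 0 0 + f2 x * v 0 1].

Lemma pd_gen f : smooth_at 0 f -> pd f ('D_(delta_mx 0 0) f) ('D_(delta_mx 0 1) f).
Proof.
move=> sf; split=> //; try exact: smooth_at_derive.
apply: filterS (smooth_at_near sf) => x /smooth_at_differentiable df v.
by rewrite (derive_sum_rV v df) sum2 mulrC [X in _ + X]mulrC.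
Qed.

Lemma pd_uniq f (f1 f2 : 'rV[R]_2 -> R) : pd f f1 f2 ->
  (\near0 x, 'D_(delta_mx 0 0) f x = f1 x) /\
  (\near0 x, 'D_(delta_mx 0 1) f x = f2 x).
Proof.
move=> [_ _ _ H]; split; apply: filterS H => x ->; rewrite !mxE /=.
  by rewrite mulr1 mulr0 addr0.
by rewrite mulr1 mulr0 add0r.
Qed.

Lemma pd_ext f (f1 f2 g1 g2 : 'rV[R]_2 -> R) : smooth_at 0 g1 -> smooth_at 0 g2 ->
  (\near0 x, f1 x = g1 x) ->
  (\near0 x, f2 x = g2 x) -> pd f f1 f2 -> pd f g1 g2.
Proof.
move=> s1 s2 E1 E2 [sf _ _ H]; split=> //.
by apply: filter_app E1; apply: filter_app E2; apply: filterS H => x H <- <-.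
Qed.

Lemma pd_cst (k : R) : pd (fun=> k) (fun=> 0) (fun=> 0).
Proof.
have s0 := @smooth_at_cst R 'rV[R]_2 R 0.
split; try exact: s0.
by apply: near_all => x v; rewrite derive_cst !mul0r addr0.
Qed.

Lemma pd_X1 : pd (fun x => x 0 0) (fun=> 1) (fun=> 0).
Proof.
have s0 := @smooth_at_cst R 'rV[R]_2 R 0.
split; [exact: smooth_at_X|exact: s0|exact: s0|].
by apply: near_all => x v; rewrite derive_coord mul1r mul0r addr0.
Qed.

Lemma pd_X2 : pd (fun x => x 0 1) (fun=> 0) (fun=> 1).
Proof.
have s0 := @smooth_at_cst R 'rV[R]_2 R 0.
split; [exact: smooth_at_X|exact: s0|exact: s0|].
by apply: near_all => x v; rewrite derive_coord mul1r mul0r add0r.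
Qed.

Lemma pd_add f (f1 f2 : 'rV[R]_2 -> R) g (g1 g2 : 'rV[R]_2 -> R) : pd f f1 f2 -> pd g g1 g2 ->
  pd (fun x => f x + g x) (fun x => f1 x + g1 x) (fun x => f2 x + g2 x).
Proof.
move=> [sf sf1 sf2 Hf] [sg sg1 sg2 Hg]; split; try by smooth.
have nf := smooth_at_near sf; have ng := smooth_at_near sg.
apply: filter_app Hf; apply: filter_app Hg; apply: filter_app nf; apply: filterS ng.
move=> x /smooth_at_differentiable dg /smooth_at_differentiable df Hg Hf v.
have E := deriveD (diff_derivable (v := v) df) (diff_derivable (v := v) dg).
by apply: etrans E _; rewrite Hf Hg; ring.
Qed.

Lemma pd_mul f (f1 f2 : 'rV[R]_2 -> R) g (g1 g2 : 'rV[R]_2 -> R) : pd f f1 f2 -> pd g g1 g2 ->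
  pd (fun x => f x * g x) (fun x => f1 x * g x + f x * g1 x)
     (fun x => f2 x * g x + f x * g2 x).
Proof.
move=> [sf sf1 sf2 Hf] [sg sg1 sg2 Hg]; split; try by smooth.
have nf := smooth_at_near sf; have ng := smooth_at_near sg.
apply: filter_app Hf; apply: filter_app Hg; apply: filter_app nf; apply: filterS ng.
move=> x /smooth_at_differentiable dg /smooth_at_differentiable df Hg Hf v.
have E := deriveM (diff_derivable (v := v) df) (diff_derivable (v := v) dg).
by apply: etrans E _; rewrite Hf Hg -![_ *: _]/(_ * _); ring.
Qed.

Lemma pd_Z f (f1 f2 : 'rV[R]_2 -> R) (k : R) : pd f f1 f2 ->
  pd (fun x => k * f x) (fun x => k * f1 x) (fun x => k * f2 x).
Proof.
move=> pf; have [sf s1 s2 _] := pf.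
have sk := @smooth_at_cst R 'rV[R]_2 R 0 k.
by apply: pd_ext (pd_mul (pd_cst k) pf); try (by smooth);
  apply: near_all => x; rewrite mul0r add0r.
Qed.

Lemma pd_exp f (f1 f2 : 'rV[R]_2 -> R) n : pd f f1 f2 ->
  pd (fun x => f x ^+ n) (fun x => n%:R * f x ^+ n.-1 * f1 x)
     (fun x => n%:R * f x ^+ n.-1 * f2 x).
Proof.
move=> pf; have [sf s1 s2 _] := pf.
have sk (k : R) := @smooth_at_cst R 'rV[R]_2 R 0 k.
elim: n => [|n IH].
  apply: pd_ext (pd_cst 1); try (by smooth); apply: near_all => x; by rewrite !mul0r.
rewrite (_ : (fun x => f x ^+ n.+1) = fun x => f x * f x ^+ n); last first.
  by apply/funext => x; rewrite exprS.
apply: pd_ext (pd_mul pf IH); try (by smooth); apply: near_all => x /=;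
  by case: n {IH} => [|n] /=; rewrite ?exprS -?natr1; ring.
Qed.

Lemma pd_indep1 f : smooth_at 0 f -> (forall x, f (setc 0 0 x) = f x) ->
  pd f (fun=> 0) ('D_(delta_mx 0 1) f).
Proof.
move=> sf fi; apply: pd_ext (pd_gen sf).
- exact: smooth_at_cst.
- exact: smooth_at_derive.
- apply: near_all => x; have -> : 'D_(delta_mx 0 0) f x = 'D_(delta_mx 0 0) (fun=> f 0) x.
    apply: derive_quot => t; rewrite subrr -fi -[f x]fi.
    suff -> : setc 0 0 (t *: delta_mx 0 0 + x) = setc 0 0 x by rewrite subrr.
    by apply: rV2P; rewrite !mxE //= mulr0 add0r.
  exact: derive_cst.
- exact: near_all.
Qed.

Lemma add3mxE (M N P : 'M[R]_2) i j : (M + N + P) i j = M i j + N i j + P i j.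
Proof. by rewrite !mxE. Qed.

Lemma trmx2E (M : 'M[R]_2) i j : M^T i j = M j i.
Proof. by rewrite mxE. Qed.

(** The definition of the tangent space written entry by entry, for the field [(v1, v2)] and
    [U = (u1, u2; u3, u4)]. *)
Lemma tangentI a b c (a1 a2 b1 b2 c1 c2 v1 v2 u1 u2 u3 u4 : 'rV[R]_2 -> R) C :
  pd a a1 a2 -> pd b b1 b2 -> pd c c1 c2 ->
  smooth_at 0 v1 -> smooth_at 0 v2 ->
  smooth_at 0 u1 -> smooth_at 0 u2 -> smooth_at 0 u3 -> smooth_at 0 u4 ->
  (\near0 x, C x = sym2
     (a1 x * v1 x + a2 x * v2 x + 2 * (a x * u1 x + b x * u3 x))
     (b1 x * v1 x + b2 x * v2 x + a x * u2 x + b x * (u1 x + u4 x) + c x * u3 x)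
     (c1 x * v1 x + c2 x * v2 x + 2 * (b x * u2 x + c x * u4 x))) ->
  Ge_tangent (germ3 a b c) C.
Proof.
move=> [sa _ _ Ha] [sb _ _ Hb] [sc _ _ Hc] sv1 sv2 su1 su2 su3 su4 E.
exists (fun x => vec2 (v1 x) (v2 x)), (fun x => mx2 (u1 x) (u2 x) (u3 x) (u4 x)); split.
- by apply/smooth_germP; smooth.
- by apply/smooth_germP; exact: smooth_at_mx2.
have sA : smooth_at 0 (germ3 a b c) by exact: smooth_at_sym2.
apply: filter_app E; apply: filter_app Ha; apply: filter_app Hb; apply: filter_app Hc.
apply: filterS (smooth_at_near sA) => x /smooth_at_differentiable dA Hc Hb Ha ->.
have D i j : 'd (germ3 a b c) x (vec2 (v1 x) (v2 x)) i j =
    'D_(vec2 (v1 x) (v2 x)) (fun y => germ3 a b c y i j) x.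
  by rewrite -(deriveE _ dA) derive_entry.
have D00 : (fun y => germ3 a b c y 0 0) = a by apply/funext => y; rewrite mxE.
have D01 : (fun y => germ3 a b c y 0 1) = b by apply/funext => y; rewrite mxE.
have D10 : (fun y => germ3 a b c y 1 0) = b by apply/funext => y; rewrite mxE.
have D11 : (fun y => germ3 a b c y 1 1) = c by apply/funext => y; rewrite mxE.
apply: mx2P; rewrite add3mxE !mul2E !trmx2E !mx2E !sym2E D
  ?D00 ?D01 ?D10 ?D11 ?Ha ?Hb ?Hc vec2_1 vec2_2; ring.
Qed.

Lemma tangentE a b c (a1 a2 b1 b2 c1 c2 : 'rV[R]_2 -> R) C :
  pd a a1 a2 -> pd b b1 b2 -> pd c c1 c2 -> Ge_tangent (germ3 a b c) C ->
  exists (v1 v2 u1 u2 u3 u4 : 'rV[R]_2 -> R),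
  [/\ [/\ smooth_at 0 v1, smooth_at 0 v2 & smooth_at 0 u1],
      [/\ smooth_at 0 u2, smooth_at 0 u3 & smooth_at 0 u4],
      \near0 x, C x 0 0 =
        a1 x * v1 x + a2 x * v2 x + 2 * (a x * u1 x + b x * u3 x),
      \near0 x, C x 0 1 =
        b1 x * v1 x + b2 x * v2 x + a x * u2 x + b x * (u1 x + u4 x) + c x * u3 x &
      \near0 x, C x 1 1 =
        c1 x * v1 x + c2 x * v2 x + 2 * (b x * u2 x + c x * u4 x)].
Proof.
move=> [sa _ _ Ha] [sb _ _ Hb] [sc _ _ Hc] [V [U [/smooth_germP sV /smooth_germP sU E]]].
exists (fun x => V x 0 0), (fun x => V x 0 1), (fun x => U x 0 0), (fun x => U x 0 1),
  (fun x => U x 1 0), (fun x => U x 1 1).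
have sA : smooth_at 0 (germ3 a b c) by exact: smooth_at_sym2.
have D00 : (fun y => germ3 a b c y 0 0) = a by apply/funext => y; rewrite mxE.
have D01 : (fun y => germ3 a b c y 0 1) = b by apply/funext => y; rewrite mxE.
have D11 : (fun y => germ3 a b c y 1 1) = c by apply/funext => y; rewrite mxE.
have D : \near0 x, forall i j, 'd (germ3 a b c) x (V x) i j =
    'D_(V x) (fun y => germ3 a b c y i j) x.
  apply: filterS (smooth_at_near sA) => x /smooth_at_differentiable dA i j.
  by rewrite -(deriveE _ dA) derive_entry.
split; try by split; exact: smooth_at_entry.
- apply: filter_app E; apply: filter_app D; apply: filterS Ha => x Ha D ->.
  by rewrite add3mxE !mul2E !trmx2E !sym2E D D00 Ha; ring.
- apply: filter_app E; apply: filter_app D; apply: filterS Hb => x Hb D ->.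
  by rewrite add3mxE !mul2E !trmx2E !sym2E D D01 Hb; ring.
- apply: filter_app E; apply: filter_app D; apply: filterS Hc => x Hc D ->.
  by rewrite add3mxE !mul2E !trmx2E !sym2E D D11 Hc; ring.
Qed.

Definition germ_functional (L : ('rV[R]_2 -> 'M[R]_2) -> R) :=
  (forall C T (k : R), smooth_at 0 C -> smooth_at 0 T ->
     L (fun x => C x + k *: T x) = L C + k * L T) /\
  (forall C T, smooth_at 0 C -> smooth_at 0 T ->
     (\near0 x, C x = T x) -> L C = L T).

Lemma functional_tc i j f g h : smooth_at 0 f -> smooth_at 0 g -> smooth_at 0 h ->
  germ_functional (fun C => tc i j (fun x => f x * C x 0 0 + g x * C x 0 1 + h x * C x 1 1)).
Proof.
move=> sf sg sh.
have S C : smooth_at 0 C ->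
    smooth_at 0 (fun x => f x * C x 0 0 + g x * C x 0 1 + h x * C x 1 1).
  move=> sC; have s0 := smooth_at_entry 0 0 sC; have s1 := smooth_at_entry 0 1 sC.
  by have s2 := smooth_at_entry 1 1 sC; smooth.
split=> [C T k sC sT|C T sC sT E].
  rewrite -tcZ; last exact: S.
  rewrite -tcD; last 2 first.
  - exact: S.
  - by apply: smooth_at_mul; [exact: smooth_at_cst|exact: S].
  by congr tc; apply/funext => x; rewrite !mxE; ring.
by apply: tc_ext; [exact: S|exact: S|apply: filterS E => x ->].
Qed.

Lemma functional_add (L L' : ('rV[R]_2 -> 'M[R]_2) -> R) (k : R) :
  germ_functional L -> germ_functional L' -> germ_functional (fun C => L C + k * L' C).
Proof.
move=> [lL eL] [lL' eL']; split=> [C T p sC sT|C T sC sT E].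
  by rewrite lL // lL' //; ring.
by rewrite (eL C T) // (eL' C T).
Qed.

Lemma functional_linear N (L : 'I_N -> ('rV[R]_2 -> 'M[R]_2) -> R) :
  (forall i, germ_functional (L i)) -> germ_linear (fun C => \row_i L i C).
Proof.
move=> lL; split=> [C T k sC sT|C T sC sT E]; apply/rowP => i; rewrite !mxE.
  exact: (lL i).1.
exact: (lL i).2.
Qed.

Lemma codim_dual_fin (I : finType) (A : 'rV[R]_2 -> 'M[R]_2) (B : I -> 'rV[R]_2 -> 'M[R]_2)
    (L : I -> ('rV[R]_2 -> 'M[R]_2) -> R) :
  (forall i, sym_germ (B i)) -> (forall i, germ_functional (L i)) ->
  (forall i T, smooth_at 0 T -> Ge_tangent A T -> L i T = 0) ->
  (forall i j, L i (B j) = (i == j)%:R) ->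
  (forall C, sym_germ C -> (forall i, L i C = 0) -> Ge_tangent A C) ->
  Ge_codim A #|I|.
Proof.
move=> sB lL LT LB LC.
apply: (@codim_dual R A #|I| (fun k => B (enum_val k)) (fun C => \row_k L (enum_val k) C)).
- by move=> i; exact: sB.
- by apply: functional_linear => i.
- by move=> T sT tT; apply/rowP => i; rewrite !mxE; exact: LT.
- move=> i; apply/rowP => j; rewrite !mxE LB eqxx /=.
  by rewrite (inj_eq enum_val_inj) eq_sym.
- move=> C sC /rowP H; apply: LC => // i.
  by have := H (enum_rank i); rewrite !mxE enum_rankK.
Qed.

Lemma split_axis2 l f : smooth_at 0 f -> (forall i, (i < l)%N -> tc i 0 f = 0) ->
  exists g h, [/\ smooth_at 0 g, smooth_at 0 h &
    forall x, f x = x 0 0 ^+ l * g x + x 0 1 * h x].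
Proof.
move=> sf H; have [h [sh _ _ E]] := axis2_div sf H.
exists h, (hq 1 f); split=> //; first exact: smooth_at_hq.
by move=> x; rewrite [LHS](hqE 1) E.
Qed.

(** Membership in the ideal generated by [x1^2] and [x2^2] is detected by four coefficients. *)
Lemma split22 f : smooth_at 0 f ->
  (forall i j, (i < 2)%N -> (j < 2)%N -> tc i j f = 0) ->
  exists g h, [/\ smooth_at 0 g, smooth_at 0 h &
    forall x, f x = x 0 0 ^+ 2 * g x + x 0 1 ^+ 2 * h x].
Proof.
move=> sf H; have [g0 [sg0 _ _ E0]] := axis2_div (l := 2) sf (fun i i2 => H i 0%N i2 isT).
have s1 := smooth_at_hq 1 sf.
have [g [h [sg sh E]]] := @split_axis2 2 _ s1 (fun i i2 => etrans (tc_hq2 i 0 f) (H i 1%N i2 isT)).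
exists (fun x => g0 x + x 0 1 * g x), h; split=> //; first by smooth.
by move=> x; rewrite [LHS](hqE 1) E0 E; ring.
Qed.

End ScalarTangent.

Ltac tangent_entries P1 P2 P3 T :=
  let sT := fresh "sT" in let v1 := fresh "v1" in
  move=> sT /(tangentE P1 P2 P3) [v1 [v2 [u1 [u2 [u3 [u4 [[sv1 sv2 su1] [su2 su3 su4] E11 E12 E22]]]]]]];
  have sT11 := smooth_at_entry 0 0 sT; have sT12 := smooth_at_entry 0 1 sT;
  have sT22 := smooth_at_entry 1 1 sT.

(** * Codimension of the normal forms *)

Section CodimNormalForms.
Variable R : realType.
Implicit Types (x y v : 'rV[R]_2) (C T : 'rV[R]_2 -> 'M[R]_2) (f g h : 'rV[R]_2 -> R).

Lemma tc_mono i j m n :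
  tc i j (fun x : 'rV[R]_2 => x 0 0 ^+ m * x 0 1 ^+ n) = ((i == m) && (j == n))%:R.
Proof.
have s1 (k : nat) : smooth_at 0 (fun x : 'rV[R]_2 => x 0 1 ^+ k * 1) by smooth.
rewrite (_ : (fun x => _) = fun x : 'rV[R]_2 => x 0 0 ^+ m * (x 0 1 ^+ n * 1)); last first.
  by apply/funext => x; rewrite mulr1.
rewrite tc_mulX1n // tc_mulX2n; last exact: smooth_at_cst.
rewrite tc_cst !subn_eq0 (eqn_leq i) (eqn_leq j).
by case: (leqP m i); case: (leqP n j); case: (leqP i m); case: (leqP j n).
Qed.

Lemma tc_X1n i j n : tc i j (fun x : 'rV[R]_2 => x 0 0 ^+ n) = ((i == n) && (j == 0%N))%:R.
Proof.
by rewrite -tc_mono; congr tc; apply/funext => x; rewrite expr0 mulr1.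
Qed.

Lemma tc_X2n i j n : tc i j (fun x : 'rV[R]_2 => x 0 1 ^+ n) = ((i == 0%N) && (j == n))%:R.
Proof.
by rewrite -tc_mono; congr tc; apply/funext => x; rewrite expr0 mul1r.
Qed.

Lemma tc_zero i j : tc i j (fun _ : 'rV[R]_2 => 0 : R) = 0.
Proof. by rewrite tc_cst; case: ifP. Qed.

(** Besides the coefficients that vanish on the ideal of [x1] and [x2^k], the two boundary
    coefficients read off the multipliers at 0. They detect a multiplier shared by two entries of a
    tangent vector. *)
Lemma tc_ideal1 k f g h : smooth_at 0 f -> smooth_at 0 g -> smooth_at 0 h ->
  (\near0 x, f x = x 0 0 * g x + x 0 1 ^+ k * h x) ->
  [/\ forall j, (j < k)%N -> tc 0 j f = 0, tc 0 k f = h 0 &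
      (1 < k)%N -> tc 1 0 f = g 0].
Proof.
move=> sf sg sh E.
have H i j : tc i j f = (if i is i'.+1 then tc i' j g else 0) +
    (if (k <= j)%N then tc i (j - k) h else 0).
  rewrite (tc_ext i j sf _ E); last by smooth.
  by rewrite tcD ?tc_mulX1 ?tc_mulX2n //; smooth.
split=> [j jk||k1]; rewrite H ?add0r.
- by rewrite leqNgt jk.
- by rewrite leqnn subnn.
- by case: k k1 {E H} => // k _; rewrite addr0.
Qed.

Lemma tc_ideal2 k f g h : smooth_at 0 f -> smooth_at 0 g -> smooth_at 0 h ->
  (\near0 x, f x = x 0 0 ^+ k * g x + x 0 1 * h x) ->
  forall i, (i < k)%N -> tc i 0 f = 0.
Proof.
move=> sf sg sh E i ik; rewrite (tc_ext i 0 sf _ E); last by smooth.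
by rewrite tcD ?tc_mulX1n ?tc_mulX2 //; try smooth; rewrite leqNgt ik addr0.
Qed.

Lemma tc_ideal22 f g h : smooth_at 0 f -> smooth_at 0 g -> smooth_at 0 h ->
  (\near0 x, f x = x 0 0 ^+ 2 * g x + x 0 1 ^+ 2 * h x) ->
  (forall i j, (i < 2)%N -> (j < 2)%N -> tc i j f = 0) /\ tc 0 2 f = h 0.
Proof.
move=> sf sg sh E.
have H i j : (i < 2)%N -> tc i j f = if (2 <= j)%N then tc i (j - 2) h else 0.
  move=> i2; rewrite (tc_ext i j sf _ E); last by smooth.
  by rewrite tcD ?tc_mulX1n ?tc_mulX2n //; try smooth; rewrite leqNgt i2 add0r.
by split=> [i j i2 j2|]; rewrite H // leqNgt j2.
Qed.

Lemma split_axis1 l f : smooth_at 0 f -> (forall j, (j < l)%N -> tc 0 j f = 0) ->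
  exists g h, [/\ smooth_at 0 g, smooth_at 0 h, g 0 = tc 1 0 f, h 0 = tc 0 l f &
    forall x, f x = x 0 0 * g x + x 0 1 ^+ l * h x].
Proof.
move=> sf H; have [h [sh _ h0 E]] := axis1_div sf H.
exists (hq 0 f), h; split=> //; first exact: smooth_at_hq.
by move=> x; rewrite [LHS](hqE 0) E addrC.
Qed.

Lemma split22' f : smooth_at 0 f ->
  (forall i j, (i < 2)%N -> (j < 2)%N -> tc i j f = 0) ->
  exists g h, [/\ smooth_at 0 g, smooth_at 0 h, h 0 = tc 0 2 f &
    forall x, f x = x 0 0 ^+ 2 * g x + x 0 1 ^+ 2 * h x].
Proof.
move=> sf H; have [g [h [sg sh E]]] := split22 sf H.
by exists g, h; split=> //; have [_ ->] := tc_ideal22 sf sg sh (near_all E).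
Qed.

Lemma pd_X1n n : pd (fun x : 'rV[R]_2 => x 0 0 ^+ n) (fun x => n%:R * x 0 0 ^+ n.-1) (fun=> 0).
Proof.
have s (k : R) := @smooth_at_cst R 'rV[R]_2 R 0 k.
by apply: pd_ext (pd_exp n (@pd_X1 R)); try (by smooth); apply: near_all => x;
  rewrite ?mulr1 ?mulr0.
Qed.

Lemma pd_X2n n : pd (fun x : 'rV[R]_2 => x 0 1 ^+ n) (fun=> 0) (fun x => n%:R * x 0 1 ^+ n.-1).
Proof.
have s (k : R) := @smooth_at_cst R 'rV[R]_2 R 0 k.
by apply: pd_ext (pd_exp n (@pd_X2 R)); try (by smooth); apply: near_all => x;
  rewrite ?mulr1 ?mulr0.
Qed.

Lemma sign_case (s : bool) : (-1) ^+ s = 1 :> R \/ (-1) ^+ s = -1 :> R.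
Proof. by case: s; [right|left]. Qed.

Lemma sym2_by (M : 'M[R]_2) (a b c : R) : M = sym2 (M 0 0) (M 0 1) (M 1 1) ->
  M 0 0 = a -> M 0 1 = b -> M 1 1 = c -> M = sym2 a b c.
Proof. by move=> E <- <- <-. Qed.

Definition lf i j f g h C := tc i j (fun x => f x * C x 0 0 + g x * C x 0 1 + h x * C x 1 1).

Lemma lf_functional i j f g h : smooth_at 0 f -> smooth_at 0 g -> smooth_at 0 h ->
  germ_functional (lf i j f g h).
Proof. exact: functional_tc. Qed.

Definition e11 i j := lf i j (fun=> 1) (fun=> 0) (fun=> 0).
Definition e12 i j := lf i j (fun=> 0) (fun=> 1) (fun=> 0).
(** For [a = x1] the component [v1] of the field enters [C11] with coefficient 1 and [C22] with
    coefficient the [x1]-derivative of [c]. Taking this derivative for [f] eliminates [v1]; [f = 0]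
    gives the plain coefficient of [C22]. *)
Definition e22 f i j := lf i j (fun x => - f x) (fun=> 0) (fun=> 1).

Lemma e11E i j C : e11 i j C = tc i j (fun x => C x 0 0).
Proof. by congr tc; apply/funext => x; ring. Qed.

Lemma e12E i j C : e12 i j C = tc i j (fun x => C x 0 1).
Proof. by congr tc; apply/funext => x; ring. Qed.

Lemma e22E f i j C : e22 f i j C = tc i j (fun x => C x 1 1 - f x * C x 0 0).
Proof. by congr tc; apply/funext => x; ring. Qed.

Lemma e11_germ3 i j f g h : e11 i j (germ3 f g h) = tc i j f.
Proof. by rewrite e11E; congr tc; apply/funext => x; rewrite mxE. Qed.

Lemma e12_germ3 i j f g h : e12 i j (germ3 f g h) = tc i j g.
Proof. by rewrite e12E; congr tc; apply/funext => x; rewrite mxE. Qed.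

Lemma e22_germ3 f i j g h : e22 f i j (germ3 (fun=> 0) g h) = tc i j h.
Proof. by rewrite e22E; congr tc; apply/funext => x; rewrite !mxE /= mulr0 subr0. Qed.

Lemma e22_0germ3 i j f g h : e22 (fun=> 0) i j (germ3 f g h) = tc i j h.
Proof. by rewrite e22E; congr tc; apply/funext => x; rewrite !mxE /= mul0r subr0. Qed.

Lemma e11_functional i j : germ_functional (e11 i j).
Proof. by apply: lf_functional; smooth. Qed.

Lemma e12_functional i j : germ_functional (e12 i j).
Proof. by apply: lf_functional; smooth. Qed.

Lemma e22_functional f i j : smooth_at 0 f -> germ_functional (e22 f i j).
Proof. by move=> sf; apply: lf_functional; smooth. Qed.

Definition tcE := (e11_germ3, e12_germ3, e22_germ3, e22_0germ3, tc_zero, tc_mono, tc_X1n, tc_X2n).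

Local Notation X1 := (fun x : 'rV[R]_2 => x 0 0).
Local Notation X2 := (fun x : 'rV[R]_2 => x 0 1).
Local Notation O := (fun=> 0).

(** [v1] and [v2] make the diagonal entries arbitrary, and the off-diagonal entry is
    [x1 u2 + x2 u3]; only its value at 0 is constrained. *)
Lemma codim_NF1 : Ge_codim (germ3 X1 O X2) 1.
Proof.
have P1 := @pd_X1 R; have P2 := pd_cst (0 : R); have P3 := @pd_X2 R.
rewrite -[X in Ge_codim _ X](card_ord 1).
apply: (@codim_dual_fin R 'I_1 _ (fun=> germ3 O (fun x => x 0 1 ^+ 0) O) (fun=> e12 0 0)).
- by move=> i; apply: sym_germ3; smooth.
- by move=> i; exact: e12_functional.
- move=> i T; tangent_entries P1 P2 P3 T; rewrite e12E.
  have [|H _ _] := @tc_ideal1 1 (fun x => T x 0 1) u2 u3 sT12 su2 su3; last exact: H.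
  by apply: filterS E12 => x ->; ring.
- by move=> i j; rewrite !ord1 !tcE !eqxx.
- move=> C sC H; have [sC0 sC1 sC2 CE] := sym_germ_entries sC.
  have [j j1|p [q [sp sq _ _ E]]] := @split_axis1 1 (fun x => C x 0 1) sC1.
    by rewrite -e12E; case: j j1 => // _; exact: (H ord0).
  apply: (@tangentI R _ _ _ _ _ _ _ _ _ (fun x => C x 0 0) (fun x => C x 1 1) O p q O
    C P1 P2 P3); try (by smooth).
  apply: filterS CE => x CE; apply: sym2_by CE _ _ _; [by ring| |by ring].
  by rewrite E; ring.
Qed.

(** [v1] and [v2] take care of [C11] and [C12]; what remains, [C11 + C22], runs through the maximal
    ideal. *)
Lemma codim_NF2 : Ge_codim (germ3 X1 X2 (fun x => - x 0 0)) 1.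
Proof.
have P1 := @pd_X1 R; have P2 := @pd_X2 R; have P3 := pd_Z (-1) (@pd_X1 R).
have -> : germ3 X1 X2 (fun x => - x 0 0) = germ3 X1 X2 (fun x => -1 * x 0 0).
  by apply/funext => x; rewrite /germ3 mulN1r.
rewrite -[X in Ge_codim _ X](card_ord 1).
apply: (@codim_dual_fin R 'I_1 _ (fun=> germ3 O O (fun x => x 0 1 ^+ 0)) (fun=> e22 (fun=> -1) 0 0)).
- by move=> i; apply: sym_germ3; smooth.
- by move=> i; apply: e22_functional; smooth.
- move=> i T; tangent_entries P1 P2 P3 T; rewrite e22E.
  have [| | | |H _ _] := @tc_ideal1 1 (fun x => T x 1 1 - -1 * T x 0 0)
    (fun x => 2 * (u1 x - u4 x)) (fun x => 2 * (u3 x + u2 x)); try (by smooth); last exact: H.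
  by apply: filter_app E11; apply: filterS E22 => x -> ->; ring.
- by move=> i j; rewrite !ord1 !tcE !eqxx.
- move=> C sC H; have [sC0 sC1 sC2 CE] := sym_germ_entries sC.
  have [||g [h [sg sh _ _ E]]] := @split_axis1 1 (fun x => C x 1 1 - -1 * C x 0 0).
  + by smooth.
  + by move=> j j1; rewrite -(e22E (fun=> -1)); case: j j1 => // _; exact: (H ord0).
  apply: (@tangentI R _ _ _ _ _ _ _ _ _ (fun x => C x 0 0 - x 0 0 * g x)
    (fun x => C x 0 1 - x 0 0 * (h x / 2) - x 0 1 * (g x / 2)) (fun x => g x / 2)
    (fun x => h x / 2) O O C P1 P2 P3); try (by smooth).
  apply: filterS CE => x CE; apply: sym2_by CE _ _ _; [by field|by field|].
  have -> : C x 1 1 = (x 0 0 * g x + x 0 1 ^+ 1 * h x) - C x 0 0 by rewrite -E; ring.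
  by field.
Qed.

(** With [v1] and [v2] spent on [C11] and [C12], the combination [C22 - f C11] runs through the
    ideal of [x1^l] and [x2], of colength [l]. *)
Lemma codim_NF3 (e : R) l : e = 1 \/ e = -1 -> (1 <= l)%N ->
  Ge_codim (germ3 X1 X2 (fun x => e * x 0 0 ^+ l)) l.
Proof.
case: l => // l He _; rewrite -[X in Ge_codim _ X](card_ord l.+1).
have P1 := @pd_X1 R; have P2 := @pd_X2 R; have P3 := pd_Z e (pd_X1n l.+1).
pose f := fun x : 'rV[R]_2 => e * (l.+1%:R * x 0 0 ^+ l).
have sf : smooth_at 0 f by rewrite /f; smooth.
apply: (@codim_dual_fin R 'I_l.+1 _ (fun j => germ3 O O (fun x => x 0 0 ^+ j))
  (fun j => e22 f j 0)).
- by move=> i; apply: sym_germ3; smooth.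
- by move=> i; apply: e22_functional; smooth.
- move=> i T; tangent_entries P1 P2 P3 T; rewrite e22E.
  apply: (@tc_ideal2 l.+1 _ (fun x => 2 * e * (u4 x - l.+1%:R * u1 x))
    (fun x => 2 * u2 x - 2 * f x * u3 x)); try (by rewrite ?ltn_ord; smooth).
  by apply: filter_app E11; apply: filterS E22 => x -> ->; rewrite /f /= exprS; ring.
- by move=> i j; rewrite !tcE andbT.
- move=> C sC H; have [sC0 sC1 sC2 CE] := sym_germ_entries sC.
  have [|i il|g [h [sg sh E]]] := @split_axis2 R l.+1 (fun x => C x 1 1 - f x * C x 0 0).
  + by smooth.
  + by have := H (Ordinal il); rewrite e22E.
  pose u4 x := e * g x / 2; pose u2 x := h x / 2.
  have su4 : smooth_at 0 u4 by rewrite /u4; smooth.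
  have su2 : smooth_at 0 u2 by rewrite /u2; smooth.
  apply: (@tangentI R _ _ _ _ _ _ _ _ _ (fun x => C x 0 0)
    (fun x => C x 0 1 - x 0 0 * u2 x - x 0 1 * u4 x) O u2 O u4 C P1 P2 P3);
    try (by smooth).
  apply: filterS CE => x CE; apply: sym2_by CE _ _ _; first by ring.
    by rewrite /u2 /u4; ring.
  have -> : C x 1 1 = f x * C x 0 0 + (x 0 0 ^+ l.+1 * g x + x 0 1 * h x) by rewrite -E; ring.
  by rewrite /f /u2 /u4 /= ?exprS; case: He => ->; field.
Qed.

(** [C22 - C11] runs through the ideal of [x1], [x2^l] and [C12] through that of [x1], [x2^(l-1)].
    The two are independent, since they involve [u2 - u3] and [u2 + u3], and the colengths are [l]
    and [l - 1]. *)
Lemma codim_NF4 l : (1 <= l)%N ->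
  Ge_codim (germ3 X1 (fun x => x 0 1 ^+ l) X1) (2 * l - 1).
Proof.
case: l => // l _; rewrite (_ : (2 * l.+1 - 1)%N = #|{: 'I_l.+1 + 'I_l}|); last first.
  by rewrite card_sum !card_ord mul2n -addnn addnS subn1.
have P1 := @pd_X1 R; have P2 := pd_X2n l.+1.
apply: (@codim_dual_fin R ('I_l.+1 + 'I_l)%type _
  (fun i => match i with inl j => germ3 O O (fun x => x 0 1 ^+ j)
                       | inr j => germ3 O (fun x => x 0 1 ^+ j) O end)
  (fun i => match i with inl j => e22 (fun=> 1) 0 j | inr j => e12 0 j end)).
- by case=> i; apply: sym_germ3; smooth.
- by case=> i; [apply: e22_functional; smooth|exact: e12_functional].
- case=> i T; tangent_entries P1 P2 P1 T.
    rewrite e22E; have [| | | |H _ _] := @tc_ideal1 l.+1 (fun x => T x 1 1 - 1 * T x 0 0)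
      (fun x => 2 * (u4 x - u1 x)) (fun x => 2 * (u2 x - u3 x)); try (by smooth).
      by apply: filter_app E11; apply: filterS E22 => x -> ->; ring.
    by apply: H; rewrite ltn_ord.
  rewrite e12E; have [| | | |H _ _] := @tc_ideal1 l (fun x => T x 0 1)
      (fun x => u2 x + u3 x) (fun x => l.+1%:R * v2 x + x 0 1 * (u1 x + u4 x)); try (by smooth).
    by apply: filterS E12 => x ->; rewrite /= exprS; ring.
  by apply: H; rewrite ltn_ord.
- by case=> i [j|j]; rewrite !tcE.
- move=> C sC H; have [sC0 sC1 sC2 CE] := sym_germ_entries sC.
  have [||g [h [sg sh _ _ E]]] := @split_axis1 l.+1 (fun x => C x 1 1 - 1 * C x 0 0).
  + by smooth.
  + by move=> j jl; have := H (inl (Ordinal jl)); rewrite e22E.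
  have [|p [q [sp sq _ _ F]]] := @split_axis1 l (fun x => C x 0 1) sC1.
    by move=> j jl; have := H (inr (Ordinal jl)); rewrite e12E.
  (* Together with the [u2] supplied below, the solution of [u2 + u3 = p] and [2 (u2 - u3) = h]. *)
  pose u3 x := p x / 2 - h x / 4%:R.
  have su3 : smooth_at 0 u3 by rewrite /u3; smooth.
  have l0 : l.+1%:R != 0 :> R by rewrite pnatr_eq0.
  apply: (@tangentI R _ _ _ _ _ _ _ _ _ (fun x => C x 0 0 - 2 * x 0 1 ^+ l.+1 * u3 x)
    (fun x => l.+1%:R^-1 * (q x - x 0 1 * g x / 2)) O (fun x => p x / 2 + h x / 4%:R) u3
    (fun x => g x / 2) C P1 P2 P1); try (by smooth).
  apply: filterS CE => x CE; apply: sym2_by CE _ _ _; first by ring.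
    by rewrite F /u3 /= exprS; field.
  have -> : C x 1 1 = C x 0 0 + (x 0 0 * g x + x 0 1 ^+ l.+1 * h x) by rewrite -E; ring.
  by rewrite /u3; field.
Qed.

End CodimNormalForms.

Section CodimNormalForms2.
Variable R : realType.
Implicit Types (x y v : 'rV[R]_2) (C T : 'rV[R]_2 -> 'M[R]_2) (f g h : 'rV[R]_2 -> R).

Local Notation X1 := (fun x : 'rV[R]_2 => x 0 0).
Local Notation X2 := (fun x : 'rV[R]_2 => x 0 1).
Local Notation O := (fun=> 0).

(** Colength 2 for [C12], in the ideal of [x1] and [x2^2], and [l] for [C22 - f C11], in the ideal
    of [x1^l] and [x2]. *)
Lemma codim_NF7 (e1 e2 : R) l : e1 = 1 \/ e1 = -1 -> e2 = 1 \/ e2 = -1 -> (1 <= l)%N ->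
  Ge_codim (germ3 X1 O (fun x => e1 * x 0 1 ^+ 2 + e2 * x 0 0 ^+ l)) (l + 2).
Proof.
move=> H1 H2; case: l => // l _.
rewrite (_ : (l.+1 + 2)%N = #|{: 'I_2 + 'I_l.+1}|); last by rewrite card_sum !card_ord addnC.
have P1 := @pd_X1 R; have P2 := pd_cst (0 : R).
have P3 := pd_add (pd_Z e1 (@pd_X2n R 2)) (pd_Z e2 (@pd_X1n R l.+1)).
pose f := fun x : 'rV[R]_2 => e2 * (l.+1%:R * x 0 0 ^+ l).
have sf : smooth_at 0 f by rewrite /f; smooth.
apply: (@codim_dual_fin R ('I_2 + 'I_l.+1)%type _
  (fun i => match i with inl j => germ3 O (fun x => x 0 1 ^+ j) O
                       | inr j => germ3 O O (fun x => x 0 0 ^+ j) end)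
  (fun i => match i with inl j => e12 0 j | inr j => e22 f j 0 end)).
- by case=> i; apply: sym_germ3; smooth.
- by case=> i; [exact: e12_functional|exact: e22_functional].
- case=> i T; tangent_entries P1 P2 P3 T.
    rewrite e12E; have [| | | |H _ _] := @tc_ideal1 R 2 (fun x => T x 0 1)
      (fun x => u2 x + e2 * x 0 0 ^+ l * u3 x) (fun x => e1 * u3 x); try (by smooth).
      by apply: filterS E12 => x ->; rewrite !exprS; ring.
    by apply: H; rewrite ltn_ord.
  rewrite e22E; apply: (@tc_ideal2 R l.+1 _ (fun x => 2 * e2 * (u4 x - l.+1%:R * u1 x))
    (fun x => 2 * e1 * (v2 x + x 0 1 * u4 x))); try (by rewrite ?ltn_ord; smooth).
  by apply: filter_app E11; apply: filterS E22 => x -> ->; rewrite /f /= !exprS; ring.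
- by case=> i [j|j]; rewrite !tcE ?andbT.
- move=> C sC H; have [sC0 sC1 sC2 CE] := sym_germ_entries sC.
  have [j jl|p [q [sp sq _ _ E]]] := @split_axis1 R 2 (fun x => C x 0 1) sC1.
    by have := H (inl (Ordinal jl)); rewrite e12E.
  have [|i il|g [h [sg sh F]]] := @split_axis2 R l.+1 (fun x => C x 1 1 - f x * C x 0 0).
  + by smooth.
  + by have := H (inr (Ordinal il)); rewrite e22E.
  pose u3 x := e1 * q x; pose u4 x := e2 * g x / 2.
  have su3 : smooth_at 0 u3 by rewrite /u3; smooth.
  have su4 : smooth_at 0 u4 by rewrite /u4; smooth.
  apply: (@tangentI R _ _ _ _ _ _ _ _ _ (fun x => C x 0 0)
    (fun x => e1 * h x / 2 - x 0 1 * u4 x) O (fun x => p x - e2 * x 0 0 ^+ l * u3 x) u3 u4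
    C P1 P2 P3); try (by smooth).
  apply: filterS CE => x CE; apply: sym2_by CE _ _ _; first by ring.
    by rewrite E /u3 /= !exprS; case: H1 => ->; ring.
  have -> : C x 1 1 = f x * C x 0 0 + (x 0 0 ^+ l.+1 * g x + x 0 1 * h x) by rewrite -F; ring.
  by rewrite /f /u4 /= ?exprS; case: H1 => ->; case: H2 => ->; field.
Qed.

(** Colength 3 for [C12], in the ideal of [x1] and [x2^3], and 4 for [C22 - f C11], in the ideal of
    [x1^2] and [x2^2]. *)
Lemma codim_NF10 (e : R) : e = 1 \/ e = -1 ->
  Ge_codim (germ3 X1 O (fun x => e * x 0 0 ^+ 2 + x 0 1 ^+ 3)) 7.
Proof.
move=> He.
rewrite (_ : 7%N = #|{: 'I_3 + 'I_2 * 'I_2}|); last by rewrite card_sum card_prod !card_ord.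
have P1 := @pd_X1 R; have P2 := pd_cst (0 : R).
have P3 := pd_add (pd_Z e (@pd_X1n R 2)) (@pd_X2n R 3).
pose f := fun x : 'rV[R]_2 => e * (2 * x 0 0).
have sf : smooth_at 0 f by rewrite /f; smooth.
apply: (@codim_dual_fin R ('I_3 + 'I_2 * 'I_2)%type _
  (fun i => match i with inl j => germ3 O (fun x => x 0 1 ^+ j) O
                       | inr j => germ3 O O (fun x => x 0 0 ^+ j.1 * x 0 1 ^+ j.2) end)
  (fun i => match i with inl j => e12 0 j | inr j => e22 f j.1 j.2 end)).
- by case=> i; apply: sym_germ3; smooth.
- by case=> i; [exact: e12_functional|exact: e22_functional].
- case=> i T; tangent_entries P1 P2 P3 T.
    rewrite e12E; have [| | | |H _ _] := @tc_ideal1 R 3 (fun x => T x 0 1)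
      (fun x => u2 x + e * x 0 0 * u3 x) u3; try (by smooth).
      by apply: filterS E12 => x ->; ring.
    by apply: H; rewrite ltn_ord.
  rewrite e22E; have [| | | |H _] := @tc_ideal22 R (fun x => T x 1 1 - f x * T x 0 0)
    (fun x => 2 * e * (u4 x - 2 * u1 x)) (fun x => 3 * v2 x + 2 * x 0 1 * u4 x);
    try (by smooth).
    by apply: filter_app E11; apply: filterS E22 => x -> ->; rewrite /f /=; ring.
  by apply: H; rewrite ltn_ord.
- by case=> i [j|j]; rewrite !tcE.
- move=> C sC H; have [sC0 sC1 sC2 CE] := sym_germ_entries sC.
  have [j jl|p [q [sp sq _ _ E]]] := @split_axis1 R 3 (fun x => C x 0 1) sC1.
    by have := H (inl (Ordinal jl)); rewrite e12E.
  have [|i j il jl|g [h [sg sh F]]] := @split22 R (fun x => C x 1 1 - f x * C x 0 0).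
  + by smooth.
  + by have := H (inr (Ordinal il, Ordinal jl)); rewrite e22E.
  pose u4 x := e * g x / 2.
  have su4 : smooth_at 0 u4 by rewrite /u4; smooth.
  apply: (@tangentI R _ _ _ _ _ _ _ _ _ (fun x => C x 0 0)
    (fun x => (h x - 2 * x 0 1 * u4 x) / 3%:R) O (fun x => p x - e * x 0 0 * q x) q u4
    C P1 P2 P3); try (by smooth).
  apply: filterS CE => x CE; apply: sym2_by CE _ _ _; first by ring.
    by rewrite E; ring.
  have -> : C x 1 1 = f x * C x 0 0 + (x 0 0 ^+ 2 * g x + x 0 1 ^+ 2 * h x) by rewrite -F; ring.
  by rewrite /f /u4 /=; case: He => ->; field.
Qed.

(** Colengths 1 and 4 account for five functionals. The sixth is a coupling: [u2 0] is the
    coefficient of [x1] in [C12] and half that of [x2^2] in [C22 - f C11]. *)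
Lemma codim_NF6 (e : R) : e = 1 \/ e = -1 ->
  Ge_codim (germ3 X1 (fun x => x 0 1 ^+ 2) (fun x => e * x 0 0 ^+ 2)) 6.
Proof.
move=> He.
rewrite (_ : 6%N = #|{: unit + 'I_2 * 'I_2 + unit}|); last first.
  by rewrite !card_sum card_prod !card_ord card_unit.
have P1 := @pd_X1 R; have P2 := @pd_X2n R 2; have P3 := pd_Z e (@pd_X1n R 2).
pose f := fun x : 'rV[R]_2 => e * (2 * x 0 0).
have sf : smooth_at 0 f by rewrite /f; smooth.
have HT T : smooth_at 0 T -> Ge_tangent (germ3 X1 (fun x => x 0 1 ^+ 2) (fun x => e * x 0 0 ^+ 2)) T ->
  [/\ e12 0 0 T = 0, forall i j, (i < 2)%N -> (j < 2)%N -> e22 f i j T = 0 &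
      e22 f 0 2 T + (-2) * e12 1 0 T = 0].
  tangent_entries P1 P2 P3 T.
  have [| | | |H1 H2] := @tc_ideal22 R (fun x => T x 1 1 - f x * T x 0 0)
    (fun x => 2 * e * (u4 x - 2 * u1 x)) (fun x => 2 * (u2 x - 2 * e * x 0 0 * u3 x));
    try (by smooth).
    by apply: filter_app E11; apply: filterS E22 => x -> ->; rewrite /f /=; ring.
  have E12' : \near0 x, T x 0 1 = x 0 0 * (u2 x + e * x 0 0 * u3 x) +
      x 0 1 * (2 * v2 x + x 0 1 * (u1 x + u4 x)) by apply: filterS E12 => x ->; rewrite /=; ring.
  have s1 : smooth_at 0 (fun x => u2 x + e * x 0 0 * u3 x) by smooth.
  have s2 : smooth_at 0 (fun x => 2 * v2 x + x 0 1 * (u1 x + u4 x)) by smooth.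
  have K i j : tc i j (fun x => T x 0 1) =
      (if i is i'.+1 then tc i' j (fun x => u2 x + e * x 0 0 * u3 x) else 0) +
      (if j is j'.+1 then tc i j' (fun x => 2 * v2 x + x 0 1 * (u1 x + u4 x)) else 0).
    rewrite (tc_ext i j sT12 _ E12'); last by smooth.
    by rewrite tcD ?tc_mulX1 ?tc_mulX2 //; smooth.
  split.
  - by rewrite e12E K addr0.
  - by move=> i j i2 j2; rewrite e22E; exact: H1.
  - by rewrite e22E e12E H2 K /tc /= !mxE; ring.
apply: (@codim_dual_fin R (unit + 'I_2 * 'I_2 + unit)%type _
  (fun i => match i with inl (inl _) => germ3 O (fun x => x 0 1 ^+ 0) O
                       | inl (inr j) => germ3 O O (fun x => x 0 0 ^+ j.1 * x 0 1 ^+ j.2)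
                       | inr _ => germ3 O O (fun x => x 0 1 ^+ 2) end)
  (fun i => match i with inl (inl _) => e12 0 0 | inl (inr j) => e22 f j.1 j.2
     | inr _ => fun C => e22 f 0 2 C + (-2) * e12 1 0 C end)).
- by case=> [[]|] i; apply: sym_germ3; smooth.
- case=> [[]|] i; [exact: e12_functional|exact: e22_functional|].
  by apply: functional_add; [exact: e22_functional|exact: e12_functional].
- by case=> [[i|[[i i2] [j j2]]]|i] T sT /(HT T sT)[H1 H2 H3] //; exact: H2.
- case=> [[[]|[[i i2] [j j2]]]|[]] [[[]|[[i' i2'] [j' j2']]]|[]];
    rewrite !tcE /= ?mulr0 ?addr0 //.
    by rewrite (ltn_eqF j2) andbF.
  by rewrite (gtn_eqF j2') andbF.
- move=> C sC H; have [sC0 sC1 sC2 CE] := sym_germ_entries sC.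
  have [j jl|p [q [sp sq p0 _ E]]] := @split_axis1 R 1 (fun x => C x 0 1) sC1.
    by have := H (inl (inl tt)); rewrite e12E; case: j jl.
  have [|i j il jl|g [h [sg sh h0 F]]] := @split22' R (fun x => C x 1 1 - f x * C x 0 0).
  + by smooth.
  + by have := H (inl (inr (Ordinal il, Ordinal jl))); rewrite e22E.
  have s1 : smooth_at 0 (fun x => p x - h x / 2) by smooth.
  have [m [n [sm sn _ _ G]]] := hadamard2 s1.
  have {}G x : p x = h x / 2 + x 0 0 * m x + x 0 1 * n x.
    have := G x; rewrite p0 h0 -e22E -e12E.
    have -> : e22 f 0 2 C = 2 * e12 1 0 C by have := H (inr tt); rewrite mulNr => /subr0_eq.
    move=> {}G; have -> : p x = (p x - h x / 2) + h x / 2 by ring.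
    by rewrite G; field.
  (* From [p = u2 + e x1 u3] and [h / 2 = u2 - 2 e x1 u3], the [x1] part of [p - h / 2] is
     [3 e x1 u3]; its [x2] part is left to [v2]. *)
  pose u3 x := e * m x / 3%:R; pose u4 x := e * g x / 2.
  have su3 : smooth_at 0 u3 by rewrite /u3; smooth.
  have su4 : smooth_at 0 u4 by rewrite /u4; smooth.
  apply: (@tangentI R _ _ _ _ _ _ _ _ _ (fun x => C x 0 0 - 2 * x 0 1 ^+ 2 * u3 x)
    (fun x => (q x + x 0 0 * n x - x 0 1 * u4 x) / 2) O
    (fun x => h x / 2 + 2 * e * x 0 0 * u3 x) u3 u4 C P1 P2 P3); try (by smooth).
  apply: filterS CE => x CE; apply: sym2_by CE _ _ _; first by ring.
    by rewrite E G /u3 /=; case: He => ->; field.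
  have -> : C x 1 1 = f x * C x 0 0 + (x 0 0 ^+ 2 * g x + x 0 1 ^+ 2 * h x) by rewrite -F; ring.
  by rewrite /f /u4 /u3 /=; case: He => ->; field.
Qed.

(** [v1] disposes of [C12]. The diagonal entries lie in the ideals of [x1], [x2^(l1-1)] and of [x1],
    [x2^(l2-1)] but share the multiplier [v2]; eliminating [v2 0] from the two boundary coefficients
    gives one more functional, with weight [K]. *)
Lemma codim_NF5 (e1 e2 : R) l1 l2 : e1 = 1 \/ e1 = -1 -> e2 = 1 \/ e2 = -1 ->
  (2 <= l2)%N -> (2 <= l1)%N ->
  Ge_codim (germ3 (fun x => e1 * x 0 1 ^+ l1) X1 (fun x => e2 * x 0 1 ^+ l2)) (l1 + l2 - 1).
Proof.
move=> H1 H2; case: l2 => [|[|k]] // _; case: l1 => [|[|l]] // _.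
rewrite (_ : (l.+2 + k.+2 - 1)%N = #|{: 'I_l.+1 + 'I_k.+1 + unit}|); last first.
  by rewrite !card_sum !card_ord card_unit; lia.
have P1 := pd_Z e1 (@pd_X2n R l.+2); have P2 := @pd_X1 R.
have P3 := pd_Z e2 (@pd_X2n R k.+2).
pose K : R := - (l.+2%:R * e1 / (k.+2%:R * e2)).
have k0 : k.+2%:R != 0 :> R by rewrite pnatr_eq0.
have HT T : smooth_at 0 T ->
    Ge_tangent (germ3 (fun x => e1 * x 0 1 ^+ l.+2) X1 (fun x => e2 * x 0 1 ^+ k.+2)) T ->
    [/\ forall j, (j < l.+1)%N -> e11 0 j T = 0, forall j, (j < k.+1)%N -> e22 O 0 j T = 0 &
      e11 0 l.+1 T + K * e22 O 0 k.+1 T = 0].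
  tangent_entries P1 P2 P3 T.
  have [| | | |L1 L2 _] := @tc_ideal1 R l.+1 (fun x => T x 0 0) (fun x => 2 * u3 x)
    (fun x => e1 * (l.+2%:R * v2 x + 2 * x 0 1 * u1 x)); try (by smooth).
    by apply: filterS E11 => x ->; rewrite !exprS; ring.
  have [| | | |M1 M2 _] := @tc_ideal1 R k.+1 (fun x => T x 1 1 - 0 * T x 0 0) (fun x => 2 * u2 x)
    (fun x => e2 * (k.+2%:R * v2 x + 2 * x 0 1 * u4 x)); try (by smooth).
    by apply: filterS E22 => x ->; rewrite !exprS; ring.
  split.
  - by move=> j jl; rewrite e11E; exact: L1.
  - by move=> j jl; rewrite e22E; exact: M1.
  - rewrite e11E e22E L2 M2 !mxE /K.
    by case: H1 => ->; case: H2 => ->; move: (k.+2%:R) k0 => n n0; field.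
apply: (@codim_dual_fin R ('I_l.+1 + 'I_k.+1 + unit)%type _
  (fun i => match i with inl (inl j) => germ3 (fun x => x 0 1 ^+ j) O O
                       | inl (inr j) => germ3 O O (fun x => x 0 1 ^+ j)
                       | inr _ => germ3 (fun x => x 0 1 ^+ l.+1) O O end)
  (fun i => match i with inl (inl j) => e11 0 j | inl (inr j) => e22 O 0 j
     | inr _ => fun C => e11 0 l.+1 C + K * e22 O 0 k.+1 C end)).
- by case=> [[]|] i; apply: sym_germ3; smooth.
- case=> [[]|] i; [exact: e11_functional|by apply: e22_functional; smooth|].
  by apply: functional_add; [exact: e11_functional|apply: e22_functional; smooth].
- by case=> [[[i i1]|[i i1]]|[]] T sT /(HT T sT)[L1 L2 L3] //; [exact: L1|exact: L2].
- case=> [[[i i1]|[i i1]]|[]] [[[j j1]|[j j1]]|[]]; rewrite !tcE /= ?mulr0 ?addr0 ?add0r //.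
  + by rewrite (ltn_eqF i1).
  + by rewrite (gtn_eqF j1).
  + by rewrite (gtn_eqF j1) mulr0.
  + by rewrite eqxx.
- move=> C sC H; have [sC0 sC1 sC2 CE] := sym_germ_entries sC.
  have [j jl|p1 [q1 [sp1 sq1 _ q10 E]]] := @split_axis1 R l.+1 (fun x => C x 0 0) sC0.
    by have := H (inl (inl (Ordinal jl))); rewrite e11E.
  have [||p2 [q2 [sp2 sq2 _ q20 F]]] := @split_axis1 R k.+1 (fun x => C x 1 1 - 0 * C x 0 0).
  + by smooth.
  + by move=> j jl; have := H (inl (inr (Ordinal jl))); rewrite e22E.
  have s1 : smooth_at 0 (fun x => q1 x + K * q2 x) by smooth.
  have [m [n [sm sn _ _ G]]] := hadamard2 s1.
  have {}G x : q1 x = x 0 0 * m x + x 0 1 * n x - K * q2 x.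
    have := G x; rewrite q10 q20 -(e22E O) -e11E (H (inr tt)) add0r => <-.
    by move: (q1 x) (K * q2 x) => a b; ring.
  (* The multipliers of [x1] and of the power of [x2] are defined up to a syzygy, which serves to
     move the [x1] part [m] of [q1] into [u3]. *)
  pose u3 x := (p1 x + x 0 1 ^+ l.+1 * m x) / 2; pose u1 x := e1 * n x / 2.
  pose u2 x := p2 x / 2; pose v2 x := e2 * q2 x / k.+2%:R.
  have su3 : smooth_at 0 u3 by rewrite /u3; smooth.
  have su1 : smooth_at 0 u1 by rewrite /u1; smooth.
  have su2 : smooth_at 0 u2 by rewrite /u2; smooth.
  have sv2 : smooth_at 0 v2 by rewrite /v2; smooth.
  apply: (@tangentI R _ _ _ _ _ _ _ _ _
    (fun x => C x 0 1 - (e1 * x 0 1 ^+ l.+2 * u2 x + x 0 0 * u1 x + e2 * x 0 1 ^+ k.+2 * u3 x))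
    v2 u1 u2 u3 O C P1 P2 P3); try (by smooth).
  apply: filterS CE => x CE; apply: sym2_by CE _ _ _.
  + rewrite E G /K /u1 /u3 /v2 /= !exprS; move: (k.+2%:R) k0 => r r0.
    by case: H1 => ->; case: H2 => ->; field.
  + by rewrite /=; ring.
  + have -> : C x 1 1 = x 0 0 * p2 x + x 0 1 ^+ k.+1 * q2 x by rewrite -F; ring.
    rewrite /u2 /v2 /= !exprS; move: (k.+2%:R) k0 => r r0.
    by case: H2 => ->; field.
Qed.

(** Colengths [l] for [C12] and [l - 1] for [C22 - x2 C11], plus one coupling: [v2 0] is the
    coefficient of [x1] and, up to the factor [e l], that of [x2^(l-1)]. *)
Lemma codim_NF8 (e : R) l : e = 1 \/ e = -1 -> (3 <= l)%N ->
  Ge_codim (germ3 X1 O (fun x => x 0 0 * x 0 1 + e * x 0 1 ^+ l)) (2 * l).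
Proof.
move=> He; case: l => [|[|[|l]]] // _.
rewrite (_ : (2 * l.+3)%N = #|{: 'I_l.+3 + 'I_l.+2 + unit}|); last first.
  by rewrite !card_sum !card_ord card_unit; lia.
have P1 := @pd_X1 R; have P2 := pd_cst (0 : R).
have P3 := pd_add (pd_mul (@pd_X1 R) (@pd_X2 R)) (pd_Z e (@pd_X2n R l.+3)).
pose f := fun x : 'rV[R]_2 => x 0 1.
have sf : smooth_at 0 f by rewrite /f; smooth.
pose K : R := - (e * l.+3%:R).
have HT T : smooth_at 0 T ->
    Ge_tangent (germ3 X1 O (fun x => x 0 0 * x 0 1 + e * x 0 1 ^+ l.+3)) T ->
    [/\ forall j, (j < l.+3)%N -> e12 0 j T = 0, forall j, (j < l.+2)%N -> e22 f 0 j T = 0 &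
      e22 f 0 l.+2 T + K * e22 f 1 0 T = 0].
  tangent_entries P1 P2 P3 T.
  have [| | | |L1 _ _] := @tc_ideal1 R l.+3 (fun x => T x 0 1) (fun x => u2 x + x 0 1 * u3 x)
    (fun x => e * u3 x); try (by smooth).
    by apply: filterS E12 => x ->; rewrite /=; ring.
  have [| | | |M1 M2 M3] := @tc_ideal1 R l.+2 (fun x => T x 1 1 - f x * T x 0 0)
    (fun x => v2 x + 2 * x 0 1 * (u4 x - u1 x))
    (fun x => e * (l.+3%:R * v2 x + 2 * x 0 1 * u4 x)); try (by smooth).
    by apply: filter_app E11; apply: filterS E22 => x -> ->; rewrite /f /= !exprS; ring.
  split.
  - by move=> j jl; rewrite e12E; exact: L1.
  - by move=> j jl; rewrite e22E; exact: M1.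
  - by rewrite !e22E M2 M3 // !mxE /K; ring.
apply: (@codim_dual_fin R ('I_l.+3 + 'I_l.+2 + unit)%type _
  (fun i => match i with inl (inl j) => germ3 O (fun x => x 0 1 ^+ j) O
                       | inl (inr j) => germ3 O O (fun x => x 0 1 ^+ j)
                       | inr _ => germ3 O O (fun x => x 0 1 ^+ l.+2) end)
  (fun i => match i with inl (inl j) => e12 0 j | inl (inr j) => e22 f 0 j
     | inr _ => fun C => e22 f 0 l.+2 C + K * e22 f 1 0 C end)).
- by case=> [[]|] i; apply: sym_germ3; smooth.
- case=> [[]|] i; [exact: e12_functional|exact: e22_functional|].
  by apply: functional_add; exact: e22_functional.
- by case=> [[[i i1]|[i i1]]|[]] T sT /(HT T sT)[L1 L2 L3] //; [exact: L1|exact: L2].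
- case=> [[[i i1]|[i i1]]|[]] [[[j j1]|[j j1]]|[]]; rewrite !tcE /= ?mulr0 ?addr0 ?add0r //.
  + by rewrite (ltn_eqF i1).
  + by rewrite (gtn_eqF j1).
  + by rewrite eqxx.
- move=> C sC H; have [sC0 sC1 sC2 CE] := sym_germ_entries sC.
  have [j jl|p [q [sp sq _ _ E]]] := @split_axis1 R l.+3 (fun x => C x 0 1) sC1.
    by have := H (inl (inl (Ordinal jl))); rewrite e12E.
  have [||g [h [sg sh g0 h0 F]]] := @split_axis1 R l.+2 (fun x => C x 1 1 - f x * C x 0 0).
  + by smooth.
  + by move=> j jl; have := H (inl (inr (Ordinal jl))); rewrite e22E.
  have s1 : smooth_at 0 (fun x => h x + K * g x) by smooth.
  have [m [n [sm sn _ _ G]]] := hadamard2 s1.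
  have {}G x : h x = x 0 0 * m x + x 0 1 * n x - K * g x.
    have := G x; rewrite g0 h0 -!(e22E f) (H (inr tt)) add0r => <-.
    by move: (h x) (K * g x) => a b; ring.
  pose u3 x := e * q x; pose u2 x := p x - x 0 1 * u3 x.
  pose u1 x := (e * n x - l.+3%:R * x 0 1 ^+ l.+1 * m x) / 2.
  pose v2 x := g x + x 0 1 ^+ l.+2 * m x.
  have su3 : smooth_at 0 u3 by rewrite /u3; smooth.
  have su1 : smooth_at 0 u1 by rewrite /u1; smooth.
  have su2 : smooth_at 0 u2 by rewrite /u2; smooth.
  have sv2 : smooth_at 0 v2 by rewrite /v2; smooth.
  apply: (@tangentI R _ _ _ _ _ _ _ _ _ (fun x => C x 0 0 - 2 * x 0 0 * u1 x)
    v2 u1 u2 u3 u1 C P1 P2 P3); try (by smooth).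
  apply: filterS CE => x CE; apply: sym2_by CE _ _ _.
  + by rewrite /=; ring.
  + by rewrite E /u2 /u3 /=; case: He => ->; ring.
  + have -> : C x 1 1 = f x * C x 0 0 + (x 0 0 * g x + x 0 1 ^+ l.+2 * h x) by rewrite -F; ring.
    by rewrite G /K /u1 /v2 /f /= !exprS; case: He => ->; field.
Qed.

(** Colengths [l - 1] and [l], plus two couplings between [C12] and [C22 - x2 C11], one through
    [v2 0] and one through [u2 0]. *)
Lemma codim_NF9 l : (2 <= l)%N ->
  Ge_codim (germ3 X1 (fun x => x 0 1 ^+ l) (fun x => x 0 0 * x 0 1)) (2 * l + 1).
Proof.
case: l => [|[|l]] // _.
rewrite (_ : (2 * l.+2 + 1)%N = #|{: 'I_l.+1 + 'I_l.+2 + bool}|); last first.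
  by rewrite !card_sum !card_ord card_bool; lia.
have P1 := @pd_X1 R; have P2 := @pd_X2n R l.+2; have P3 := pd_mul (@pd_X1 R) (@pd_X2 R).
pose f := fun x : 'rV[R]_2 => x 0 1.
have sf : smooth_at 0 f by rewrite /f; smooth.
pose K : R := - l.+2%:R.
have HT T : smooth_at 0 T ->
    Ge_tangent (germ3 X1 (fun x => x 0 1 ^+ l.+2) (fun x => x 0 0 * x 0 1)) T ->
    [/\ forall j, (j < l.+1)%N -> e12 0 j T = 0, forall j, (j < l.+2)%N -> e22 f 0 j T = 0,
      e12 0 l.+1 T + K * e22 f 1 0 T = 0 & e22 f 0 l.+2 T + (-2) * e12 1 0 T = 0].
  tangent_entries P1 P2 P3 T.
  have E12' : \near0 x, T x 0 1 = x 0 0 * (u2 x + x 0 1 * u3 x) +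
      x 0 1 ^+ l.+1 * (l.+2%:R * v2 x + x 0 1 * (u1 x + u4 x)).
    by apply: filterS E12 => x ->; rewrite /= !exprS; ring.
  have s1 : smooth_at 0 (fun x => u2 x + x 0 1 * u3 x) by smooth.
  have s2 : smooth_at 0 (fun x => l.+2%:R * v2 x + x 0 1 * (u1 x + u4 x)) by smooth.
  have N i j : tc i j (fun x => T x 0 1) =
      (if i is i'.+1 then tc i' j (fun x => u2 x + x 0 1 * u3 x) else 0) +
      (if (l.+1 <= j)%N then tc i (j - l.+1)%N
         (fun x => l.+2%:R * v2 x + x 0 1 * (u1 x + u4 x)) else 0).
    rewrite (tc_ext i j sT12 _ E12'); last by smooth.
    by rewrite tcD ?tc_mulX1 ?tc_mulX2n //; smooth.
  have [| | | |M1 M2 M3] := @tc_ideal1 R l.+2 (fun x => T x 1 1 - f x * T x 0 0)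
    (fun x => v2 x + 2 * x 0 1 * (u4 x - u1 x))
    (fun x => 2 * (u2 x - x 0 1 * u3 x)); try (by smooth).
    by apply: filter_app E11; apply: filterS E22 => x -> ->; rewrite /f /= !exprS; ring.
  split.
  - by move=> j jl; rewrite e12E N leqNgt jl addr0.
  - by move=> j jl; rewrite e22E; exact: M1.
  - by rewrite e12E e22E M3 // N leqnn subnn /tc /= !mxE /K; ring.
  - by rewrite e12E e22E M2 N /tc /= !mxE; ring.
apply: (@codim_dual_fin R ('I_l.+1 + 'I_l.+2 + bool)%type _
  (fun i => match i with inl (inl j) => germ3 O (fun x => x 0 1 ^+ j) O
                       | inl (inr j) => germ3 O O (fun x => x 0 1 ^+ j)
                       | inr true => germ3 O (fun x => x 0 1 ^+ l.+1) O
                       | inr false => germ3 O O (fun x => x 0 1 ^+ l.+2) end)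
  (fun i => match i with inl (inl j) => e12 0 j | inl (inr j) => e22 f 0 j
     | inr true => fun C => e12 0 l.+1 C + K * e22 f 1 0 C
     | inr false => fun C => e22 f 0 l.+2 C + (-2) * e12 1 0 C end)).
- by case=> [[|]|[]] => *; apply: sym_germ3; smooth.
- case=> [[i|i]|[]]; [exact: e12_functional|exact: e22_functional| |];
  by apply: functional_add; first [exact: e22_functional|exact: e12_functional].
- by case=> [[[i i1]|[i i1]]|[]] T sT /(HT T sT)[L1 L2 L3 L4] //; [exact: L1|exact: L2].
- case=> [[[i i1]|[i i1]]|[]] [[[j j1]|[j j1]]|[]]; rewrite !tcE /= ?mulr0 ?addr0 ?add0r //.
  + by rewrite (ltn_eqF i1).
  + by rewrite (ltn_eqF i1).
  + by rewrite (gtn_eqF j1).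
  + by rewrite eqxx.
  + by rewrite (gtn_eqF j1).
  + by rewrite eqxx.
- move=> C sC H; have [sC0 sC1 sC2 CE] := sym_germ_entries sC.
  have [j jl|p [q [sp sq p0 q0 E]]] := @split_axis1 R l.+1 (fun x => C x 0 1) sC1.
    by have := H (inl (inl (Ordinal jl))); rewrite e12E.
  have [||g [h [sg sh g0 h0 F]]] := @split_axis1 R l.+2 (fun x => C x 1 1 - f x * C x 0 0).
  + by smooth.
  + by move=> j jl; have := H (inl (inr (Ordinal jl))); rewrite e22E.
  have s1 : smooth_at 0 (fun x => h x + (-2) * p x) by smooth.
  have [m [n [sm sn _ _ G]]] := hadamard2 s1.
  have {}G x : h x = x 0 0 * m x + x 0 1 * n x + 2 * p x.
    have := G x; rewrite p0 h0 -(e22E f) -e12E (H (inr false)) add0r => <-.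
    by move: (h x) (p x) => a b; ring.
  have s2 : smooth_at 0 (fun x => q x + K * g x) by smooth.
  have [m' [n' [sm' sn' _ _ G']]] := hadamard2 s2.
  have {}G' x : q x = x 0 0 * m' x + x 0 1 * n' x - K * g x.
    have := G' x; rewrite g0 q0 -(e22E f) -e12E (H (inr true)) add0r => <-.
    by move: (q x) (K * g x) => a b; ring.
  (* [mm] and [nn] cancel the parts of [h / 2 - p] along [x1] and [x2]. The multipliers [g] and [h]
     are changed by [2 mm] times the syzygy of [x1] and the power of [x2], and [u4 = u1] is
     imposed. *)
  pose mm x := - m x / 2; pose nn x := - n x / 2.
  pose u3 x := (nn x + x 0 1 ^+ l * m' x) / 2; pose u2 x := h x / 2 + x 0 1 * u3 x + x 0 0 * mm x.
  pose u1 x := n' x / 2 + l.+2%:R * x 0 1 ^+ l.+1 * mm x.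
  pose v2 x := g x - 2 * x 0 1 ^+ l.+2 * mm x.
  have smm : smooth_at 0 mm by rewrite /mm; smooth.
  have snn : smooth_at 0 nn by rewrite /nn; smooth.
  have su3 : smooth_at 0 u3 by rewrite /u3; smooth.
  have su1 : smooth_at 0 u1 by rewrite /u1; smooth.
  have su2 : smooth_at 0 u2 by rewrite /u2; smooth.
  have sv2 : smooth_at 0 v2 by rewrite /v2; smooth.
  apply: (@tangentI R _ _ _ _ _ _ _ _ _
    (fun x => C x 0 0 - 2 * x 0 0 * u1 x - 2 * x 0 1 ^+ l.+2 * u3 x)
    v2 u1 u2 u3 u1 C P1 P2 P3); try (by smooth).
  apply: filterS CE => x CE; apply: sym2_by CE _ _ _.
  + by rewrite /=; ring.
  + by rewrite E G' /K /u1 /v2 /u2 /u3 /mm /nn G /= !exprS; field.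
  + have -> : C x 1 1 = f x * C x 0 0 + (x 0 0 * g x + x 0 1 ^+ l.+2 * h x) by rewrite -F; ring.
    by rewrite /u1 /v2 /u2 /u3 /f /mm /nn /= !exprS; field.
Qed.

End CodimNormalForms2.

(** * Corank, and the invariants of the normal forms *)

Section Corank.
Variable R : realType.
Implicit Types (x y v : 'rV[R]_2) (A : 'rV[R]_2 -> 'M[R]_2) (a b c f g h : 'rV[R]_2 -> R).

Lemma derive0_tc f v : smooth_at 0 f -> 'D_v f 0 = tc 1 0 f * v 0 0 + tc 0 1 f * v 0 1.
Proof.
move=> sf; rewrite (derive_sum_rV v (smooth_at_differentiable sf)) sum2 /tc /= !hq0.
by rewrite mulrC [X in _ + X]mulrC.
Qed.

Lemma diff_germ3 a b c v : smooth_at 0 a -> smooth_at 0 b -> smooth_at 0 c ->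
  'd (germ3 a b c) (0 : 'rV[R]_2) v = sym2 (tc 1 0 a * v 0 0 + tc 0 1 a * v 0 1)
    (tc 1 0 b * v 0 0 + tc 0 1 b * v 0 1) (tc 1 0 c * v 0 0 + tc 0 1 c * v 0 1).
Proof.
move=> sa sb sc; have sA : smooth_at 0 (germ3 a b c) by exact: smooth_at_sym2.
have dA := smooth_at_differentiable sA.
have D i j : 'd (germ3 a b c) (0 : 'rV[R]_2) v i j = 'D_v (fun y => germ3 a b c y i j) 0.
  by rewrite -(deriveE _ dA) derive_entry.
have D00 : (fun y => germ3 a b c y 0 0) = a by apply/funext => y; rewrite mxE.
have D01 : (fun y => germ3 a b c y 0 1) = b by apply/funext => y; rewrite mxE.
have D10 : (fun y => germ3 a b c y 1 0) = b by apply/funext => y; rewrite mxE.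
have D11 : (fun y => germ3 a b c y 1 1) = c by apply/funext => y; rewrite mxE.
by apply: mx2P; rewrite !sym2E D ?D00 ?D01 ?D10 ?D11 derive0_tc.
Qed.

(** Rank-nullity in dimension 2; through the kernel, coranks 0 and 1 are settled by exhibiting
    vectors. *)
Lemma corank_ker A : corank A = \dim (lker (linfun ('d A (0 : 'rV[R]_2)))).
Proof.
have := limg_ker_dim (linfun ('d A (0 : 'rV[R]_2))) fullv.
have -> : \dim {: 'rV[R]_2} = 2%N by rewrite dimvf /dim /= mul1n.
rewrite capfv /corank => E; rewrite -[X in (X - _)%N]E.
by rewrite addnK.
Qed.

Lemma corank0P A : corank A = 0%N <-> forall v, 'd A (0 : 'rV[R]_2) v = 0 -> v = 0.
Proof.
rewrite corank_ker; split=> [/eqP|H].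
  rewrite dimv_eq0 => /eqP E v Av.
  by apply/eqP; rewrite -memv0 -E memv_ker lfunE /=; apply/eqP.
apply/eqP; rewrite dimv_eq0 -subv0; apply/subvP => v.
by rewrite memv_ker lfunE /= => /eqP /H ->; rewrite mem0v.
Qed.

Lemma corank_le1 A : (corank A <= 1)%N -> exists v, 'd A (0 : 'rV[R]_2) v != 0.
Proof.
move=> H; apply: contrapT => N.
have E : lker (linfun ('d A (0 : 'rV[R]_2))) = fullv.
  apply/eqP; rewrite eqEsubv subvf; apply/subvP => v _.
  by rewrite memv_ker lfunE /=; apply/negPn/negP => Av; apply: N; exists v.
by move: H; rewrite corank_ker E dimvf /dim /= mul1n.
Qed.

Lemma corank1 A v w : v != 0 -> 'd A (0 : 'rV[R]_2) v = 0 -> 'd A (0 : 'rV[R]_2) w != 0 ->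
  corank A = 1%N.
Proof.
move=> v0 Av Aw; have : corank A <> 0%N by move=> /corank0P /(_ v Av) /eqP; apply/negP.
rewrite corank_ker; set K := lker _ => K0.
suff : (\dim K < 2)%N by case: (\dim K) K0 => [|[]].
rewrite ltnNge; apply/negP => K2; suff E : K = fullv.
  have : w \in K by rewrite E memvf.
  by rewrite memv_ker lfunE /=; exact/negP.
by apply/eqP; rewrite eqEdim subvf dimvf /dim /= mul1n.
Qed.

End Corank.

Section NormalForms.
Variable R : realType.
Implicit Types (x v : 'rV[R]_2).

Lemma tcZ1n i j n (e : R) : tc i j (fun x : 'rV[R]_2 => e * x 0 0 ^+ n) =
  e * ((i == n) && (j == 0%N))%:R.
Proof. by rewrite tcZ ?tc_X1n //; smooth. Qed.

Lemma tcZ2n i j n (e : R) : tc i j (fun x : 'rV[R]_2 => e * x 0 1 ^+ n) =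
  e * ((i == 0%N) && (j == n))%:R.
Proof. by rewrite tcZ ?tc_X2n //; smooth. Qed.

Lemma tc_X12 i j : tc i j (fun x : 'rV[R]_2 => x 0 0 * x 0 1) = ((i == 1%N) && (j == 1%N))%:R.
Proof. exact: (tc_mono _ i j 1 1). Qed.

Lemma tc_NF7 i j (e1 e2 : R) l :
  tc i j (fun x : 'rV[R]_2 => e1 * x 0 1 ^+ 2 + e2 * x 0 0 ^+ l) =
  e1 * ((i == 0%N) && (j == 2%N))%:R + e2 * ((i == l) && (j == 0%N))%:R.
Proof. by rewrite tcD ?tcZ1n ?tcZ2n //; smooth. Qed.

Lemma tc_NF8 i j (e : R) l :
  tc i j (fun x : 'rV[R]_2 => x 0 0 * x 0 1 + e * x 0 1 ^+ l) =
  ((i == 1%N) && (j == 1%N))%:R + e * ((i == 0%N) && (j == l))%:R.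
Proof. by rewrite tcD ?tc_X12 ?tcZ2n //; smooth. Qed.

Lemma tc_NF10 i j (e : R) :
  tc i j (fun x : 'rV[R]_2 => e * x 0 0 ^+ 2 + x 0 1 ^+ 3) =
  e * ((i == 2%N) && (j == 0%N))%:R + ((i == 0%N) && (j == 3%N))%:R.
Proof. by rewrite tcD ?tcZ1n ?tc_X2n //; smooth. Qed.

Lemma tc_X1b i j : tc i j (fun x : 'rV[R]_2 => x 0 0) = ((i == 1%N) && (j == 0%N))%:R.
Proof. by rewrite tc_X1; case: ifP. Qed.

Lemma tc_X2b i j : tc i j (fun x : 'rV[R]_2 => x 0 1) = ((i == 0%N) && (j == 1%N))%:R.
Proof. by rewrite tc_X2; case: ifP. Qed.

Lemma tc_X1N i j : tc i j (fun x : 'rV[R]_2 => - x 0 0) = - ((i == 1%N) && (j == 0%N))%:R.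
Proof. by rewrite tcN ?tc_X1b //; smooth. Qed.

Definition nf_a (f : normal_form) : 'rV[R]_2 -> R := fun x =>
  match f with NF5 s1 _ l1 _ => (-1) ^+ s1 * x 0 1 ^+ l1 | _ => x 0 0 end.
Definition nf_b (f : normal_form) : 'rV[R]_2 -> R := fun x =>
  match f with
  | NF1 | NF7 _ _ _ | NF8 _ _ | NF10 _ => 0
  | NF2 | NF3 _ _ => x 0 1
  | NF4 l | NF9 l => x 0 1 ^+ l
  | NF5 _ _ _ _ => x 0 0
  | NF6 _ => x 0 1 ^+ 2
  end.
Definition nf_c (f : normal_form) : 'rV[R]_2 -> R := fun x =>
  match f with
  | NF1 => x 0 1
  | NF2 => - x 0 0
  | NF3 s l => (-1) ^+ s * x 0 0 ^+ l
  | NF4 l => x 0 0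
  | NF5 _ s2 _ l2 => (-1) ^+ s2 * x 0 1 ^+ l2
  | NF6 s => (-1) ^+ s * x 0 0 ^+ 2
  | NF7 s1 s2 l => (-1) ^+ s1 * x 0 1 ^+ 2 + (-1) ^+ s2 * x 0 0 ^+ l
  | NF8 s l => x 0 0 * x 0 1 + (-1) ^+ s * x 0 1 ^+ l
  | NF9 l => x 0 0 * x 0 1
  | NF10 s => (-1) ^+ s * x 0 0 ^+ 2 + x 0 1 ^+ 3
  end.

Definition tc_nf := (tc_zero, tcZ1n, tcZ2n, tc_NF7, tc_NF8, tc_NF10, tc_X12, tc_X1b, tc_X2b,
  tc_X1N, tc_X1n, tc_X2n).

Lemma nf_germE f : nf_germ R f = germ3 (nf_a f) (nf_b f) (nf_c f).
Proof. by case: f. Qed.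

Lemma smooth_nf f : [/\ smooth_at 0 (nf_a f), smooth_at 0 (nf_b f) & smooth_at 0 (nf_c f)].
Proof.
by case: f => [||s l|l|s1 s2 l1 l2|s|s1 s2 l|s l|l|s]; split; rewrite /nf_a /nf_b /nf_c; smooth.
Qed.

Lemma sym_germ_nf f : sym_germ (nf_germ R f).
Proof. by rewrite nf_germE; have [sa sb sc] := smooth_nf f; exact: sym_germ3. Qed.

Lemma sym2_0 : sym2 0 0 0 = 0 :> 'M[R]_2.
Proof. by apply: mx2P; rewrite !mxE. Qed.

Lemma nf_germ0 f : nf_range f -> nf_germ R f 0 = 0.
Proof.
rewrite nf_germE /germ3 /nf_a /nf_b /nf_c.
case: f => [||s l|l|s1 s2 l1 l2|s|s1 s2 l|s l|l|s] /= rg; rewrite !mxE ?oppr0 ?mulr0 ?expr0n //=;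
  rewrite ?mulr0 ?addr0 ?sym2_0 //;
  try (by case: l rg => // l _; rewrite ?mulr0 ?addr0 ?sym2_0).
have /andP[r2 r1] := rg; case: l2 r2 r1 {rg} => // l2 _ r1; case: l1 r1 => // l1 _.
by rewrite ?mulr0 ?sym2_0.
Qed.

Lemma diff_nf f v : 'd (nf_germ R f) (0 : 'rV[R]_2) v =
  sym2 (tc 1 0 (nf_a f) * v 0 0 + tc 0 1 (nf_a f) * v 0 1)
    (tc 1 0 (nf_b f) * v 0 0 + tc 0 1 (nf_b f) * v 0 1)
    (tc 1 0 (nf_c f) * v 0 0 + tc 0 1 (nf_c f) * v 0 1).
Proof. by rewrite nf_germE; have [sa sb sc] := smooth_nf f; exact: diff_germ3. Qed.

Lemma sym2_inj (a b c a' b' c' : R) : sym2 a b c = sym2 a' b' c' -> [/\ a = a', b = b' & c = c'].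
Proof.
by move=> /matrixP E; have := E 0 0; have := E 0 1; have := E 1 1; rewrite !mxE.
Qed.

Lemma nf_diff f v : nf_range f -> 'd (nf_germ R f) (0 : 'rV[R]_2) v =
  match f with
  | NF1 => sym2 (v 0 0) 0 (v 0 1)
  | NF2 => sym2 (v 0 0) (v 0 1) (- v 0 0)
  | NF3 _ _ => sym2 (v 0 0) (v 0 1) 0
  | NF4 _ => sym2 (v 0 0) 0 (v 0 0)
  | NF5 _ _ _ _ => sym2 0 (v 0 0) 0
  | _ => sym2 (v 0 0) 0 0
  end.
Proof.
move=> rg; rewrite diff_nf.
case: f rg => [||s l|l|s1 s2 l1 l2|s|s1 s2 l|s l|l|s] /= rg; rewrite /nf_a /nf_b /nf_c !tc_nf /=;
  try (by congr sym2; ring);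
  try (by case: l rg => [|[|l]] //= _; congr sym2; ring).
have /andP[r2 r1] := rg; case: l2 r2 r1 {rg} => [|[|l2]] //= _; case: l1 => [|[|l1]] //= _.
by congr sym2; ring.
Qed.

Lemma vec2_0P v : v 0 0 = 0 -> v 0 1 = 0 -> v = 0.
Proof. by move=> E1 E2; apply: rV2P; rewrite ?E1 ?E2 mxE. Qed.

Lemma corank_nf f : nf_range f -> corank (nf_germ R f) = nf_corank f.
Proof.
move=> rg.
have K1 (a b c : R) : sym2 a b c = 0 -> [/\ a = 0, b = 0 & c = 0].
  by rewrite -sym2_0 => /sym2_inj.
have [c0|c1] : nf_corank f = 0%N \/ nf_corank f = 1%N by case: f {rg}; [left|left|left|right..].
  rewrite c0; apply/corank0P => v; rewrite nf_diff //.
  by case: f c0 {rg} => //= [_|_|_ _ _] /K1[E1 E2 E3]; exact: vec2_0P.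
rewrite c1; apply: (@corank1 _ _ (vec2 0 1) (vec2 1 0)).
- by apply/eqP => /rowP /(_ 1); rewrite vec2_2 mxE => /eqP; rewrite oner_eq0.
- by rewrite nf_diff // !vec2_1 !vec2_2; case: f c1 {rg} => //= *; rewrite ?sym2_0.
- apply/eqP; rewrite nf_diff // !vec2_1.
  have one : (1 : R) <> 0 by apply/eqP; exact: oner_neq0.
  by case: f c1 {rg} => //= *; move=> /K1[].
Qed.

Lemma nf_codim f : nf_range f -> Ge_codim (nf_germ R f) (nf_cod f).
Proof.
have S (s : bool) := @sign_case R s.
case: f => [||s l|l|s1 s2 l1 l2|s|s1 s2 l|s l|l|s] /= rg.
- exact: codim_NF1.
- exact: codim_NF2.
- by apply: codim_NF3 => //; exact: ltnW.
- by apply: codim_NF4; exact: ltnW.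
- have /andP[r1 r2] := rg; apply: codim_NF5 => //; exact: leq_trans r2.
- exact: codim_NF6.
- by apply: codim_NF7 => //; exact: ltnW.
- exact: codim_NF8.
- exact: codim_NF9.
- exact: codim_NF10.
Qed.

End NormalForms.

(** * Reduction to the normal forms *)

Section Vanishing.
Variable R : realType.
Implicit Types (x v : 'rV[R]_2) (a b c f g h : 'rV[R]_2 -> R).

(* vanishing to order [k] along the axes [x1 = 0] and [x2 = 0] *)
Definition van1 k f := smooth_at 0 f /\ forall j, (j < k)%N -> tc 0 j f = 0.
Definition van2 k f := smooth_at 0 f /\ forall j, (j < k)%N -> tc j 0 f = 0.

Lemma van1M k f g : van1 k f -> smooth_at 0 g -> van1 k (fun x => f x * g x).
Proof.
move=> [sf H] sg; split; first by smooth.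
have [p [q [sp sq _ _ E]]] := split_axis1 sf H.
have [| | | |K _ _] := @tc_ideal1 R k (fun x => f x * g x) (fun x => p x * g x)
  (fun x => q x * g x); try (by smooth).
by apply: near_all => x; rewrite E; ring.
Qed.

Lemma van1D k f g : van1 k f -> van1 k g -> van1 k (fun x => f x + g x).
Proof.
move=> [sf Hf] [sg Hg]; split; first by smooth.
by move=> j jk; rewrite tcD // Hf // Hg // addr0.
Qed.

Lemma van1Z k (r : R) f : van1 k f -> van1 k (fun x => r * f x).
Proof.
move=> [sf Hf]; split; first by smooth.
by move=> j jk; rewrite tcZ // Hf // mulr0.
Qed.

Lemma van1_X1 k : van1 k (fun x => x 0 0).
Proof. by split; [smooth|move=> j _; rewrite tc_X1]. Qed.

Lemma van1_0 k : van1 k (fun=> 0).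
Proof. by split; [smooth|move=> j _; rewrite tc_zero]. Qed.

Lemma van1_le k l f : (l <= k)%N -> van1 k f -> van1 l f.
Proof. by move=> lk [sf H]; split=> // j jl; apply: H; exact: leq_trans lk. Qed.

Lemma van1_pd k f (f1 f2 : 'rV[R]_2 -> R) : van1 k.+1 f -> pd f f1 f2 -> van1 k f2.
Proof.
move=> [sf H] pf; have [p [q [sp sq _ _ E]]] := split_axis1 sf H.
have P := pd_add (pd_mul (@pd_X1 R) (pd_gen sp)) (pd_mul (@pd_X2n R k.+1) (pd_gen sq)).
have Ef : f = fun x => x 0 0 * p x + x 0 1 ^+ k.+1 * q x by apply/funext.
rewrite -Ef in P; have [_ s1 s2 _] := pf; have [_ _ sP _] := P; split=> // j jk.
have [_ F1] := pd_uniq pf; have [_ F2] := pd_uniq P.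
have F : \near0 x, f2 x = x 0 0 * 'D_(delta_mx 0 1) p x +
    x 0 1 ^+ k * (k.+1%:R * q x + x 0 1 * 'D_(delta_mx 0 1) q x).
  by apply: filter_app F1; apply: filterS F2 => x -> <-; rewrite /= exprS; ring.
have sp2 : smooth_at 0 ('D_(delta_mx 0 1) p) by exact: smooth_at_derive.
have sq2 : smooth_at 0 ('D_(delta_mx 0 1) q) by exact: smooth_at_derive.
have [| | | |K _ _] := @tc_ideal1 R k f2 ('D_(delta_mx 0 1) p)
  (fun x => k.+1%:R * q x + x 0 1 * 'D_(delta_mx 0 1) q x); try (by smooth).
exact: K.
Qed.

Lemma van2M k f g : van2 k f -> smooth_at 0 g -> van2 k (fun x => f x * g x).
Proof.
move=> [sf H] sg; split; first by smooth.
have [p [q [sp sq E]]] := split_axis2 sf H.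
apply: (@tc_ideal2 R k _ (fun x => p x * g x) (fun x => q x * g x)); try (by smooth).
by apply: near_all => x; rewrite E; ring.
Qed.

Lemma van2D k f g : van2 k f -> van2 k g -> van2 k (fun x => f x + g x).
Proof.
move=> [sf Hf] [sg Hg]; split; first by smooth.
by move=> j jk; rewrite tcD // Hf // Hg // addr0.
Qed.

Lemma van2Z k (r : R) f : van2 k f -> van2 k (fun x => r * f x).
Proof.
move=> [sf Hf]; split; first by smooth.
by move=> j jk; rewrite tcZ // Hf // mulr0.
Qed.

Lemma van2_X2 k : van2 k (fun x => x 0 1).
Proof. by split; [smooth|move=> j _; rewrite tc_X2 andbF]. Qed.

Lemma van2_0 k : van2 k (fun=> 0).
Proof. by split; [smooth|move=> j _; rewrite tc_zero]. Qed.

Lemma van2_le k l f : (l <= k)%N -> van2 k f -> van2 l f.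
Proof. by move=> lk [sf H]; split=> // j jl; apply: H; exact: leq_trans lk. Qed.

Lemma van2_pd k f (f1 f2 : 'rV[R]_2 -> R) : van2 k.+1 f -> pd f f1 f2 -> van2 k f1.
Proof.
move=> [sf H] pf; have [p [q [sp sq E]]] := split_axis2 sf H.
have P := pd_add (pd_mul (@pd_X1n R k.+1) (pd_gen sp)) (pd_mul (@pd_X2 R) (pd_gen sq)).
have Ef : f = fun x => x 0 0 ^+ k.+1 * p x + x 0 1 * q x by apply/funext.
rewrite -Ef in P; have [_ s1 s2 _] := pf; have [_ sP _ _] := P; split=> // j jk.
have [F1 _] := pd_uniq pf; have [F2 _] := pd_uniq P.
have F : \near0 x, f1 x =
    x 0 0 ^+ k * (k.+1%:R * p x + x 0 0 * 'D_(delta_mx 0 0) p x) +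
    x 0 1 * 'D_(delta_mx 0 0) q x.
  by apply: filter_app F1; apply: filterS F2 => x -> <-; rewrite /= exprS; ring.
have sp1 : smooth_at 0 ('D_(delta_mx 0 0) p) by exact: smooth_at_derive.
have sq1 : smooth_at 0 ('D_(delta_mx 0 0) q) by exact: smooth_at_derive.
by apply: (tc_ideal2 s1 _ sq1 F jk); smooth.
Qed.

Lemma codim_kill A d N (L : 'I_N -> ('rV[R]_2 -> 'M[R]_2) -> R)
    (E : 'I_N -> 'rV[R]_2 -> 'M[R]_2) :
  Ge_codim A d -> (forall i, germ_functional (L i)) ->
  (forall i T, smooth_at 0 T -> Ge_tangent A T -> L i T = 0) ->
  (forall i, sym_germ (E i)) -> (forall i j, L i (E j) = (i == j)%:R) -> (N <= d)%N.
Proof.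
move=> cA lL LT sE LE.
apply: (@codim_ge R A d 0 N (fun C => \row_i L i C) 0 E cA) => //.
- exact: functional_linear.
- by move=> T sT tT; exists 0; rewrite mulmx0; apply/rowP => i; rewrite !mxE LT.
- by move=> i; apply/rowP => j; rewrite !mxE LE eqxx eq_sym.
Qed.

(** Each term in the first entry of a tangent vector contains a factor vanishing to order [k] on
    [x1 = 0], so [k] Taylor coefficients along that axis kill the tangent space. Data too flat along
    an axis are excluded in this way. *)
Lemma codim_van11 a b c (a1 a2 : 'rV[R]_2 -> R) k d : pd a a1 a2 ->
  smooth_at 0 b -> smooth_at 0 c -> Ge_codim (germ3 a b c) d ->
  van1 k a1 -> van1 k a2 -> van1 k a -> van1 k b -> (k <= d)%N.
Proof.
move=> Pa sb sc cA Va1 Va2 Va Vb; have sa := Va.1.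
apply: (codim_kill (N := k) (L := fun j => e11 0 j)
  (E := fun j => germ3 (fun x => x 0 1 ^+ j) (fun=> 0) (fun=> 0)) cA).
- by move=> i; exact: e11_functional.
- move=> i T; tangent_entries Pa (pd_gen sb) (pd_gen sc) T; rewrite e11E.
  have V : van1 k (fun x => a1 x * v1 x + a2 x * v2 x + 2 * (a x * u1 x + b x * u3 x)).
    by apply: van1D; [apply: van1D|apply: van1Z; apply: van1D]; apply: van1M.
  rewrite (tc_ext 0 i sT11 _ E11); [exact: V.2|exact: V.1].
- by move=> i; apply: sym_germ3; smooth.
- by move=> i j; rewrite !tcE.
Qed.

Lemma codim_van12 a b c (b1 b2 : 'rV[R]_2 -> R) k d : pd b b1 b2 ->
  Ge_codim (germ3 a b c) d ->
  van1 k b1 -> van1 k b2 -> van1 k a -> van1 k b -> van1 k c -> (k <= d)%N.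
Proof.
move=> Pb cA Vb1 Vb2 Va Vb Vc; have sa := Va.1; have sc := Vc.1.
apply: (codim_kill (N := k) (L := fun j => e12 0 j)
  (E := fun j => germ3 (fun=> 0) (fun x => x 0 1 ^+ j) (fun=> 0)) cA).
- by move=> i; exact: e12_functional.
- move=> i T; tangent_entries (pd_gen sa) Pb (pd_gen sc) T; rewrite e12E.
  have V : van1 k (fun x => b1 x * v1 x + b2 x * v2 x + a x * u2 x + b x * (u1 x + u4 x) + c x * u3 x).
    have s := smooth_at_add su1 su4.
    apply: van1D; last exact: van1M.
    apply: van1D; last exact: van1M.
    by apply: van1D; [apply: van1D|]; exact: van1M.
  rewrite (tc_ext 0 i sT12 _ E12); [exact: V.2|exact: V.1].
- by move=> i; apply: sym_germ3; smooth.
- by move=> i j; rewrite !tcE.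
Qed.

Lemma codim_van22 a b c (c1 c2 : 'rV[R]_2 -> R) k d : pd c c1 c2 ->
  smooth_at 0 a -> Ge_codim (germ3 a b c) d ->
  van2 k c1 -> van2 k c2 -> van2 k b -> van2 k c -> (k <= d)%N.
Proof.
move=> Pc sa cA Vc1 Vc2 Vb Vc; have sb := Vb.1.
apply: (codim_kill (N := k) (L := fun j => e22 (fun=> 0) j 0)
  (E := fun j => germ3 (fun=> 0) (fun=> 0) (fun x => x 0 0 ^+ j)) cA).
- by move=> i; apply: e22_functional; smooth.
- move=> i T; tangent_entries (pd_gen sa) (pd_gen sb) Pc T; rewrite e22E.
  have V : van2 k (fun x => c1 x * v1 x + c2 x * v2 x + 2 * (b x * u2 x + c x * u4 x)).
    by apply: van2D; [apply: van2D|apply: van2Z; apply: van2D]; apply: van2M.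
  have E : \near0 x, T x 1 1 - 0 * T x 0 0 =
      c1 x * v1 x + c2 x * v2 x + 2 * (b x * u2 x + c x * u4 x).
    by apply: filterS E22 => x ->; ring.
  rewrite (tc_ext i 0 _ _ E); [exact: V.2|smooth|exact: V.1].
- by move=> i; apply: sym_germ3; smooth.
- by move=> i j; rewrite !tcE andbT.
Qed.

Lemma first_tc1 k f : smooth_at 0 f -> van1 k f \/
  exists l, [/\ (l < k)%N, van1 l f & tc 0 l f != 0].
Proof.
move=> sf; elim: k => [|k [V|[l [lk V n]]]]; first by left.
  have [z|n] := eqVneq (tc 0 k f) 0; last by right; exists k.
  by left; split=> // j; rewrite ltnS leq_eqVlt => /orP[/eqP ->|/V.2].
by right; exists l; split=> //; exact: leq_trans lk _.
Qed.

Lemma first_tc2 k f : smooth_at 0 f -> van2 k f \/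
  exists l, [/\ (l < k)%N, van2 l f & tc l 0 f != 0].
Proof.
move=> sf; elim: k => [|k [V|[l [lk V n]]]]; first by left.
  have [z|n] := eqVneq (tc k 0 f) 0; last by right; exists k.
  by left; split=> // j; rewrite ltnS leq_eqVlt => /orP[/eqP ->|/V.2].
by right; exists l; split=> //; exact: leq_trans lk _.
Qed.

End Vanishing.

(** * One-jets of rank two: families 1, 2 and 3 *)

Section CorankZero.
Variable R : realType.
Implicit Types (x v : 'rV[R]_2) (a b c f g h u z : 'rV[R]_2 -> R) (A B : 'rV[R]_2 -> 'M[R]_2).

Local Notation X1 := (fun x : 'rV[R]_2 => x 0 0).
Local Notation X2 := (fun x : 'rV[R]_2 => x 0 1).

Definition simple A := exists f : normal_form, nf_range f /\ G_equiv A (nf_germ R f).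

Definition codim_lt9 A := exists d, (d < 9)%N /\ Ge_codim A d.

Lemma simple_equiv A B : G_equiv A B -> simple B -> simple A.
Proof. by move=> E [f [rf F]]; exists f; split=> //; exact: G_equiv_trans F. Qed.

Lemma codim_lt9_equiv A B : sym_germ A -> G_equiv A B -> codim_lt9 A -> codim_lt9 B.
Proof. by move=> sA E [d [d9 cd]]; exists d; split=> //; exact: codim_inv cd. Qed.

Lemma germ3_coord a b c a' b' c' u z : smooth_at 0 u -> smooth_at 0 z -> u 0 = 0 -> z 0 = 0 ->
  tc 1 0 u * tc 0 1 z - tc 0 1 u * tc 1 0 z != 0 ->
  (\near0 x, a' (vec2 (u x) (z x)) = a x) ->
  (\near0 x, b' (vec2 (u x) (z x)) = b x) ->
  (\near0 x, c' (vec2 (u x) (z x)) = c x) ->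
  G_equiv (germ3 a b c) (germ3 a' b' c').
Proof.
move=> su sz u0 z0 J Ea Eb Ec.
apply: (@G_equiv_trans R _ (fun x => germ3 a' b' c' (vec2 (u x) (z x)))); last exact: G_equiv_coord.
apply: G_equiv_near; apply: filter_app Ea; apply: filter_app Eb; apply: filterS Ec => x.
by rewrite /germ3 => -> -> ->.
Qed.

Lemma jac_X1 z : tc 1 0 X1 * tc 0 1 z - tc 0 1 X1 * tc 1 0 z = tc 0 1 z.
Proof. by rewrite !tc_X1b /= mul1r mul0r subr0. Qed.

Lemma jac_X2 u : tc 1 0 u * tc 0 1 X2 - tc 0 1 u * tc 1 0 X2 = tc 1 0 u.
Proof. by rewrite !tc_X2b /= mulr1 mulr0 subr0. Qed.

Lemma tc10M f g : smooth_at 0 f -> smooth_at 0 g ->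
  tc 1 0 (fun x => f x * g x) = f 0 * tc 1 0 g + tc 1 0 f * g 0.
Proof. by move=> sf sg; rewrite tcM // !big_ord_recl !big_ord0 /= !addr0. Qed.

Lemma tc01M f g : smooth_at 0 f -> smooth_at 0 g ->
  tc 0 1 (fun x => f x * g x) = f 0 * tc 0 1 g + tc 0 1 f * g 0.
Proof. by move=> sf sg; rewrite tcM // !big_ord_recl !big_ord0 /= !addr0. Qed.

Lemma tc20M f g : smooth_at 0 f -> smooth_at 0 g ->
  tc 2 0 (fun x => f x * g x) = f 0 * tc 2 0 g + tc 1 0 f * tc 1 0 g + tc 2 0 f * g 0.
Proof. by move=> sf sg; rewrite tcM // !big_ord_recl !big_ord0 /= !addr0 addrA. Qed.

Lemma tc02M f g : smooth_at 0 f -> smooth_at 0 g ->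
  tc 0 2 (fun x => f x * g x) = f 0 * tc 0 2 g + tc 0 1 f * tc 0 1 g + tc 0 2 f * g 0.
Proof. by move=> sf sg; rewrite tcM // !big_ord_recl !big_ord0 /= !addr0 addrA. Qed.

Lemma tc11M f g : smooth_at 0 f -> smooth_at 0 g ->
  tc 1 1 (fun x => f x * g x) =
    f 0 * tc 1 1 g + tc 0 1 f * tc 1 0 g + (tc 1 0 f * tc 0 1 g + tc 1 1 f * g 0).
Proof. by move=> sf sg; rewrite tcM // !big_ord_recl !big_ord0 /= !addr0. Qed.

Lemma pick_sign (r : R) : r != 0 -> exists s : bool, 0 < (-1) ^+ s * r.
Proof.
rewrite neq_lt => /orP[r0|r0]; first by exists true; rewrite expr1 mulN1r oppr_gt0.
by exists false; rewrite expr0 mul1r.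
Qed.

Lemma sqr_sign (s : bool) : (-1) ^+ s * (-1) ^+ s = 1 :> R.
Proof. by case: s; rewrite ?expr1 ?expr0 ?mulrNN mulr1. Qed.

Lemma indep_hq (i j : 'I_2) f : i != j -> (forall x, f (setc j 0 x) = f x) ->
  forall x, hq i f (setc j 0 x) = hq i f x.
Proof.
move=> ij fi x; rewrite -hq_axis //; congr hq; exact/funext.
Qed.

Lemma pd_indep2 f : smooth_at 0 f -> (forall x, f (setc 1 0 x) = f x) ->
  pd f ('D_(delta_mx 0 0) f) (fun=> 0).
Proof.
move=> sf fi; apply: pd_ext (pd_gen sf).
- exact: smooth_at_derive.
- exact: smooth_at_cst.
- exact: near_all.
- apply: near_all => x; have -> : 'D_(delta_mx 0 1) f x = 'D_(delta_mx 0 1) (fun=> f 0) x.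
    apply: derive_quot => t; rewrite subrr -fi -[f x]fi.
    suff -> : setc 1 0 (t *: delta_mx 0 1 + x) = setc 1 0 x by rewrite subrr.
    by apply: rV2P; rewrite !mxE //= mulr0 add0r.
  exact: derive_cst.
Qed.

Lemma corank0_coord a b c : smooth_at 0 a -> smooth_at 0 b -> smooth_at 0 c ->
  a 0 = 0 -> b 0 = 0 -> tc 1 0 a * tc 0 1 b - tc 0 1 a * tc 1 0 b != 0 ->
  exists c', [/\ smooth_at 0 c', c' 0 = c 0 & G_equiv (germ3 a b c) (germ3 X1 X2 c')].
Proof.
move=> sa sb sc a0 b0 J; have [c' [sc' c'0 E]] := change_coord sa sb a0 b0 J sc.
exists c'; split=> //; apply: (germ3_coord sa sb a0 b0 J) => //;
  by apply: near_all => x; rewrite ?vec2_1 ?vec2_2.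
Qed.

(** The determinant [D] is Morse in [x2], so [D = de(x1) - z^2] with [z = x2] on [x1 = 0]. Then
    [z = x2 + p x1] is the off-diagonal entry after a shear by [p], and the determinant forces the
    new corner to be [de / x1], a function of [x1] alone. *)
Lemma corank0_morse c : smooth_at 0 c -> c 0 = 0 ->
  exists g, [/\ smooth_at 0 g, g 0 = 0, forall x, g (setc 1 0 x) = g x &
    G_equiv (germ3 X1 X2 c) (germ3 X1 X2 g)].
Proof.
move=> sc c0; pose D x := x 0 0 * c x - x 0 1 ^+ 2.
have sD : smooth_at 0 D by rewrite /D; smooth.
have tD j : tc 0 j D = - ((j == 2%N))%:R.
  rewrite /D tcD; [|smooth|smooth].
  by rewrite tc_mulX1 // tcN ?tc_X2n ?add0r //; smooth.
have H1 : hq 1 D 0 = 0 by rewrite -[LHS]/(tc 0 1 D) tD oppr0.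
have H2 : hq 1 (hq 1 D) 0 = -1 by rewrite -[LHS]/(tc 0 2 D) tD.
have N1 : hq 1 (hq 1 D) 0 != 0 by rewrite H2 oppr_eq0 oner_neq0.
have [xi [de [q [[sxi sde sq] xi0 [ixi ide] q0 E]]]] := morse sD H1 N1.
rewrite H2 in q0.
have de0 : de 0 = 0.
  have := nbhs_singleton E; rewrite /D !mxE c0 xi0 subr0 !mulr0 expr0n /= subr0 mul0r addr0.
  exact: esym.
have axis h : (forall x, h (setc 1 0 x) = h x) -> forall x, h (setc 0 0 x) = h 0.
  move=> ih x; rewrite -ih; congr h; apply: rV2P; rewrite !mxE //.
(* On [x1 = 0] both sides are multiples of [x2^2]; cancelling [x2] twice gives [q = -1] along the
   whole axis. *)
have q1 : \near0 x, q (setc 0 0 x) = -1.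
  have sqx := smooth_at_axis 0 sq; have s1 := @smooth_at_cst R 'rV[R]_2 R 0 (-1).
  apply: (coord_cancel (i := 1)) => //; apply: (coord_cancel (i := 1)); [smooth|smooth|].
  apply: filterS (near_setc0 0 E) => x; rewrite /D (axis _ ixi) (axis _ ide) de0 xi0 !mxE /=.
  by move: (q _) => r; rewrite mul0r !add0r subr0 => H; rewrite -mulrA in H *; lra.
have q00 : 0 < - q 0 by rewrite q0 opprK.
have sr : smooth_at 0 (fun x => Num.sqrt (- q x)) by apply: smooth_at_sqrt; [smooth|].
pose z x := (x 0 1 - xi x) * Num.sqrt (- q x).
have sz : smooth_at 0 z by rewrite /z; smooth.
have Ez : \near0 x, D x = de x - z x ^+ 2.
  have sNq : smooth_at 0 (fun x => - q x) by smooth.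
  apply: filter_app E; apply: filterS (near_pos sNq q00) => x /ltW qx ->.
  by rewrite /z exprMn sqr_sqrtr // mulrN opprK.
have z1 : \near0 x, z (setc 0 0 x) = x 0 1.
  apply: filterS q1 => x qx; rewrite /z qx opprK sqrtr1 (axis _ ixi) xi0 mulr1 subr0.
  by rewrite mxE.
have z0 : z 0 = 0 by rewrite /z xi0 mxE subr0 mul0r.
have tz : tc 0 1 z = 1.
  rewrite tc_axis1 (tc_ext 0 1 _ _ z1) ?tc_X2b //; last by smooth.
  exact: smooth_at_axis.
pose p := hq 0 z; have sp : smooth_at 0 p by exact: smooth_at_hq.
pose g := hq 0 de; have sg : smooth_at 0 g by exact: smooth_at_hq.
have ig : forall x, g (setc 1 0 x) = g x by exact: indep_hq.
have Eg x : de x = x 0 0 * g x by rewrite [LHS](hqE 0) axis // de0 add0r.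
have zp : \near0 x, x 0 1 + p x * x 0 0 = z x.
  by apply: filterS z1 => x zx; rewrite [RHS](hqE 0) zx mulrC.
have gp : \near0 x, c x + 2 * p x * x 0 1 + p x ^+ 2 * x 0 0 = g x.
  apply: (coord_cancel (i := 0)) => //; first by smooth.
  apply: filter_app zp; apply: filterS Ez => x; rewrite /D Eg => H Z.
  have H' : x 0 0 * g x = x 0 0 * c x - x 0 1 ^+ 2 + z x ^+ 2 by rewrite H subrK.
  by rewrite H' -Z; move: (c x) (p x) => k r; ring.
exists g; split=> //.
  have <- := nbhs_singleton gp.
  by rewrite c0 !mxE /= !mulr0 !addr0.
apply: G_equiv_trans (@G_equiv_shear R X1 X2 c p sp) _.
apply: G_equiv_trans (G_equiv_near (germ3_near (b' := z) (near_all (fun=> erefl)) zp gp)) _.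
have sX1 : smooth_at 0 X1 by smooth.
apply: (germ3_coord sX1 sz) => //.
- by rewrite mxE.
- by rewrite jac_X1 tz oner_neq0.
- by apply: near_all => x; rewrite vec2_1.
- by apply: near_all => x; rewrite vec2_2.
- apply: near_all => x; rewrite -ig -[RHS]ig; congr g.
  by apply: rV2P; rewrite !mxE.
Qed.

(** The vectors [e1 + e2] and [e1 - e2] are orthogonal for every value of the germ; the diagonal
    entries in this basis are the new coordinates. *)
Lemma simple_NF1 : simple (germ3 X1 X2 X1).
Proof.
exists NF1; split=> //; rewrite nf_germE.
have s1 := @smooth_at_cst R 'rV[R]_2 R 0 1; have sm := @smooth_at_cst R 'rV[R]_2 R 0 (-1).
have := @G_equiv_congr R X1 X2 X1 (fun=> 1) (fun=> 1) (fun=> 1) (fun=> -1) s1 s1 s1 sm.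
have -> : 1 * -1 - 1 * 1 != 0 :> R by rewrite mulr1 mul1r -opprD oppr_eq0 -[1 + 1]/(2%:R) pnatr_eq0.
move=> /(_ isT) H; apply: G_equiv_trans H _.
pose u x : R := 2 * (x 0 0 + x 0 1); pose z x : R := 2 * (x 0 0 - x 0 1).
have su : smooth_at 0 u by rewrite /u; smooth.
have sz : smooth_at 0 z by rewrite /z; smooth.
apply: (germ3_coord su sz).
- by rewrite /u !mxE addr0 mulr0.
- by rewrite /z !mxE subr0 mulr0.
- have sX : smooth_at 0 X1 by smooth.
  have sY : smooth_at 0 X2 by smooth.
  have tu i j : tc i j u = 2 * (tc i j X1 + tc i j X2).
    by rewrite -tcD // -tcZ //; smooth.
  have tz i j : tc i j z = 2 * (tc i j X1 - tc i j X2).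
    by rewrite -tcN // -tcD ?tcZ //; smooth.
  rewrite !tu !tz !tc_X1b !tc_X2b /= !addr0 !sub0r !subr0 !add0r.
  have -> : 2 * 1 * (2 * -1) - 2 * 1 * (2 * 1) = - 8%:R :> R by ring.
  by rewrite oppr_eq0 pnatr_eq0.
- by apply: near_all => x; rewrite /nf_a vec2_1 /u; ring.
- by apply: near_all => x; rewrite /nf_b; ring.
- by apply: near_all => x; rewrite /nf_c vec2_2 /z; ring.
Qed.

Lemma unit_scale h : smooth_at 0 h -> h 0 != 0 ->
  exists (s : bool) (t : 'rV[R]_2 -> R), [/\ smooth_at 0 t, t 0 != 0 &
    \near0 x, t x ^+ 2 * h x = (-1) ^+ s].
Proof.
move=> sh n; have [s es] := pick_sign n.
have seh : smooth_at 0 (fun x => (-1) ^+ s * h x) by smooth.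
have sr := smooth_at_sqrt seh es.
exists s, (fun x => (Num.sqrt ((-1) ^+ s * h x))^-1); split.
- by apply: smooth_at_inv => //; rewrite gt_eqF // sqrtr_gt0.
- by rewrite invr_neq0 // gt_eqF // sqrtr_gt0.
apply: filterS (near_pos seh es) => x hx; rewrite exprVn sqr_sqrtr; last exact: ltW.
have r0 : h x != 0 by apply: contraTneq hx => ->; rewrite mulr0 ltxx.
by case: s {es seh sr} hx => _; move: (h x) r0 => r r0; rewrite ?expr1 ?expr0; field.
Qed.

Lemma simple_corank0_germ g : smooth_at 0 g -> g 0 = 0 -> (forall x, g (setc 1 0 x) = g x) ->
  codim_lt9 (germ3 X1 X2 g) -> simple (germ3 X1 X2 g).
Proof.
move=> sg g0 ig [d [d9 cd]]; have sX1 : smooth_at 0 X1 by smooth.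
have sX2 : smooth_at 0 X2 by smooth.
(* Order 10 rather than 9, since [codim_van22] also needs the derivative of [g] to vanish to order
   9. *)
have [V|[l [_ V n]]] := first_tc2 10 sg.
  have P := pd_indep2 sg ig.
  have := codim_van22 P sX1 cd (van2_pd V P) (van2_0 _ _) (van2_X2 _ _) (van2_le _ V).
  by move=> /(_ isT); rewrite leqNgt d9.
have [h [sh ih h0 E]] := axis2_div sg V.2; rewrite -h0 in n.
have [s [t [st t0 H]]] := unit_scale sh n.
have th : \near0 x, t x ^+ 2 * g x = (-1) ^+ s * x 0 0 ^+ l.
  by apply: filterS H => x <-; rewrite -ig E; move: (h x) (x 0 0 ^+ l) => r y; ring.
have one := @smooth_at_cst R 'rV[R]_2 R 0 1.
have Q := @G_equiv_scale R X1 X2 g (fun=> 1) t one st (oner_neq0 R) t0.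
pose z x := t x * x 0 1; have sz : smooth_at 0 z by rewrite /z; smooth.
have {}Q : G_equiv (germ3 X1 X2 g) (germ3 X1 X2 (fun x => (-1) ^+ s * x 0 0 ^+ l)).
  apply: G_equiv_trans Q _; apply: (germ3_coord sX1 sz).
  - by rewrite mxE.
  - by rewrite /z mxE mulr0.
  - by rewrite jac_X1 /z tc01M // tc_X2b mxE /= mulr1 mulr0 addr0.
  - by apply: near_all => x; rewrite vec2_1 expr1n mul1r.
  - by apply: near_all => x; rewrite vec2_2 mul1r.
  - by apply: filterS th => x ->; rewrite vec2_1.
apply: simple_equiv Q _.
(* Order 0 contradicts [g 0 = 0], and order 1 gives one of the two first forms according to the
   sign. *)
case: l V n th h0 E => [|[|l]] V n th h0 E.
- by move: n; rewrite h0 -[tc 0 0 g]/(g 0) g0 eqxx.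
- case: s {H th}.
    exists NF2; split=> //; rewrite nf_germE; apply: G_equiv_near; apply: near_all => x.
    by rewrite /germ3 /= !expr1 mulN1r.
  apply: simple_equiv simple_NF1; apply: G_equiv_near; apply: near_all => x.
  by rewrite /germ3 /= expr1 expr0 mul1r.
- exists (NF3 s l.+2); split=> //; rewrite nf_germE; exact: G_equiv_refl.
Qed.

End CorankZero.

(** * One-jets of rank one *)

Section FormOne.
Variable R : realType.
Implicit Types (x v : 'rV[R]_2) (a b c f g h u z : 'rV[R]_2 -> R) (A B : 'rV[R]_2 -> 'M[R]_2).

Local Notation X1 := (fun x : 'rV[R]_2 => x 0 0).
Local Notation X2 := (fun x : 'rV[R]_2 => x 0 1).

Definition minor f g := tc 1 0 f * tc 0 1 g - tc 0 1 f * tc 1 0 g.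

Lemma simple_corank0 a b c : smooth_at 0 a -> smooth_at 0 b -> smooth_at 0 c ->
  a 0 = 0 -> b 0 = 0 -> c 0 = 0 -> minor a b != 0 ->
  codim_lt9 (germ3 a b c) -> simple (germ3 a b c).
Proof.
move=> sa sb sc a0 b0 c0 J cd; have [c1 [s1 z1 E1]] := corank0_coord sa sb sc a0 b0 J.
rewrite c0 in z1; have [g [sg g0 ig E2]] := corank0_morse s1 z1.
have E := G_equiv_trans E1 E2; apply: simple_equiv (E) _.
apply: simple_corank0_germ => //; exact: codim_lt9_equiv (sym_germ3 sa sb sc) E cd.
Qed.

Lemma indep_axis1 h : (forall x, h (setc 0 0 x) = h x) ->
  forall x (y : 'rV[R]_2), x 0 1 = y 0 1 -> h x = h y.
Proof.
move=> ih x y E; rewrite -ih -[RHS]ih; congr h; apply: rV2P; rewrite !mxE //=.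
Qed.

(** The vanishing minors say that the differentials of [b] and [c] are multiples of that of [a], so
    they have no [x2] term once [a] is the first coordinate. *)
Lemma form1_coord a b c : smooth_at 0 a -> smooth_at 0 b -> smooth_at 0 c ->
  a 0 = 0 -> b 0 = 0 -> c 0 = 0 -> (tc 1 0 a != 0) || (tc 0 1 a != 0) ->
  minor a b = 0 -> minor a c = 0 ->
  exists (b' c' : 'rV[R]_2 -> R), [/\ smooth_at 0 b' /\ smooth_at 0 c', b' 0 = 0 /\ c' 0 = 0,
    tc 0 1 b' = 0 /\ tc 0 1 c' = 0 & G_equiv (germ3 a b c) (germ3 X1 b' c')].
Proof.
move=> sa sb sc a0 b0 c0 da mb mc.
have [z [sz z0 J]] : exists z : 'rV[R]_2 -> R,
    [/\ smooth_at 0 z, z 0 = 0 & minor a z != 0].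
  have [a1|a1] := eqVneq (tc 1 0 a) 0.
    exists X1; split; [by smooth|by rewrite mxE|].
    rewrite a1 eqxx in da.
    by rewrite /minor !tc_X1b /= mulr0 mulr1 sub0r oppr_eq0.
  by exists X2; split; [by smooth|by rewrite mxE|rewrite /minor jac_X2].
have [b' [sb' b'0 Eb]] := change_coord sa sz a0 z0 J sb.
have [c' [sc' c'0 Ec]] := change_coord sa sz a0 z0 J sc.
have K f f' : smooth_at 0 f -> smooth_at 0 f' ->
    (\near0 x, f' (vec2 (a x) (z x)) = f x) -> minor a f = 0 -> tc 0 1 f' = 0.
  move=> sf sf' E mf; have [T1 T2] := tc_comp1 sf' sa sz a0 z0.
  have sc1 : smooth_at 0 (fun x => f' (vec2 (a x) (z x))) by exact: smooth_at_comp0.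
  rewrite (tc_ext 1 0 sc1 sf E) in T1; rewrite (tc_ext 0 1 sc1 sf E) in T2.
  move: mf J; rewrite /minor T1 T2.
  move: (tc 1 0 a) (tc 0 1 a) (tc 1 0 f') (tc 0 1 f') (tc 1 0 z) (tc 0 1 z) => p q r s t w.
  have -> : p * (r * q + s * w) - q * (r * p + s * t) = s * (p * w - q * t) by ring.
  by move=> /eqP; rewrite mulf_eq0 => /orP[/eqP //|->].
exists b', c'; split; [by []|by rewrite b'0 c'0| |].
  by split; [apply: K Eb mb|apply: K Ec mc].
apply: (germ3_coord sa sz a0 z0 J) => //.
by apply: near_all => x; rewrite vec2_1.
Qed.

(** The part of [b] that involves [x1] is a multiple of the entry [x1], which a shear can
    subtract. *)
Lemma form1_shear b c : smooth_at 0 b -> smooth_at 0 c -> b 0 = 0 -> c 0 = 0 ->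
  tc 0 1 b = 0 -> tc 0 1 c = 0 ->
  exists (b' c' : 'rV[R]_2 -> R), [/\ smooth_at 0 b' /\ smooth_at 0 c', (forall x, b' (setc 0 0 x) = b' x) /\ c' 0 = 0,
    b' 0 = 0 /\ tc 0 1 b' = 0, tc 0 1 c' = 0 & G_equiv (germ3 X1 b c) (germ3 X1 b' c')].
Proof.
move=> sb sc b0 c0 tb tcc; pose p x := - hq 0 b x.
have sp : smooth_at 0 p by apply: smooth_at_opp; exact: smooth_at_hq.
have sX1 : smooth_at 0 X1 by smooth.
exists (fun x => b (setc 0 0 x)), (fun x => c x + 2 * p x * b x + p x ^+ 2 * x 0 0).
have s0 : setc 0 0 0 = 0 :> 'rV[R]_2 by rewrite setc00.
split.
- by split; [exact: smooth_at_axis|smooth].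
- split; first by move=> x; rewrite setcK.
  by rewrite c0 b0 !mxE /= !mulr0 !addr0.
- by rewrite s0 -tc_axis1.
- have s1 : smooth_at 0 (fun x => 2 * p x) by smooth.
  have s2 : smooth_at 0 (fun x => p x ^+ 2) by smooth.
  rewrite !tcD; try by smooth.
  by rewrite (tc01M s1 sb) (tc01M s2 sX1) tcc tb b0 tc_X1b !mxE /= !mulr0 !addr0.
- apply: G_equiv_trans (@G_equiv_shear R X1 b c p sp) _; apply: G_equiv_near; apply: near_all => x.
  congr sym2; rewrite [b x](hqE 0) /p; ring.
Qed.

Lemma form1_exists a b c : smooth_at 0 a -> smooth_at 0 b -> smooth_at 0 c ->
  a 0 = 0 -> b 0 = 0 -> c 0 = 0 -> (tc 1 0 a != 0) || (tc 0 1 a != 0) ->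
  minor a b = 0 -> minor a c = 0 ->
  exists (b' c' : 'rV[R]_2 -> R), [/\ smooth_at 0 b' /\ smooth_at 0 c', (forall x, b' (setc 0 0 x) = b' x) /\ c' 0 = 0,
    b' 0 = 0 /\ tc 0 1 b' = 0, tc 0 1 c' = 0 & G_equiv (germ3 a b c) (germ3 X1 b' c')].
Proof.
move=> sa sb sc a0 b0 c0 da mb mc.
have [b1 [c1 [[sb1 sc1] [b10 c10] [tb1 tc1] E1]]] := form1_coord sa sb sc a0 b0 c0 da mb mc.
have [b' [c' [H1 H2 H3 H4 E2]]] := form1_shear sb1 sc1 b10 c10 tb1 tc1.
by exists b', c'; split=> //; exact: G_equiv_trans E2.
Qed.

(* [D = det] is, up to sign, a square modulo a function of [x2]; with
   [eta(x2) = z1(0, x2)] the germ becomes [(x1 - eta, beta; beta, e (x1 + eta))] *)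
Lemma form1_factor b c : smooth_at 0 b -> smooth_at 0 c -> (forall x, b (setc 0 0 x) = b x) ->
  c 0 = 0 -> b 0 = 0 -> tc 0 1 c = 0 -> tc 1 0 c != 0 ->
  exists (s : bool) (h : 'rV[R]_2 -> R), [/\ smooth_at 0 h, forall x, h (setc 0 0 x) = h x,
    h 0 = 0 /\ tc 0 1 h = 0 &
    G_equiv (germ3 X1 b c) (germ3 (fun x => x 0 0 - h x) b (fun x => (-1) ^+ s * (x 0 0 + h x)))].
Proof.
move=> sb sc ib c0 b0 t01 al; have sX1 : smooth_at 0 X1 by smooth.
pose D x := x 0 0 * c x - b x * b x; have sD : smooth_at 0 D by rewrite /D; smooth.
have sbb : smooth_at 0 (fun x => b x * b x) by smooth.
have tD i : tc i.+1 0 D = tc i 0 c.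
  rewrite /D tcD; [|smooth|smooth].
  rewrite tc_mulX1 // tcN // tc_indep1 ?subr0 //; by move=> x; rewrite ib.
have H1 : hq 0 D 0 = 0 by rewrite -[LHS]/(tc 1 0 D) tD.
have H2 : hq 0 (hq 0 D) 0 = tc 1 0 c by rewrite -[LHS]/(tc 2 0 D) tD.
have N1 : hq 0 (hq 0 D) 0 != 0 by rewrite H2.
have [xi [de [q [[sxi sde sq] xi0 [ixi ide] q0 E]]]] := morse sD H1 N1; rewrite H2 in q0.
have n0 : q 0 != 0 by rewrite q0.
have [s es] := pick_sign n0.
have seq' : smooth_at 0 (fun x => (-1) ^+ s * q x) by smooth.
have sr := smooth_at_sqrt seq' es.
pose z x := (x 0 0 - xi x) * Num.sqrt ((-1) ^+ s * q x).
have sz : smooth_at 0 z by rewrite /z; smooth.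
have Ez : \near0 x, D x = de x + (-1) ^+ s * z x ^+ 2.
  apply: filter_app E; apply: filterS (near_pos seq' es) => x /ltW qx ->.
  rewrite /z exprMn sqr_sqrtr //; have := sqr_sign R s; move: ((-1) ^+ s) => e ee.
  move: (x 0 0 - xi x) (q x) => y r; congr (_ + _).
  have -> : e * (y ^+ 2 * (e * r)) = (e * e) * (y ^+ 2 * r) by ring.
  by rewrite ee mul1r.
pose h x := z (setc 0 0 x); have sh : smooth_at 0 h by exact: smooth_at_axis.
have ih x : h (setc 0 0 x) = h x by rewrite /h setcK.
pose w := hq 0 z; have sw : smooth_at 0 w by exact: smooth_at_hq.
have zw x : z x = h x + x 0 0 * w x by exact: hqE.
have z0 : z 0 = 0 by rewrite /z xi0 mxE subr0 mul0r.
have h0 : h 0 = 0 by rewrite /h setc00.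
have w0 : w 0 = Num.sqrt ((-1) ^+ s * q 0).
  have tz : tc 1 0 z = w 0 by [].
  rewrite -tz /z tc10M //; last by smooth.
  rewrite mxE xi0 subrr mul0r add0r tcD; [|smooth|smooth].
  by rewrite tcN // tc_X1b tc_indep1 // subr0 mul1r.
have w0p : 0 < w 0 by rewrite w0 sqrtr_gt0.
have cw : \near0 x, c x = w x * ((-1) ^+ s * (z x + h x)).
  apply: (coord_cancel (i := 0)) => //; first by smooth.
  have Ez' := near_setc0 0 Ez; apply: filter_app Ez; apply: filterS Ez' => x.
  rewrite -/(h x) /D ide ib.
  rewrite [X in X * c _]mxE /= mul0r sub0r => H1' H2'.
  have : x 0 0 * c x = (-1) ^+ s * (z x ^+ 2 - h x ^+ 2).
    apply: (@addIr _ (- (b x * b x))); rewrite H2'; move: H1'.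
    by move: (b x) (de x) ((-1) ^+ s) (z x) (h x) => p1 p2 p3 p4 p5 H; lra.
  by move=> ->; rewrite zw; move: (w x) (h x) ((-1)^+ s) => p1 p2 p3; ring.
have sqw := smooth_at_sqrt sw w0p.
pose t x := (Num.sqrt (w x))^-1.
have qw0 : Num.sqrt (w 0) != 0 by rewrite gt_eqF // sqrtr_gt0.
have t0 : t 0 != 0 by rewrite invr_neq0.
have st : smooth_at 0 t by exact: smooth_at_inv.
(* Scaling the basis by [w^(1/2)] and [w^(-1/2)] makes the diagonal [w x1 = z - h] and
   [c / w = (-1)^s (z + h)] without changing [b]; [z] then serves as first coordinate. *)
have Q := @G_equiv_scale R X1 b c _ t sqw st qw0 t0.
have tz1 : tc 1 0 z != 0 by rewrite -[tc 1 0 z]/(w 0) gt_eqF.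
have sX2 : smooth_at 0 X2 by smooth.
exists s, h; split=> //.
- split=> //; have e0 : (-1) ^+ s != 0 :> R by rewrite signr_eq0.
  have szh : smooth_at 0 (fun x => z x + h x) by smooth.
  have T : tc 0 1 c = w 0 * ((-1) ^+ s * (tc 0 1 z + tc 0 1 h)).
    rewrite (tc_ext 0 1 sc _ cw); last by smooth.
    rewrite tc01M //; last by smooth.
    by rewrite tcZ // tcD // z0 h0 addr0 mulr0 mulr0 addr0.
  have T2 : tc 0 1 z = tc 0 1 h by rewrite tc_axis1.
  apply/eqP; move: t01; rewrite T T2 => /eqP; rewrite !mulf_eq0 gt_eqF //= (negbTE e0) /=.
  by rewrite -mulr2n mulrn_eq0.
- apply: G_equiv_trans Q _; apply: (germ3_coord sz sX2 z0) => //.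
  + by rewrite mxE.
  + by rewrite jac_X2.
  + apply: filterS (near_pos sw w0p) => x /ltW wx; rewrite vec2_1 sqr_sqrtr //.
    rewrite (indep_axis1 ih (y := x)) ?vec2_2 // zw; ring.
  + apply: filterS (near_pos sw w0p) => x wx; rewrite /t mulfV ?mul1r ?gt_eqF ?sqrtr_gt0 //.
    by rewrite (indep_axis1 ib (y := x)) // vec2_2.
  + apply: filter_app cw; apply: filterS (near_pos sw w0p) => x wx ->; rewrite vec2_1.
    rewrite (indep_axis1 ih (y := x)) ?vec2_2 // /t exprVn sqr_sqrtr ?(ltW wx) //.
    by rewrite mulrA mulVf ?mul1r // gt_eqF.
Qed.

End FormOne.

(** * Families 4 and 5 *)

Section FormOneEnd.
Variable R : realType.
Implicit Types (x v : 'rV[R]_2) (a b c f g h u z : 'rV[R]_2 -> R) (A B : 'rV[R]_2 -> 'M[R]_2).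

Local Notation X1 := (fun x : 'rV[R]_2 => x 0 0).
Local Notation X2 := (fun x : 'rV[R]_2 => x 0 1).

Lemma unit_root h l : smooth_at 0 h -> 0 < h 0 -> (0 < l)%N ->
  exists m : 'rV[R]_2 -> R, [/\ smooth_at 0 m, 0 < m 0 &
    \near0 x, m x ^+ l = h x].
Proof.
move=> sh h0 l0; exists (fun x => h x `^ l%:R^-1); split.
- exact: smooth_at_powR.
- exact: powR_gt0.
apply: filterS (near_pos sh h0) => x hx.
by rewrite -powR_mulrn ?powR_ge0 // -powRrM mulVf ?pnatr_eq0 -?lt0n // powRr1 // ltW.
Qed.

Lemma common_order f g : smooth_at 0 f -> smooth_at 0 g ->
  (forall x, f (setc 0 0 x) = f x) -> (forall x, g (setc 0 0 x) = g x) ->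
  f 0 = 0 -> g 0 = 0 -> tc 0 1 f = 0 -> tc 0 1 g = 0 ->
  (van1 10 f /\ van1 10 g) \/
  exists l (f0 g0 : 'rV[R]_2 -> R), [/\ smooth_at 0 f0 /\ smooth_at 0 g0,
    (forall x, f x = x 0 1 ^+ l * f0 x) /\ (forall x, g x = x 0 1 ^+ l * g0 x),
    (forall x, f0 (setc 0 0 x) = f0 x) /\ (forall x, g0 (setc 0 0 x) = g0 x),
    (2 <= l)%N & (f0 0 != 0) || (g0 0 != 0)].
Proof.
move=> sf sg jf jg f0 g0 tf tg.
have K l f' : smooth_at 0 f' -> (forall x, f' (setc 0 0 x) = f' x) -> van1 l f' -> exists h,
    [/\ smooth_at 0 h, (forall x, h (setc 0 0 x) = h x), h 0 = tc 0 l f' &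
      forall x, f' x = x 0 1 ^+ l * h x].
  move=> sf' jf' [_ V]; have [h [sh ih h0 E]] := axis1_div sf' V.
  by exists h; split=> // x; rewrite -jf' E.
have L2 l f' : f' 0 = 0 -> tc 0 1 f' = 0 -> tc 0 l f' != 0 -> (2 <= l)%N.
  by move=> f0' tf'; case: l => [|[|]] //; rewrite ?tf' ?eqxx // -[tc 0 0 f']/(f' 0) f0' eqxx.
have M l l' : van1 l f -> van1 l g -> (2 <= l')%N -> l = l' -> (tc 0 l f != 0) || (tc 0 l g != 0) ->
  exists l (f0 g0 : 'rV[R]_2 -> R), [/\ smooth_at 0 f0 /\ smooth_at 0 g0,
    (forall x, f x = x 0 1 ^+ l * f0 x) /\ (forall x, g x = x 0 1 ^+ l * g0 x),
    (forall x, f0 (setc 0 0 x) = f0 x) /\ (forall x, g0 (setc 0 0 x) = g0 x),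
    (2 <= l)%N & (f0 0 != 0) || (g0 0 != 0)].
  move=> Vf Vg l2 ll; have [h [sh ih <- E]] := K l f sf jf Vf.
  have [k [sk ik <- F]] := K l g sg jg Vg => n.
  by exists l, h, k; split=> //; rewrite ll.
have [Vf|[l [l10 Vf nf]]] := first_tc1 10 sf; have [Vg|[l' [l10' Vg ng]]] := first_tc1 10 sg.
- by left.
- right; apply: (M l' l') => //; last by rewrite ng orbT.
    by apply: van1_le Vf; exact: ltnW.
  exact: L2 ng.
- right; apply: (M l l) => //; last by rewrite nf.
    by apply: van1_le Vg; exact: ltnW.
  exact: L2 nf.
- right; case: (leqP l l') => ll.
    apply: (M l l) => //; last by rewrite nf.
      exact: van1_le Vg.
    exact: L2 nf.
  apply: (M l' l') => //; last by rewrite ng orbT.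
    by apply: van1_le Vf; exact: ltnW.
  exact: L2 ng.
Qed.

(** The germ is [x1] times the identity plus [x2^l] times a trace-free matrix, which a rotation
    turns by twice its angle. Here [p + i r] is a square root of [g + i f], and the scaled rotation
    it defines makes the trace-free part off-diagonal. The sign of [g 0] keeps [(ro + g) / 2]
    positive, so that [p] is smooth. *)
Lemma simple_NF4_pos l f g : smooth_at 0 f -> smooth_at 0 g -> (2 <= l)%N ->
  (f 0 != 0) || (g 0 != 0) -> 0 <= g 0 ->
  simple (germ3 (fun x => x 0 0 - x 0 1 ^+ l * f x) (fun x => x 0 1 ^+ l * g x)
    (fun x => x 0 0 + x 0 1 ^+ l * f x)).
Proof.
move=> sf sg l2 n g0.
pose N x := f x ^+ 2 + g x ^+ 2; have sN : smooth_at 0 N by rewrite /N; smooth.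
have N0 : 0 < N 0.
  case/orP: n => n; first by apply: ltr_pwDl; rewrite ?sqr_ge0 // exprn_even_gt0.
  by apply: ltr_wpDl; rewrite ?sqr_ge0 // exprn_even_gt0.
have sq := smooth_at_sqrt sN N0.
have [ro [sro ro0 Ero]] : exists ro : 'rV[R]_2 -> R, [/\ smooth_at 0 ro, 0 < ro 0 &
    \near0 x, ro x ^+ 2 = N x].
  exact: unit_root sN N0 _.
have sS : smooth_at 0 (fun x => (ro x + g x) / 2) by smooth.
have S0 : 0 < (ro 0 + g 0) / 2 by rewrite divr_gt0 // ltr_pwDl.
have [p [sp p0 Ep]] : exists p : 'rV[R]_2 -> R, [/\ smooth_at 0 p, 0 < p 0 &
    \near0 x, p x ^+ 2 = (ro x + g x) / 2].
  exact: unit_root sS S0 _.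
have s2p : smooth_at 0 (fun x => 2 * p x) by smooth.
have n2p : 2 * p 0 != 0 by rewrite mulf_neq0 ?pnatr_eq0 // gt_eqF.
pose r x := f x / (2 * p x).
have sr : smooth_at 0 r by rewrite /r; apply: smooth_at_mul => //; exact: smooth_at_inv.
have H : \near0 x,
    [/\ 0 < p x, 2 * p x * r x = f x, p x ^+ 2 - r x ^+ 2 = g x & p x ^+ 2 + r x ^+ 2 = ro x].
  apply: filter_app Ep; apply: filter_app Ero; apply: filterS (near_pos sp p0) => x px Ero Ep.
  have px0 : p x != 0 by rewrite gt_eqF.
  have r1 : 2 * p x * r x = f x by rewrite /r mulrC divfK // mulf_neq0 // pnatr_eq0.
  suff r2 : r x ^+ 2 = (ro x - g x) / 2 by rewrite Ep r2; split=> //; field.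
  apply: (@mulfI _ (p x ^+ 2 * 4%:R)); first by rewrite mulf_neq0 ?expf_neq0 ?pnatr_eq0.
  have -> : p x ^+ 2 * 4%:R * r x ^+ 2 = (2 * p x * r x) ^+ 2.
    by move: (p x) (r x) => p' r'; ring.
  rewrite r1 Ep; have -> : f x ^+ 2 = ro x ^+ 2 - g x ^+ 2 by rewrite Ero /N addrK.
  by field.
have snr : smooth_at 0 (fun x => - r x) by smooth.
have J : p 0 * p 0 - - r 0 * r 0 != 0.
  have [_ _ _ E] := nbhs_singleton H; by rewrite mulNr opprK -!expr2 E gt_eqF.
pose a x := x 0 0 - x 0 1 ^+ l * f x; pose b x := x 0 1 ^+ l * g x.
pose c x := x 0 0 + x 0 1 ^+ l * f x.
have Q1 := @G_equiv_congr R a b c p (fun x => - r x) r p sp snr sr sp J.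
have Q2 : G_equiv (germ3 a b c) (germ3 (fun x => ro x * x 0 0) (fun x => x 0 1 ^+ l * ro x ^+ 2)
    (fun x => ro x * x 0 0)).
  apply: G_equiv_trans Q1 (G_equiv_near _); apply: filter_app Ero; apply: filterS H => x.
  move=> [_ H1 H2 H3] Ero.
  rewrite /germ3; congr sym2; rewrite /a /b /c ?Ero /N -?H3 -?H1 -?H2; ring.
have sR := smooth_at_sqrt sro ro0.
have R0 : 0 < Num.sqrt (ro 0) by rewrite sqrtr_gt0.
pose t x := (Num.sqrt (ro x))^-1.
have st : smooth_at 0 t by apply: smooth_at_inv => //; rewrite gt_eqF.
have t0 : t 0 != 0 by rewrite invr_neq0 // gt_eqF.
have Q3 := @G_equiv_scale R (fun x => ro x * x 0 0) (fun x => x 0 1 ^+ l * ro x ^+ 2)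
    (fun x => ro x * x 0 0) t t st st t0 t0.
(* After scaling by [t] the off-diagonal entry is [x2^l ro], and an [l]-th root of [ro] is absorbed
   into [x2]. *)
have [m [sm m0 Em]] := unit_root sro ro0 (ltnW l2).
pose z x := x 0 1 * m x; have sz : smooth_at 0 z by rewrite /z; smooth.
have sX1 : smooth_at 0 X1 by smooth.
have sX2 : smooth_at 0 X2 by smooth.
exists (NF4 l); split=> //; apply: G_equiv_trans Q2 (G_equiv_trans Q3 _); rewrite nf_germE.
have T : \near0 x, t x ^+ 2 * ro x = 1.
  apply: filterS (near_pos sro ro0) => x rx; rewrite /t exprVn sqr_sqrtr ?(ltW rx) // mulVf //.
  by rewrite gt_eqF.
apply: (germ3_coord sX1 sz).
- by rewrite mxE.
- by rewrite /z mxE mul0r.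
- by rewrite jac_X1 /z tc01M // tc_X2b mxE mul0r add0r mul1r gt_eqF.
- by apply: filterS T => x Tx; rewrite /nf_a vec2_1 mulrA Tx mul1r.
- apply: filter_app Em; apply: filterS T => x Tx Em; rewrite /nf_b vec2_2 /z exprMn Em.
  have -> : t x * t x * (x 0 1 ^+ l * ro x ^+ 2) = x 0 1 ^+ l * ro x * (t x ^+ 2 * ro x).
    by move: (t x) (ro x) (x 0 1 ^+ l) => p1 p2 p3; ring.
  by rewrite Tx mulr1.
- by apply: filterS T => x Tx; rewrite /nf_c vec2_1 mulrA Tx mul1r.
Qed.

Lemma simple_form1_pos b h : smooth_at 0 b -> smooth_at 0 h ->
  (forall x, b (setc 0 0 x) = b x) -> (forall x, h (setc 0 0 x) = h x) ->
  b 0 = 0 -> h 0 = 0 -> tc 0 1 b = 0 -> tc 0 1 h = 0 ->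
  codim_lt9 (germ3 (fun x => x 0 0 - h x) b (fun x => x 0 0 + h x)) ->
  simple (germ3 (fun x => x 0 0 - h x) b (fun x => x 0 0 + h x)).
Proof.
move=> sb sh ib ih b0 h0 tb th [d [d9 cd]].
have [[Vh Vb]|[l [f [g [[sf sg] [Ef Eg] [jf jg] l2 n]]]]] := common_order sh sb ih ib h0 b0 th tb.
  have V9 := van1_le (leqnSn 9) Vh; have V9' := van1Z (-1) V9.
  have Va : van1 9 (fun x => x 0 0 - h x).
    by have := van1D (van1_X1 R 9) V9'; under eq_fun do rewrite mulN1r.
  have := codim_van12 (pd_indep1 sb ib) cd (van1_0 _ _) (van1_pd Vb (pd_indep1 sb ib)) Va
    (van1_le (leqnSn 9) Vb) (van1D (van1_X1 R 9) V9).
  by rewrite leqNgt d9.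
have -> : h = fun x => x 0 1 ^+ l * f x by exact/funext.
have -> : b = fun x => x 0 1 ^+ l * g x by exact/funext.
have [g0|g0] := lerP 0 (g 0); first exact: simple_NF4_pos.
have sg' : smooth_at 0 (fun x => - g x) by smooth.
have n' : (f 0 != 0) || (- g 0 != 0) by rewrite oppr_eq0.
have g0' : 0 <= - g 0 by rewrite oppr_ge0 ltW.
apply: simple_equiv (simple_NF4_pos sf sg' l2 n' g0').
have one := @smooth_at_cst R 'rV[R]_2 R 0 1; have mone := @smooth_at_cst R 'rV[R]_2 R 0 (-1).
have m0 : -1 != 0 :> R by rewrite oppr_eq0 oner_neq0.
apply: G_equiv_trans (@G_equiv_scale R _ _ _ _ _ one mone (oner_neq0 R) m0) _.
by apply: G_equiv_near; apply: near_all => x; congr sym2; ring.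
Qed.

Lemma simple_NF5_le l1 l2 f g : smooth_at 0 f -> smooth_at 0 g -> f 0 != 0 -> g 0 != 0 ->
  (2 <= l2 <= l1)%N ->
  simple (germ3 (fun x => x 0 1 ^+ l1 * f x) (fun x => 2 * x 0 0) (fun x => x 0 1 ^+ l2 * g x)).
Proof.
move=> sf sg nf ng ll.
have [s1 [t1 [st1 t10 E1]]] := unit_scale sf nf.
have [s2 [t2 [st2 t20 E2]]] := unit_scale sg ng.
exists (NF5 s1 s2 l1 l2); split=> //; rewrite nf_germE.
apply: G_equiv_trans (@G_equiv_scale R _ _ _ _ _ st1 st2 t10 t20) _.
pose u x := t1 x * t2 x * (2 * x 0 0); have su : smooth_at 0 u by rewrite /u; smooth.
have sX2 : smooth_at 0 X2 by smooth.
have sX1 : smooth_at 0 (fun x : 'rV[R]_2 => 2 * x 0 0) by smooth.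
apply: (germ3_coord su sX2).
- by rewrite /u mxE !mulr0.
- by rewrite mxE.
- have st : smooth_at 0 (fun x => t1 x * t2 x) by smooth.
  rewrite jac_X2 /u (tc10M st sX1) mxE !mulr0 addr0 -[X in tc 1 0 X]/(fun x : 'rV[R]_2 => 2 * X1 x).
  by rewrite tcZ ?tc_X1b; [rewrite mulr1 !mulf_neq0 // pnatr_eq0|smooth].
- apply: filterS E1 => x E; rewrite /nf_a vec2_2 -E.
  by move: (t1 x) (f x) (x 0 1 ^+ l1) => p q r; ring.
- by apply: near_all => x; rewrite /nf_b vec2_1.
- apply: filterS E2 => x E; rewrite /nf_c vec2_2 -E.
  by move: (t2 x) (g x) (x 0 1 ^+ l2) => p q r; ring.
Qed.

(** [e1 + e2] and [e1 - e2] are isotropic for [diag(1, -1)]; in this basis [x1] moves off the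
    diagonal and the diagonal entries depend on [x2] alone. *)
Lemma simple_form1_neg b h : smooth_at 0 b -> smooth_at 0 h ->
  (forall x, b (setc 0 0 x) = b x) -> (forall x, h (setc 0 0 x) = h x) ->
  b 0 = 0 -> h 0 = 0 -> tc 0 1 b = 0 -> tc 0 1 h = 0 ->
  codim_lt9 (germ3 (fun x => x 0 0 - h x) b (fun x => - (x 0 0 + h x))) ->
  simple (germ3 (fun x => x 0 0 - h x) b (fun x => - (x 0 0 + h x))).
Proof.
move=> sb sh ib ih b0 h0 tb th cd.
pose P x := 2 * (b x - h x); pose Q x := - 2 * (b x + h x).
have sP : smooth_at 0 P by rewrite /P; smooth.
have sQ : smooth_at 0 Q by rewrite /Q; smooth.
have iP x : P (setc 0 0 x) = P x by rewrite /P ib ih.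
have iQ x : Q (setc 0 0 x) = Q x by rewrite /Q ib ih.
have s2 : smooth_at 0 (fun x : 'rV[R]_2 => 2 * x 0 0) by smooth.
have E : G_equiv (germ3 (fun x => x 0 0 - h x) b (fun x => - (x 0 0 + h x)))
    (germ3 P (fun x => 2 * x 0 0) Q).
  have one := @smooth_at_cst R 'rV[R]_2 R 0 1; have mone := @smooth_at_cst R 'rV[R]_2 R 0 (-1).
  have J : (1 : R) * -1 - 1 * 1 != 0.
    by rewrite mulr1 mul1r -opprD oppr_eq0 -[1 + 1]/(2%:R) pnatr_eq0.
  apply: G_equiv_trans (@G_equiv_congr R _ _ _ _ _ _ _ one one one mone J) _.
  apply: G_equiv_near; apply: near_all => x; rewrite /germ3 /P /Q.
  by congr sym2; move: (x 0 0) (b x) (h x) => p q r; ring.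
have sA : sym_germ (germ3 (fun x => x 0 0 - h x) b (fun x => - (x 0 0 + h x))).
  by apply: sym_germ3; smooth.
have {cd} [d [d9 cd]] := codim_lt9_equiv sA E cd.
apply: simple_equiv E _.
have V2 : van1 9 (fun x : 'rV[R]_2 => 2 * x 0 0) by apply: van1Z; exact: van1_X1.
(* One bound serves both diagonal entries, the second after a swap. *)
have contra P' Q' : smooth_at 0 P' -> smooth_at 0 Q' -> (forall x, P' (setc 0 0 x) = P' x) ->
    Ge_codim (germ3 P' (fun x => 2 * x 0 0) Q') d -> van1 10 P' -> False.
  move=> sP' sQ' iP' cd' V.
  have := codim_van11 (pd_indep1 sP' iP') s2 sQ' cd' (van1_0 _ _) (van1_pd V (pd_indep1 sP' iP'))
    (van1_le (leqnSn 9) V) V2.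
  by rewrite leqNgt d9.
have L2 l f : f 0 = 0 -> tc 0 1 f = 0 -> tc 0 l f != 0 -> (2 <= l)%N.
  by move=> f0' tf'; case: l => [|[|]] //; rewrite ?tf' ?eqxx // -[tc 0 0 f]/(f 0) f0' eqxx.
have P0 : P 0 = 0 by rewrite /P b0 h0 subr0 mulr0.
have Q0 : Q 0 = 0 by rewrite /Q b0 h0 addr0 mulr0.
have tP : tc 0 1 P = 0 by rewrite /P tcZ ?tcD ?tcN // ?tb ?th ?subr0 ?mulr0 //; smooth.
have tQ : tc 0 1 Q = 0 by rewrite /Q tcZ ?tcD // ?tb ?th ?addr0 ?mulr0 //; smooth.
have [V|[l1 [_ V1 n1]]] := first_tc1 10 sP; first by case: (contra P Q sP sQ iP cd V).
have [V|[l2 [_ V2' n2]]] := first_tc1 10 sQ.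
  have E := @G_equiv_swap R P (fun x => 2 * x 0 0) Q.
  by case: (contra Q P sQ sP iQ (codim_inv (sym_germ3 sP s2 sQ) E cd) V).
have [f [sf jf f0 Ef]] := axis1_div sP V1.2; have [g [sg jg g0 Eg]] := axis1_div sQ V2'.2.
have -> : P = fun x => x 0 1 ^+ l1 * f x by apply/funext => x; rewrite -iP Ef.
have -> : Q = fun x => x 0 1 ^+ l2 * g x by apply/funext => x; rewrite -iQ Eg.
have l1g := L2 l1 P P0 tP n1; have l2g := L2 l2 Q Q0 tQ n2; rewrite -f0 in n1; rewrite -g0 in n2.
case: (leqP l2 l1) => ll; first by apply: simple_NF5_le => //; rewrite l2g ll.
apply: simple_equiv (G_equiv_swap _ _ _) _.
by apply: simple_NF5_le => //; rewrite l1g ltnW.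
Qed.

Lemma simple_form1_unit b c : smooth_at 0 b -> smooth_at 0 c -> (forall x, b (setc 0 0 x) = b x) ->
  c 0 = 0 -> b 0 = 0 -> tc 0 1 b = 0 -> tc 0 1 c = 0 -> tc 1 0 c != 0 ->
  codim_lt9 (germ3 X1 b c) -> simple (germ3 X1 b c).
Proof.
move=> sb sc ib c0 b0 tb tcc al cd; have sX1 : smooth_at 0 X1 by smooth.
have [s [h [sh ih [h0 th] E]]] := form1_factor sb sc ib c0 b0 tcc al.
apply: simple_equiv (E) _; have {cd} := codim_lt9_equiv (sym_germ3 sX1 sb sc) E cd.
case: s {E}.
  have -> : (fun x => (-1) ^+ true * (x 0 0 + h x)) = fun x => - (x 0 0 + h x).
    by apply/funext => x; rewrite expr1 mulN1r.
  exact: simple_form1_neg.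
have -> : (fun x => (-1) ^+ false * (x 0 0 + h x)) = fun x => x 0 0 + h x.
  by apply/funext => x; rewrite expr0 mul1r.
exact: simple_form1_pos.
Qed.

End FormOneEnd.

(** * Removal of the off-diagonal entry *)

Section Diagonalise.
Variable R : realType.
Implicit Types (x v : 'rV[R]_2) (a b c f g h u z : 'rV[R]_2 -> R) (A B : 'rV[R]_2 -> 'M[R]_2).

Local Notation X1 := (fun x : 'rV[R]_2 => x 0 0).
Local Notation X2 := (fun x : 'rV[R]_2 => x 0 1).

Lemma hadamard_2jet f : smooth_at 0 f -> f 0 = 0 -> tc 1 0 f = 0 -> tc 0 1 f = 0 ->
  exists p q r : 'rV[R]_2 -> R, [/\ [/\ smooth_at 0 p, smooth_at 0 q & smooth_at 0 r],
    p 0 = tc 2 0 f, q 0 = tc 1 1 f, r 0 = tc 0 2 f &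
    forall x, f x = x 0 0 ^+ 2 * p x + x 0 0 * x 0 1 * q x + x 0 1 ^+ 2 * r x].
Proof.
move=> sf f0 t10 t01; have V j : (j < 2)%N -> tc 0 j f = 0 by case: j => [|[|]].
have [r [sr _ r0 Er]] := axis1_div sf V.
have s1 := smooth_at_hq 0 sf.
have [p [q [sp sq p0 q0 E]]] := hadamard2 s1.
exists p, q, r; split=> //; try by rewrite ?p0 ?q0 tc_hq1.
move=> x; rewrite [LHS](hqE 0) Er E -[hq 0 f 0]/(tc 1 0 f) t10; ring.
Qed.

Lemma tc_sqr u z : smooth_at 0 u -> smooth_at 0 z -> u 0 = 0 -> z 0 = 0 ->
  forall p, smooth_at 0 p ->
  [/\ tc 2 0 (fun x => u x * z x * p x) = tc 1 0 u * tc 1 0 z * p 0,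
    tc 1 1 (fun x => u x * z x * p x) = (tc 1 0 u * tc 0 1 z + tc 0 1 u * tc 1 0 z) * p 0 &
    tc 0 2 (fun x => u x * z x * p x) = tc 0 1 u * tc 0 1 z * p 0].
Proof.
move=> su sz u0 z0 p sp; have s1 : smooth_at 0 (fun x => u x * z x) by smooth.
rewrite (tc20M s1 sp) (tc11M s1 sp) (tc02M s1 sp) (tc10M su sz) (tc01M su sz).
rewrite (tc20M su sz) (tc11M su sz) (tc02M su sz) u0 z0; split; ring.
Qed.

Lemma tc_comp2 f u z : smooth_at 0 f -> smooth_at 0 u -> smooth_at 0 z -> u 0 = 0 -> z 0 = 0 ->
  f 0 = 0 -> tc 1 0 f = 0 -> tc 0 1 f = 0 ->
  [/\ tc 2 0 (fun x => f (vec2 (u x) (z x))) = tc 2 0 f * tc 1 0 u ^+ 2 +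
        tc 1 1 f * (tc 1 0 u * tc 1 0 z) + tc 0 2 f * tc 1 0 z ^+ 2,
      tc 1 1 (fun x => f (vec2 (u x) (z x))) = 2 * tc 2 0 f * (tc 1 0 u * tc 0 1 u) +
        tc 1 1 f * (tc 1 0 u * tc 0 1 z + tc 0 1 u * tc 1 0 z) +
        2 * tc 0 2 f * (tc 1 0 z * tc 0 1 z) &
      tc 0 2 (fun x => f (vec2 (u x) (z x))) = tc 2 0 f * tc 0 1 u ^+ 2 +
        tc 1 1 f * (tc 0 1 u * tc 0 1 z) + tc 0 2 f * tc 0 1 z ^+ 2].
Proof.
move=> sf su sz u0 z0 f0 t10 t01.
have [p [q [r [[sp sq sr] p0 q0 r0 E]]]] := hadamard_2jet sf f0 t10 t01.
have sp' : smooth_at 0 (fun x => p (vec2 (u x) (z x))) by exact: smooth_at_comp0.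
have sq' : smooth_at 0 (fun x => q (vec2 (u x) (z x))) by exact: smooth_at_comp0.
have sr' : smooth_at 0 (fun x => r (vec2 (u x) (z x))) by exact: smooth_at_comp0.
have -> : (fun x => f (vec2 (u x) (z x))) = fun x => u x * u x * p (vec2 (u x) (z x)) +
    u x * z x * q (vec2 (u x) (z x)) + z x * z x * r (vec2 (u x) (z x)).
  by apply/funext => x; rewrite E vec2_1 vec2_2 !expr2.
have [P1 P2 P3] := tc_sqr su su u0 u0 sp'; have [Q1 Q2 Q3] := tc_sqr su sz u0 z0 sq'.
have [R1 R2 R3] := tc_sqr sz sz z0 z0 sr'.
have T i j : tc i j (fun x => u x * u x * p (vec2 (u x) (z x)) +
    u x * z x * q (vec2 (u x) (z x)) + z x * z x * r (vec2 (u x) (z x))) =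
    tc i j (fun x => u x * u x * p (vec2 (u x) (z x))) +
    tc i j (fun x => u x * z x * q (vec2 (u x) (z x))) +
    tc i j (fun x => z x * z x * r (vec2 (u x) (z x))).
  by rewrite !tcD //; smooth.
rewrite !T P1 P2 P3 Q1 Q2 Q3 R1 R2 R3 u0 z0 vec200 p0 q0 r0; split; ring.
Qed.

(** On a branch [x1 = xi(x2)] of the curve [x1 c = b^2] the matrix is degenerate, and a shear by the
    slope [q] of its kernel makes the first two entries vanish there. The new [b] is then a multiple
    of the new [a], and a second shear removes it. The coefficients of [x1^2] and [x1 x2] in [c] are
    followed throughout because they decide the family. *)
Lemma diagonalise l b0 g0 c : smooth_at 0 b0 -> smooth_at 0 g0 -> smooth_at 0 c ->
  (forall x, b0 (setc 0 0 x) = b0 x) -> (forall x, g0 (setc 0 0 x) = g0 x) ->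
  (forall x, c (setc 0 0 x) = x 0 1 ^+ l * g0 x) -> g0 0 != 0 -> tc 1 0 c = 0 -> (2 <= l)%N ->
  exists c' h' : 'rV[R]_2 -> R, [/\ smooth_at 0 c' /\ smooth_at 0 h',
    (\near0 x, c' (setc 0 0 x) = x 0 1 ^+ l * h' x), h' 0 != 0,
    [/\ tc 1 0 c' = 0, tc 2 0 c' = tc 2 0 c & tc 1 1 c' = tc 1 1 c] &
    G_equiv (germ3 X1 (fun x => x 0 1 ^+ l * b0 x) c) (germ3 X1 (fun=> 0) c')].
Proof.
move=> sb sg sc ib ig E n t10 l2.
have sX1 : smooth_at 0 X1 by smooth.
have sX2 : smooth_at 0 X2 by smooth.
have c0 : c 0 = 0.
  by rewrite -(setc00 R 0) E mxE expr0n /= (gtn_eqF (ltnW l2)) mul0r.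
have t01 : tc 0 1 c = 0.
  rewrite tc_axis1; have -> : (fun x => c (setc 0 0 x)) = fun x => x 0 1 ^+ l * g0 x by apply/funext.
  by rewrite tc_mulX2n // leqNgt l2.
pose c1 := hq 0 c; have sc1 : smooth_at 0 c1 by exact: smooth_at_hq.
have c10 : c1 0 = 0 by [].
have Ec x : c x = x 0 1 ^+ l * g0 x + x 0 0 * c1 x by rewrite [LHS](hqE 0) E.
pose t0 := b0 0 ^+ 2 / g0 0; pose T x := x 0 0 + t0.
have sT : smooth_at 0 T by rewrite /T; smooth.
have sK : smooth_at 0 (fun x => x 0 1 ^+ l * T x) by smooth.
have X20 : (0 : 'rV[R]_2) 0 1 = 0 by rewrite mxE.
have K0 : (0 : 'rV[R]_2) 0 1 ^+ l * T 0 = 0 by rewrite X20 expr0n (gtn_eqF (ltnW l2)) mul0r.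
pose G x := c1 (vec2 (x 0 1 ^+ l * T x) (x 0 1)).
have sG : smooth_at 0 G by exact: smooth_at_comp0.
have G0 : G 0 = 0 by rewrite /G K0 X20 vec200.
have tG : tc 1 0 G = 0.
  rewrite /G (tc_comp1 sc1 sK sX2 K0 X20).1 tc_mulX2n // leqNgt (ltnW l2) tc_X2b /=.
  by rewrite !mulr0 addr0.
have T0 : T 0 = t0 by rewrite /T mxE add0r.
have tT : tc 1 0 T = 1.
  by rewrite /T tcD ?tc_X1b ?tc_cst ?addr0 //; smooth.
pose F x := T x * (g0 x + T x * G x) - b0 x ^+ 2.
have sF : smooth_at 0 F by rewrite /F; smooth.
have F0 : F 0 = 0 by rewrite /F G0 T0 mulr0 addr0 /t0 divfK ?subrr.
have tF : hq 0 F 0 = g0 0.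
  rewrite -[LHS]/(tc 1 0 F) /F.
  have s1 : smooth_at 0 (fun x => g0 x + T x * G x) by smooth.
  have s2 : smooth_at 0 (fun x => T x * G x) by smooth.
  rewrite tcD; [|smooth|smooth].
  rewrite tcN; last by smooth.
  rewrite (tc10M sT s1) (tcD _ _ sg s2) (tc10M sT sG) tG G0 tT T0.
  have -> : tc 1 0 (fun x => b0 x ^+ 2) = 0.
    by apply: tc_indep1 => [|x]; [smooth|rewrite ib].
  by rewrite (tc_indep1 _ _ sg ig); ring.
have [s [ss s0 is_ Es]] := implicit_hq sF F0 (smooth_at_hq 0 sF)
  (eq_ind_r (fun r => r != 0) n tF) (near_all (hqE 0 F)).
pose ta x := s x + t0; have sta : smooth_at 0 ta by rewrite /ta; smooth.
have ita x : ta (setc 0 0 x) = ta x by rewrite /ta is_.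
pose xi x := x 0 1 ^+ l * ta x; have sxi : smooth_at 0 xi by rewrite /xi; smooth.
have ixi x : xi (setc 0 0 x) = xi x by rewrite /xi ita mxE.
have xi0 : xi 0 = 0 by rewrite /xi mxE expr0n (gtn_eqF (ltnW l2)) mul0r.
pose C x := g0 x + ta x * c1 (vec2 (xi x) (x 0 1)).
have scx : smooth_at 0 (fun x => c1 (vec2 (xi x) (x 0 1))) by exact: smooth_at_comp0.
have sC : smooth_at 0 C by rewrite /C; smooth.
have C0 : C 0 = g0 0 by rewrite /C xi0 X20 vec200 c10 mulr0 addr0.
have nC : C 0 != 0 by rewrite C0.
have tC : \near0 x, ta x * C x = b0 x ^+ 2.
  apply: filterS Es => x /eqP; rewrite /F /G /T subr_eq0 => /eqP.
  rewrite (indep_axis1 ig (y := x)) ?(indep_axis1 ib (y := x)) ?mxE //=.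
pose q x := - b0 x / C x.
have sq : smooth_at 0 q by rewrite /q; apply: smooth_at_mul; [smooth|exact: smooth_at_inv].
pose b x := x 0 1 ^+ l * b0 x; have sb' : smooth_at 0 b by rewrite /b; smooth.
have b0' : b 0 = 0 by rewrite /b X20 expr0n (gtn_eqF (ltnW l2)) mul0r.
have ibb x : b (setc 0 0 x) = b x by rewrite /b ib mxE.
pose a1 x := x 0 0 + 2 * q x * b x + q x ^+ 2 * c x; pose b1 x := b x + q x * c x.
have sa1 : smooth_at 0 a1 by rewrite /a1; smooth.
have sb1 : smooth_at 0 b1 by rewrite /b1; smooth.
have iC x : C (setc 0 (xi x) x) = C x.
  have iC' y : C (setc 0 0 y) = C y by rewrite /C ig ita ixi mxE.
  by apply: (indep_axis1 iC'); rewrite mxE.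
have iq x : q (setc 0 (xi x) x) = q x.
  by rewrite /q iC (indep_axis1 ib (y := x)) // mxE.
have bxi x : b (setc 0 (xi x) x) = b x by apply: (indep_axis1 ibb); rewrite mxE.
have cxi x : c (setc 0 (xi x) x) = x 0 1 ^+ l * C x.
  rewrite Ec !mxE /= (indep_axis1 ig (y := x)) ?mxE // /C setc_vec2_1 /xi; ring.
have nearC := near_neq0 sC nC.
have Za1 : \near0 x, a1 (setc 0 (xi x) x) = 0.
  apply: filter_app tC; apply: filterS nearC => x Cx tC.
  rewrite /a1 iq bxi cxi !mxE /= /xi /q /b.
  have -> : ta x = b0 x ^+ 2 / C x by rewrite -tC mulfK.
  by field.
have Zb1 : \near0 x, b1 (setc 0 (xi x) x) = 0.
  apply: filterS nearC => x Cx; rewrite /b1 iq bxi cxi /q /b; field => //.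
have tb : tc 1 0 b = 0 by rewrite tc_indep1.
have s2q : smooth_at 0 (fun x => 2 * q x) by smooth.
have sq2 : smooth_at 0 (fun x => q x ^+ 2) by smooth.
have a10 : a1 0 = 0 by rewrite /a1 b0' c0 mxE !mulr0 !addr0.
have ta1 : tc 1 0 a1 = 1.
  rewrite /a1 !tcD; try by smooth.
  by rewrite (tc10M s2q sb') (tc10M sq2 sc) tb t10 b0' c0 tc_X1b !mulr0 !addr0.
have ta1' : tc 0 1 a1 = 0.
  rewrite /a1 !tcD; try by smooth.
  rewrite (tc01M s2q sb') (tc01M sq2 sc) t01 b0' c0 tc_X1b !mulr0 !addr0 add0r /b.
  by rewrite tc_mulX2n // leqNgt l2 mulr0.
have [w [sw w0 Ew]] := factor_graph sa1 sxi xi0 ixi Za1.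
have [h1 [sh1 h10 Eh1]] := factor_graph sb1 sxi xi0 ixi Zb1.
rewrite -[hq 0 a1 0]/(tc 1 0 a1) ta1 in w0.
have tb1 : tc 1 0 b1 = 0.
  by rewrite /b1 tcD ?(tc10M sq sc) ?tb ?t10 ?c0 ?mulr0 ?addr0 //; smooth.
rewrite -[hq 0 b1 0]/(tc 1 0 b1) tb1 in h10.
have nw : w 0 != 0 by rewrite w0 oner_neq0.
(* [a1 = (x1 - xi) w] with [w 0 = 1] and [b1 = (x1 - xi) h1], so a shear by [h] cancels [b1]
   exactly; [h 0 = 0] protects the coefficients to be followed. *)
pose h x := - (h1 x / w x).
have siw := smooth_at_inv sw nw.
have sh : smooth_at 0 h by rewrite /h; smooth.
have h0 : h 0 = 0 by rewrite /h h10 mul0r oppr0.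
have Eb1 : \near0 x, b1 x + h x * a1 x = 0.
  apply: filter_app Ew; apply: filter_app Eh1; apply: filterS (near_neq0 sw nw) => x wx -> ->.
  by rewrite /h; move: (x 0 0 - xi x) (h1 x) (w x) wx => p r t ?; field.
pose c2 x := c x + 2 * h x * b1 x + h x ^+ 2 * a1 x.
have sc2 : smooth_at 0 c2 by rewrite /c2; smooth.
have J : tc 1 0 a1 * tc 0 1 X2 - tc 0 1 a1 * tc 1 0 X2 != 0 by rewrite jac_X2 ta1 oner_neq0.
have [c' [sc' c'0 Ec']] := change_coord sa1 sX2 a10 X20 J sc2.
exists c', C.
have Q1 := @G_equiv_lshear R X1 b c q sq; have Q2 := @G_equiv_shear R a1 b1 c h sh.
have Q3 : G_equiv (germ3 X1 b c) (germ3 X1 (fun=> 0) c').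
  apply: G_equiv_trans Q1 _; apply: G_equiv_trans Q2 _.
  apply: (germ3_coord sa1 sX2 a10 X20 J) => //.
    by apply: near_all => x; rewrite vec2_1.
  by apply: filterS Eb1 => x ->.
have b10 : b1 0 = 0 by rewrite /b1 b0' c0 mulr0 addr0.
have c20 : c2 0 = 0 by rewrite /c2 c0 b10 a10 !mulr0 !addr0.
rewrite c20 in c'0.
have scc : smooth_at 0 (fun x => c' (vec2 (a1 x) (x 0 1))) by exact: smooth_at_comp0.
have s2h : smooth_at 0 (fun x => 2 * h x) by smooth.
have sh2 : smooth_at 0 (fun x => h x ^+ 2) by smooth.
have h20 : 2 * h 0 = 0 by rewrite h0 mulr0.
have tc2 i j : tc i j c2 = tc i j c + tc i j (fun x => 2 * h x * b1 x) +
    tc i j (fun x => h x ^+ 2 * a1 x) by rewrite !tcD //; smooth.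
have t10c2 : tc 1 0 c2 = 0.
  rewrite tc2 (tc10M s2h sb1) (tc10M sh2 sa1) t10 b10 a10 h0 expr0n /= !mulr0 !mul0r !addr0 //.
have t01c2 : tc 0 1 c2 = 0.
  rewrite tc2 (tc01M s2h sb1) (tc01M sh2 sa1) t01 b10 a10 h0 expr0n /= !mulr0 !mul0r !addr0 //.
have tb1' : tc 0 1 b1 = 0.
  rewrite /b1 tcD ?(tc01M sq sc) ?t01 ?c0 ?mulr0 ?addr0 //; last by smooth.
  by rewrite /b tc_mulX2n // leqNgt l2.
have h2E : (fun x => h x ^+ 2 * a1 x) = fun x => h x * h x * a1 x.
  by apply/funext => x; rewrite expr2.
have [S1 S2 _] := tc_sqr sh sh h0 h0 sa1.
have t20c2 : tc 2 0 c2 = tc 2 0 c.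
  by rewrite tc2 h2E S1 (tc20M s2h sb1) tb1 b10 a10 h20 !mulr0 mul0r !addr0.
have t11c2 : tc 1 1 c2 = tc 1 1 c.
  by rewrite tc2 h2E S2 (tc11M s2h sb1) tb1 tb1' b10 a10 h20 !mulr0 mul0r !addr0.
have [T1 T2] := tc_comp1 sc' sa1 sX2 a10 X20.
rewrite (tc_ext 1 0 scc sc2 Ec') t10c2 ta1 tc_X2b /= mulr0 addr0 mulr1 in T1.
rewrite (tc_ext 0 1 scc sc2 Ec') t01c2 ta1' tc_X2b /= mulr0 add0r mulr1 in T2.
have [U1 U2 _] := tc_comp2 sc' sa1 sX2 a10 X20 c'0 (esym T1) (esym T2).
rewrite (tc_ext 2 0 scc sc2 Ec') t20c2 ta1 tc_X2b /= in U1.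
rewrite (tc_ext 1 1 scc sc2 Ec') t11c2 ta1 ta1' !tc_X2b /= in U2.
split=> //.
- have sPhi : smooth_at 0 (fun x => vec2 (xi x) (x 0 1)) by exact: smooth_at_vec2.
  have Phi0 : vec2 (xi 0) ((0 : 'rV[R]_2) 0 1) = 0 by rewrite xi0 X20 vec200.
  apply: filter_app Za1; apply: filter_app Zb1; apply: filterS (near_comp sPhi Phi0 Ec') => x.
  rewrite -(setc_vec2_1 (xi x) x) => H Zb Za; move: H; rewrite Za /c2 Zb Za cxi.
  by rewrite [X in vec2 0 X]mxE /= -(setc_vec2_1 0 x) !mulr0 !addr0.
- split=> //.
  + by rewrite U1; ring.
  + by rewrite U2; ring.
Qed.

End Diagonalise.

(** * Families 7 and 8 *)

Section DiagonalFamilies.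
Variable R : realType.
Implicit Types (x v : 'rV[R]_2) (a b c f g h u z : 'rV[R]_2 -> R) (A B : 'rV[R]_2 -> 'M[R]_2).

Local Notation X1 := (fun x : 'rV[R]_2 => x 0 0).
Local Notation X2 := (fun x : 'rV[R]_2 => x 0 1).

Lemma germ3_coord2 b c b' c' z : smooth_at 0 z -> z 0 = 0 -> tc 0 1 z != 0 ->
  (\near0 x, b' (vec2 (x 0 0) (z x)) = b x) ->
  (\near0 x, c' (vec2 (x 0 0) (z x)) = c x) ->
  G_equiv (germ3 X1 b c) (germ3 X1 b' c').
Proof.
move=> sz z0 tz Eb Ec; have sX1 : smooth_at 0 X1 by smooth.
apply: (germ3_coord sX1 sz) => //; first by rewrite mxE.
  by rewrite jac_X1.
by apply: near_all => x; rewrite vec2_1.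
Qed.

Lemma germ3_scale2 b c (t : 'rV[R]_2 -> R) : smooth_at 0 t -> t 0 != 0 ->
  G_equiv (germ3 X1 b c) (germ3 X1 (fun x => t x * b x) (fun x => t x ^+ 2 * c x)).
Proof.
move=> st t0; have one := @smooth_at_cst R 'rV[R]_2 R 0 1.
apply: G_equiv_trans (@G_equiv_scale R X1 b c _ t one st (oner_neq0 R) t0) _.
by apply: G_equiv_near; apply: near_all => x; congr sym2; ring.
Qed.

(** The Morse lemma in [x2] splits [c] into a function of [x1] and a signed square. The order of the
    former is [l]; its unit factor is removed by scaling the second basis vector, and the square
    absorbs the scaling into [x2]. *)
Lemma simple_NF7 c : smooth_at 0 c -> c 0 = 0 -> tc 1 0 c = 0 -> tc 0 1 c = 0 -> tc 0 2 c != 0 ->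
  codim_lt9 (germ3 X1 (fun=> 0) c) -> simple (germ3 X1 (fun=> 0) c).
Proof.
move=> sc c0 t10 t01 n cd; have sX1 : smooth_at 0 X1 by smooth.
have s0 := @smooth_at_cst R 'rV[R]_2 R 0 0.
have [xi [de [q [[sxi sde sq] xi0 [ixi ide] q0 E]]]] := morse (i := 1) sc t01 n.
have nq : q 0 != 0 by rewrite q0.
have [s1 es] := pick_sign nq.
have seq' : smooth_at 0 (fun x => (-1) ^+ s1 * q x) by smooth.
have [r [sr r0 Er]] := unit_root seq' es (isT : (0 < 2)%N).
pose z x := (x 0 1 - xi x) * r x; have sz : smooth_at 0 z by rewrite /z; smooth.
have z0 : z 0 = 0 by rewrite /z xi0 mxE subr0 mul0r.
have txi : tc 0 1 xi = 0.
  by have := pd_uniq (pd_indep2 sxi ixi); rewrite /tc /= hq0 => -[_ /nbhs_singleton].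
have tz : tc 0 1 z != 0.
  have sy : smooth_at 0 (fun x => x 0 1 - xi x) by smooth.
  rewrite /z (tc01M sy sr) tcD; [|smooth|smooth].
  by rewrite tcN // tc_X2b txi mxE xi0 /= !subr0 mul0r add0r mul1r gt_eqF.
have Ec : \near0 x, c x = de x + (-1) ^+ s1 * z x ^+ 2.
  apply: filter_app E; apply: filterS Er => x Er ->; rewrite /z exprMn Er.
  have := sqr_sign R s1; move: ((-1) ^+ s1 : R) (q x) (x 0 1 - xi x) => e p y ee.
  have -> : e * (y ^+ 2 * (e * p)) = (e * e) * (y ^+ 2 * p) by ring.
  by rewrite ee mul1r.
have d0 : de 0 = 0.
  by have := nbhs_singleton Ec; rewrite c0 z0 expr0n /= mulr0 addr0.
have t10d : tc 1 0 de = 0.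
  have szz : smooth_at 0 (fun x => (-1) ^+ s1 * z x ^+ 2) by smooth.
  have sz2 : smooth_at 0 (fun x => z x * z x) by smooth.
  have := tc_ext 1 0 sc (smooth_at_add sde szz) Ec.
  rewrite tcD // tcZ; last by smooth.
  by rewrite (tc10M sz sz) z0 mul0r mulr0 addr0 mulr0 addr0 t10.
have Q : G_equiv (germ3 X1 (fun=> 0) c)
    (germ3 X1 (fun=> 0) (fun x => de x + (-1) ^+ s1 * x 0 1 ^+ 2)).
  apply: (germ3_coord2 sz z0 tz); first exact: near_all.
  apply: filterS Ec => x ->; rewrite vec2_2 -ide setc_vec2_2 vec2_1 -(setc_vec2_2 0 x) ide //.
apply: simple_equiv (Q) _.
have [d [d9 {}cd]] := codim_lt9_equiv (sym_germ3 sX1 s0 sc) Q cd.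
have [V|[l [_ V nl]]] := first_tc2 10 sde.
  have V2 := van2_X2 R 9; have P := pd_indep2 sde ide.
  have V2' : van2 9 (fun x : 'rV[R]_2 => (-1) ^+ s1 * x 0 1 ^+ 2).
    by apply: van2Z; exact: van2M V2 V2.1.
  have Pc := pd_add P (pd_Z ((-1) ^+ s1) (@pd_X2n R 2)).
  have C1 : van2 9 (fun x => 'D_(delta_mx 0 0) de x + (-1) ^+ s1 * 0).
    by apply: van2D (van2_pd V P) _; apply: van2Z; exact: van2_0.
  have C2 : van2 9 (fun x : 'rV[R]_2 => 0 + (-1) ^+ s1 * (2%:R * x 0 1 ^+ 2.-1)).
    by apply: van2D; [exact: van2_0|apply: van2Z; apply: van2Z].
  have := codim_van22 Pc sX1 cd C1 C2 (van2_0 _ _) (van2D (van2_le (leqnSn 9) V) V2').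
  by rewrite leqNgt d9.
have [h [sh ih h0 Eh]] := axis2_div sde V.2.
have l2 : (2 <= l)%N.
  by case: l nl {V h0 Eh} => [|[|]] //; rewrite ?t10d ?eqxx // -[tc 0 0 de]/(de 0) d0 eqxx.
rewrite -h0 in nl.
have [s2 [t [st t0 Et]]] := unit_scale sh nl.
exists (NF7 s1 s2 l); split=> //; rewrite nf_germE.
apply: G_equiv_trans (@germ3_scale2 _ _ t st t0) _.
pose y x := t x * x 0 1; have sy : smooth_at 0 y by rewrite /y; smooth.
have sX2 : smooth_at 0 X2 by smooth.
apply: (germ3_coord2 sy).
- by rewrite /y mxE mulr0.
- by rewrite /y (tc01M st sX2) tc_X2b mxE /= mulr1 mulr0 addr0.
- by apply: near_all => x; rewrite mulr0.
- apply: filterS Et => x Et; rewrite /nf_c vec2_1 vec2_2 /y -ide Eh -Et.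
  by move: (t x) (h x) (x 0 0 ^+ l) ((-1) ^+ s1 : R) => p1 p2 p3 p4; ring.
Qed.

(* the branch [x2 = x1 sigma(x1)] of a curve whose tangent cone contains [x1^3 (m + sigma n)] *)
Lemma branch (m n H : 'rV[R]_2 -> R) : smooth_at 0 m -> smooth_at 0 n -> smooth_at 0 H -> n 0 != 0 ->
  exists s : 'rV[R]_2 -> R, [/\ smooth_at 0 s, s 0 = - m 0 / n 0, forall x, s (setc 1 0 x) = s x &
    \near0 x, m (vec2 (x 0 0) (x 0 0 * s x)) +
      s x * n (vec2 (x 0 0) (x 0 0 * s x)) + x 0 0 * H (vec2 (x 0 0) (s x - s 0)) = 0].
Proof.
move=> sm sn sH n0; pose k := - m 0 / n 0; pose S x := x 0 1 + k.
have sS : smooth_at 0 S by rewrite /S; smooth.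
have sX1 : smooth_at 0 X1 by smooth.
have X10 : (0 : 'rV[R]_2) 0 0 = 0 by rewrite mxE.
have sv : smooth_at 0 (fun x => x 0 0 * S x) by smooth.
have v0 : (0 : 'rV[R]_2) 0 0 * S 0 = 0 by rewrite X10 mul0r.
have sm' : smooth_at 0 (fun x => m (vec2 (x 0 0) (x 0 0 * S x))) by exact: smooth_at_comp0.
have sn' : smooth_at 0 (fun x => n (vec2 (x 0 0) (x 0 0 * S x))) by exact: smooth_at_comp0.
have tv : tc 0 1 (fun x => x 0 0 * S x) = 0 by rewrite tc_mulX1.
have tm : tc 0 1 (fun x => m (vec2 (x 0 0) (x 0 0 * S x))) = 0.
  by rewrite (tc_comp1 sm sX1 sv X10 v0).2 tv tc_X1b /= !mulr0 addr0.
have tn : tc 0 1 (fun x => n (vec2 (x 0 0) (x 0 0 * S x))) = 0.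
  by rewrite (tc_comp1 sn sX1 sv X10 v0).2 tv tc_X1b /= !mulr0 addr0.
pose F x := m (vec2 (x 0 0) (x 0 0 * S x)) + S x * n (vec2 (x 0 0) (x 0 0 * S x)) + x 0 0 * H x.
have sF : smooth_at 0 F by rewrite /F; smooth.
have S0 : S 0 = k by rewrite /S mxE add0r.
have F0 : F 0 = 0 by rewrite /F S0 X10 !mul0r vec200 /k divfK // addr0 subrr.
have tS : tc 0 1 S = 1 by rewrite /S tcD ?tc_X2b ?tc_cst ?addr0 //; smooth.
have tF : hq 1 F 0 = n 0.
  rewrite -[LHS]/(tc 0 1 F) /F !tcD; try by smooth.
  by rewrite tm (tc01M sS sn') tn tS tc_mulX1 // X10 mul0r vec200; ring.
have [s [ss s0 is_ Es]] := implicit_hq sF F0 (smooth_at_hq 1 sF)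
  (eq_ind_r (fun r => r != 0) n0 tF) (near_all (hqE 1 F)).
exists (fun x => s x + k); split.
- by smooth.
- by rewrite s0 add0r.
- by move=> x; rewrite is_.
- apply: filterS Es => x; rewrite /F /S !setc_vec2_2 vec2_1 vec2_2 s0 add0r addrK //.
Qed.

Lemma simple_NF8_unit l g : smooth_at 0 g -> g 0 != 0 -> (3 <= l)%N ->
  simple (germ3 X1 (fun=> 0) (fun x => x 0 0 * x 0 1 + x 0 1 ^+ l * g x)).
Proof.
move=> sg n l3; have [s es] := pick_sign n.
have sg' : smooth_at 0 (fun x => (-1) ^+ s * g x) by smooth.
have lp : l.-1.+1 = l by rewrite prednK // (leq_trans _ l3).
have l1 : (0 < l.-1)%N by rewrite -ltnS lp ltnW.
(* Scaling the second basis vector by a square root of [M] and [x2] by [M] preserves [x1 x2] and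
   multiplies the coefficient of [x2^l] by [M^(1-l)]; hence the exponent [l - 1]. *)
have [M [sM M0 EM]] := unit_root sg' es l1.
have [r [sr r0 Er]] := unit_root sM M0 (isT : (0 < 2)%N).
have nr : r 0 != 0 by rewrite gt_eqF.
exists (NF8 s l); split=> //; rewrite nf_germE.
apply: G_equiv_trans (@germ3_scale2 _ _ r sr nr) _.
pose z x := x 0 1 * M x; have sz : smooth_at 0 z by rewrite /z; smooth.
have sX2 : smooth_at 0 X2 by smooth.
apply: (germ3_coord2 sz).
- by rewrite /z mxE mul0r.
- by rewrite /z (tc01M sX2 sM) tc_X2b mxE /= mul0r add0r mul1r gt_eqF.
- by apply: near_all => x; rewrite mulr0.
- apply: filter_app Er; apply: filterS EM => x EM ->; rewrite /nf_c vec2_1 vec2_2 /z exprMn.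
  have -> : M x ^+ l = M x * ((-1) ^+ s * g x) by rewrite -EM -exprS lp.
  have := sqr_sign R s; move: (x 0 0) (x 0 1) (M x) (g x) ((-1) ^+ s : R) => p1 p2 p3 p4 e ee.
  move: (p2 ^+ l) => p5.
  have -> : e * (p5 * (p3 * (e * p4))) = (e * e) * (p5 * p3 * p4) by ring.
  by rewrite ee; ring.
Qed.

Lemma simple_NF8_factor l k g : smooth_at 0 k -> smooth_at 0 g -> k 0 != 0 -> g 0 != 0 -> (3 <= l)%N ->
  simple (germ3 X1 (fun=> 0) (fun x => x 0 1 * (x 0 0 * k x + x 0 1 ^+ l.-1 * g x))).
Proof.
move=> sk sg nk ng l3; have [s [t [st t0 Et]]] := unit_scale sk nk.
have sX1 : smooth_at 0 X1 by smooth.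
have lp : l.-1.+1 = l by rewrite prednK // (leq_trans _ l3).
pose e : R := (-1) ^+ s; have ee : e * e = 1 := sqr_sign R s.
have e0 : e != 0 by rewrite signr_eq0.
have sX2e : smooth_at 0 (fun x : 'rV[R]_2 => e * x 0 1) by smooth.
have X20 : (0 : 'rV[R]_2) 0 1 = 0 by rewrite mxE.
have X10 : (0 : 'rV[R]_2) 0 0 = 0 by rewrite mxE.
pose g1 x := e ^+ l * (t x ^+ 2 * g x).
have sg1 : smooth_at 0 g1 by rewrite /g1; smooth.
pose g2 x := g1 (vec2 (x 0 0) (e * x 0 1)).
have sg2 : smooth_at 0 g2 by apply: smooth_at_comp0 => //; rewrite X20 mulr0.
have g20 : g2 0 != 0.
  by rewrite /g2 X20 X10 mulr0 vec200 /g1 !mulf_neq0 // expf_neq0.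
apply: simple_equiv (simple_NF8_unit sg2 g20 l3).
apply: G_equiv_trans (@germ3_scale2 _ _ t st t0) _.
apply: (germ3_coord2 sX2e).
- by rewrite X20 mulr0.
- by rewrite tcZ ?tc_X2b /= ?mulr1 //; smooth.
- by apply: near_all => x; rewrite mulr0.
- apply: filterS Et => x Et; rewrite vec2_1 vec2_2 /g2 vec2_1 vec2_2.
  have -> : e * (e * x 0 1) = x 0 1 by rewrite mulrA ee mul1r.
  rewrite vec2E /g1.
  have -> : (e * x 0 1) ^+ l * (e ^+ l * (t x ^+ 2 * g x)) = (e * e) ^+ l * (x 0 1 ^+ l * (t x ^+ 2 * g x)).
    by rewrite !exprMn; move: (e ^+ l) (x 0 1 ^+ l) (t x ^+ 2 * g x) => p1 p2 p3; ring.
  rewrite ee expr1n mul1r.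
  have -> : t x ^+ 2 * (x 0 1 * (x 0 0 * k x + x 0 1 ^+ l.-1 * g x)) =
      x 0 1 * x 0 0 * (t x ^+ 2 * k x) + (x 0 1 * x 0 1 ^+ l.-1) * (t x ^+ 2 * g x).
    by move: (x 0 1 ^+ l.-1) (x 0 1) (k x) (t x) (g x) => p1 p2 p3 p4 p5; ring.
  rewrite Et -exprS lp.
  by rewrite -/e; ring.
Qed.

(** In [c = x1 (x1 m + x2 n) + x2^l g] the factor [n] is a unit, so the curve [c = 0] has a branch
    [x2 = x1 s(x1)]. Taken as the axis [x2 = 0], it splits off a factor [x2], and the cofactor has
    order [l - 1] on [x1 = 0]. *)
Lemma simple_NF8 l c h : smooth_at 0 c -> smooth_at 0 h -> h 0 != 0 -> (3 <= l)%N ->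
  (\near0 x, c (setc 0 0 x) = x 0 1 ^+ l * h x) ->
  tc 1 0 c = 0 -> tc 1 1 c != 0 -> simple (germ3 X1 (fun=> 0) c).
Proof.
move=> sc sh nh l3 Eh t10 n11; have sX1 : smooth_at 0 X1 by smooth.
have sX2 : smooth_at 0 X2 by smooth.
have sc1 := smooth_at_hq 0 sc.
have [m [n [sm sn m0 n0 Emn]]] := hadamard2 sc1.
rewrite -[hq 0 c 0]/(tc 1 0 c) t10 in Emn; rewrite tc_hq1 // in n0.
pose g x := h (setc 0 0 x); have sg : smooth_at 0 g by exact: smooth_at_axis.
have ig x : g (setc 0 0 x) = g x by rewrite /g setcK.
have Ec : \near0 x, c x = x 0 0 * (x 0 0 * m x + x 0 1 * n x) + x 0 1 ^+ l * g x.
  apply: filterS (near_setc0 0 Eh) => x; rewrite setcK mxE /= => H.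
  by rewrite [LHS](hqE 0) H Emn /g; ring.
have nn : n 0 != 0 by rewrite n0.
(* On [x2 = x1 sigma] the term [x2^l g] is [x1^2] times [x1 H], which uses [3 <= l]. The second
   argument of [H] is [sigma] minus its value at 0. *)
pose H x := x 0 0 ^+ (l - 3) * (x 0 1 + - m 0 / n 0) ^+ l * g (vec2 (x 0 0) (x 0 0 * (x 0 1 + - m 0 / n 0))).
have sH : smooth_at 0 H.
  rewrite /H; apply: smooth_at_mul; first by smooth.
  by apply: smooth_at_comp0 => //; [rewrite mxE|rewrite mxE mul0r|smooth].
have [s [ss s0 is_ Es]] := branch sm sn sH nn.
pose ze x := x 0 0 * s x; have sze : smooth_at 0 ze by rewrite /ze; smooth.
have ize x : ze (setc 1 0 x) = ze x by rewrite /ze is_ mxE.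
have ze0 : ze 0 = 0 by rewrite /ze mxE mul0r.
have Zc : \near0 x, c (setc 1 (ze x) x) = 0.
  have sPhi : smooth_at 0 (fun x => vec2 (x 0 0) (ze x)) by exact: smooth_at_vec2.
  have Phi0 : vec2 ((0 : 'rV[R]_2) 0 0) (ze 0) = 0 by rewrite ze0 mxE vec200.
  apply: filter_app (near_comp sPhi Phi0 Ec); apply: filterS Es => x Es.
  rewrite -!(setc_vec2_2 (ze x) x) => ->; rewrite setc_vec2_2 vec2_1 vec2_2.
  move: Es; rewrite /H vec2_1 vec2_2 -s0 subrK -/(ze x).
  move: (m _) (n _) (g _) => p1 p2 p3 Es.
  have -> : ze x ^+ l = x 0 0 ^+ 3 * x 0 0 ^+ (l - 3) * s x ^+ l.
    by rewrite -exprD subnKC // exprMn.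
  have -> : x 0 0 * (x 0 0 * p1 + ze x * p2) + x 0 0 ^+ 3 * x 0 0 ^+ (l - 3) * s x ^+ l * p3 =
    x 0 0 ^+ 2 * (p1 + s x * p2 + x 0 0 * (x 0 0 ^+ (l - 3) * s x ^+ l * p3)).
    by rewrite /ze; move: (x 0 0 ^+ (l - 3)) (s x ^+ l) => p4 p5; ring.
  by rewrite Es mulr0.
have [e [se e0 Ee]] := factor_graph sc sze ze0 ize Zc.
pose y x := x 0 1 - ze x; have sy : smooth_at 0 y by rewrite /y; smooth.
have y0 : y 0 = 0 by rewrite /y ze0 mxE subr0.
have tze : tc 0 1 ze = 0 by rewrite /ze tc_mulX1.
have ty : tc 0 1 y = 1.
  by rewrite /y tcD ?tcN ?tze ?tc_X2b ?subr0 //; smooth.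
have J : tc 1 0 X1 * tc 0 1 y - tc 0 1 X1 * tc 1 0 y != 0 by rewrite jac_X1 ty oner_neq0.
have X10 : (0 : 'rV[R]_2) 0 0 = 0 by rewrite mxE.
have [e' [se' e'0 Ee']] := change_coord sX1 sy X10 y0 J se.
have l1 : l.-1.+1 = l by rewrite prednK // (leq_trans _ l3).
have l2 : (1 < l.-1)%N by rewrite -ltnS l1.
have e_axis : \near0 x, e (setc 0 0 x) = x 0 1 ^+ l.-1 * g x.
  apply: (coord_cancel (i := 1)); [exact: smooth_at_axis|by smooth|].
  apply: filter_app (near_setc0 0 Ee); apply: filterS (near_setc0 0 Ec) => x.
  rewrite ig !mxE /= mul0r add0r /ze [X in X * s _]mxE mul0r subr0 => -> <-.
  by rewrite mulrA -exprS l1.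
have e'_axis : \near0 x, e' (setc 0 0 x) = x 0 1 ^+ l.-1 * g x.
  apply: filter_app e_axis; apply: filterS (near_setc0 0 Ee') => x.
  by rewrite /y /ze !mxE /= mul0r subr0 -(setc_vec2_1 0 x) => -> ->.
have te01 : tc 0 1 e = 0.
  rewrite tc_axis1 (tc_ext 0 1 (smooth_at_axis 0 se) _ e_axis); last by smooth.
  by rewrite tc_mulX2n // leqNgt l2.
have te01' : tc 0 1 e' = 0.
  rewrite tc_axis1 (tc_ext 0 1 (smooth_at_axis 0 se') _ e'_axis); last by smooth.
  by rewrite tc_mulX2n // leqNgt l2.
have ee0 : e 0 = 0.
  by have := nbhs_singleton e_axis; rewrite setc00 mxE expr0n (gtn_eqF (ltnW l2)) mul0r.
have te10 : tc 1 0 e = tc 1 1 c.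
  have sye : smooth_at 0 (fun x => y x * e x) by smooth.
  rewrite (tc_ext 1 1 sc sye Ee) (tc11M sy se) y0 te01 ty ee0; ring.
have te10' : tc 1 0 e' = tc 1 1 c.
  have se2 : smooth_at 0 (fun x => e' (vec2 (x 0 0) (y x))) by exact: smooth_at_comp0.
  rewrite -te10 -(tc_ext 1 0 se2 se Ee') (tc_comp1 se' sX1 sy X10 y0).1 te01' tc_X1b /=.
  by rewrite mulr1 mul0r addr0.
pose k := hq 0 e'; have sk : smooth_at 0 k by exact: smooth_at_hq.
have k0 : k 0 != 0 by rewrite -[k 0]/(tc 1 0 e') te10'.
have ng : g 0 != 0 by rewrite /g setc00.
apply: simple_equiv (simple_NF8_factor sk sg k0 ng l3).
have ty' : tc 0 1 y != 0 by rewrite ty oner_neq0.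
apply: G_equiv_trans (@germ3_coord2 (fun=> 0) c (fun=> 0) (fun x => x 0 1 * e' x) y sy y0 ty' _ _) _.
- exact: near_all.
- by apply: filter_app Ee; apply: filterS Ee' => x <- ->; rewrite vec2_2.
apply: G_equiv_near; apply: filterS e'_axis => x E.
by rewrite /germ3; congr sym2; rewrite [e' x](hqE 0) E addrC.
Qed.

End DiagonalFamilies.

(** * Family 9 *)

Section FamilyNine.
Variable R : realType.
Implicit Types (x v : 'rV[R]_2) (a b c f g h u z : 'rV[R]_2 -> R) (A B : 'rV[R]_2 -> 'M[R]_2).

Local Notation X1 := (fun x : 'rV[R]_2 => x 0 0).
Local Notation X2 := (fun x : 'rV[R]_2 => x 0 1).

(** Rescaling [x2] by [t^2 e] turns the corner into [x1 x2]; the off-diagonal entry then requires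
    [t^(2k-1) = B / e^k], solvable for either sign because the exponent is odd. *)
Lemma simple_NF9_unit k (B e : 'rV[R]_2 -> R) : smooth_at 0 B -> smooth_at 0 e -> B 0 != 0 ->
  e 0 != 0 -> (2 <= k)%N ->
  simple (germ3 X1 (fun x => x 0 1 ^+ k * B x) (fun x => x 0 0 * x 0 1 * e x)).
Proof.
move=> sB se nB ne k2.
have sek : smooth_at 0 (fun x => (e x ^+ k)^-1) by apply: smooth_at_inv; [smooth|rewrite expf_neq0].
have sQ : smooth_at 0 (fun x => B x * (e x ^+ k)^-1) by smooth.
have nQ : B 0 * (e 0 ^+ k)^-1 != 0 by rewrite mulf_neq0 // invr_neq0 // expf_neq0.
have [s es] := pick_sign nQ.
have sQ' : smooth_at 0 (fun x => (-1) ^+ s * (B x * (e x ^+ k)^-1)) by smooth.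
have kk : (0 < (2 * k).-1)%N by lia.
have [M [sM M0 EM]] := unit_root sQ' es kk.
pose t x := (-1) ^+ s * M x; have st : smooth_at 0 t by rewrite /t; smooth.
have t0 : t 0 != 0 by rewrite mulf_neq0 ?signr_eq0 // gt_eqF.
have Et : \near0 x, (t x ^+ 2 * e x) ^+ k = t x * B x.
  apply: filter_app EM; apply: filterS (near_neq0 se ne) => x ex EM.
  rewrite exprMn -exprM.
  have -> : (2 * k)%N = (2 * k).-1.+1 by lia.
  rewrite exprS {2}/t exprMn EM.
  have -> : ((-1) ^+ s : R) ^+ (2 * k).-1 = (-1) ^+ s.
    have H (u : bool) : ((-1) ^+ u : R) ^+ (2 * k).-1 = (-1) ^+ u.
      case: u; last by rewrite expr0 expr1n.
      by rewrite expr1 -signr_odd; have -> : odd (2 * k).-1 by lia.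
    exact: H.
  have := sqr_sign R s; move: ((-1) ^+ s : R) => r rr.
  have -> : t x * (r * (r * (B x * (e x ^+ k)^-1))) * e x ^+ k = t x * (r * r) * B x * ((e x ^+ k)^-1 * e x ^+ k).
    by move: (t x) (B x) (e x ^+ k) ((e x ^+ k)^-1) => p1 p2 p3 p4; ring.
  by rewrite rr mulVf ?expf_neq0 // !mulr1.
exists (NF9 k); split=> //; rewrite nf_germE.
apply: G_equiv_trans (@germ3_scale2 _ _ _ t st t0) _.
pose y x := t x ^+ 2 * e x; have sy : smooth_at 0 y by rewrite /y; smooth.
have sX2 : smooth_at 0 X2 by smooth.
pose z x := x 0 1 * y x; have sz : smooth_at 0 z by rewrite /z; smooth.
apply: (germ3_coord2 sz).
- by rewrite /z mxE mul0r.
- rewrite /z (tc01M sX2 sy) tc_X2b mxE /= mul0r add0r mul1r /y mulf_neq0 // expf_neq0 //.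
- apply: filterS Et => x Et; rewrite /nf_b vec2_2 /z /y exprMn Et.
  by move: (t x) (B x) (x 0 1 ^+ k) => p1 p2 p3; ring.
- apply: near_all => x; rewrite /nf_c vec2_1 vec2_2 /z /y; ring.
Qed.

(** The congruence [(1, p; q, 1)] with [p = - x2 q e] leaves one free function. Asking the new
    corner to be [x2 e] times the new first entry amounts to the quadratic equation [Eq] for [q]. *)
Lemma simple_NF9_quad k b0 e g : smooth_at 0 b0 -> smooth_at 0 e -> smooth_at 0 g ->
  (forall x, b0 (setc 0 0 x) = b0 x) -> b0 0 != 0 -> e 0 != 0 -> (2 <= k)%N ->
  simple (germ3 X1 (fun x => x 0 1 ^+ k * b0 x)
    (fun x => x 0 1 * (x 0 0 * e x + x 0 1 ^+ k * g x))).
Proof.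
move=> sb se sg ib nb ne k2.
have sX1 : smooth_at 0 X1 by smooth.
have sX2 : smooth_at 0 X2 by smooth.
have X10 : (0 : 'rV[R]_2) 0 0 = 0 by rewrite mxE.
have X20 : (0 : 'rV[R]_2) 0 1 = 0 by rewrite mxE.
have k0 : (0 : R) ^+ k = 0 by rewrite expr0n (gtn_eqF (ltnW k2)).
pose B x := 4%:R * e x * b0 x; have sB : smooth_at 0 B by rewrite /B; smooth.
have nB : B 0 != 0 by rewrite !mulf_neq0 // pnatr_eq0.
have siB := smooth_at_inv sB nB.
pose N x := 1 + 4%:R * x 0 1 * e x * g x ^+ 2 * (B x)^-1 * (B x)^-1.
have sN : smooth_at 0 N by rewrite /N; smooth.
have N0 : N 0 = 1 by rewrite /N X20 mulr0 !mul0r addr0.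
have N0p : 0 < N 0 by rewrite N0 ltr01.
have [r [sr r0 Er]] := unit_root sN N0p (isT : (0 < 2)%N).
have sr1 : smooth_at 0 (fun x => 1 + r x) by smooth.
have r1p : 0 < 1 + r 0 by rewrite addr_gt0.
have sir := smooth_at_inv sr1 (lt0r_neq0 r1p).
(* The root that stays bounded when the leading coefficient [x2 e g] tends to 0, written without
   dividing by that coefficient. *)
pose q x := 2 * g x * (B x)^-1 * (1 + r x)^-1.
have sq : smooth_at 0 q by rewrite /q; smooth.
pose p x := - (x 0 1 * q x * e x); have sp : smooth_at 0 p by rewrite /p; smooth.
have Eq : \near0 x,
    x 0 1 * e x * g x * q x ^+ 2 + 4%:R * e x * b0 x * q x - g x = 0.
  apply: filter_app Er; apply: filter_app (near_neq0 sB nB).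
  apply: filterS (near_pos sr1 r1p) => x rx Bx; rewrite /N => Er.
  have rx0 : 1 + r x != 0 by rewrite gt_eqF.
  have E : x 0 1 * e x * g x ^+ 2 = (r x ^+ 2 - 1) * B x ^+ 2 / 4%:R by rewrite Er; field.
  have -> : x 0 1 * e x * g x * q x ^+ 2 =
      (x 0 1 * e x * g x ^+ 2) * (4%:R * g x * (B x)^-1 ^+ 2 * (1 + r x)^-1 ^+ 2).
    by rewrite /q; move: ((B x)^-1) ((1 + r x)^-1) (e x) (g x) => p1 p2 p3 p4; ring.
  rewrite E -/(B x) /q; move: (B x) (r x) (g x) Bx rx0 => p1 p2 p3 n1 n2; field.
  by rewrite n1 n2.
have one := @smooth_at_cst R 'rV[R]_2 R 0 1.
have J0 : 1 * 1 - p 0 * q 0 != 0 by rewrite /p X20 !mul0r oppr0 mul0r subr0 mulr1 oner_neq0.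
pose b x := x 0 1 ^+ k * b0 x; pose c x := x 0 1 * (x 0 0 * e x + x 0 1 ^+ k * g x).
have sb' : smooth_at 0 b by rewrite /b; smooth.
have sc : smooth_at 0 c by rewrite /c; smooth.
have Q1 := @G_equiv_congr R X1 b c _ p q _ one sp sq one J0.
pose a1 x := x 0 0 + 2 * q x * b x + q x ^+ 2 * c x.
have sa1 : smooth_at 0 a1 by rewrite /a1; smooth.
pose B1 x := (1 + p x * q x) * b0 x + q x * x 0 1 * g x.
have sB1 : smooth_at 0 B1 by rewrite /B1; smooth.
have b00 : b 0 = 0 by rewrite /b X20 k0 mul0r.
have c00 : c 0 = 0 by rewrite /c X20 mul0r.
have a10 : a1 0 = 0 by rewrite /a1 b00 c00 X10 !mulr0 !addr0.
have tb : tc 1 0 b = 0 by apply: tc_indep1 => // x; rewrite /b ib mxE.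
have ta1 : tc 1 0 a1 = 1.
  have s2q : smooth_at 0 (fun x => 2 * q x) by smooth.
  have sq2 : smooth_at 0 (fun x => q x ^+ 2) by smooth.
  rewrite /a1 !tcD; try by smooth.
  by rewrite (tc10M s2q sb') (tc10M sq2 sc) tb b00 c00 tc_X1b /c tc_mulX2 ?mulr0 ?addr0 //; smooth.
have J : tc 1 0 a1 * tc 0 1 X2 - tc 0 1 a1 * tc 1 0 X2 != 0 by rewrite jac_X2 ta1 oner_neq0.
have [B2 [sB2 B20 EB2]] := change_coord sa1 sX2 a10 X20 J sB1.
have [e2 [se2 e20 Ee2]] := change_coord sa1 sX2 a10 X20 J se.
have nB2 : B2 0 != 0 by rewrite B20 /B1 /p X20 !mul0r oppr0 mulr0 !mul0r !addr0 mul1r.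
have ne2 : e2 0 != 0 by rewrite e20.
apply: simple_equiv (simple_NF9_unit sB2 se2 nB2 ne2 k2).
apply: G_equiv_trans Q1 _; apply: (germ3_coord sa1 sX2 a10 X20 J).
- by apply: near_all => x; rewrite vec2_1 /a1; ring.
- apply: filterS EB2 => x ->; rewrite vec2_2 /B1 /b /c /p.
  by move: (x 0 1 ^+ k) (q x) (e x) (g x) (b0 x) => p1 p2 p3 p4 p5; ring.
- apply: filter_app Ee2; apply: filterS Eq => x Eq ->; rewrite vec2_1 vec2_2.
  apply/eqP; rewrite -subr_eq0; apply/eqP.
  transitivity (x 0 1 * x 0 1 ^+ k *
    (x 0 1 * e x * g x * q x ^+ 2 + 4%:R * e x * b0 x * q x - g x)); last by rewrite Eq mulr0.
  rewrite /a1 /b /c /p.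
  by move: (x 0 1 ^+ k) (q x) (e x) (g x) (b0 x) => p1 p2 p3 p4 p5; ring.
Qed.

(** The branch now belongs to [x1 c = b^2], not to [c = 0]. Once it is the axis [x2 = 0] and a shear
    has made [b] vanish there, the determinant forces the corner to vanish there too and so to be
    divisible by [x2]. *)
Lemma simple_NF9 k b0 c : smooth_at 0 b0 -> smooth_at 0 c -> (forall x, b0 (setc 0 0 x) = b0 x) ->
  b0 0 != 0 -> (2 <= k)%N -> van1 k.+1 c -> tc 1 0 c = 0 -> tc 1 1 c != 0 ->
  simple (germ3 X1 (fun x => x 0 1 ^+ k * b0 x) c).
Proof.
move=> sb sc ib nb k2 [_ V] t10 n11.
have sX1 : smooth_at 0 X1 by smooth.
have X10 : (0 : 'rV[R]_2) 0 0 = 0 by rewrite mxE.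
have X20 : (0 : 'rV[R]_2) 0 1 = 0 by rewrite mxE.
have k0 : (0 : R) ^+ k = 0 by rewrite expr0n (gtn_eqF (ltnW k2)).
have sc1 := smooth_at_hq 0 sc.
have [m [n [sm sn m0 n0 Emn]]] := hadamard2 sc1.
rewrite -[hq 0 c 0]/(tc 1 0 c) t10 in Emn; rewrite tc_hq1 // in n0.
have [g [sg ig _ Eg]] := axis1_div sc V.
have c0 : c 0 = 0 by rewrite -(setc00 R 0) Eg X20 exprS mul0r mul0r.
pose b x := x 0 1 ^+ k * b0 x; have sb' : smooth_at 0 b by rewrite /b; smooth.
have b00 : b 0 = 0 by rewrite /b X20 k0 mul0r.
have ibb x : b (setc 0 0 x) = b x by rewrite /b ib mxE.
have Ec x : c x = x 0 0 * (x 0 0 * m x + x 0 1 * n x) + x 0 1 ^+ k.+1 * g x.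
  by rewrite [LHS](hqE 0) Eg Emn; ring.
have nn : n 0 != 0 by rewrite n0.
pose S x := x 0 1 + - m 0 / n 0; have sS : smooth_at 0 S by rewrite /S; smooth.
have K0 : (0 : 'rV[R]_2) 0 0 * S 0 = 0 by rewrite X10 mul0r.
have sXS : smooth_at 0 (fun x => x 0 0 * S x) by smooth.
(* On [x2 = x1 sigma], [x1 c - b^2] is [x1^3 (m + sigma n + x1 H)]; the exponents [k - 2] and
   [2 (k - 2)] are what remains after division by [x1^4]. *)
pose H x := x 0 0 ^+ (k - 2) * S x ^+ k.+1 * g (vec2 (x 0 0) (x 0 0 * S x)) -
  x 0 0 ^+ (2 * (k - 2)) * S x ^+ (2 * k) * b0 (vec2 (x 0 0) (x 0 0 * S x)) ^+ 2.
have sgS : smooth_at 0 (fun x => g (vec2 (x 0 0) (x 0 0 * S x))) by exact: smooth_at_comp0.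
have sbS : smooth_at 0 (fun x => b0 (vec2 (x 0 0) (x 0 0 * S x))) by exact: smooth_at_comp0.
have sH : smooth_at 0 H by rewrite /H; smooth.
have [s [ss s0 is_ Es]] := branch sm sn sH nn.
pose ze x := x 0 0 * s x; have sze : smooth_at 0 ze by rewrite /ze; smooth.
have ize x : ze (setc 1 0 x) = ze x by rewrite /ze is_ mxE.
have ze0 : ze 0 = 0 by rewrite /ze X10 mul0r.
have ZD : \near0 x,
    x 0 0 * c (vec2 (x 0 0) (ze x)) - b (vec2 (x 0 0) (ze x)) ^+ 2 = 0.
  apply: filterS Es => x Es; rewrite Ec /b vec2_1 vec2_2.
  move: Es; rewrite /H /S vec2_1 vec2_2 -s0 subrK -/(ze x).
  move: (m _) (n _) (g _) (b0 _) => p1 p2 p3 p4 Es.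
  have Ez : ze x ^+ k = x 0 0 ^+ 2 * x 0 0 ^+ (k - 2) * s x ^+ k.
    by rewrite -exprD subnKC // exprMn.
  rewrite exprS Ez; move: Es.
  rewrite [s x ^+ k.+1]exprS (mulnC 2%N k) (mulnC 2%N (k - 2)%N) (exprM _ k) (exprM _ (k - 2)%N).
  rewrite /ze => Es; transitivity (x 0 0 ^+ 3 * 0 : R); last by rewrite mulr0.
  rewrite -Es; move: (x 0 0 ^+ (k - 2)) (s x ^+ k) => p5 p6; ring.
pose y x := x 0 1 - ze x; have sy : smooth_at 0 y by rewrite /y; smooth.
have y0 : y 0 = 0 by rewrite /y ze0 X20 subr0.
have tze : tc 0 1 ze = 0 by rewrite /ze tc_mulX1.
have ty : tc 0 1 y = 1.
  by rewrite /y tcD ?tcN ?tze ?tc_X2b ?subr0 //; smooth.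
have nty : tc 0 1 y != 0 by rewrite ty oner_neq0.
have J : tc 1 0 X1 * tc 0 1 y - tc 0 1 X1 * tc 1 0 y != 0 by rewrite jac_X1.
have [b' [sb1 b'0 Eb']] := change_coord sX1 sy X10 y0 J sb'.
have [c' [sc' c'0 Ec']] := change_coord sX1 sy X10 y0 J sc.
have axis f f' : (\near0 x, f' (vec2 (x 0 0) (y x)) = f x) ->
    \near0 x, f' (setc 0 0 x) = f (setc 0 0 x).
  move=> E; apply: filterS (near_setc0 0 E) => x.
  by rewrite /y /ze !mxE /= mul0r subr0 -(setc_vec2_1 0 x).
have b'_axis : \near0 x, b' (setc 0 0 x) = x 0 1 ^+ k * b0 x.
  by apply: filterS (axis _ _ Eb') => x ->; rewrite ibb.
have c'_axis : \near0 x, c' (setc 0 0 x) = x 0 1 ^+ k.+1 * g x.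
  by apply: filterS (axis _ _ Ec') => x ->; rewrite Eg.
have tb'01 : tc 0 1 b' = 0.
  rewrite tc_axis1 (tc_ext 0 1 (smooth_at_axis 0 sb1) _ b'_axis); last by smooth.
  by rewrite tc_mulX2n // leqNgt k2.
have tc'j j : (j < k.+1)%N -> tc 0 j c' = 0.
  move=> jk; rewrite tc_axis1 (tc_ext 0 j (smooth_at_axis 0 sc') _ c'_axis); last by smooth.
  by rewrite tc_mulX2n // leqNgt jk.
have tb'10 : tc 1 0 b' = 0.
  have s1 : smooth_at 0 (fun x => b' (vec2 (x 0 0) (y x))) by exact: smooth_at_comp0.
  have := (tc_comp1 sb1 sX1 sy X10 y0).1; rewrite (tc_ext 1 0 s1 sb' Eb') tb'01 tc_X1b /=.
  by rewrite tc_indep1 // mulr1 mul0r addr0 => <-.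
have s2 : smooth_at 0 (fun x => c' (vec2 (x 0 0) (y x))) by exact: smooth_at_comp0.
have tc'01 : tc 0 1 c' = 0 by apply: tc'j; rewrite ltnS ltnW.
have tc'10 : tc 1 0 c' = 0.
  have := (tc_comp1 sc' sX1 sy X10 y0).1; rewrite (tc_ext 1 0 s2 sc Ec') tc'01 tc_X1b /= t10.
  by rewrite mulr1 mul0r addr0 => <-.
rewrite c0 in c'0; rewrite b00 in b'0.
have tc'11 : tc 1 1 c' = tc 1 1 c.
  have [_ + _] := tc_comp2 sc' sX1 sy X10 y0 c'0 tc'10 tc'01.
  have t02 : tc 0 2 c' = 0 by apply: tc'j; rewrite ltnS.
  rewrite (tc_ext 1 1 s2 sc Ec') t02 ty !tc_X1b /= => ->; ring.
pose p x := - hq 0 b' x.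
have sp : smooth_at 0 p by apply: smooth_at_opp; exact: smooth_at_hq.
have p0 : p 0 = 0 by rewrite /p -[hq 0 b' 0]/(tc 1 0 b') tb'10 oppr0.
have Vp : forall j, (j < 1)%N -> tc 0 j p = 0 by case=> [|j] // _; exact: p0.
have [p1 [sp1 ip1 _ Ep1]] := axis1_div sp Vp.
pose c2 x := c' x + 2 * p x * b' x + p x ^+ 2 * x 0 0.
have sc2 : smooth_at 0 c2 by rewrite /c2; smooth.
have c2_axis : \near0 x, c2 (setc 0 0 x) =
    x 0 1 ^+ k.+1 * (g x + 2 * p1 x * b0 x).
  apply: filter_app c'_axis; apply: filterS b'_axis => x; rewrite /c2 => -> ->.
  by rewrite Ep1 mxE /= exprS; ring.
have b2E : \near0 x, b' x + p x * x 0 0 = x 0 1 ^+ k * b0 x.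
  by apply: filterS b'_axis => x E; rewrite [b' x](hqE 0) E /p; ring.
have c2_0 : \near0 x, c2 (setc 1 0 x) = 0.
  have D0 : \near0 x, x 0 0 * c' (setc 1 0 x) - b' (setc 1 0 x) ^+ 2 = 0.
    have sPhi : smooth_at 0 (fun x => vec2 (x 0 0) (ze x)) by exact: smooth_at_vec2.
    have Phi0 : vec2 ((0 : 'rV[R]_2) 0 0) (ze 0) = 0 by rewrite ze0 X10 vec200.
    apply: filter_app ZD; apply: filter_app (near_comp sPhi Phi0 Ec').
    apply: filterS (near_comp sPhi Phi0 Eb') => x.
    rewrite vec2_1; have -> : y (vec2 (x 0 0) (ze x)) = 0.
      rewrite /y vec2_2; have -> : ze (vec2 (x 0 0) (ze x)) = ze x; last by rewrite subrr.
      by rewrite -ize setc_vec2_2 vec2_1 -(setc_vec2_2 0 x) ize.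
    by rewrite -(setc_vec2_2 0 x) => -> ->.
  have s3 : smooth_at 0 (fun x => c2 (setc 1 0 x)) by exact: smooth_at_axis.
  apply: (coord_cancel (i := 0)) => //; first by smooth.
  apply: filter_app D0; apply: filterS (near_setc0 1 b2E) => x.
  have -> : (setc 1 0 x) 0 1 = 0 :> R by rewrite mxE.
  have -> : (setc 1 0 x) 0 0 = x 0 0 :> R by rewrite mxE.
  rewrite k0 mul0r /c2 => H1 H2; rewrite mulr0.
  have -> : (setc 1 0 x) 0 0 = x 0 0 :> R by rewrite mxE.
  transitivity ((x 0 0 * c' (setc 1 0 x) - b' (setc 1 0 x) ^+ 2) +
    (b' (setc 1 0 x) + p (setc 1 0 x) * x 0 0) ^+ 2); last by rewrite H1 H2 expr0n addr0.
  ring.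
pose e := hq 1 c2; have se : smooth_at 0 e by exact: smooth_at_hq.
have Ee : \near0 x, c2 x = x 0 1 * e x.
  by apply: filterS c2_0 => x E; rewrite [LHS](hqE 1) E add0r.
pose g' x := g x + 2 * p1 x * b0 x; have sg' : smooth_at 0 g' by rewrite /g'; smooth.
have e_axis : \near0 x, e (setc 0 0 x) = x 0 1 ^+ k * g' x.
  apply: (coord_cancel (i := 1)); [exact: smooth_at_axis|by smooth|].
  apply: filter_app (near_setc0 0 Ee); apply: filterS c2_axis => x -> E1.
  by rewrite mulrA -exprS /g' E1 mxE.
pose K := hq 0 e; have sK : smooth_at 0 K by exact: smooth_at_hq.
have tc11 : tc 1 1 c2 = tc 1 1 c.
  have s2p : smooth_at 0 (fun x => 2 * p x) by smooth.
  rewrite /c2 !tcD; try by smooth.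
  have [_ U _] := tc_sqr sp sp p0 p0 sX1.
  rewrite -[X in _ + tc 1 1 X](_ : (fun x => p x * p x * x 0 0) = _); last first.
    by apply/funext => x; rewrite expr2.
  by rewrite U X10 (tc11M s2p sb1) tb'10 tb'01 b'0 p0 tc'11; ring.
have nK : K 0 != 0.
  by rewrite -[K 0]/(tc 1 0 e) tc_hq2 tc11.
apply: simple_equiv (simple_NF9_quad sb sK sg' ib nb nK k2).
apply: G_equiv_trans (@germ3_coord2 R b c b' c' y sy y0 nty Eb' Ec') _.
apply: G_equiv_trans (@G_equiv_shear R X1 b' c' p sp) _.
apply: G_equiv_near; apply: filter_app b2E; apply: filter_app Ee; apply: filterS e_axis => x Ea Ee Eb.
rewrite /germ3 Eb -/(c2 x) Ee; congr sym2.
by rewrite [e x](hqE 0) Ea addrC.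
Qed.

End FamilyNine.

(** * Family 10 and the two lower bounds *)

Section FamilyTen.
Variable R : realType.
Implicit Types (x v : 'rV[R]_2) (a b c f g h u z : 'rV[R]_2 -> R) (A B : 'rV[R]_2 -> 'M[R]_2).

Local Notation X1 := (fun x : 'rV[R]_2 => x 0 0).
Local Notation X2 := (fun x : 'rV[R]_2 => x 0 1).

Lemma odd_root h l : smooth_at 0 h -> h 0 != 0 -> odd l ->
  exists m : 'rV[R]_2 -> R, [/\ smooth_at 0 m, m 0 != 0 &
    \near0 x, m x ^+ l = h x].
Proof.
move=> sh n ol; have [s es] := pick_sign n.
have sh' : smooth_at 0 (fun x => (-1) ^+ s * h x) by smooth.
have l0 : (0 < l)%N by case: l ol.
have [M [sM M0 EM]] := unit_root sh' es l0.
exists (fun x => (-1) ^+ s * M x); split; [by smooth| |].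
  by rewrite mulf_neq0 ?signr_eq0 // gt_eqF.
apply: filterS EM => x EM; rewrite exprMn EM.
have -> : ((-1) ^+ s : R) ^+ l = (-1) ^+ s.
  have H (r : bool) : ((-1) ^+ r : R) ^+ l = (-1) ^+ r.
    by case: r; rewrite ?expr0 ?expr1n // expr1 -signr_odd ol.
  exact: H.
by rewrite mulrA sqr_sign mul1r.
Qed.

Lemma tc_pd1 i j f (f1 f2 : 'rV[R]_2 -> R) : pd f f1 f2 -> tc i j f1 = i.+1%:R * tc i.+1 j f.
Proof.
elim: i f f1 f2 => [|i IH] f f1 f2 pf; have [sf s1 s2 _] := pf.
all: have sg := smooth_at_hq 0 sf; have sx := smooth_at_axis 0 sf.
all: have P := pd_add (pd_indep1 sx (fun x => congr1 f (setcK 0 0 0 x))) (pd_mul (@pd_X1 R) (pd_gen sg)).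
all: have Ef : f = (fun x => f (setc 0 0 x) + x 0 0 * hq 0 f x) by apply/funext => x; exact: hqE.
all: rewrite -Ef in P; have [F1 _] := pd_uniq pf; have [F2 _] := pd_uniq P.
all: have sd : smooth_at 0 ('D_(delta_mx 0 0) (hq 0 f)) by exact: smooth_at_derive.
all: have F : \near0 x, f1 x = hq 0 f x + x 0 0 * 'D_(delta_mx 0 0) (hq 0 f) x
  by apply: filter_app F1; apply: filterS F2 => x -> <-; rewrite add0r mul1r.
  rewrite (tc_ext 0 j s1 _ F); last by smooth.
  by rewrite tcD ?tc_mulX1 ?tc_hq1 ?addr0 ?mul1r //; smooth.
rewrite (tc_ext i.+1 j s1 _ F); last by smooth.
rewrite tcD ?tc_mulX1 ?tc_hq1 //; try by smooth.
by rewrite (IH _ _ _ (pd_gen sg)) tc_hq1 // -[i.+2%:R]natr1; ring.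
Qed.

Lemma tc_pd2 i j f (f1 f2 : 'rV[R]_2 -> R) : pd f f1 f2 -> tc i j f2 = j.+1%:R * tc i j.+1 f.
Proof.
elim: j f f1 f2 => [|j IH] f f1 f2 pf; have [sf s1 s2 _] := pf.
all: have sg := smooth_at_hq 1 sf; have sx := smooth_at_axis 1 sf.
all: have P := pd_add (pd_indep2 sx (fun x => congr1 f (setcK 1 0 0 x))) (pd_mul (@pd_X2 R) (pd_gen sg)).
all: have Ef : f = (fun x => f (setc 1 0 x) + x 0 1 * hq 1 f x) by apply/funext => x; exact: hqE.
all: rewrite -Ef in P; have [_ F1] := pd_uniq pf; have [_ F2] := pd_uniq P.
all: have sd : smooth_at 0 ('D_(delta_mx 0 1) (hq 1 f)) by exact: smooth_at_derive.
all: have F : \near0 x, f2 x = hq 1 f x + x 0 1 * 'D_(delta_mx 0 1) (hq 1 f) x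
  by apply: filter_app F1; apply: filterS F2 => x -> <-; rewrite add0r mul1r.
  rewrite (tc_ext i 0 s2 _ F); last by smooth.
  by rewrite tcD ?tc_mulX2 ?tc_hq2 ?addr0 ?mul1r //; smooth.
rewrite (tc_ext i j.+1 s2 _ F); last by smooth.
rewrite tcD ?tc_mulX2 ?tc_hq2 //; try by smooth.
by rewrite (IH _ _ _ (pd_gen sg)) tc_hq2 -[j.+2%:R]natr1; ring.
Qed.

Lemma codim_ge_fin (I : finType) A d m (L : I -> ('rV[R]_2 -> 'M[R]_2) -> R)
    (E : I -> 'rV[R]_2 -> 'M[R]_2) (W : 'I_m -> I -> R) :
  Ge_codim A d -> (forall i, germ_functional (L i)) ->
  (forall T, smooth_at 0 T -> Ge_tangent A T ->
    exists p : 'I_m -> R, forall i, L i T = \sum_j p j * W j i) ->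
  (forall i, sym_germ (E i)) -> (forall i j, L i (E j) = (i == j)%:R) -> (#|I| <= m + d)%N.
Proof.
move=> cA lL LT sE LE.
apply: (@codim_ge R A d m #|I| (fun C => \row_k L (enum_val k) C)
  (\matrix_(j, k) W j (enum_val k)) (fun k => E (enum_val k)) cA).
- by apply: functional_linear => i.
- move=> T sT tT; have [p Hp] := LT T sT tT; exists (\row_j p j).
  by apply/rowP => k; rewrite !mxE Hp; apply: eq_bigr => j _; rewrite !mxE.
- by move=> i; exact: sE.
- move=> i; apply/rowP => j; rewrite !mxE LE eqxx /=.
  by rewrite (inj_eq enum_val_inj) eq_sym.
Qed.

(** Completing the cube: [y = x2 + x1 u] with [u = m / (3 g)] removes [x1 x2^2], and what is left
    besides [g y^3] is [x1^2] times a unit. Since 3 is odd, the sign of the cubic term is absorbed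
    into the coordinate. *)
Lemma simple_NF10 c h : smooth_at 0 c -> smooth_at 0 h -> h 0 != 0 ->
  (\near0 x, c (setc 0 0 x) = x 0 1 ^+ 3 * h x) ->
  tc 1 0 c = 0 -> tc 1 1 c = 0 -> tc 2 0 c != 0 -> simple (germ3 X1 (fun=> 0) c).
Proof.
move=> sc sh nh Eh t10 t11 n20.
have sX1 : smooth_at 0 X1 by smooth.
have X10 : (0 : 'rV[R]_2) 0 0 = 0 by rewrite mxE.
have X20 : (0 : 'rV[R]_2) 0 1 = 0 by rewrite mxE.
pose c1 := hq 0 c; have sc1 : smooth_at 0 c1 by exact: smooth_at_hq.
have V : forall j, (j < 2)%N -> tc 0 j c1 = 0.
  by case=> [|[|]] // _; rewrite /c1 tc_hq1.
have [m [sm im _ Em]] := axis1_div sc1 V.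
pose A := hq 0 c1; have sA : smooth_at 0 A by exact: smooth_at_hq.
have A0 : A 0 = tc 2 0 c by [].
pose g x := h (setc 0 0 x); have sg : smooth_at 0 g by exact: smooth_at_axis.
have g0 : g 0 != 0 by rewrite /g setc00.
have Ec : \near0 x,
    c x = x 0 0 ^+ 2 * A x + x 0 0 * x 0 1 ^+ 2 * m x + x 0 1 ^+ 3 * g x.
  apply: filterS (near_setc0 0 Eh) => x; rewrite setcK mxE /= => H.
  by rewrite [LHS](hqE 0) H -/c1 [c1 x](hqE 0) Em /g -/A; ring.
have sg3 : smooth_at 0 (fun x => (3%:R * g x)^-1).
  by apply: smooth_at_inv; [smooth|rewrite mulf_neq0 // pnatr_eq0].
pose u x := m x * (3%:R * g x)^-1; have su : smooth_at 0 u by rewrite /u; smooth.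
pose e x := A x - 3%:R * g x * x 0 1 * u x ^+ 2 - g x * x 0 0 * u x ^+ 3.
have se : smooth_at 0 e by rewrite /e; smooth.
have e0 : e 0 != 0 by rewrite /e X10 X20 !(mulr0, mul0r) !subr0 A0.
pose y x := x 0 1 + x 0 0 * u x; have sy : smooth_at 0 y by rewrite /y; smooth.
have Ec' : \near0 x, c x = g x * y x ^+ 3 + x 0 0 ^+ 2 * e x.
  apply: filter_app Ec; apply: filterS (near_neq0 sg g0) => x gx ->.
  have -> : m x = 3%:R * g x * u x by rewrite /u mulrC divfK // mulf_neq0 // pnatr_eq0.
  by rewrite /y /e; move: (A x) (g x) (u x) => p1 p2 p3; ring.
have [s [t [st t0 Et]]] := unit_scale se e0.
have sr : smooth_at 0 (fun x => t x ^+ 2 * g x) by smooth.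
have r0 : t 0 ^+ 2 * g 0 != 0 by rewrite mulf_neq0 // expf_neq0.
have [M [sM M0 EM]] := odd_root sr r0 (isT : odd 3).
exists (NF10 s); split=> //; rewrite nf_germE.
apply: G_equiv_trans (@germ3_scale2 _ _ _ t st t0) _.
pose z x := y x * M x; have sz : smooth_at 0 z by rewrite /z; smooth.
have y0 : y 0 = 0 by rewrite /y X10 X20 mul0r addr0.
apply: (germ3_coord2 sz).
- by rewrite /z y0 mul0r.
- rewrite /z (tc01M sy sM) y0 mul0r add0r mulf_neq0 // /y tcD; [|smooth|smooth].
  by rewrite tc_X2b tc_mulX1 // addr0 oner_neq0.
- by apply: near_all => x; rewrite mulr0.
- apply: filter_app Ec'; apply: filter_app Et; apply: filterS EM => x EM Et ->.
  rewrite /nf_c vec2_1 vec2_2 /z exprMn EM -Et.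
  by move: (t x) (g x) (y x) (e x) => p1 p2 p3 p4; ring.
Qed.

(** Coefficients of a tangent vector as explicit bilinear sums, with [v1] already eliminated and
    [bu] standing for [b u3]. When the low coefficients of [b] and [c] vanish, few coefficients of
    the field and of [U] survive in them. *)
Lemma tangent_X1_tc b c T : smooth_at 0 b -> smooth_at 0 c -> (forall x, b (setc 0 0 x) = b x) ->
  smooth_at 0 T -> Ge_tangent (germ3 X1 b c) T ->
  exists v2 u1 u2 u3 u4 bu : 'rV[R]_2 -> R,
  [/\ forall i j, e12 i j T =
        \sum_(k < i.+1) \sum_(l < j.+1) l.+1%:R * tc k l.+1 b * tc (i - k) (j - l) v2 +
        (if i is i'.+1 then tc i' j u2 else 0) +
        \sum_(k < i.+1) \sum_(l < j.+1) tc k l b * (tc (i - k) (j - l) u1 + tc (i - k) (j - l) u4) +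
        \sum_(k < i.+1) \sum_(l < j.+1) tc k l c * tc (i - k) (j - l) u3,
      forall i j, e22 ('D_(delta_mx 0 0) c) i j T =
        \sum_(k < i.+1) \sum_(l < j.+1) l.+1%:R * tc k l.+1 c * tc (i - k) (j - l) v2 +
        2 * (\sum_(k < i.+1) \sum_(l < j.+1) tc k l b * tc (i - k) (j - l) u2) +
        2 * (\sum_(k < i.+1) \sum_(l < j.+1) tc k l c * tc (i - k) (j - l) u4) +
        (- 2) * (\sum_(k < i.+1) \sum_(l < j.+1) k.+1%:R * tc k.+1 l c *
          ((if (i - k)%N is i'.+1 then tc i' (j - l) u1 else 0) + tc (i - k) (j - l) bu)) &
      forall i j, tc i j bu = \sum_(k < i.+1) \sum_(l < j.+1) tc k l b * tc (i - k) (j - l) u3].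
Proof.
move=> sb sc ib; have Pb := pd_indep1 sb ib; have Pc := pd_gen sc; have P1 := @pd_X1 R.
have [_ sc1 sc2 _] := Pc; have [_ _ sb2 _] := Pb.
set c1 := 'D_(delta_mx 0 0) c in Pc sc1 *; set c2 := 'D_(delta_mx 0 1) c in Pc sc2 *.
set b2 := 'D_(delta_mx 0 1) b in Pb sb2 *.
tangent_entries P1 Pb Pc T.
exists v2, u1, u2, u3, u4, (fun x => b x * u3 x).
have su14 : smooth_at 0 (fun x => u1 x + u4 x) by exact: smooth_at_add.
have sbu : smooth_at 0 (fun x => b x * u3 x) by exact: smooth_at_mul.
have sX1 : smooth_at 0 X1 by exact: smooth_at_X.
have sxu1 := smooth_at_mul sX1 su1; have sxu2 := smooth_at_mul sX1 su2.
have sxu : smooth_at 0 (fun x => x 0 0 * u1 x + b x * u3 x) by exact: smooth_at_add.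
have scx := smooth_at_mul sc1 sxu; have sbv := smooth_at_mul sb2 sv2.
have sbu14 := smooth_at_mul sb su14; have scu3 := smooth_at_mul sc su3.
have scv := smooth_at_mul sc2 sv2; have sbu2 := smooth_at_mul sb su2; have scu4 := smooth_at_mul sc su4.
have s2 := @smooth_at_cst R 'rV[R]_2 R 0 2; have sm2 := @smooth_at_cst R 'rV[R]_2 R 0 (- 2).
have sb2u := smooth_at_mul s2 sbu2; have sc2u := smooth_at_mul s2 scu4; have smcx := smooth_at_mul sm2 scx.
have D2 i j (f g : 'rV[R]_2 -> R) : smooth_at 0 f -> smooth_at 0 g ->
    tc i j (fun x => f x + g x) = tc i j f + tc i j g := @tcD R i j f g.
split=> i j.
- have G1 : \near0 x, T x 0 1 =
      b2 x * v2 x + x 0 0 * u2 x + b x * (u1 x + u4 x) + c x * u3 x.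
    by apply: filterS E12 => x ->; rewrite mul0r add0r.
  have sG := smooth_at_add (smooth_at_add (smooth_at_add sbv sxu2) sbu14) scu3.
  rewrite e12E (tc_ext i j sT12 sG G1) (tcD i j (smooth_at_add (smooth_at_add sbv sxu2) sbu14) scu3).
  rewrite (tcD i j (smooth_at_add sbv sxu2) sbu14) (tcD i j sbv sxu2) tc_mulX1 //.
  rewrite (tcM i j sb2 sv2) (tcM i j sb su14) (tcM i j sc su3).
  congr (_ + _ + _ + _); apply: eq_bigr => k _; apply: eq_bigr => l _.
    by rewrite (tc_pd2 k l Pb).
  by rewrite tcD.
- have G2 : \near0 x, T x 1 1 - c1 x * T x 0 0 =
      c2 x * v2 x + 2 * (b x * u2 x) + 2 * (c x * u4 x) +
      (- 2) * (c1 x * (x 0 0 * u1 x + b x * u3 x)).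
    by apply: filter_app E11; apply: filterS E22 => x -> ->; ring.
  have sL := smooth_at_sub sT22 (smooth_at_mul sc1 sT11).
  have sG := smooth_at_add (smooth_at_add (smooth_at_add scv sb2u) sc2u) smcx.
  rewrite e22E (tc_ext i j sL sG G2) (tcD i j (smooth_at_add (smooth_at_add scv sb2u) sc2u) smcx).
  rewrite (tcD i j (smooth_at_add scv sb2u) sc2u) (tcD i j scv sb2u).
  rewrite (tcZ i j 2 sbu2) (tcZ i j 2 scu4) (tcZ i j (- 2) scx).
  rewrite (tcM i j sc2 sv2) (tcM i j sb su2) (tcM i j sc su4) (tcM i j sc1 sxu).
  congr (_ + _ + _ + _ * _); apply: eq_bigr => k _; apply: eq_bigr => l _.
    by rewrite (tc_pd2 k l Pc).
  by rewrite (tc_pd1 k l Pc) (tcD _ _ sxu1 sbu) tc_mulX1.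
- exact: tcM.
Qed.

(* with fewer than [9] relations unaccounted for, the codimension is at least [9] *)
Lemma codim_X1_ge b c d (s1 s2 : seq (nat * nat)) m (W : 'I_m -> nat -> R) :
  smooth_at 0 b -> smooth_at 0 c -> (forall x, b (setc 0 0 x) = b x) ->
  uniq s1 -> uniq s2 -> Ge_codim (germ3 X1 b c) d ->
  (forall T, smooth_at 0 T -> Ge_tangent (germ3 X1 b c) T -> exists p : 'I_m -> R,
    (forall i, (i < size s1)%N ->
      e12 (nth (0, 0)%N s1 i).1 (nth (0, 0)%N s1 i).2 T = \sum_j p j * W j i) /\
    (forall i, (i < size s2)%N ->
      e22 ('D_(delta_mx 0 0) c) (nth (0, 0)%N s2 i).1 (nth (0, 0)%N s2 i).2 T =
      \sum_j p j * W j (size s1 + i)%N)) ->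
  (size s1 + size s2 <= m + d)%N.
Proof.
move=> sb sc ib n1 n2 cd HT.
have [_ sc1 _ _] := pd_gen sc.
rewrite (_ : (size s1 + size s2)%N = #|{: 'I_(size s1) + 'I_(size s2)}|); last first.
  by rewrite card_sum !card_ord.
pose L (i : 'I_(size s1) + 'I_(size s2)) := match i with
  | inl i => e12 (nth (0, 0)%N s1 i).1 (nth (0, 0)%N s1 i).2
  | inr i => e22 ('D_(delta_mx 0 0) c) (nth (0, 0)%N s2 i).1 (nth (0, 0)%N s2 i).2 end.
pose E (i : 'I_(size s1) + 'I_(size s2)) := match i with
  | inl i => germ3 (fun=> 0) (fun x : 'rV[R]_2 => x 0 0 ^+ (nth (0, 0)%N s1 i).1 * x 0 1 ^+ (nth (0, 0)%N s1 i).2) (fun=> 0)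
  | inr i => germ3 (fun=> 0) (fun=> 0) (fun x : 'rV[R]_2 => x 0 0 ^+ (nth (0, 0)%N s2 i).1 * x 0 1 ^+ (nth (0, 0)%N s2 i).2) end.
apply: (codim_ge_fin (L := L) (E := E)
  (W := fun j i => match i with inl i => W j i | inr i => W j (size s1 + i)%N end) cd).
- by case=> i; [exact: e12_functional|exact: e22_functional].
- move=> T sT /(HT T sT)[p [H1 H2]]; exists p.
  by case=> i; [exact: H1|exact: H2].
- by case=> i; apply: sym_germ3; smooth.
- have K s (n : uniq s) (i j : 'I_(size s)) : ((nth (0, 0)%N s i).1 == (nth (0, 0)%N s j).1) &&
      ((nth (0, 0)%N s i).2 == (nth (0, 0)%N s j).2) = (i == j).
    have -> : (i == j) = (nth (0, 0)%N s i == nth (0, 0)%N s j) by rewrite nth_uniq.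
    by case: (nth _ s i); case: (nth _ s j).
  case=> [i|i] [j|j]; rewrite /L /E !tcE //; first by rewrite (K _ n1).
  by rewrite (K _ n2).
Qed.

Ltac expand_sums := rewrite ?big_ord_recl ?big_ord0 /= ?big_ord_recl ?big_ord0 /= /bump
  ?leq0n /= ?add1n ?subSS ?subn0.

(** Fifteen functionals are evaluated on the tangent space. Under the vanishing assumptions their
    values depend linearly on six Taylor coefficients, so at least nine dimensions are left for the
    quotient. *)
Lemma contra_cubic b c d : smooth_at 0 b -> smooth_at 0 c -> (forall x, b (setc 0 0 x) = b x) ->
  b 0 = 0 -> tc 0 1 b = 0 -> tc 0 2 b = 0 ->
  c 0 = 0 -> tc 0 1 c = 0 -> tc 0 2 c = 0 -> tc 0 3 c = 0 -> tc 1 0 c = 0 -> tc 1 1 c = 0 ->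
  Ge_codim (germ3 X1 b c) d -> (9 <= d)%N.
Proof.
move=> sb sc ib b0 b01 b02 c00 c01 c02 c03 c10 c11 cd.
have tb i j : tc i.+1 j b = 0 by rewrite tc_indep1.
have b00 : tc 0 0 b = 0 by [].
have c000 : tc 0 0 c = 0 by [].
pose K1 := tc 0 3 b; pose k4 := tc 0 4 c; pose m := tc 1 2 c; pose n := tc 2 0 c.
(* One row per parameter, in the order of the list given below; the first six columns belong to
   [C12], the other nine to [C22]. *)
pose W := [:: [:: 0; 0; 3%:R * K1; 0; 4%:R * tc 0 4 b; 0; 0; 0; 0; 0; 4%:R * k4; 2 * m; 5%:R * tc 0 5 c; 3%:R * tc 1 3 c; tc 2 1 c];
   [:: 0; 0; 0; 1; 0; 0; 0; 0; 0; 0; 2 * K1; 0; 2 * tc 0 4 b; 0; 0];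
   [:: 0; 0; 0; 0; 3%:R * K1; 0; 0; 0; 0; 0; 0; 0; 4%:R * k4; 2 * m; 0];
   [:: 0; 0; 0; 0; 0; 1; 0; 0; 0; 0; 0; 0; 2 * K1; 0; 0];
   [:: 0; 0; 0; 0; K1; 0; 0; 0; 0; 0; 0; 0; 0; - 2 * m; - 4%:R * n];
   [:: 0; 0; 0; 0; K1; 0; 0; 0; 0; 0; 0; 0; 2 * k4; 2 * m; 2 * n]].
suff : (6 + 9 <= 6 + d)%N by [].
apply: (@codim_X1_ge b c d [:: (0, 0); (0, 1); (0, 2); (1, 0); (0, 3); (1, 1)]%N
  [:: (0, 0); (0, 1); (0, 2); (1, 0); (0, 3); (1, 1); (0, 4); (1, 2); (2, 0)]%N
  6 (fun j i => (nth [::] W j)`_i) sb sc ib isT isT cd) => T sT tT.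
have [v2 [u1 [u2 [u3 [u4 [bu [H1 H2 H3]]]]]]] := tangent_X1_tc sb sc ib sT tT.
have Q := (tb, b00, b01, b02, c000, c01, c02, c03, c10, c11).
exists (fun j => [:: tc 0 0 v2; tc 0 0 u2; tc 0 1 v2; tc 0 1 u2; tc 0 0 u1; tc 0 0 u4]`_j).
split=> i.
  by case: i => [|[|[|[|[|[|i]]]]]] // _; rewrite H1; expand_sums; rewrite ?Q /K1; ring.
case: i => [|[|[|[|[|[|[|[|[|i]]]]]]]]] // _; rewrite H2; expand_sums; rewrite ?H3;
  by expand_sums; rewrite ?Q /K1 /k4 /m /n; ring.
Qed.

(** The sixteen functionals meet eight Taylor coefficients of the field and of [U], which alone
    would only give 8; hence the need to merge one of them with the others. *)
Lemma contra_quartic b c d : smooth_at 0 b -> smooth_at 0 c -> (forall x, b (setc 0 0 x) = b x) ->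
  b 0 = 0 -> tc 0 1 b = 0 -> c 0 = 0 -> tc 0 1 c = 0 -> tc 0 2 c = 0 -> tc 1 0 c = 0 ->
  tc 1 1 c = 0 -> tc 2 0 c = 0 -> Ge_codim (germ3 X1 b c) d -> (9 <= d)%N.
Proof.
move=> sb sc ib b0 b01 c00 c01 c02 c10 c11 c20 cd.
have tb i j : tc i.+1 j b = 0 by rewrite tc_indep1.
have b00 : tc 0 0 b = 0 by [].
have c000 : tc 0 0 c = 0 by [].
pose B := tc 0 2 b; pose b3 := tc 0 3 b; pose c03 := tc 0 3 c; pose c12 := tc 1 2 c.
pose c21 := tc 2 1 c; pose c30 := tc 3 0 c.
pose W := [:: [:: 0; 0; 2 * B; 0; 0; 3%:R * b3; 0; 0; 0; c21; 2 * c12; 3%:R * c03;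
     tc 3 1 c; 2 * tc 2 2 c; 3%:R * tc 1 3 c; 4%:R * tc 0 4 c];
   [:: 0; 1; 0; 0; 0; 0; 0; 0; 0; 0; 0; 2 * B; 0; 0; 0; 2 * b3];
   [:: 0; 0; 0; 0; 2 * B; 0; 0; 0; 0; 0; 0; 0; c21; 2 * c12; 3%:R * c03; 0];
   [:: 0; 0; 0; 1; 0; 0; 0; 0; 0; 0; 0; 0; 0; 0; 2 * B; 0];
   [:: 0; 0; 0; 0; 1; 0; 0; 0; 0; 0; 0; 0; 0; 0; 0; 2 * B];
   [:: 0; 0; 0; 0; 0; B; 0; 0; 0; 0; 0; 0; - 6%:R * c30; - 4%:R * c21; - 2 * c12; 0];
   [:: 0; 0; 0; 0; 0; B; 0; 0; 0; 0; 0; 0; 2 * c30; 2 * c21; 2 * c12; 2 * c03]].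
suff : (6 + 10 <= 7 + d)%N by [].
apply: (@codim_X1_ge b c d [:: (0, 0); (1, 0); (0, 1); (2, 0); (1, 1); (0, 2)]%N
  [:: (0, 0); (1, 0); (0, 1); (2, 0); (1, 1); (0, 2); (3, 0); (2, 1); (1, 2); (0, 3)]%N
  7 (fun j i => (nth [::] W j)`_i) sb sc ib isT isT cd) => T sT tT.
have [v2 [u1 [u2 [u3 [u4 [bu [H1 H2 H3]]]]]]] := tangent_X1_tc sb sc ib sT tT.
have Q := (tb, b00, b01, c000, c01, c02, c10, c11, c20).
(* Euler's relation [x1 c1 + x2 c2 = 3 c] for the cubic part absorbs the parameter [tc 0 1 v2] *)
exists (fun j => [:: tc 0 0 v2; tc 0 0 u2; tc 1 0 v2; tc 1 0 u2; tc 0 1 u2;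
  tc 0 0 u1 + tc 0 1 v2 / 2; tc 0 0 u4 + 3%:R * tc 0 1 v2 / 2]`_j).
split=> i.
  by case: i => [|[|[|[|[|[|i]]]]]] // _; rewrite H1; expand_sums; rewrite ?Q /B /b3; field.
case: i => [|[|[|[|[|[|[|[|[|[|i]]]]]]]]]] // _; rewrite H2; expand_sums; rewrite ?H3;
  by expand_sums; rewrite ?Q /B /b3 /c03 /c12 /c21 /c30; field.
Qed.

End FamilyTen.

(** * Family 6 *)

Section FamilySix.
Variable R : realType.
Implicit Types (x v : 'rV[R]_2) (a b c f g h u z e m : 'rV[R]_2 -> R) (A B : 'rV[R]_2 -> 'M[R]_2).

Local Notation X1 := (fun x : 'rV[R]_2 => x 0 0).
Local Notation X2 := (fun x : 'rV[R]_2 => x 0 1).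

(** Once [t^2 e] is a sign, the sign of [t] is still free; it is chosen to make [t b] positive at 0,
    and a square root of [t b] then rescales [x2]. *)
Lemma simple_NF6_unit b e : smooth_at 0 b -> smooth_at 0 e -> b 0 != 0 -> e 0 != 0 ->
  simple (germ3 X1 (fun x => x 0 1 ^+ 2 * b x) (fun x => x 0 0 ^+ 2 * e x)).
Proof.
move=> sb se nb ne; have [s [t0 [st0 nt0 Et0]]] := unit_scale se ne.
have ntb : t0 0 * b 0 != 0 by rewrite mulf_neq0.
have [r er] := pick_sign ntb.
pose t x := (-1) ^+ r * t0 x; have st : smooth_at 0 t by rewrite /t; smooth.
have nt : t 0 != 0 by rewrite mulf_neq0 // signr_eq0.
have Et : \near0 x, t x ^+ 2 * e x = (-1) ^+ s.
  apply: filterS Et0 => x <-; rewrite /t exprMn expr2.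
  by rewrite sqr_sign mul1r.
have stb : smooth_at 0 (fun x => t x * b x) by smooth.
have ptb : 0 < t 0 * b 0 by rewrite /t -mulrA.
have [M [sM M0 EM]] := unit_root stb ptb (isT : (0 < 2)%N).
exists (NF6 s); split=> //; rewrite nf_germE.
apply: G_equiv_trans (@germ3_scale2 _ _ _ t st nt) _.
pose y x := x 0 1 * M x; have sy : smooth_at 0 y by rewrite /y; smooth.
have sX2 : smooth_at 0 X2 by smooth.
apply: (germ3_coord2 sy).
- by rewrite /y mxE mul0r.
- by rewrite /y (tc01M sX2 sM) tc_X2b mxE /= mul0r add0r mul1r gt_eqF.
- apply: filterS EM => x EM; rewrite /nf_b vec2_2 /y exprMn EM.
  by move: (t x) (b x) => p1 p2; ring.
- apply: filterS Et => x Et; rewrite /nf_c vec2_1 -Et.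
  by move: (t x) (e x) => p1 p2; ring.
Qed.

(** The obstruction to making the corner a multiple of the square of the new first entry
    [x1 w + x2^2 v], under the congruence [(1, p; q, 1)] with [p = x1 pt + x2^2 ph]. [pt] clears
    [x1^2] off the diagonal, [ph] matches the coefficients of [x2^4], and the value is the mismatch
    in [x1 x2^2]; [X] and [Y] stand for [x1] and [x2^2]. *)
Definition F6 (b e m X Y q : R) : R :=
  let pt := - q * e in let w := 1 + q ^+ 2 * (e * X + m * Y) in let v := 2 * q * b in
  let ph := (e + X * pt ^+ 2) * v ^+ 2 * (2 * b * w ^+ 2 - 2 * Y * pt * v ^+ 2)^-1 in
  let E := e + X * pt ^+ 2 + 2 * Y * pt * ph in
  m + 2 * pt * b + Y * ph ^+ 2 - 2 * E * v * w^-1.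

(** At the origin the equation for [q] is linear, with the simple root [m / (6 e b)]. *)
Lemma F6_axis (b e m q : R) : b != 0 -> F6 b e m 0 0 q = m - 6%:R * q * e * b.
Proof. by move=> b0; rewrite /F6 !mul0r !mulr0 !mul0r !addr0 mulr0 addr0 invr1; ring. Qed.

Lemma smooth_F6 (V : normedModType R) (b e m X Y q : V -> R) (t : V) :
  smooth_at t b -> smooth_at t e -> smooth_at t m -> smooth_at t X -> smooth_at t Y -> smooth_at t q ->
  X t = 0 -> Y t = 0 -> b t != 0 -> smooth_at t (fun r : V => F6 (b r) (e r) (m r) (X r) (Y r) (q r)).
Proof.
move=> sb se sm sX sY sq X0 Y0 b0; rewrite /F6.
have sw : smooth_at t (fun z : V => 1 + q z ^+ 2 * (e z * X z + m z * Y z)) by smooth.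
have siw : smooth_at t (fun z : V => (1 + q z ^+ 2 * (e z * X z + m z * Y z))^-1).
  by apply: smooth_at_inv => //; rewrite X0 Y0 !mulr0 addr0 mulr0 addr0 oner_neq0.
have sd : smooth_at t (fun z : V => (2 * b z * (1 + q z ^+ 2 * (e z * X z + m z * Y z)) ^+ 2 -
    2 * Y z * (- q z * e z) * (2 * q z * b z) ^+ 2)^-1).
  apply: smooth_at_inv; first by smooth.
  rewrite X0 Y0 !mulr0 !mul0r addr0 mulr0 addr0 subr0 expr1n mulr1 mulf_neq0 // pnatr_eq0.
by smooth.
Qed.

(** The unknown, shifted to vanish at 0, is put into a third coordinate. Its partial derivative at 0
    only sees the line where [F6] is linear in [q]. *)
Lemma implicit_F6 b e m : smooth_at 0 b -> smooth_at 0 e -> smooth_at 0 m -> b 0 != 0 -> e 0 != 0 ->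
  exists q : 'rV[R]_2 -> R, smooth_at 0 q /\
    \near0 x, F6 (b x) (e x) (m x) (x 0 0) (x 0 1 ^+ 2) (q x) = 0.
Proof.
move=> sb se sm nb ne; pose q0 := m 0 / (6%:R * e 0 * b 0).
pose j : 'I_3 := inord 2.
have j0 : (0 == j) = false by rewrite -val_eqE /= inordK.
have j1 : (1 == j) = false by rewrite -val_eqE /= inordK.
pose pr f (y : 'rV[R]_3) := f (vec2 (y 0 0) (y 0 1)).
have spr f : smooth_at 0 f -> smooth_at 0 (pr f).
  by move=> sf; apply: smooth_at_comp0 => //; try (by rewrite mxE); exact: smooth_at_coord.
have pr0 f : pr f 0 = f 0 by rewrite /pr !mxE vec200.
pose F (y : 'rV[R]_3) := F6 (pr b y) (pr e y) (pr m y) (y 0 0) (y 0 1 ^+ 2) (q0 + y 0 j).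
have sy k : smooth_at 0 (fun y : 'rV[R]_3 => y 0 k) by exact: smooth_at_coord.
have sF : smooth_at 0 F.
  apply: smooth_F6; try exact: spr; try exact: sy.
  - by apply: smooth_at_exp; exact: sy.
  - by apply: smooth_at_add; [exact: smooth_at_cst|exact: sy].
  - by rewrite mxE.
  - by rewrite mxE expr0n.
  - by rewrite pr0.
have F0 : F 0 = 0.
  rewrite /F !pr0 !mxE expr0n /= F6_axis // addr0 /q0.
  by move: (m 0) (e 0) (b 0) ne nb => p1 p2 p3 n1 n2; field; rewrite n1 n2.
have dF : 'D_(delta_mx 0 j) F 0 = - 6%:R * e 0 * b 0.
  have -> : 'D_(delta_mx 0 j) F 0 = 'D_(delta_mx 0 j) (fun y : 'rV[R]_3 => (- 6%:R * e 0 * b 0) * y 0 j) 0.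
    apply: derive_quot => t; rewrite F0 /F /pr !addr0.
    have -> : (t *: delta_mx 0 j : 'rV[R]_3) 0 0 = 0 by rewrite !mxE j0 mulr0.
    have -> : (t *: delta_mx 0 j : 'rV[R]_3) 0 1 = 0 by rewrite !mxE j1 mulr0.
    have -> : (t *: delta_mx 0 j : 'rV[R]_3) 0 j = t by rewrite !mxE !eqxx mulr1.
    have -> : (0 : 'rV[R]_3) 0 j = 0 by rewrite mxE.
    rewrite vec200 expr0n F6_axis // /q0.
    by move: (m 0) (e 0) (b 0) ne nb => p1 p2 p3 n1 n2; field; rewrite n1 n2.
  have d1 : derivable (fun y : 'rV[R]_3 => y 0 j) 0 (delta_mx 0 j).
    by apply: diff_derivable; apply: smooth_at_differentiable.
  have d2 : derivable (fun _ : 'rV[R]_3 => - 6%:R * e 0 * b 0) 0 (delta_mx 0 j) by exact: derivable_cst.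
  apply: etrans (deriveM d2 d1) _; rewrite derive_cst scaler0 addr0 derive_coord mxE !eqxx.
  by rewrite -[_ *: _]/(_ * _) mulr1.
have nF : 'D_(delta_mx 0 j) F 0 != 0.
  by rewrite dF mulNr mulNr oppr_eq0 !mulf_neq0 // pnatr_eq0.
have [s [ss s0 is_ Es]] := implicit_function sF F0 nF.
have sPhi0 : smooth_at 0 (fun x : 'rV[R]_2 => vec3 (x 0 0) (x 0 1) 0).
  by apply: smooth_at_vec3; [exact: smooth_at_X|exact: smooth_at_X|exact: smooth_at_cst].
have Z0 : vec3 ((0 : 'rV[R]_2) 0 0) ((0 : 'rV[R]_2) 0 1) 0 = 0 by rewrite !mxE vec3000.
pose r x := s (vec3 (x 0 0) (x 0 1) 0).
have sr : smooth_at 0 r by apply: smooth_at_comp => //; rewrite Z0.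
have r0 : r 0 = 0 by rewrite /r Z0.
have sPhi : smooth_at 0 (fun x : 'rV[R]_2 => vec3 (x 0 0) (x 0 1) (r x)).
  by apply: smooth_at_vec3 => //; exact: smooth_at_X.
have Phi0 : vec3 ((0 : 'rV[R]_2) 0 0) ((0 : 'rV[R]_2) 0 1) (r 0) = 0 by rewrite r0 Z0.
exists (fun x => q0 + r x); split; first by smooth.
have v1 p1 p2 p3 : vec3 p1 p2 p3 0 0 = p1 :> R by rewrite mxE.
have v2 p1 p2 p3 : vec3 p1 p2 p3 0 1 = p2 :> R by rewrite mxE.
have v3 p1 p2 p3 : vec3 p1 p2 p3 0 j = p3 :> R by rewrite /j vec3_3.
apply: filterS (near_comp sPhi Phi0 Es) => x [_ /(_ _)].
rewrite /F /pr v1 v2 v3 vec2E; apply.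
by rewrite -is_ setc_vec3.
Qed.

(** With [q] from [implicit_F6] the corner is exactly [K a1^2], and [a1] becomes the first
    coordinate. *)
Lemma simple_NF6_quad b e m : smooth_at 0 b -> smooth_at 0 e -> smooth_at 0 m -> b 0 != 0 -> e 0 != 0 ->
  simple (germ3 X1 (fun x => x 0 1 ^+ 2 * b x)
    (fun x => x 0 0 ^+ 2 * e x + x 0 0 * x 0 1 ^+ 2 * m x)).
Proof.
move=> sb se sm nb ne; have [q [sq Eq]] := implicit_F6 sb se sm nb ne.
have sX1 : smooth_at 0 X1 by smooth.
have sX2 : smooth_at 0 X2 by smooth.
have X10 : (0 : 'rV[R]_2) 0 0 = 0 by rewrite mxE.
have X20 : (0 : 'rV[R]_2) 0 1 = 0 by rewrite mxE.
pose pt x := - q x * e x; have spt : smooth_at 0 pt by rewrite /pt; smooth.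
pose w x := 1 + q x ^+ 2 * (e x * x 0 0 + m x * x 0 1 ^+ 2).
have sw : smooth_at 0 w by rewrite /w; smooth.
have w0 : w 0 = 1 by rewrite /w X10 X20 expr0n /= !mulr0 addr0 mulr0 addr0.
have nw : w 0 != 0 by rewrite w0 oner_neq0.
pose v x := 2 * q x * b x; have sv : smooth_at 0 v by rewrite /v; smooth.
pose de x := 2 * b x * w x ^+ 2 - 2 * x 0 1 ^+ 2 * pt x * v x ^+ 2.
have sde : smooth_at 0 de by rewrite /de; smooth.
have nde : de 0 != 0.
  rewrite /de w0 X20 expr0n /= mulr0 !mul0r subr0 expr1n mulr1 mulf_neq0 // pnatr_eq0 //.
have sid := smooth_at_inv sde nde.
pose ph x := (e x + x 0 0 * pt x ^+ 2) * v x ^+ 2 * (de x)^-1.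
have sph : smooth_at 0 ph by rewrite /ph; smooth.
pose E x := e x + x 0 0 * pt x ^+ 2 + 2 * x 0 1 ^+ 2 * pt x * ph x.
have sE : smooth_at 0 E by rewrite /E; smooth.
have E0 : E 0 = e 0 by rewrite /E X10 X20 expr0n /= mulr0 !mul0r !addr0.
pose p x := x 0 0 * pt x + x 0 1 ^+ 2 * ph x; have sp : smooth_at 0 p by rewrite /p; smooth.
have p0 : p 0 = 0 by rewrite /p X10 X20 expr0n /= !mul0r addr0.
have one := @smooth_at_cst R 'rV[R]_2 R 0 1.
have J0 : 1 * 1 - p 0 * q 0 != 0 by rewrite p0 mul0r subr0 mulr1 oner_neq0.
have Q1 := @G_equiv_congr R X1 (fun x => x 0 1 ^+ 2 * b x)
  (fun x => x 0 0 ^+ 2 * e x + x 0 0 * x 0 1 ^+ 2 * m x) _ p q _ one sp sq one J0.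
pose a1 x := x 0 0 * w x + x 0 1 ^+ 2 * v x.
have sa1 : smooth_at 0 a1 by rewrite /a1; smooth.
have a10 : a1 0 = 0 by rewrite /a1 X10 X20 expr0n /= !mul0r addr0.
pose B x := x 0 0 * ph x + (1 + p x * q x) * b x + q x * m x * x 0 0.
have sB : smooth_at 0 B by rewrite /B; smooth.
have B0 : B 0 = b 0 by rewrite /B X10 p0 !mul0r mulr0 !addr0 add0r mul1r.
have siw := smooth_at_inv sw nw.
pose K x := E x * (w x)^-1 ^+ 2; have sK : smooth_at 0 K by rewrite /K; smooth.
have nK : K 0 != 0 by rewrite /K w0 invr1 expr1n mulr1 E0.
have ta1 : tc 1 0 a1 = 1.
  rewrite /a1 tcD; [|smooth|smooth].
  by rewrite tc_mulX1 // tc_mulX2n // addr0.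
have J : tc 1 0 a1 * tc 0 1 X2 - tc 0 1 a1 * tc 1 0 X2 != 0 by rewrite jac_X2 ta1 oner_neq0.
have [B2 [sB2 B20 EB2]] := change_coord sa1 sX2 a10 X20 J sB.
have [K2 [sK2 K20 EK2]] := change_coord sa1 sX2 a10 X20 J sK.
have nB2 : B2 0 != 0 by rewrite B20 B0.
have nK2 : K2 0 != 0 by rewrite K20.
apply: simple_equiv (simple_NF6_unit sB2 sK2 nB2 nK2).
apply: G_equiv_trans Q1 _; apply: (germ3_coord sa1 sX2 a10 X20 J).
- apply: near_all => x; rewrite vec2_1 /a1 /w /v.
  by move: (q x) (b x) (e x) (m x) => p1 p2 p3 p4; ring.
- apply: filterS EB2 => x ->; rewrite vec2_2 /B /p /pt.
  by move: (q x) (b x) (e x) (m x) (ph x) => p1 p2 p3 p4 p5; ring.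
- apply: filter_app EK2; apply: filter_app (near_neq0 sw nw); apply: filter_app (near_neq0 sde nde).
  apply: filterS Eq => x Eq dx wx ->; rewrite vec2_1.
  have EM : m x + 2 * pt x * b x + x 0 1 ^+ 2 * ph x ^+ 2 = 2 * E x * v x * (w x)^-1.
    by apply/eqP; rewrite -subr_eq0; apply/eqP; exact: Eq.
  have EN : 2 * ph x * b x = E x * v x ^+ 2 * (w x)^-1 ^+ 2.
    apply: (@mulIf _ (w x ^+ 2)); first by rewrite expf_neq0.
    rewrite -(mulrA (E x * v x ^+ 2)) -exprMn mulVf // expr1n mulr1 /E.
    have H : ph x * de x = (e x + x 0 0 * pt x ^+ 2) * v x ^+ 2 by rewrite /ph divfK.
    transitivity (ph x * de x + 2 * x 0 1 ^+ 2 * pt x * ph x * v x ^+ 2); last by rewrite H; ring.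
    rewrite /de.
    by move: (ph x) (b x) (w x) (pt x) (v x) => p1 p2 p3 p4 p5; ring.
  transitivity (x 0 0 ^+ 2 * E x + x 0 0 * x 0 1 ^+ 2 * (m x + 2 * pt x * b x + x 0 1 ^+ 2 * ph x ^+ 2) +
    x 0 1 ^+ 4 * (2 * ph x * b x)).
    rewrite EM EN /a1 /K; move: (w x) (v x) (E x) wx => p1 p2 p3 n1; field => //.
  rewrite /E /p; move: (pt x) (ph x) (b x) (e x) (m x) => p1 p2 p3 p4 p5; ring.
Qed.

(** A shear by a multiple of [x2] makes [c] vanish on [x1 = 0], at the price of a term in [x1 x2]
    off the diagonal. Completing the square in [y = x2 + x1 u], with a further shear by [x1 r],
    turns that entry into a unit times [y^2] again. *)
Lemma simple_NF6 b c : smooth_at 0 b -> smooth_at 0 c -> (forall x, b (setc 0 0 x) = b x) -> b 0 != 0 ->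
  van1 3 c -> tc 1 0 c = 0 -> tc 1 1 c = 0 -> tc 2 0 c != 0 ->
  simple (germ3 X1 (fun x => x 0 1 ^+ 2 * b x) c).
Proof.
move=> sb sc ib nb [_ V] t10 t11 n20.
have sX1 : smooth_at 0 X1 by smooth.
have X10 : (0 : 'rV[R]_2) 0 0 = 0 by rewrite mxE.
have X20 : (0 : 'rV[R]_2) 0 1 = 0 by rewrite mxE.
have [g [sg ig _ Eg]] := axis1_div sc V.
have s2b : smooth_at 0 (fun x => (2 * b x)^-1).
  by apply: smooth_at_inv; [smooth|rewrite mulf_neq0 // pnatr_eq0].
pose p0 x := - g x * (2 * b x)^-1; have sp0 : smooth_at 0 p0 by rewrite /p0; smooth.
have ip0 x : p0 (setc 0 0 x) = p0 x by rewrite /p0 ig ib.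
pose p x := x 0 1 * p0 x; have sp : smooth_at 0 p by rewrite /p; smooth.
pose b1 x := x 0 1 ^+ 2 * b x; have sb1 : smooth_at 0 b1 by rewrite /b1; smooth.
pose c1 x := c x + 2 * p x * b1 x + p x ^+ 2 * x 0 0.
have sc1 : smooth_at 0 c1 by rewrite /c1; smooth.
have nb' : \near0 x, b x != 0 by exact: near_neq0.
have c1_0 : \near0 x, c1 (setc 0 0 x) = 0.
  apply: filterS nb' => x bx; rewrite /c1 Eg /p /b1 ip0 ib !mxE /= /p0.
  by move: (g x) (b x) bx => q1 q2 n2; field.
pose d1 := hq 0 c1; have sd1 : smooth_at 0 d1 by exact: smooth_at_hq.
have p00 : p 0 = 0 by rewrite /p X20 mul0r.
have b10 : b1 0 = 0 by rewrite /b1 X20 expr0n mul0r.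
have tb10 : tc 1 0 b1 = 0 by rewrite /b1 tc_mulX2n.
have tb01 : tc 0 1 b1 = 0 by rewrite /b1 tc_mulX2n.
have tp10 : tc 1 0 p = 0 by rewrite /p tc_mulX2.
have s2p : smooth_at 0 (fun x => 2 * p x) by smooth.
have spp : smooth_at 0 (fun x => p x ^+ 2) by smooth.
have tc1 i j : tc i j c1 = tc i j c + tc i j (fun x => 2 * p x * b1 x) + tc i j (fun x => p x * p x * x 0 0).
  rewrite /c1; under eq_fun do rewrite expr2.
  by rewrite !tcD //; smooth.
have [U1 U2 _] := tc_sqr sp sp p00 p00 sX1.
have s2pp : smooth_at 0 (fun x => p x * p x) by smooth.
have tc10 : tc 1 0 c1 = 0.
  by rewrite tc1 t10 (tc10M s2p sb1) (tc10M s2pp sX1) p00 b10 X10 !mulr0 !mul0r !addr0.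
have tc11 : tc 1 1 c1 = 0.
  by rewrite tc1 t11 (tc11M s2p sb1) U2 p00 b10 X10 tb10 tb01 !mulr0 !mul0r !addr0.
have tc20 : tc 2 0 c1 = tc 2 0 c.
  by rewrite tc1 (tc20M s2p sb1) U1 p00 b10 X10 tb10 !mulr0 !mul0r !addr0.
have Vd : forall j, (j < 2)%N -> tc 0 j d1 = 0.
  by case=> [|[|]] // _; rewrite /d1 tc_hq1.
have [M [sM _ _ EM]] := axis1_div sd1 Vd.
pose A := hq 0 d1; have sA : smooth_at 0 A by exact: smooth_at_hq.
have A0 : A 0 = tc 2 0 c by rewrite -tc20.
have Ec1 : \near0 x, c1 x = x 0 0 ^+ 2 * A x + x 0 0 * x 0 1 ^+ 2 * M x.
  apply: filterS c1_0 => x E; rewrite [LHS](hqE 0) E -/d1 [d1 x](hqE 0) EM -/A; ring.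
pose u x := p0 x * (2 * b x)^-1; have su : smooth_at 0 u by rewrite /u; smooth.
pose y x := x 0 1 + x 0 0 * u x; have sy : smooth_at 0 y by rewrite /y; smooth.
have y0 : y 0 = 0 by rewrite /y X10 X20 mul0r addr0.
have ty : tc 0 1 y = 1.
  rewrite /y tcD; [|smooth|smooth].
  by rewrite tc_X2b tc_mulX1 // addr0.
have nty : tc 0 1 y != 0 by rewrite ty oner_neq0.
have J : tc 1 0 X1 * tc 0 1 y - tc 0 1 X1 * tc 1 0 y != 0 by rewrite jac_X1.
pose r x := b x * u x ^+ 2; have sr : smooth_at 0 r by rewrite /r; smooth.
pose e x := A x - 2 * x 0 1 * u x * M x - x 0 0 * u x ^+ 2 * M x - x 0 0 * r x ^+ 2.
have se : smooth_at 0 e by rewrite /e; smooth.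
pose m x := M x + 2 * r x * b x; have sm : smooth_at 0 m by rewrite /m; smooth.
have [b' [sb' b'0 Eb']] := change_coord sX1 sy X10 y0 J sb.
have [e' [se' e'0 Ee']] := change_coord sX1 sy X10 y0 J se.
have [m' [sm' m'0 Em']] := change_coord sX1 sy X10 y0 J sm.
have nb2 : b' 0 != 0 by rewrite b'0.
have ne2 : e' 0 != 0 by rewrite e'0 /e X10 X20 !(mulr0, mul0r) !subr0 A0.
apply: simple_equiv (simple_NF6_quad sb' se' sm' nb2 ne2).
pose p2 x := x 0 0 * r x; have sp2 : smooth_at 0 p2 by rewrite /p2; smooth.
apply: G_equiv_trans (@G_equiv_shear R X1 b1 c p sp) _.
apply: G_equiv_trans (@G_equiv_shear R X1 _ _ p2 sp2) _.
have Ep : \near0 x, p0 x = 2 * b x * u x.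
  by apply: filterS nb' => x bx; rewrite /u mulrC divfK // mulf_neq0 // pnatr_eq0.
apply: (germ3_coord2 sy y0 nty).
- apply: filter_app Ep; apply: filterS Eb' => x -> Ep; rewrite vec2_2 /b1 /p /p2 /r /y Ep; ring.
- apply: filter_app Ep; apply: filter_app Ec1; apply: filter_app Ee'; apply: filterS Em' => x -> ->.
  rewrite -/(c1 x) => -> Ep; rewrite vec2_1 vec2_2 /e /m /b1 /p /p2 /y Ep /r.
  by move: (A x) (M x) (b x) (u x) => q1 q2 q3 q4; ring.
Qed.

End FamilySix.

(** * The case distinction *)

Section Classification.
Variable R : realType.
Implicit Types (x v : 'rV[R]_2) (a b c f g h : 'rV[R]_2 -> R) (A B : 'rV[R]_2 -> 'M[R]_2).

Local Notation X1 := (fun x : 'rV[R]_2 => x 0 0).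
Local Notation X2 := (fun x : 'rV[R]_2 => x 0 1).

Lemma axis_tc l c h : smooth_at 0 c -> smooth_at 0 h ->
  (\near0 x, c (setc 0 0 x) = x 0 1 ^+ l * h x) ->
  (forall j, (j < l)%N -> tc 0 j c = 0) /\ tc 0 l c = h 0.
Proof.
move=> sc sh E; have sx := smooth_at_axis 0 sc.
have K j : tc 0 j c = if (l <= j)%N then tc 0 (j - l) h else 0.
  by rewrite tc_axis1 (tc_ext 0 j sx _ E) ?tc_mulX2n //; smooth.
by split=> [j jl|]; rewrite K ?leqnn ?subnn // leqNgt jl.
Qed.

Lemma tc_near l f g : smooth_at 0 f -> (forall x, f (setc 0 0 x) = f x) ->
  (forall x, f (setc 0 0 x) = x 0 1 ^+ l * g x) -> f = fun x => x 0 1 ^+ l * g x.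
Proof. by move=> _ jf E; apply/funext => x; rewrite -jf E. Qed.

(** The 2-jet of [c] selects the family. A term [x2^2] gives 7. Failing that, [x1 x2] gives 8 if on
    [x1 = 0] the order of [c] does not exceed that of [b], and 9 otherwise. Failing that, [x1^2]
    gives 6 if [b] has order 2 there, and 10 if not but [c] has order 3. The remaining cases
    contradict the bound on the codimension. *)
Lemma simple_form1_null b c : smooth_at 0 b -> smooth_at 0 c -> (forall x, b (setc 0 0 x) = b x) ->
  c 0 = 0 -> b 0 = 0 -> tc 0 1 b = 0 -> tc 0 1 c = 0 -> tc 1 0 c = 0 ->
  codim_lt9 (germ3 X1 b c) -> simple (germ3 X1 b c).
Proof.
move=> sb sc ib c0 b0 tb01 tc01 tc10 cd; have sX1 : smooth_at 0 X1 by smooth.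
have sO := @smooth_at_cst R 'rV[R]_2 R 0 0.
have diag l : (2 <= l)%N -> van1 l b -> van1 l c -> tc 0 l c != 0 ->
    exists c' h' : 'rV[R]_2 -> R, [/\ smooth_at 0 c' /\ smooth_at 0 h',
    (\near0 x, c' (setc 0 0 x) = x 0 1 ^+ l * h' x), h' 0 != 0,
    [/\ tc 1 0 c' = 0, tc 2 0 c' = tc 2 0 c & tc 1 1 c' = tc 1 1 c] &
    G_equiv (germ3 X1 b c) (germ3 X1 (fun=> 0) c')].
  move=> l2 [_ Vb] [_ Vc] n; have [b1 [sb1 ib1 _ Eb]] := axis1_div sb Vb.
  have [g [sg ig g0 Eg]] := axis1_div sc Vc; rewrite -g0 in n.
  by rewrite (tc_near sb ib Eb); exact: (diagonalise sb1 sg sc ib1 ig Eg n tc10 l2).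
have Vb j : (j < 2)%N -> tc 0 j b = 0 by case: j => [|[|]].
have [k02|k02] := eqVneq (tc 0 2 c) 0; last first.
  have Vc j : (j < 2)%N -> tc 0 j c = 0 by case: j => [|[|]].
  have [c' [h' [[sc' sh'] E nh [t10 _ _] Q]]] := diag 2 isT (conj sb Vb) (conj sc Vc) k02.
  have [K1 K2] := axis_tc sc' sh' E.
  apply: simple_equiv (Q) _; apply: simple_NF7 => //.
  - exact: (K1 0%N).
  - exact: K1.
  - by rewrite K2.
  - by apply: codim_lt9_equiv Q cd; exact: sym_germ3.
have Vc3 j : (j < 3)%N -> tc 0 j c = 0 by case: j => [|[|[|]]].
have [k11|k11] := eqVneq (tc 1 1 c) 0; last first.
  have NF8 l : van1 l b -> van1 l c -> tc 0 l c != 0 -> simple (germ3 X1 b c).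
    move=> Vb' Vc' n; have l3 : (3 <= l)%N by rewrite leqNgt; apply: contra n => l3; rewrite Vc3.
    have [c' [h' [[sc' sh'] E nh [t10 _ t11] Q]]] := diag l (ltnW l3) Vb' Vc' n.
    by apply: simple_equiv (Q) _; apply: simple_NF8 sc' sh' nh l3 E t10 _; rewrite t11.
  have NF9 k : van1 k b -> tc 0 k b != 0 -> van1 k.+1 c -> simple (germ3 X1 b c).
    move=> Vb' n Vc'; have k2 : (2 <= k)%N by rewrite leqNgt; apply: contra n => k2; rewrite Vb.
    have [b1 [sb1 ib1 b10 Eb]] := axis1_div sb Vb'.2; rewrite -b10 in n.
    by rewrite (tc_near sb ib Eb); apply: simple_NF9.
  have [Wb|[k [k9 Wb nb]]] := first_tc1 10 sb; have [Wc|[l [l9 Wc nc]]] := first_tc1 10 sc.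
  - have [d [d9 cd']] := cd.
    have := codim_van12 (pd_indep1 sb ib) cd' (van1_0 _ _) (van1_pd Wb (pd_indep1 sb ib))
      (van1_X1 R 9) (van1_le (leqnSn 9) Wb) (van1_le (leqnSn 9) Wc).
    by rewrite leqNgt d9.
  - by apply: NF8 nc => //; apply: van1_le Wb; exact: ltnW.
  - by apply: NF9 nb _ => //; exact: van1_le Wc.
  - have [lk|kl] := leqP l k; first by apply: NF8 nc => //; exact: van1_le Wb.
    by apply: NF9 nb _ => //; exact: van1_le Wc.
have [d [d9 cd']] := cd.
have [k20|k20] := eqVneq (tc 2 0 c) 0.
  by have := contra_quartic sb sc ib b0 tb01 c0 tc01 k02 tc10 k11 k20 cd'; rewrite leqNgt d9.
have [tb02|tb02] := eqVneq (tc 0 2 b) 0; last first.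
  have [b1 [sb1 ib1 b10 Eb]] := axis1_div sb Vb; rewrite -b10 in tb02.
  by rewrite (tc_near sb ib Eb); apply: simple_NF6.
have [k03|k03] := eqVneq (tc 0 3 c) 0.
  by have := contra_cubic sb sc ib b0 tb01 tb02 c0 tc01 k02 k03 tc10 k11 cd'; rewrite leqNgt d9.
have Vb3 j : (j < 3)%N -> tc 0 j b = 0 by case: j => [|[|[|]]].
have [c' [h' [[sc' sh'] E nh [t10 t20 t11] Q]]] := diag 3 isT (conj sb Vb3) (conj sc Vc3) k03.
by apply: simple_equiv (Q) _; apply: simple_NF10 sc' sh' nh E t10 _ _; rewrite ?t11 ?t20.
Qed.

Lemma simple_rank1 a b c : smooth_at 0 a -> smooth_at 0 b -> smooth_at 0 c ->
  a 0 = 0 -> b 0 = 0 -> c 0 = 0 -> (tc 1 0 a != 0) || (tc 0 1 a != 0) ->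
  minor a b = 0 -> minor a c = 0 -> codim_lt9 (germ3 a b c) -> simple (germ3 a b c).
Proof.
move=> sa sb sc a0 b0 c0 da mb mc cd.
have [b' [c' [[sb' sc'] [ib' c'0] [b'0 tb'] tc' Q]]] := form1_exists sa sb sc a0 b0 c0 da mb mc.
apply: simple_equiv (Q) _; have {cd} := codim_lt9_equiv (sym_germ3 sa sb sc) Q cd.
by have [t10|t10] := eqVneq (tc 1 0 c') 0; [exact: simple_form1_null|exact: simple_form1_unit].
Qed.

Lemma minorC f g : minor f g = - minor g f.
Proof. by rewrite /minor; move: (tc _ _ f) (tc _ _ f) (tc _ _ g) (tc _ _ g) => p q r s; ring. Qed.

(** A nonzero minor means a 1-jet of rank two; it is brought to the first two entries by a swap or,
    for the pair [a], [c], by a shear with constant 1. If all minors vanish, the same two moves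
    bring a nonzero differential to the first entry. *)
Lemma simple_germ3 a b c : smooth_at 0 a -> smooth_at 0 b -> smooth_at 0 c ->
  a 0 = 0 -> b 0 = 0 -> c 0 = 0 ->
  (exists f, [\/ f = a, f = b | f = c] /\ ((tc 1 0 f != 0) || (tc 0 1 f != 0))) ->
  codim_lt9 (germ3 a b c) -> simple (germ3 a b c).
Proof.
move=> sa sb sc a0 b0 c0 df cd.
have S1 := @G_equiv_swap R a b c.
have cdS := codim_lt9_equiv (sym_germ3 sa sb sc) S1 cd.
have one := @smooth_at_cst R 'rV[R]_2 R 0 1.
have S2 := @G_equiv_lshear R a b c _ one.
have cdL := codim_lt9_equiv (sym_germ3 sa sb sc) S2 cd.
pose a1 x := a x + 2 * 1 * b x + 1 ^+ 2 * c x; pose b1 x := b x + 1 * c x.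
have sa1 : smooth_at 0 a1 by rewrite /a1; smooth.
have sb1 : smooth_at 0 b1 by rewrite /b1; smooth.
have a10 : a1 0 = 0 by rewrite /a1 a0 b0 c0 !mulr0 !addr0.
have b10 : b1 0 = 0 by rewrite /b1 b0 c0 mulr0 addr0.
have ta1 i j : tc i j a1 = tc i j a + 2 * tc i j b + tc i j c.
  by rewrite /a1 !tcD ?tcZ //; try (by smooth); rewrite mulr1 expr1n mul1r.
have tb1 i j : tc i j b1 = tc i j b + tc i j c.
  by rewrite /b1 !tcD ?tcZ //; try (by smooth); rewrite mul1r.
have [mab|mab] := eqVneq (minor a b) 0; last exact: simple_corank0.
have [mbc|mbc] := eqVneq (minor b c) 0; last first.
  apply: simple_equiv S1 _; apply: simple_corank0 => //.
  by rewrite minorC oppr_eq0.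
have m1 : minor a1 b1 = minor a c.
  transitivity (minor a b + minor a c + minor b c); last by rewrite mab mbc add0r addr0.
  rewrite /minor !ta1 !tb1.
  by move: (tc 1 0 a) (tc 0 1 a) (tc 1 0 b) (tc 0 1 b) (tc 1 0 c) (tc 0 1 c) => *; ring.
have m2 : minor a1 c = minor a c.
  transitivity (minor a c + 2 * minor b c); last by rewrite mbc mulr0 addr0.
  rewrite /minor !ta1.
  by move: (tc 1 0 a) (tc 0 1 a) (tc 1 0 b) (tc 0 1 b) (tc 1 0 c) (tc 0 1 c) => *; ring.
have [mac|mac] := eqVneq (minor a c) 0; last first.
  by apply: simple_equiv S2 _; apply: (@simple_corank0 R a1 b1 c) => //; rewrite m1.
have [da|/norP[/negPn/eqP a10' /negPn/eqP a01']] := boolP ((tc 1 0 a != 0) || (tc 0 1 a != 0)).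
  exact: simple_rank1.
have [dc|/norP[/negPn/eqP c10' /negPn/eqP c01']] := boolP ((tc 1 0 c != 0) || (tc 0 1 c != 0)).
  apply: simple_equiv S1 _; apply: simple_rank1 => //.
    by rewrite minorC mbc oppr0.
  by rewrite minorC mac oppr0.
apply: simple_equiv S2 _; apply: (@simple_rank1 a1 b1 c) => //; rewrite ?m1 ?m2 //.
have [f [[->|->|->]]] := df.
- by rewrite a10' a01' eqxx.
- by rewrite !ta1 a10' a01' c10' c01' !add0r !addr0 !mulf_eq0 !pnatr_eq0.
- by rewrite c10' c01' eqxx.
Qed.

Theorem simple_of_codim A : sym_germ A -> A 0 = 0 -> (corank A <= 1)%N -> codim_lt9 A ->
  exists f : normal_form, [/\ nf_range f, (nf_cod f < 9)%N & G_equiv A (nf_germ R f)].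
Proof.
move=> sA A0 cA cd; have [sa sb sc E] := sym_germ_entries sA.
have Q := G_equiv_near E.
have sA' : smooth_at 0 A by apply/smooth_germP; case: sA.
suff [f [rf Q2]] : simple (germ3 (fun x => A x 0 0) (fun x => A x 0 1) (fun x => A x 1 1)).
  have Q3 := G_equiv_trans Q Q2; exists f; split=> //.
  have [d [d9 cdA]] := cd.
  by rewrite (codim_unique (nf_codim R rf) (codim_inv sA Q3 cdA)).
apply: simple_germ3 => //; try (by rewrite A0 mxE); last exact: codim_lt9_equiv Q cd.
have [v Av] := corank_le1 cA.
apply: contrapT => N; move/eqP: Av; apply.
have K f : [\/ f = (fun x => A x 0 0), f = (fun x => A x 0 1) | f = (fun x => A x 1 1)] ->
    smooth_at 0 f -> 'D_v f 0 = 0.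
  move=> fE sf; rewrite derive0_tc //.
  have [n|/norP[/negPn/eqP -> /negPn/eqP ->]] := boolP ((tc 1 0 f != 0) || (tc 0 1 f != 0)).
    by case: N; exists f.
  by rewrite !mul0r addr0.
have dA := smooth_at_differentiable sA'.
have D i j : 'd A (0 : 'rV[R]_2) v i j = 'D_v (fun y => A y i j) 0.
  by rewrite -(deriveE _ dA) derive_entry.
have s10 := smooth_at_entry 1 0 sA'.
apply: mx2P; rewrite D [RHS]mxE.
- by apply: K => //; constructor 1.
- by apply: K => //; constructor 2.
- have E10 : \near0 x, A x 1 0 = A x 0 1.
    by apply: filterS sA.2 => x Ax; rewrite -{1}Ax mxE.
  rewrite derive0_tc // (tc_ext 1 0 s10 sb E10) (tc_ext 0 1 s10 sb E10) -derive0_tc //.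
  by apply: K => //; constructor 2.
- by apply: K => //; constructor 3.
Qed.

End Classification.

(** * Separation of the normal forms *)

Section OneJet.
Variable K : numFieldType.
Implicit Types (A B : 'rV[K]_2 -> 'M[K]_2) (v w : 'rV[K]_2).

(** Since [A 0 = 0], the terms containing derivatives of [X] drop out. Of the differential of the
    diffeomorphism only additivity and the inverse are recorded. *)
Lemma G_equiv_diff A B : smooth_at 0 A -> A 0 = 0 -> G_equiv A B ->
  exists (L L' : 'rV[K]_2 -> 'rV[K]_2) (P : 'M[K]_2), [/\ L' 0 = 0 /\ {morph L : v w / v + w}, cancel L L',
    cancel L' L, P \in unitmx & forall v, 'd B (0 : 'rV[K]_2) v = P^T *m 'd A (0 : 'rV[K]_2) (L v) *m P].
Proof.
move=> sA A0 [Phi [X [[/smooth_germP sP P0 [Psi [/smooth_germP sQ Q0 K1 K2]]] [/smooth_germP sX uX] E]]].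
have dP := smooth_at_differentiable sP; have dQ := smooth_at_differentiable sQ.
have sP0 : smooth_at (Psi 0) Phi by rewrite Q0.
have sQ0 : smooth_at (Phi 0) Psi by rewrite P0.
exists ('d Phi (0 : 'rV[K]_2)), ('d Psi (0 : 'rV[K]_2)), (X 0); split.
- split; first exact: linear0.
  by move=> v w; rewrite linearD.
- move=> v; have := diff_right_inverse v dP (smooth_at_differentiable sQ0) K1.
  by rewrite P0.
- move=> v; have := diff_right_inverse v dQ (smooth_at_differentiable sP0) K2.
  by rewrite Q0.
- exact: nbhs_singleton uX.
move=> v.
have sXT : smooth_at 0 (fun x => (X x)^T).
  apply: smooth_at_entries => i j; rewrite (_ : (fun x => _) = fun x => X x j i).
    exact: smooth_at_entry.
  by apply/funext => x; rewrite mxE.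
have sAP : smooth_at 0 (fun x => A (Phi x)) by apply: smooth_at_comp_mx => //; rewrite P0.
have s1 := smooth_at_mulmx sXT sAP; have s2 := smooth_at_mulmx s1 sX.
have dC := smooth_at_differentiable s2.
have [_ EB] := near_eq_differentiable (filterS (fun y (e : B y = _) => esym e) E) dC.
have dA : differentiable A (Phi 0) by rewrite P0; exact: smooth_at_differentiable.
have D4 := etrans (derive_comp_dir v dP dA) (congr1 (fun y => 'd A y ('d Phi (0 : 'rV[K]_2) v)) P0).
have AP0 : A (Phi 0) = 0 by rewrite P0.
have D5 := etrans (derive_mulmx v sXT sAP) (congr2 (fun p q => 'D_v (fun x => (X x)^T) 0 *m p + (X 0)^T *m q) AP0 D4).
have D6 := etrans (derive_mulmx v s1 sX) (congr2 (fun p q => p *m X 0 + (X 0)^T *m q *m 'D_v X 0) D5 AP0).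
have D7 : 'd B (0 : 'rV[K]_2) v = 'D_v (fun y => (X y)^T *m A (Phi y) *m X y) 0.
  by rewrite EB (deriveE _ dC).
have alg (M N S Q T : 'M[K]_2) : (M *m 0 + N) *m S + Q *m 0 *m T = N *m S.
  by rewrite !mulmx0 mul0mx add0r addr0.
exact: etrans D7 (etrans D6 (alg _ _ _ _ _)).
Qed.

Lemma G_equiv_det A B : smooth_at 0 A -> A 0 = 0 -> G_equiv A B ->
  exists (L L' : 'rV[K]_2 -> 'rV[K]_2) (k : K), [/\ L' 0 = 0 /\ {morph L : v w / v + w}, cancel L L',
    cancel L' L, k != 0 &
    forall v, \det ('d B (0 : 'rV[K]_2) v) = k ^+ 2 * \det ('d A (0 : 'rV[K]_2) (L v))].
Proof.
move=> sA A0 /(G_equiv_diff sA A0)[L [L' [P [L0 L1 L2 uP E]]]].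
have alg (M : 'M[K]_2) : \det (P^T *m M *m P) = \det P ^+ 2 * \det M.
  by rewrite !det_mulmx det_tr mulrAC -expr2.
have nP : \det P != 0 by move: uP; rewrite unitmxE unitfE.
exists L, L', (\det P); split; [exact: L0|exact: L1|exact: L2|exact: nP|].
by move=> v; exact: etrans (congr1 determinant (E v)) (alg _).
Qed.

Lemma det_sym2 (a b c : K) : \det (sym2 a b c) = a * c - b ^+ 2.
Proof.
have -> : sym2 a b c = mx2 a b b c by apply: mx2P; rewrite !mxE.
by rewrite det_mx2 expr2.
Qed.

Lemma diff_sym2 (a b c : 'rV[K]_2 -> K) v : smooth_at 0 a -> smooth_at 0 b -> smooth_at 0 c ->
  'd (fun x => sym2 (a x) (b x) (c x)) (0 : 'rV[K]_2) v =
  sym2 ('D_v a 0) ('D_v b 0) ('D_v c 0).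
Proof.
move=> sa sb sc; have dA := smooth_at_differentiable (smooth_at_sym2 sa sb sc).
have D i j : 'd (fun x => sym2 (a x) (b x) (c x)) (0 : 'rV[K]_2) v i j =
    'D_v (fun y => sym2 (a y) (b y) (c y) i j) 0.
  by rewrite -(deriveE _ dA) derive_entry.
have D00 : (fun y => sym2 (a y) (b y) (c y) 0 0) = a by apply/funext => y; rewrite mxE.
have D01 : (fun y => sym2 (a y) (b y) (c y) 0 1) = b by apply/funext => y; rewrite mxE.
have D10 : (fun y => sym2 (a y) (b y) (c y) 1 0) = b by apply/funext => y; rewrite mxE.
have D11 : (fun y => sym2 (a y) (b y) (c y) 1 1) = c by apply/funext => y; rewrite mxE.
by apply: mx2P; rewrite !sym2E D ?D00 ?D01 ?D10 ?D11.
Qed.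

Lemma derive0_mul (f g : 'rV[K]_2 -> K) v : smooth_at 0 f -> smooth_at 0 g -> f 0 = 0 -> g 0 = 0 ->
  'D_v (fun x => f x * g x) 0 = 0.
Proof.
move=> sf sg f0 g0; have df := diff_derivable (v := v) (smooth_at_differentiable sf).
have dg := diff_derivable (v := v) (smooth_at_differentiable sg).
by apply: etrans (deriveM df dg) _; rewrite f0 g0 !scale0r addr0.
Qed.

Lemma derive0_add (f g : 'rV[K]_2 -> K) v : smooth_at 0 f -> smooth_at 0 g ->
  'D_v (fun x => f x + g x) 0 = 'D_v f 0 + 'D_v g 0.
Proof.
move=> sf sg; have df := diff_derivable (v := v) (smooth_at_differentiable sf).
have dg := diff_derivable (v := v) (smooth_at_differentiable sg).
exact: etrans (deriveD df dg) _.
Qed.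

Lemma derive0_pow (i : 'I_2) n v : (2 <= n)%N -> 'D_v (fun x : 'rV[K]_2 => x 0 i ^+ n) 0 = 0.
Proof.
case: n => [|[|n]] // _; rewrite (_ : (fun x => _) = fun x : 'rV[K]_2 => x 0 i * x 0 i ^+ n.+1).
  apply: derive0_mul; rewrite ?mxE ?expr0n //; first exact: smooth_at_coord.
  by apply: smooth_at_exp; exact: smooth_at_coord.
by apply/funext => x; rewrite exprS.
Qed.

Lemma sym2_00 : sym2 0 0 0 = 0 :> 'M[K]_2.
Proof. by apply: mx2P; rewrite !mxE. Qed.

(** A nonzero vector in the radical of the quadratic form [det (dA(0) v)], phrased without the polar
    form. *)
Definition det_translation A :=
  exists v, v != 0 /\ forall w, \det ('d A (0 : 'rV[K]_2) (w + v)) = \det ('d A (0 : 'rV[K]_2) w).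

End OneJet.

Section Separation.
Variable R : realType.
Implicit Types (A B : 'rV[R]_2 -> 'M[R]_2) (v w x : 'rV[R]_2) (f g : normal_form).

(** Equivalence multiplies the quadratic form by a nonzero square, so any [S] stable under such
    factors, a sign for instance, yields an invariant. *)
Definition exdet (S : R -> Prop) A := exists v, v != 0 /\ S (\det ('d A (0 : 'rV[R]_2) v)).

Lemma exdet_equiv (S : R -> Prop) A B : (forall k x : R, k != 0 -> S x -> S (k ^+ 2 * x)) ->
  smooth_at 0 A -> A 0 = 0 -> G_equiv A B -> exdet S A -> exdet S B.
Proof.
move=> HS sA A0 /(G_equiv_det sA A0)[L [L' [k [[L0 La] L1 L2 k0 E]]]] [v [v0 Sv]].
exists (L' v); split.
  by apply: contraNneq v0 => Lv; rewrite -(L2 v) Lv -[X in L X]L0 L2.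
have E2 := congr1 (fun y => k ^+ 2 * \det ('d A (0 : 'rV[R]_2) y)) (L2 v).
exact: (eq_ind_r S (HS k _ k0 Sv) (etrans (E (L' v)) E2)).
Qed.

Definition exker A := exists v, v != 0 /\ 'd A (0 : 'rV[R]_2) v = 0.

Lemma exker_equiv A B : smooth_at 0 A -> A 0 = 0 -> G_equiv A B -> exker A -> exker B.
Proof.
move=> sA A0 /(G_equiv_diff sA A0)[L [L' [P [[L0 La] L1 L2 uP E]]]] [v [v0 Sv]].
exists (L' v); split.
  by apply: contraNneq v0 => Lv; rewrite -(L2 v) Lv -[X in L X]L0 L2.
have E1 := congr1 (fun y => P^T *m 'd A (0 : 'rV[R]_2) y *m P) (L2 v).
have E2 := congr1 (fun M => P^T *m M *m P) Sv.
by apply: etrans (E (L' v)) (etrans E1 (etrans E2 _)); rewrite mulmx0 mul0mx.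
Qed.

Definition nf_det f v : R := match f with
  | NF1 => v 0 0 * v 0 1 | NF2 => - v 0 0 ^+ 2 - v 0 1 ^+ 2 | NF3 _ _ => - v 0 1 ^+ 2
  | NF4 _ => v 0 0 ^+ 2 | NF5 _ _ _ _ => - v 0 0 ^+ 2 | _ => 0 end.

Lemma nf_detE f v : nf_range f -> \det ('d (nf_germ R f) (0 : 'rV[R]_2) v) = nf_det f v.
Proof.
move=> rg; apply: etrans (congr1 determinant (nf_diff v rg)) _.
by case: f rg => [||s l|l|s1 s2 l1 l2|s|s1 s2 l|s l|l|s] /= rg; rewrite det_sym2; ring.
Qed.

Lemma exdet_nf (S : R -> Prop) f : nf_range f ->
  exdet S (nf_germ R f) <-> exists v, v != 0 /\ S (nf_det f v).
Proof.
by move=> rg; split=> -[v [v0 Sv]]; exists v; split=> //; move: Sv; rewrite nf_detE.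
Qed.

Lemma vec2_neq0 (a b : R) : (vec2 a b != 0) = (a != 0) || (b != 0).
Proof.
rewrite -negb_and; congr (~~ _); apply/eqP/andP => [/rowP E|[/eqP -> /eqP ->]].
  by have := E 0; have := E 1; rewrite vec2_1 vec2_2 !mxE => -> ->.
exact: vec200.
Qed.

(** With the next two, the type of the quadratic form: hyperbolic for [NF1], negative definite for
    [NF2], negative of rank one for [NF3] and [NF5], positive of rank one for [NF4], zero for the
    others. The corank then tells [NF3] from [NF5]. *)
Definition nf_pos f := match f with NF1 | NF4 _ => true | _ => false end.
Definition nf_neg f := match f with NF1 | NF2 | NF3 _ _ | NF5 _ _ _ _ => true | _ => false end.
Definition nf_zero f := if f is NF2 then false else true.

Lemma nf_posP f : (exists v, v != 0 /\ 0 < nf_det f v) <-> nf_pos f.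
Proof.
case: f => [||s l|l|s1 s2 l1 l2|s|s1 s2 l|s l|l|s] /=; split => //; try by move=> [v [_]]; rewrite ?ltxx.
- by exists (vec2 1 1); rewrite vec2_neq0 oner_neq0 vec2_1 vec2_2 mulr1 ltr01.
- by move=> [v [_]]; rewrite -opprD oppr_gt0 ltNge addr_ge0 // sqr_ge0.
- by move=> [v [_]]; rewrite oppr_gt0 ltNge sqr_ge0.
- by exists (vec2 1 0); rewrite vec2_neq0 oner_neq0 vec2_1 expr1n ltr01.
- by move=> [v [_]]; rewrite oppr_gt0 ltNge sqr_ge0.
Qed.

Lemma nf_negP f : (exists v, v != 0 /\ nf_det f v < 0) <-> nf_neg f.
Proof.
case: f => [||s l|l|s1 s2 l1 l2|s|s1 s2 l|s l|l|s] /=; split => //; try by move=> [v [_]]; rewrite ?ltxx.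
- by exists (vec2 1 (-1)); rewrite vec2_neq0 oner_neq0 vec2_1 vec2_2 mulrN1 oppr_lt0 ltr01.
- by exists (vec2 1 0); rewrite vec2_neq0 oner_neq0 vec2_1 vec2_2 expr1n expr0n subr0 oppr_lt0 ltr01.
- by exists (vec2 0 1); rewrite vec2_neq0 oner_neq0 orbT vec2_2 expr1n oppr_lt0 ltr01.
- by move=> [v [_]]; rewrite ltNge sqr_ge0.
- by exists (vec2 1 0); rewrite vec2_neq0 oner_neq0 vec2_1 expr1n oppr_lt0 ltr01.
Qed.

Lemma nf_zeroP f : (exists v, v != 0 /\ nf_det f v = 0) <-> nf_zero f.
Proof.
have w0 : vec2 0 1 != 0 :> 'rV[R]_2 by rewrite vec2_neq0 oner_neq0 orbT.
case: f => [||s l|l|s1 s2 l1 l2|s|s1 s2 l|s l|l|s] /=; split => //; try by exists (vec2 0 1).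
- by exists (vec2 0 1); rewrite vec2_1 mul0r.
- move=> [v [/negP v0 /eqP]]; rewrite -opprD oppr_eq0 paddr_eq0 ?sqr_ge0 // !expf_eq0 /=.
  by move=> /andP[/eqP E1 /eqP E2]; case: v0; apply/eqP; exact: vec2_0P.
- by exists (vec2 1 0); rewrite vec2_neq0 oner_neq0 vec2_2 expr0n oppr0.
- by exists (vec2 0 1); rewrite vec2_1 expr0n.
- by exists (vec2 0 1); rewrite vec2_1 expr0n oppr0.
Qed.

Lemma exker_nf f : nf_range f -> exker (nf_germ R f) <-> nf_corank f = 1%N.
Proof.
move=> rg; rewrite -(corank_nf R rg); split.
  move=> [v [v0 Av]]; have : corank (nf_germ R f) <> 0%N.
    by move=> /corank0P /(_ v Av) /eqP; apply/negP.
  by rewrite corank_nf //; case: (f) => //= *; case.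
move=> c1; apply: contrapT => N; have : corank (nf_germ R f) = 0%N; last by rewrite c1.
apply/corank0P => v Av; apply: contrapT => v0; apply: N; exists v; split=> //; exact/eqP.
Qed.

Lemma equiv_nf_tags f g : nf_range f -> nf_range g -> G_equiv (nf_germ R f) (nf_germ R g) ->
  [/\ nf_cod f = nf_cod g, nf_pos f = nf_pos g, nf_neg f = nf_neg g, nf_zero f = nf_zero g &
    (nf_corank f = 1%N <-> nf_corank g = 1%N)].
Proof.
move=> rf rg Q; have Q' := G_equiv_sym Q.
have sf : smooth_at 0 (nf_germ R f) by apply/smooth_germP; case: (sym_germ_nf R f).
have sg : smooth_at 0 (nf_germ R g) by apply/smooth_germP; case: (sym_germ_nf R g).
have f0 := nf_germ0 R rf; have g0 := nf_germ0 R rg.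
have ED (S : R -> Prop) : (forall k x : R, k != 0 -> S x -> S (k ^+ 2 * x)) ->
    (exists v, v != 0 /\ S (nf_det f v)) <-> (exists v, v != 0 /\ S (nf_det g v)).
  move=> HS; rewrite -(exdet_nf S rf) -(exdet_nf S rg).
  by split; [exact: exdet_equiv HS sf f0 Q|exact: exdet_equiv HS sg g0 Q'].
have k2 (k : R) : k != 0 -> 0 < k ^+ 2 by move=> k0; rewrite exprn_even_gt0.
have bi (p q : bool) : p <-> q -> p = q.
  by move=> [H1 H2]; apply/idP/idP.
split.
- exact: codim_unique (codim_inv (sym_germ_nf R f) Q (nf_codim R rf)) (nf_codim R rg).
- by apply: bi; rewrite -!nf_posP; apply: (ED (fun y => 0 < y)) => k x /k2 kp xp; rewrite mulr_gt0.
- by apply: bi; rewrite -!nf_negP; apply: (ED (fun y => y < 0)) => k x /k2 kp xp; rewrite pmulr_rlt0.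
- by apply: bi; rewrite -!nf_zeroP; apply: (ED (fun y => y = 0)) => k x _ ->; rewrite mulr0.
- rewrite -(exker_nf rf) -(exker_nf rg); split; first exact: exker_equiv sf f0 Q.
  exact: exker_equiv sg g0 Q'.
Qed.

End Separation.

(** * Definite values near 0 *)

Section ScalarEquivalence.
Variable R : realType.
Implicit Types (x v : 'rV[R]_2) (a b c f g h : 'rV[R]_2 -> R).

Definition scalar_equiv a b c a' b' c' (u z p q r s : 'rV[R]_2 -> R) :=
  [/\ [/\ smooth_at 0 u, smooth_at 0 z, u 0 = 0, z 0 = 0 & minor u z != 0],
      [/\ smooth_at 0 p, smooth_at 0 q, smooth_at 0 r, smooth_at 0 s & p 0 * s 0 - q 0 * r 0 != 0] &
      \near0 x, let y := vec2 (u x) (z x) in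
      [/\ a' x = p x ^+ 2 * a y + 2 * p x * r x * b y + r x ^+ 2 * c y,
          b' x = p x * q x * a y + (p x * s x + q x * r x) * b y + r x * s x * c y &
          c' x = q x ^+ 2 * a y + 2 * q x * s x * b y + s x ^+ 2 * c y]].

Lemma G_equiv_scalar a b c a' b' c' : G_equiv (germ3 a b c) (germ3 a' b' c') ->
  exists u z p q r s : 'rV[R]_2 -> R, scalar_equiv a b c a' b' c' u z p q r s.
Proof.
move=> [Phi [X [[/smooth_germP sP P0 [Psi [/smooth_germP sQ Q0 K1 _]]] [/smooth_germP sX uX] E]]].
have su := smooth_at_entry 0 0 sP; have sz := smooth_at_entry 0 1 sP.
have u0 : Phi 0 0 0 = 0 by rewrite P0 mxE.
have z0 : Phi 0 0 1 = 0 by rewrite P0 mxE.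
exists (fun x => Phi x 0 0), (fun x => Phi x 0 1), (fun x => X x 0 0), (fun x => X x 0 1),
  (fun x => X x 1 0), (fun x => X x 1 1); split.
- split=> //.
  (* The chain rule for [Psi] after [Phi] makes the product of the two Jacobian determinants equal
     to 1; [tc (1 - j) j] covers both first-order coefficients. *)
  have D (i : 'I_2) (j : nat) : tc (1 - j) j (fun x : 'rV[R]_2 => x 0 i) =
      tc (1 - j) j (fun x => (fun y => Psi y 0 i) (vec2 (Phi x 0 0) (Phi x 0 1))).
    have sPi := smooth_at_entry 0 i sQ.
    have sPi' : smooth_at 0 (fun x => (fun y => Psi y 0 i) (vec2 (Phi x 0 0) (Phi x 0 1))).
      exact: (@smooth_at_comp0 _ _ _ _ (fun y => Psi y 0 i)).
    apply: tc_ext => //; first exact: smooth_at_X.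
    by apply: filterS K1 => x; rewrite vec2E => ->.
  have C (i : 'I_2) := tc_comp1 (smooth_at_entry 0 i sQ) su sz u0 z0.
  have := D 0 0%N; have := D 0 1%N; have := D 1 0%N; have := D 1 1%N.
  rewrite !subnn !subn0 !(C _).1 !(C _).2 !tc_X1b !tc_X2b /= /minor.
  move: (tc 1 0 (fun x => Phi x 0 0)) (tc 0 1 (fun x => Phi x 0 0)) (tc 1 0 (fun x => Phi x 0 1)) (tc 0 1 (fun x => Phi x 0 1)).
  move: (tc 1 0 (fun y => Psi y 0 0)) (tc 0 1 (fun y => Psi y 0 0)) (tc 1 0 (fun y => Psi y 0 1)) (tc 0 1 (fun y => Psi y 0 1)).
  move=> p1 p2 p3 p4 q1 q2 q3 q4 H1 H2 H3 H4; apply/eqP => J.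
  have : (p1 * q1 + p2 * q3) * (p3 * q2 + p4 * q4) - (p3 * q1 + p4 * q3) * (p1 * q2 + p2 * q4) = 0.
    by rewrite (_ : _ - _ = (p1 * p4 - p2 * p3) * (q1 * q4 - q2 * q3)); [rewrite J mulr0|ring].
  by rewrite -H1 -H2 -H3 -H4 => /eqP; rewrite mul0r subr0 mulr1 oner_eq0.
- split; try exact: smooth_at_entry.
  by have := nbhs_singleton uX; rewrite [X in X \in _]mx2_eta mx2_unit.
- apply: filterS E => x; rewrite [X x]mx2_eta /germ3 congr_sym2 vec2E !mx2E.
  exact: sym2_inj.
Qed.

(** No value near 0 is definite of sign [e], for [e] equal to 1 or -1. Definiteness is preserved by
    congruence, and its occurrence near 0 depends on the signs in the normal forms. *)
Definition never_def (e : R) a b c :=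
  \near0 x, ~ (0 < e * a x /\ 0 < a x * c x - b x ^+ 2).

Lemma never_def_equiv (e : R) a b c a' b' c' : e * e = 1 ->
  G_equiv (germ3 a b c) (germ3 a' b' c') -> never_def e a b c -> never_def e a' b' c'.
Proof.
move=> ee /G_equiv_scalar[u [z [p [q [r [s [[su sz u0 z0 _] [sp sq sr ss d0] E]]]]]]] H.
have sd : smooth_at 0 (fun x => p x * s x - q x * r x) by smooth.
apply: filter_app E; apply: filterS (near0_comp2 su sz u0 z0 H) => x H0 [Ea Eb Ec] [H1 H2].
apply: H0; move: H1 H2; rewrite Ea Eb Ec.
move: (a _) (b _) (c _) (p x) (q x) (r x) (s x) => A B C P Q S T H1 H2.
have D : 0 < A * C - B ^+ 2.
  have E2 : (P ^+ 2 * A + 2 * P * S * B + S ^+ 2 * C) * (Q ^+ 2 * A + 2 * Q * T * B + T ^+ 2 * C) -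
     (P * Q * A + (P * T + Q * S) * B + S * T * C) ^+ 2 = (P * T - Q * S) ^+ 2 * (A * C - B ^+ 2) by ring.
  move: H2; rewrite E2 => H2; have := sqr_ge0 (P * T - Q * S); rewrite le0r => /orP[/eqP k0|k0].
    by move: H2; rewrite k0 mul0r ltxx.
  by move: H2; rewrite pmulr_rgt0.
split=> //; rewrite lt_neqAle; apply/andP; split.
  rewrite eq_sym; apply: contraTneq D => e0.
  have -> : A = 0 by rewrite -[A]mul1r -ee -mulrA e0 mulr0.
  by rewrite mul0r sub0r oppr_gt0 -leNgt sqr_ge0.
(* First diagonal entries of a definite form in two bases have the same sign: their product is a
   square plus a nonnegative multiple of the determinant. *)
have : 0 <= (e * A) * (e * (P ^+ 2 * A + 2 * P * S * B + S ^+ 2 * C)).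
  have -> : (e * A) * (e * (P ^+ 2 * A + 2 * P * S * B + S ^+ 2 * C)) =
     (e * e) * ((P * A + S * B) ^+ 2 + S ^+ 2 * (A * C - B ^+ 2)) by ring.
  by rewrite ee mul1r addr_ge0 ?sqr_ge0 // mulr_ge0 ?sqr_ge0 // ltW.
by rewrite pmulr_lge0.
Qed.

Lemma near_axes (P : 'rV[R]_2 -> Prop) : (\near0 x, P x) ->
  exists t : R, 0 < t /\ forall s : bool, P (vec2 ((-1) ^+ s * t) 0) /\ P (vec2 0 ((-1) ^+ s * t)).
Proof.
move=> /near_ball[r r0 H]; exists (r / 2); rewrite divr_gt0 //; split=> // s.
have N : `|(-1) ^+ s * (r / 2)| < r.
  by rewrite normrM normrX normrN1 expr1n mul1r gtr0_norm ?divr_gt0 // ltr_pdivrMr // mulr_natr mulr2n ltrDl.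
split; apply: H; rewrite /nball /=; apply: le_lt_trans N; apply: normr_rV_le => //; apply: I2P;
  by rewrite ?vec2_1 ?vec2_2 ?normr0.
Qed.

End ScalarEquivalence.

(** * Signs in families 3, 7 and 8 *)

Section SecondJet.
Variable R : realType.
Implicit Types (x v : 'rV[R]_2) (a b c h : 'rV[R]_2 -> R).
Local Notation X1 := (fun x : 'rV[R]_2 => x 0 0).

Definition nf_never (e : R) (f : normal_form) := never_def e (nf_a f) (nf_b f) (nf_c f).

Lemma nf_never_equiv (e : R) f g : e * e = 1 -> G_equiv (nf_germ R f) (nf_germ R g) ->
  nf_never e f -> nf_never e g.
Proof. by move=> ee; rewrite !nf_germE; exact: never_def_equiv. Qed.

Lemma nf_never_inv (b : normal_form -> bool) (e : R) f g : e * e = 1 ->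
  (nf_never e f <-> b f) -> (nf_never e g <-> b g) ->
  G_equiv (nf_germ R f) (nf_germ R g) -> b f = b g.
Proof.
move=> ee Hf Hg Q; apply/idP/idP => /[dup] _.
  by move=> /Hf /(nf_never_equiv ee Q) /Hg.
by move=> /Hg /(nf_never_equiv ee (G_equiv_sym Q)) /Hf.
Qed.

Lemma nf_never_NF3 (s : bool) l : nf_never 1 (NF3 s l) <-> s.
Proof.
split; last first.
  move=> -> ; apply: filterE => x; rewrite /= mul1r expr1 => -[x0].
  by rewrite mulN1r mulrN -opprD oppr_gt0 ltNge addr_ge0 ?sqr_ge0 // mulr_ge0 ?exprn_ge0 ?ltW.
case: s => // /near_axes[t [t0 /(_ false) [H _]]]; case: H.
by rewrite /= vec2_1 vec2_2 expr0 !mul1r expr0n subr0 mulr_gt0 ?exprn_gt0.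
Qed.

Lemma NF3_sign (s t : bool) l : G_equiv (nf_germ R (NF3 s l)) (nf_germ R (NF3 t l)) -> s = t.
Proof.
exact: (@nf_never_inv (fun f => if f is NF3 s _ then s else true) 1 _ _ (mulr1 1)
  (nf_never_NF3 s l) (nf_never_NF3 t l)).
Qed.

Lemma nf_never_NF7P (s : bool) l : nf_never 1 (NF7 true s l) <-> s.
Proof.
split; last first.
  move=> -> ; apply: filterE => x; rewrite /= mul1r !mulN1r expr0n subr0 => -[x0].
  by rewrite -opprD mulrN oppr_gt0 ltNge mulr_ge0 ?addr_ge0 ?sqr_ge0 ?exprn_ge0 ?ltW.
case: s => // /near_axes[t [t0 /(_ false) [H _]]]; case: H.
by rewrite /= vec2_1 vec2_2 expr0 !mul1r !expr0n /= mulr0 add0r subr0 mulr_gt0 ?exprn_gt0.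
Qed.

(** With [x2^2] positive, a negative definite value needs [x1 < 0] and a negative last term, whose
    sign at [(-t, 0)] involves the parity of [l]. *)
Lemma nf_never_NF7N (s : bool) l : nf_never (-1) (NF7 false s l) <-> s = odd l.
Proof.
have E (y : R) : (-1) ^+ s * (- y) ^+ l = (-1) ^+ (s (+) odd l) * y ^+ l.
  by rewrite [(- y) ^+ l]exprNn mulrA -(signr_odd _ l) -signr_addb.
split; last first.
  move=> s1; apply: filterE => x; rewrite /= mulN1r mul1r expr0n subr0 => -[x0].
  rewrite -[x 0 0]opprK E s1 addbb mul1r mulNr oppr_gt0 ltNge mulr_ge0 ?addr_ge0 ?sqr_ge0 ?exprn_ge0 //;
    exact: ltW.
move=> /near_axes[t [t0 /(_ true) [H _]]]; apply/eqP; rewrite -negb_add; apply/negP => so; case: H.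
rewrite /= vec2_1 vec2_2 !mulN1r opprK E so mulN1r !expr0n /= mulr0 add0r subr0 mulrNN; split=> //.
by rewrite mulr_gt0 ?exprn_gt0.
Qed.

(** The definiteness tested is the one that the [x2^2] term opposes: positive when that term is
    negative, negative when it is positive. *)
Lemma NF7_sign (s t1 t2 : bool) l : G_equiv (nf_germ R (NF7 s t1 l)) (nf_germ R (NF7 s t2 l)) -> t1 = t2.
Proof.
case: s => Q.
  exact: (@nf_never_inv (fun f => if f is NF7 _ s _ then s else true) 1 _ _ (mulr1 1)
    (nf_never_NF7P t1 l) (nf_never_NF7P t2 l) Q).
have H (t : bool) : nf_never (-1) (NF7 false t l) <-> ~~ (t (+) odd l).
  by rewrite nf_never_NF7N negb_add; split=> [->|/eqP].
have e1 : -1 * -1 = 1 :> R by rewrite mulrNN mulr1.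
have := @nf_never_inv (fun f => if f is NF7 _ s _ then ~~ (s (+) odd l) else true) (-1) _ _ e1 (H t1) (H t2) Q.
by move=> /= /(congr1 negb); rewrite !negbK => /addIb.
Qed.

Definition jet1_zero (f : 'rV[R]_2 -> R) := [/\ f 0 = 0, tc 1 0 f = 0 & tc 0 1 f = 0].

(** The entry [x1] forces [tc 0 1 u = 0] and makes [tc 1 0 u] the inverse of a square, and the
    vanishing 1-jet of [c'] forces [q 0 = 0]. Hence the 2-jet of [c'] is that of [c] after a
    triangular change of coordinates, times the square of [s 0]. *)
Lemma second_jet b c b' c' : smooth_at 0 b -> smooth_at 0 c -> smooth_at 0 b' -> smooth_at 0 c' ->
  jet1_zero b -> jet1_zero c -> jet1_zero c' ->
  G_equiv (germ3 X1 b c) (germ3 X1 b' c') ->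
  exists u z p q r s : 'rV[R]_2 -> R, scalar_equiv X1 b c X1 b' c' u z p q r s /\
    [/\ p 0 != 0 /\ 0 < tc 1 0 u, 0 < s 0 ^+ 2, tc 0 1 z != 0,
      tc 0 2 c' = s 0 ^+ 2 * tc 0 1 z ^+ 2 * tc 0 2 c & tc 0 2 c = 0 ->
      tc 1 1 c' = s 0 ^+ 2 * tc 1 0 u * tc 0 1 z * tc 1 1 c /\
      (tc 1 1 c = 0 -> tc 2 0 c' = s 0 ^+ 2 * tc 1 0 u ^+ 2 * tc 2 0 c)].
Proof.
move=> sb sc sb' sc' [b0 b10 b01] [c0 c10 c01] [c0' c10' c01'].
move=> /G_equiv_scalar[u [z [p [q [r [s Sc]]]]]]; have [[su sz u0 z0 M] [sp sq sr ss d0] E] := Sc.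
have sby : smooth_at 0 (fun x => b (vec2 (u x) (z x))) by apply: smooth_at_comp0.
have scy : smooth_at 0 (fun x => c (vec2 (u x) (z x))) by apply: smooth_at_comp0.
have [B10 B01] := tc_comp1 sb su sz u0 z0; have [C10 C01] := tc_comp1 sc su sz u0 z0.
have [C20 C11 C02] := tc_comp2 sc su sz u0 z0 c0 c10 c01.
move: B10 B01 C10 C01; rewrite b10 b01 c10 c01 !mul0r !addr0 => B10 B01 C10 C01.
set by_ := (fun x => b (vec2 (u x) (z x))) in sby B10 B01.
set cy := (fun x => c (vec2 (u x) (z x))) in scy C10 C01 C20 C11 C02.
have B0 : by_ 0 = 0 by rewrite /by_ u0 z0 vec200.
have C0 : cy 0 = 0 by rewrite /cy u0 z0 vec200.
have Ea : \near0 x, x 0 0 = p x * p x * u x + (2 * p x * r x * by_ x + r x * r x * cy x).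
  by apply: filterS E => x [-> _ _]; rewrite vec2_1 addrA !expr2.
have Ec : \near0 x, c' x = q x * q x * u x + (2 * q x * s x * by_ x + s x * s x * cy x).
  by apply: filterS E => x [_ _ ->]; rewrite vec2_1 addrA !expr2.
have s1 : smooth_at 0 (fun x => p x * p x * u x) by smooth.
have s2 : smooth_at 0 (fun x => 2 * p x * r x * by_ x) by smooth.
have s3 : smooth_at 0 (fun x => r x * r x * cy x) by smooth.
have s4 : smooth_at 0 (fun x => q x * q x * u x) by smooth.
have s5 : smooth_at 0 (fun x => 2 * q x * s x * by_ x) by smooth.
have s6 : smooth_at 0 (fun x => s x * s x * cy x) by smooth.
have s23 : smooth_at 0 (fun x => 2 * p x * r x * by_ x + r x * r x * cy x) by smooth.
have s56 : smooth_at 0 (fun x => 2 * q x * s x * by_ x + s x * s x * cy x) by smooth.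
have s7 : smooth_at 0 (fun x => p x * p x) by smooth.
have s8 : smooth_at 0 (fun x => 2 * p x * r x) by smooth.
have s9 : smooth_at 0 (fun x => r x * r x) by smooth.
have s10 : smooth_at 0 (fun x => q x * q x) by smooth.
have s11 : smooth_at 0 (fun x => 2 * q x * s x) by smooth.
have s12 : smooth_at 0 (fun x => s x * s x) by smooth.
have s13 : smooth_at 0 (fun x => 2 * q x) by smooth.
have sX : smooth_at 0 X1 by smooth.
have s123 : smooth_at 0 (fun x => p x * p x * u x + (2 * p x * r x * by_ x + r x * r x * cy x)) by smooth.
have s456 : smooth_at 0 (fun x => q x * q x * u x + (2 * q x * s x * by_ x + s x * s x * cy x)) by smooth.
have u10 : p 0 * p 0 * tc 1 0 u = 1.
  have := tc_ext 1 0 sX s123 Ea; rewrite (tcD _ _ s1 s23) (tcD _ _ s2 s3) (tc10M s7 su) (tc10M s8 sby) (tc10M s9 scy) u0 B0 C0 B10 C10 !mulr0 !addr0 tc_X1b /=.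
  by move=> <-.
have p0 : p 0 != 0 by apply/eqP => p0; move/eqP: u10; rewrite p0 !mul0r eq_sym oner_eq0.
have u01 : tc 0 1 u = 0.
  have := tc_ext 0 1 sX s123 Ea; rewrite (tcD _ _ s1 s23) (tcD _ _ s2 s3) (tc01M s7 su) (tc01M s8 sby) (tc01M s9 scy) u0 B0 C0 B01 C01 !mulr0 !addr0 tc_X1b /=.
  by move/esym/eqP; rewrite !mulf_eq0 (negbTE p0) => /eqP.
have u10n : tc 1 0 u != 0 by apply/eqP => p1; move/eqP: u10; rewrite p1 !mulr0 eq_sym oner_eq0.
have q0 : q 0 = 0.
  have := tc_ext 1 0 sc' s456 Ec; rewrite (tcD _ _ s4 s56) (tcD _ _ s5 s6) (tc10M s10 su) (tc10M s11 sby) (tc10M s12 scy) u0 B0 C0 B10 C10 !mulr0 !addr0 c10'.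
  by move/esym/eqP; rewrite !mulf_eq0 (negbTE u10n) orbF orbb => /eqP.
have s0 : s 0 != 0 by apply: contraNneq d0 => ->; rewrite q0 mulr0 mul0r subr0.
have z01 : tc 0 1 z != 0 by apply: contraNneq M => Z; rewrite /minor Z u01 mulr0 mul0r subr0.
have n0 : 0 < tc 1 0 u.
  have : 0 < p 0 * p 0 * tc 1 0 u by rewrite u10 ltr01.
  by rewrite pmulr_rgt0 // -expr2 exprn_even_gt0.
exists u, z, p, q, r, s; split=> //; split=> //.
- by rewrite exprn_even_gt0.
- have := tc_ext 0 2 sc' s456 Ec; rewrite (tcD _ _ s4 s56) (tcD _ _ s5 s6) (tc02M s10 su) (tc02M s11 sby) (tc02M s12 scy) (tc01M sq sq) (tc01M s13 ss) u0 B0 C0 B01 C01 C02 q0 u01.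
  by move=> ->; ring.
move=> c02; split.
  have := tc_ext 1 1 sc' s456 Ec; rewrite (tcD _ _ s4 s56) (tcD _ _ s5 s6) (tc11M s10 su) (tc11M s11 sby) (tc11M s12 scy) (tc01M sq sq) (tc01M s13 ss) (tc10M sq sq) (tc10M s13 ss) u0 B0 C0 B01 C01 B10 C10 C11 q0 u01 c02.
  by move=> ->; ring.
move=> c11; have := tc_ext 2 0 sc' s456 Ec; rewrite (tcD _ _ s4 s56) (tcD _ _ s5 s6) (tc20M s10 su) (tc20M s11 sby) (tc20M s12 scy) (tc10M sq sq) (tc10M s13 ss) u0 B0 C0 B10 C10 C20 q0 c02 c11.
by move=> ->; ring.
Qed.

(** The coefficient of [x1 x2] forces [tc 0 1 z] to be positive, so reversing [x2] is impossible
    even for odd [l]. The sign is then read from the coefficient of [x2^l] on [x1 = 0]. *)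
Lemma NF8_sign (e e' : bool) l : (3 <= l)%N ->
  G_equiv (nf_germ R (NF8 e l)) (nf_germ R (NF8 e' l)) -> e = e'.
Proof.
move=> l3; rewrite !nf_germE => Q.
have [_ sb sc] := smooth_nf R (NF8 e l); have [_ sb' sc'] := smooth_nf R (NF8 e' l).
have Jb : jet1_zero (nf_b (R := R) (NF8 e l)) by split; rewrite /= ?tc_nf.
have lk k : (k < 3)%N -> (k == l) = false by lia.
have Jc (t : bool) : jet1_zero (nf_c (R := R) (NF8 t l)).
  split; rewrite /= ?tc_nf //= ?lk ?mulr0 ?addr0 //.
  by rewrite !mxE mul0r expr0n eq_sym lk // mulr0 addr0.
have [u [z [p [q [r [s [Sc [[p0 n0] k0 m0 _]]]]]]]] := second_jet sb sc sb' sc' Jb (Jc e) (Jc e') Q.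
have c02 (t : bool) : tc 0 2 (nf_c (R := R) (NF8 t l)) = 0.
  by rewrite /= tc_nf /= lk // mulr0 addr0.
have c11 (t : bool) : tc 1 1 (nf_c (R := R) (NF8 t l)) = 1 by rewrite /= tc_nf /= mulr0 addr0.
rewrite !c11 => /(_ (c02 e)) [C11 _].
have {c11 C11} m1 : 0 < tc 0 1 z.
  have : 0 < s 0 ^+ 2 * tc 1 0 u * tc 0 1 z * 1 by rewrite -C11.
  by rewrite mulr1 pmulr_rgt0 // mulr_gt0.
have [[su sz u0 z0 _] [sp sq sr ss _] E] := Sc.
have [g [h [_ sh _ h0 Ez]]] := hadamard2 sz.
pose H (x : 'rV[R]_2) := s (setc 0 0 x) ^+ 2 * ((-1) ^+ e * h (setc 0 0 x) ^+ l).
have sH : smooth_at 0 H by rewrite /H; have := smooth_at_axis 0 ss; have := smooth_at_axis 0 sh; move=> *; smooth.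
have EH : \near0 x, nf_c (NF8 e' l) (setc 0 0 x) = x 0 1 ^+ l * H x.
  apply: filter_app (near_setc0 0 E); apply: filterS (near_setc0 0 (near_neq0 sp p0)) => x px [Ea Eb Ec].
  set y := setc 0 0 x in px Ea Eb Ec *.
  have y1 : y 0 0 = 0 by rewrite /y setc_vec2_1 vec2_1.
  have y2 : y 0 1 = x 0 1 by rewrite /y setc_vec2_1 vec2_2.
  (* On [x1 = 0] the target has zero first row. Away from the origin this forces [r = 0] and then
     [u = 0]: the diffeomorphism preserves the axis. *)
  have uy : u y = 0.
    have [x0|x0] := eqVneq (x 0 1) 0.
      by rewrite (_ : y = 0) //; apply: rV2P; rewrite ?y1 ?y2 ?x0 mxE.
    move: Ea Eb Ec; rewrite /= !vec2_1 !vec2_2 y1 y2 mul0r add0r !mulr0 !addr0.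
    set C := u y * z y + _ => Ea Eb Ec.
    have : p y * r y * ((-1) ^+ e' * x 0 1 ^+ l) = 0.
      rewrite Ec; transitivity (q y * s y * (p y ^+ 2 * u y + r y ^+ 2 * C) + p y * r y * (q y ^+ 2 * u y + s y ^+ 2 * C)).
        by rewrite -Ea mulr0 add0r.
      transitivity ((p y * s y + q y * r y) * (p y * q y * u y + r y * s y * C)); first ring.
      by rewrite -Eb mulr0.
    move/eqP; rewrite !mulf_eq0 signr_eq0 expf_eq0 (negbTE x0) andbF (negbTE px) !orbF => /eqP r0.
    move/esym/eqP: Ea; rewrite r0 expr0n mul0r addr0 mulf_eq0 expf_eq0 (negbTE px) /=.
    by move/eqP.
  rewrite Ec /= !vec2_1 !vec2_2 uy Ez y1 y2 z0 /H -/y !mul0r !mulr0 !add0r exprMn; ring.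
have [_ K] := axis_tc sc' sH EH.
have : (-1) ^+ e' = (s 0 ^+ 2 * tc 0 1 z ^+ l) * (-1) ^+ e :> R.
  move: K; rewrite /H setc00 h0 /= tc_nf /= eqxx mulr1 add0r => ->; ring.
have kk : 0 < s 0 ^+ 2 * tc 0 1 z ^+ l by rewrite mulr_gt0 // exprn_gt0.
case: (e) (e') => -[] //; rewrite expr0 expr1 => Ek; exfalso.
  by have := oppr_lt0 (s 0 ^+ 2 * tc 0 1 z ^+ l); rewrite kk -mulrN1 -Ek ltr10.
by move: kk; rewrite -[X in 0 < X]mulr1 -Ek oppr_gt0 ltr10.
Qed.

End SecondJet.

(** * Separation of families 6 to 10, and within family 5 *)

Section FifthFamily.
Variable R : realType.
Implicit Types (x v : 'rV[R]_2) (a b c h : 'rV[R]_2 -> R).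
Local Notation X1 := (fun x : 'rV[R]_2 => x 0 0).

Lemma sign_gt0 (s : bool) (y : R) : 0 < y -> (0 < (-1) ^+ s * y) = ~~ s.
Proof.
by move=> y0; case: s; rewrite ?expr1 ?expr0 ?mulN1r ?mul1r // oppr_gt0 ltNge ltW.
Qed.

Lemma sign_scale (s t : bool) (k : R) : 0 < k -> (-1) ^+ s = k * (-1) ^+ t -> s = t.
Proof.
move=> k0 E; have := sign_gt0 s (@ltr01 R); rewrite mulr1 E mulrC sign_gt0 //.
by case: (s) (t) => -[].
Qed.

Lemma signed_pow (y : R) n : y ^+ n = (-1) ^+ ((y < 0) && odd n) * `|y| ^+ n.
Proof.
case: ltrP => y0 /=; last by rewrite expr0 mul1r ger0_norm.
by rewrite ltr0_norm // [(- y) ^+ n]exprNn mulrA -(signr_odd _ n) -signr_addb addbb mul1r.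
Qed.

Lemma sign_pow_scale (t e : bool) (k y : R) n : 0 < k -> y != 0 -> k * ((-1) ^+ e * y ^+ n) = (-1) ^+ t ->
  t = e (+) ((y < 0) && odd n).
Proof.
move=> k0 y0 E; have k1 : 0 < k * `|y| ^+ n by rewrite mulr_gt0 // exprn_gt0 // normr_gt0.
by apply: (sign_scale k1); rewrite -E (signed_pow y) signr_addb; ring.
Qed.

(** The forms whose 1-jet is [x1] in the first entry and zero elsewhere. *)
Definition nf_tail f := match f with NF6 _ | NF7 _ _ _ | NF8 _ _ | NF9 _ | NF10 _ => true | _ => false end.

Lemma nf_tail_jets f : nf_tail f -> nf_range f ->
  [/\ jet1_zero (nf_b (R := R) f), jet1_zero (nf_c (R := R) f),
    tc 0 2 (nf_c (R := R) f) = (if f is NF7 s _ _ then (-1) ^+ s else 0),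
    tc 1 1 (nf_c (R := R) f) = (match f with NF8 _ _ | NF9 _ => 1 | _ => 0 end) &
    match f with NF6 s | NF10 s => tc 2 0 (nf_c (R := R) f) = (-1) ^+ s | _ => True end].
Proof.
case: f => //= [s|s1 s2 l|s l|l|s] _ rg.
- split=> //; try split; rewrite /= ?tc_nf //= ?mxE ?expr0n //= ?mulr0 ?mul0r ?mulr1 ?addr0 ?add0r //.
- have [k0 k1 k2] : [/\ (l == 0%N) = false, (0%N == l) = false & (1%N == l) = false] by split; lia.
  split=> //; try split; rewrite /= ?tc_nf //= ?mxE ?expr0n ?k0 ?k1 ?k2 //= ?mulr0 ?mul0r ?mulr1 ?addr0 ?add0r //.
- have [k0 k1 k2] : [/\ (l == 0%N) = false, (1%N == l) = false & (2%N == l) = false] by split; lia.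
  split=> //; try split; rewrite /= ?tc_nf //= ?mxE ?expr0n ?k0 ?k1 ?k2 //= ?mulr0 ?mul0r ?mulr1 ?addr0 ?add0r //.
- have [k0 k1] : (l == 0%N) = false /\ (1%N == l) = false by lia.
  split=> //; try split; rewrite /= ?tc_nf //= ?mxE ?expr0n ?k0 ?k1 //= ?mulr0 ?mul0r ?mulr1 ?addr0 ?add0r //.
- split=> //; try split; rewrite /= ?tc_nf //= ?mxE ?expr0n //= ?mulr0 ?mul0r ?mulr1 ?addr0 ?add0r //.
Qed.

(** The coefficient of [x2^2] singles out family 7 and its first sign, that of [x1 x2] families 8
    and 9, and that of [x1^2] gives the signs in 6 and 10. Codimensions do the rest: [2 l] against
    [2 m + 1], and 6 against 7. *)
Lemma equiv_tail f g : nf_tail f -> nf_tail g -> nf_range f -> nf_range g ->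
  G_equiv (nf_germ R f) (nf_germ R g) -> f = g.
Proof.
move=> tf tg rf rg Q; have [cod _ _ _ _] := equiv_nf_tags rf rg Q.
have [Bf Cf f02 f11 f20] := nf_tail_jets tf rf; have [_ Cg g02 g11 g20] := nf_tail_jets tg rg.
have [_ sb sc] := smooth_nf R f; have [_ sb' sc'] := smooth_nf R g.
have Q2 : G_equiv (germ3 X1 (nf_b f) (nf_c f)) (germ3 X1 (nf_b g) (nf_c g)).
  have ta n : nf_tail n -> nf_a n = X1 by case: n.
  by move: Q; rewrite !nf_germE !ta.
have [u [z [p [q [r [s [_ [[_ n0] k0 m0 E02 E]]]]]]]] := second_jet sb sc sb' sc' Bf Cf Cg Q2.
have km : 0 < s 0 ^+ 2 * tc 0 1 z ^+ 2 by rewrite mulr_gt0 // exprn_even_gt0.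
have kn : 0 < s 0 ^+ 2 * tc 1 0 u ^+ 2 by rewrite mulr_gt0 // exprn_gt0.
have no1 (k : R) (t : bool) : 0 < k -> 0 <> k * (-1) ^+ t.
  by move=> k1 /esym/eqP; rewrite mulf_eq0 signr_eq0 orbF gt_eqF.
have no2 (k : R) (t : bool) : (-1) ^+ t <> k * 0 by rewrite mulr0 => /eqP; rewrite signr_eq0.
have no3 : 0 <> s 0 ^+ 2 * tc 1 0 u * tc 0 1 z * 1.
  by apply/eqP; rewrite eq_sym mulr1 mulf_neq0 // gt_eqF // mulr_gt0.
have no4 (k : R) : 1 <> k * 0 by rewrite mulr0 => /eqP; rewrite oner_eq0.
rewrite {}f02 {}g02 in E02 E; rewrite {}f11 {}g11 in E.
case: f g {Bf Cf Cg sb sc sb' sc' Q2} tf tg rf rg Q cod f20 g20 E02 E =>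
  [||? ?|?|? ? ? ?|s1|s1 s2 l|s1 l|l|s1] [||? ?|?|? ? ? ?|t1|t1 t2 m|t1 m|m|t1] //= _ _ rf rg Q cod f20 g20 E02 E;
  try (by case: (no1 _ _ km E02)); try (by case: (no2 _ _ E02)); try (have [E1 E2] := E erefl);
  try (by case: (no3 E1)); try (by case: (no4 _ E1)); try (exfalso; lia).
- by have := E2 erefl; rewrite f20 g20 => /(sign_scale kn) ->.
- have lm : l = m by lia.
  by rewrite -lm -(sign_scale km E02) in Q *; rewrite (NF7_sign Q).
- have lm : l = m by lia.
  by rewrite -lm in Q *; rewrite (NF8_sign rf Q).
- by congr NF9; lia.
- by have := E2 erefl; rewrite f20 g20 => /(sign_scale kn) ->.
Qed.

(** On [x1 = 0] the germ is diagonal. [t] selects the half [x2 < 0], and the condition says that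
    both diagonal entries have the sign [w] there. *)
Definition NF5_definite (w s1 s2 : bool) l1 l2 (t : bool) :=
  (s1 (+) (t && odd l1) == w) && (s2 (+) (t && odd l2) == w).

(** Off the axis [x1 = 0] the term [- x1^2] only lowers the determinant, so definiteness is decided
    by the sign of [x2] alone. *)
Lemma nf_never_NF5 (w s1 s2 : bool) l1 l2 : (0 < l1)%N -> (0 < l2)%N ->
  nf_never ((-1) ^+ w : R) (NF5 s1 s2 l1 l2) <->
  ~~ (NF5_definite w s1 s2 l1 l2 false || NF5_definite w s1 s2 l1 l2 true).
Proof.
move=> l10 l20; have E (s t : bool) (y : R) n : (-1) ^+ s * ((-1) ^+ t * y) ^+ n = (-1) ^+ (s (+) (t && odd n)) * y ^+ n.
  by rewrite exprMn -exprM mulrA -(signr_odd _ (t * n)) -signr_addb oddM; case: t.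
split; last first.
  move=> N; apply: filterE => x [] /= H1 H2; move/negP: N; apply.
  suff : NF5_definite w s1 s2 l1 l2 (x 0 1 < 0) by case: (_ < 0) => ->; rewrite ?orbT.
  have y0 : x 0 1 != 0.
    by apply/eqP => y0; move: H1; rewrite y0 expr0n gtn_eqF // !mulr0 ltxx.
  have D : 0 < (-1) ^+ s1 * x 0 1 ^+ l1 * ((-1) ^+ s2 * x 0 1 ^+ l2).
    by apply: lt_le_trans H2 _; rewrite gerDl oppr_le0 sqr_ge0.
  have p1 n : 0 < `|x 0 1| ^+ n by rewrite exprn_gt0 // normr_gt0.
  move: H1 D; rewrite !(signed_pow (x 0 1)) !(mulrA ((-1) ^+ s1)) !(mulrA ((-1) ^+ s2)) -!signr_addb (mulrA ((-1) ^+ w)) -signr_addb.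
  rewrite mulrACA -signr_addb !sign_gt0 ?mulr_gt0 // /NF5_definite.
  by move: (_ && odd l1) (_ && odd l2) => b1 b2; case: (w) (s1) (s2) b1 b2 => -[] [] [] [].
move=> /near_axes[t [t0 H]]; apply/negP => D.
have [d] : exists d, NF5_definite w s1 s2 l1 l2 d by case/orP: D; [exists false|exists true].
move=> /andP[/eqP E1 /eqP E2]; have [_] := H d; apply; rewrite /= vec2_1 vec2_2 !E E1 E2 expr0n subr0.
rewrite mulrA sqr_sign mul1r mulrACA sqr_sign mul1r; split; first exact: exprn_gt0.
by rewrite mulr_gt0 // exprn_gt0.
Qed.

Lemma NF5_definite_equiv (w s1 s2 t1 t2 : bool) l1 l2 m1 m2 : (0 < l1)%N -> (0 < l2)%N -> (0 < m1)%N -> (0 < m2)%N ->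
  G_equiv (nf_germ R (NF5 s1 s2 l1 l2)) (nf_germ R (NF5 t1 t2 m1 m2)) ->
  NF5_definite w s1 s2 l1 l2 false || NF5_definite w s1 s2 l1 l2 true =
  NF5_definite w t1 t2 m1 m2 false || NF5_definite w t1 t2 m1 m2 true.
Proof.
move=> l10 l20 m10 m20 Q; apply: negb_inj.
exact: (@nf_never_inv _ (fun f => if f is NF5 s1 s2 l1 l2 then
  ~~ (NF5_definite w s1 s2 l1 l2 false || NF5_definite w s1 s2 l1 l2 true) else true) ((-1) ^+ w) _ _ (sqr_sign R w)
  (nf_never_NF5 w s1 s2 l10 l20) (nf_never_NF5 w t1 t2 m10 m20) Q).
Qed.

Lemma axis_order_unique (f H K : 'rV[R]_2 -> R) l m : smooth_at 0 f -> smooth_at 0 H -> smooth_at 0 K ->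
  H 0 != 0 -> K 0 != 0 ->
  (\near0 x, f (setc 0 0 x) = x 0 1 ^+ l * H x) ->
  (\near0 x, f (setc 0 0 x) = x 0 1 ^+ m * K x) -> l = m /\ H 0 = K 0.
Proof.
move=> sf sH sK H0 K0 /(axis_tc sf sH)[H1 H2] /(axis_tc sf sK)[K1 K2].
case: (ltngtP l m) => lm.
- by move: H0; rewrite -H2 K1 // eqxx.
- by move: K0; rewrite -K2 H1 // eqxx.
- by rewrite -H2 -K2 lm.
Qed.

(** At 0 the congruence is diagonal or antidiagonal, because the diagonal entries of the target have
    no 1-jet. On [x1 = 0] the off-diagonal entry serves to eliminate [u]; the relations left between
    powers of [x2] give orders and signs. [d] records whether the direction of [x2] is reversed. *)
Lemma NF5_orders (s1 s2 t1 t2 : bool) l1 l2 m1 m2 : (2 <= l2 <= l1)%N -> (2 <= m2 <= m1)%N ->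
  G_equiv (nf_germ R (NF5 s1 s2 l1 l2)) (nf_germ R (NF5 t1 t2 m1 m2)) ->
  exists d : bool, (l2 = m2 /\ t2 = s2 (+) (d && odd l2)) \/
    [/\ m1 = l2, t1 = s2 (+) (d && odd l2) & l1 = l2 -> l2 = m2 /\ t2 = s1 (+) (d && odd l1)].
Proof.
move=> /andP[l22 l12] /andP[m22 m12]; rewrite !nf_germE => /G_equiv_scalar[u [z [p [q [r [s]]]]]].
move=> [[su sz u0 z0 M] [sp sq sr ss d0] E].
have [g [h [_ sh _ h0 Ez]]] := hadamard2 sz.
pose N x := p x * s x + q x * r x; pose D x := p x * s x - q x * r x.
have sN : smooth_at 0 N by rewrite /N; smooth.
have sD : smooth_at 0 D by rewrite /D; smooth.
have [sa sb sc] := smooth_nf R (NF5 s1 s2 l1 l2); have [sa' sb' sc'] := smooth_nf R (NF5 t1 t2 m1 m2).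
have jets (e : bool) l : (2 <= l)%N -> jet1_zero (fun x : 'rV[R]_2 => (-1) ^+ e * x 0 1 ^+ l).
  move=> ll; have [k0 k1 k2] : [/\ (0%N == l) = false, (1%N == l) = false & (l == 0%N) = false] by split; lia.
  by split; rewrite ?mxE ?expr0n ?tc_nf /= ?k0 ?k1 ?k2 ?mulr0.
have comp f : smooth_at 0 f -> jet1_zero f -> jet1_zero (fun x => f (vec2 (u x) (z x))).
  move=> sf [f0 f10 f01]; have [E1 E2] := tc_comp1 sf su sz u0 z0.
  by split; rewrite ?E1 ?E2 ?f10 ?f01 ?mul0r ?addr0 // u0 z0 vec200.
pose ay x : R := nf_a (NF5 s1 s2 l1 l2) (vec2 (u x) (z x)).
pose cy x : R := nf_c (NF5 s1 s2 l1 l2) (vec2 (u x) (z x)).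
have say : smooth_at 0 ay by exact: smooth_at_comp0.
have scy : smooth_at 0 cy by exact: smooth_at_comp0.
have [a0 a10 a01] : jet1_zero ay by apply: comp (sa) (jets s1 l1 _); lia.
have [c0 c10 c01] : jet1_zero cy by exact: comp (sc) (jets s2 l2 _).
have Ea : \near0 x, (-1) ^+ t1 * x 0 1 ^+ m1 =
    p x * p x * ay x + (2 * p x * r x * u x + r x * r x * cy x).
  apply: filterS E => x [E1 _ _]; apply: etrans E1 _; rewrite /ay /cy /N /= !vec2_1 !vec2_2; ring.
have Eb : \near0 x, x 0 0 = p x * q x * ay x + (N x * u x + r x * s x * cy x).
  apply: filterS E => x [_ E1 _]; apply: etrans E1 _; rewrite /ay /cy /N /= !vec2_1 !vec2_2; ring.
have Ec : \near0 x, (-1) ^+ t2 * x 0 1 ^+ m2 =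
    q x * q x * ay x + (2 * q x * s x * u x + s x * s x * cy x).
  apply: filterS E => x [_ _ E1]; apply: etrans E1 _; rewrite /ay /cy /N /= !vec2_1 !vec2_2; ring.
have s_1 : smooth_at 0 (fun x => p x * p x) by smooth.
have s_2 : smooth_at 0 (fun x => 2 * p x * r x) by smooth.
have s_3 : smooth_at 0 (fun x => r x * r x) by smooth.
have s_4 : smooth_at 0 (fun x => q x * q x) by smooth.
have s_5 : smooth_at 0 (fun x => 2 * q x * s x) by smooth.
have s_6 : smooth_at 0 (fun x => s x * s x) by smooth.
have s_7 : smooth_at 0 (fun x => p x * q x) by smooth.
have s_8 : smooth_at 0 (fun x => r x * s x) by smooth.
have jet (f g2 h2 : 'rV[R]_2 -> R) : smooth_at 0 f -> smooth_at 0 g2 -> smooth_at 0 h2 ->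
    let F := fun x => f x * ay x + (g2 x * u x + h2 x * cy x) in
    [/\ smooth_at 0 F, tc 1 0 F = g2 0 * tc 1 0 u & tc 0 1 F = g2 0 * tc 0 1 u].
  move=> sf sg' sh'; have r1 : smooth_at 0 (fun x => f x * ay x) by smooth.
  have r2 : smooth_at 0 (fun x => g2 x * u x) by smooth.
  have r3 : smooth_at 0 (fun x => h2 x * cy x) by smooth.
  have r4 : smooth_at 0 (fun x => g2 x * u x + h2 x * cy x) by smooth.
  split; first by smooth.
    rewrite (tcD _ _ r1 r4) (tcD _ _ r2 r3) (tc10M sf say) (tc10M sg' su) (tc10M sh' scy).
    by rewrite a0 c0 u0 a10 c10 !mulr0 !addr0 add0r.
  rewrite (tcD _ _ r1 r4) (tcD _ _ r2 r3) (tc01M sf say) (tc01M sg' su) (tc01M sh' scy).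
  by rewrite a0 c0 u0 a01 c01 !mulr0 !addr0 add0r.
have uu (k : R) : k * tc 1 0 u = 0 -> k * tc 0 1 u = 0 -> k = 0.
  move=> /eqP; rewrite mulf_eq0 => /orP[/eqP->//|/eqP U1] /eqP; rewrite mulf_eq0 => /orP[/eqP->//|/eqP U2].
  by move: M; rewrite /minor U1 U2 !mul0r subr0 eqxx.
(* [2 p r] is the coefficient of [u] in the new first entry, and the differential of [u] at 0 is
   nonzero. *)
have pr0 : p 0 * r 0 = 0.
  have [sF F1 F2] := jet _ _ _ s_1 s_2 s_3; have [_ J1 J2] := jets t1 m1 ltac:(lia).
  have /uu : (2 * p 0 * r 0) * tc 1 0 u = 0 by rewrite -F1 -(tc_ext 1 0 sa' sF Ea).
  have Z : (2 * p 0 * r 0) * tc 0 1 u = 0 by rewrite -F2 -(tc_ext 0 1 sa' sF Ea).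
  by move=> /(_ Z) /eqP; rewrite -mulrA mulf_eq0 pnatr_eq0 => /eqP.
have qs0 : q 0 * s 0 = 0.
  have [sF F1 F2] := jet _ _ _ s_4 s_5 s_6; have [_ J1 J2] := jets t2 m2 m22.
  have /uu : (2 * q 0 * s 0) * tc 1 0 u = 0 by rewrite -F1 -(tc_ext 1 0 sc' sF Ec).
  have Z : (2 * q 0 * s 0) * tc 0 1 u = 0 by rewrite -F2 -(tc_ext 0 1 sc' sF Ec).
  by move=> /(_ Z) /eqP; rewrite -mulrA mulf_eq0 pnatr_eq0 => /eqP.
have N0 : N 0 != 0.
  have E2 : N 0 ^+ 2 = (p 0 * s 0 - q 0 * r 0) ^+ 2.
    transitivity ((p 0 * s 0 - q 0 * r 0) ^+ 2 + 4 * (p 0 * r 0) * (q 0 * s 0)); first by rewrite /N; ring.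
    by rewrite pr0 mulr0 mul0r addr0.
  by apply: contraNneq d0 => N0; move: E2; rewrite N0 expr0n => /esym/eqP; rewrite expf_eq0.
have u01 : tc 0 1 u = 0.
  have [sF F1 F2] := jet _ _ _ s_7 sN s_8.
  have : N 0 * tc 0 1 u = 0 by rewrite -F2 -(tc_ext 0 1 sb' sF Eb) /= tc_nf.
  by move/eqP; rewrite mulf_eq0 (negbTE N0) => /eqP.
have b0 : tc 0 1 z != 0 by apply: contraNneq M => Z; rewrite /minor Z u01 mulr0 mul0r subr0.
exists (tc 0 1 z < 0).
have AX : \near0 x, let y := setc 0 0 x in
    let A := (-1) ^+ s1 * (x 0 1 * h y) ^+ l1 in let C := (-1) ^+ s2 * (x 0 1 * h y) ^+ l2 in
    N y * ((-1) ^+ t1 * x 0 1 ^+ m1) = D y * (p y ^+ 2 * A - r y ^+ 2 * C) /\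
    N y * ((-1) ^+ t2 * x 0 1 ^+ m2) = D y * (s y ^+ 2 * C - q y ^+ 2 * A).
  apply: filter_app (near_setc0 0 Ea); apply: filter_app (near_setc0 0 Eb).
  apply: filterS (near_setc0 0 Ec) => x.
  set y := setc 0 0 x => {}Ec {}Eb {}Ea y_; rewrite {}/y_.
  set A := (-1) ^+ s1 * (x 0 1 * h y) ^+ l1; set C := (-1) ^+ s2 * (x 0 1 * h y) ^+ l2.
  have y1 : y 0 0 = 0 by rewrite /y setc_vec2_1 vec2_1.
  have y2 : y 0 1 = x 0 1 by rewrite /y setc_vec2_1 vec2_2.
  have Az : ay y = A by rewrite /ay /= vec2_2 Ez y1 y2 z0 mul0r !add0r.
  have Cz : cy y = C by rewrite /cy /= vec2_2 Ez y1 y2 z0 mul0r !add0r.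
  move: Ea Eb Ec; rewrite y1 y2 Az Cz => -> Eb ->.
  have Nu : N y * u y = - (p y * q y * A + r y * s y * C).
    by apply: (@addrI _ (p y * q y * A + r y * s y * C)); rewrite subrr [RHS]Eb; ring.
  split.
    transitivity (N y * (p y * p y * A + r y * r y * C) + 2 * p y * r y * (N y * u y)); first ring.
    by rewrite Nu /N /D; ring.
  transitivity (N y * (q y * q y * A + s y * s y * C) + 2 * q y * s y * (N y * u y)); first ring.
  by rewrite Nu /N /D; ring.
have step (t e : bool) m l (G : 'rV[R]_2 -> R) (k : R) : smooth_at 0 G -> 0 < k ->
    G 0 = N 0 * (k * ((-1) ^+ e * tc 0 1 z ^+ l)) ->
    (\near0 x, N (setc 0 0 x) * ((-1) ^+ t * x 0 1 ^+ m) = x 0 1 ^+ l * G x) ->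
    l = m /\ t = e (+) ((tc 0 1 z < 0) && odd l).
  move=> sG k0 G0 EG; have sNx := smooth_at_axis 0 sN.
  have sf : smooth_at 0 (fun x => N x * ((-1) ^+ t * x 0 1 ^+ m)) by smooth.
  have sK : smooth_at 0 (fun x => N (setc 0 0 x) * (-1) ^+ t) by smooth.
  have y2 x : (setc 0 0 x : 'rV[R]_2) 0 1 = x 0 1 by rewrite setc_vec2_1 vec2_2.
  have [] := axis_order_unique (l := l) (m := m) sf sG sK.
  - by rewrite G0 !mulf_neq0 ?signr_eq0 ?expf_neq0 // gt_eqF.
  - by rewrite setc00 mulf_neq0 ?N0 ?signr_eq0.
  - by apply: filterS EG => x <-; rewrite y2.
  - by apply: filterE => x; rewrite y2; ring.
  move=> lm; rewrite G0 setc00 => /(mulfI N0) E2; split=> //.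
  exact: sign_pow_scale k0 b0 E2.
have spx := smooth_at_axis 0 sp; have sqx := smooth_at_axis 0 sq; have srx := smooth_at_axis 0 sr.
have ssx := smooth_at_axis 0 ss; have shx := smooth_at_axis 0 sh; have sDx := smooth_at_axis 0 sD.
have sq_gt (k : R) : k != 0 -> 0 < k ^+ 2 by move=> k0; rewrite exprn_even_gt0.
(* The diagonal case comes first. In general only the relation dominated by the lower power [x2^l2]
   can be read, the other term contributing [x2^(l1 - l2)]; this is why a single order is obtained
   unless [l1 = l2]. *)
have [r0|r0] := eqVneq (r 0) 0.
  left; have s00 : s 0 != 0 by apply: contraNneq N0 => s00; rewrite /N s00 r0 !mulr0 addr0.
  have q0 : q 0 = 0 by move/eqP: qs0; rewrite mulf_eq0 (negbTE s00) orbF => /eqP.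
  pose G (x : 'rV[R]_2) := D (setc 0 0 x) * (s (setc 0 0 x) ^+ 2 * ((-1) ^+ s2 * h (setc 0 0 x) ^+ l2) -
    q (setc 0 0 x) ^+ 2 * ((-1) ^+ s1 * h (setc 0 0 x) ^+ l1 * x 0 1 ^+ (l1 - l2))).
  apply: (step t2 s2 m2 l2 G (s 0 ^+ 2)); [by rewrite /G; smooth|exact: sq_gt| |].
    by rewrite /G setc00 h0 q0 /N /D r0 q0; ring.
  apply: filterS AX => x [_ ->]; rewrite /G !exprMn -[in x 0 1 ^+ l1](subnK l12) exprD; ring.
have p0 : p 0 = 0 by move/eqP: pr0; rewrite mulf_eq0 (negbTE r0) orbF => /eqP.
have q0 : q 0 != 0 by apply: contraNneq N0 => q0; rewrite /N p0 q0 !mul0r addr0.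
have s00 : s 0 = 0 by move/eqP: qs0; rewrite mulf_eq0 (negbTE q0) => /eqP.
right.
pose G (x : 'rV[R]_2) := D (setc 0 0 x) * (p (setc 0 0 x) ^+ 2 * ((-1) ^+ s1 * h (setc 0 0 x) ^+ l1 * x 0 1 ^+ (l1 - l2)) -
  r (setc 0 0 x) ^+ 2 * ((-1) ^+ s2 * h (setc 0 0 x) ^+ l2)).
have [] := step t1 s2 m1 l2 G (r 0 ^+ 2); [by rewrite /G; smooth|exact: sq_gt| | |].
- by rewrite /G setc00 h0 p0 /N /D p0; ring.
- apply: filterS AX => x [-> _]; rewrite /G !exprMn -[in x 0 1 ^+ l1](subnK l12) exprD; ring.
move=> E1 E2; split=> // l12e.
pose G2 (x : 'rV[R]_2) := D (setc 0 0 x) * (s (setc 0 0 x) ^+ 2 * ((-1) ^+ s2 * h (setc 0 0 x) ^+ l2) -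
  q (setc 0 0 x) ^+ 2 * ((-1) ^+ s1 * h (setc 0 0 x) ^+ l2)).
have [] := step t2 s1 m2 l2 G2 (q 0 ^+ 2); [by rewrite /G2; smooth|exact: sq_gt| | |].
- by rewrite /G2 setc00 h0 s00 /N /D s00 p0; ring.
- by apply: filterS AX => x [_ ->]; rewrite /G2 !exprMn l12e; ring.
by rewrite l12e.
Qed.

End FifthFamily.

(** * Equivalence classes of the normal forms *)

Section Classes.
Variable R : realType.

Lemma NF5_flip (s1 s2 : bool) l1 l2 :
  G_equiv (nf_germ R (NF5 s1 s2 l1 l2)) (nf_germ R (NF5 (s1 (+) odd l1) (s2 (+) odd l2) l1 l2)).
Proof.
have E (s : bool) l (y : R) : (-1) ^+ (s (+) odd l) * (- y) ^+ l = (-1) ^+ s * y ^+ l.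
  by rewrite [(- y) ^+ l]exprNn mulrA -(signr_odd _ l) -signr_addb -addbA addbb addbF.
rewrite !nf_germE; have sX2 := @smooth_at_X R 1 0.
apply: (@germ3_coord _ _ _ _ _ _ _ (fun x => x 0 0) (fun x => - x 0 1)); first exact: smooth_at_X.
- by smooth.
- by rewrite mxE.
- by rewrite mxE oppr0.
- by rewrite !tcN ?tc_nf //= oppr0 mulr0 subr0 mul1r oppr_eq0 oner_eq0.
- by apply: filterE => x; rewrite /= vec2_2 E.
- by apply: filterE => x; rewrite /= vec2_1.
- by apply: filterE => x; rewrite /= vec2_2 E.
Qed.

Lemma nf_equiv f g : nf_range f -> nf_range g ->
  G_equiv (nf_germ R f) (nf_germ R g) <-> nf_same_class f g.
Proof.
move=> rf rg; split; last first.
  case=> [->|]; first exact: G_equiv_refl.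
  case: f g {rf rg} => // s1 s2 l1 l2 [] // t1 t2 m1 m2 [-> ->] [[-> ->]|[-> -> ->]]; first exact: NF5_flip.
  by rewrite !nf_germE; apply: G_equiv_swap.
move=> Q; have [cod pos neg zer [k1 k2]] := equiv_nf_tags rf rg Q.
have ker : (nf_corank f == 1%N) = (nf_corank g == 1%N) by apply/eqP/eqP.
have [tf|tf] := boolP (nf_tail f).
  left; apply: equiv_tail Q => //.
  by case: (f) (g) tf pos neg zer ker => [||? ?|?|? ? ? ?|?|? ? ?|? ?|?|?] [||? ?|?|? ? ? ?|?|? ? ?|? ?|?|?].
case: f g {k1 k2} tf rf rg Q cod pos neg zer ker =>
  [||s l|l|s1 s2 l1 l2|?|? ? ?|? ?|?|?] [||t m|m|t1 t2 m1 m2|?|? ? ?|? ?|?|?] //= _ rf rg Q cod _ _ _ _.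
- by left.
- by left.
- by left; rewrite -cod in Q *; rewrite (NF3_sign Q).
- by left; congr NF4; lia.
have [l22 m22] : (2 <= l2)%N /\ (2 <= m2)%N by case/andP: rf; case/andP: rg.
have [l11 m11] : (0 < l1)%N /\ (0 < m1)%N by case/andP: rf; case/andP: rg; lia.
have PD w := @NF5_definite_equiv R w s1 s2 t1 t2 l1 l2 m1 m2 l11 (ltnW l22) m11 (ltnW m22) Q.
have [d] := NF5_orders rf rg Q.
case=> [[E2 t2E]|[E1 t1E H]].
  have E1 : m1 = l1 by lia.
  (* [t2] is known up to the reversal [d]; the definite signs occurring near 0 then determine [t1],
     by a finite check over signs and parities. *)
  have : (t1 == s1) && (t2 == s2) || (t1 == s1 (+) odd l1) && (t2 == s2 (+) odd l2).
    move: (PD true) (PD false); rewrite t2E -E2 E1 /NF5_definite.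
    by case: (s1) (s2) (t1) (d) (odd l1) (odd l2) => -[] [] [] [] [].
  rewrite E1 -E2; case/orP => /andP[/eqP-> /eqP->]; [by left|right].
  by split=> //; left.
(* In the antidiagonal case [m1 = l2], so equal codimensions give [m2 = l1], and the orderings make
   all four orders equal. *)
have [E2 E3] : m2 = l1 /\ l1 = l2 by case/andP: rf; case/andP: rg; lia.
have [_ t2E] := H E3.
have : (t1 == s1) && (t2 == s2) || (t1 == s1 (+) odd l1) && (t2 == s2 (+) odd l2) || (t1 == s2) && (t2 == s1).
  by rewrite t1E t2E E3; case: (s1) (s2) (d) (odd l2) => -[] [] [].
rewrite E1 E2 E3; case/orP => [/orP[]|] /andP[/eqP-> /eqP->]; [by left|right|right].
  by split=> //; left.
by split=> //; right.
Qed.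

End Classes.

(** * Bruce's list *)

Section Complexification.
Variables (K : numFieldType) (i : K).
Hypothesis ii : i ^+ 2 = -1.
Implicit Types (A B : 'rV[K]_2 -> 'M[K]_2) (x v w : 'rV[K]_2).

Lemma G_equiv_linear A B (M P : 'M[K]_2) : M \in unitmx -> P \in unitmx ->
  (forall x, B x = P^T *m A (x *m M) *m P) -> G_equiv A B.
Proof.
have sL (N : 'M[K]_2) : smooth_germ (fun x : 'rV[K]_2 => x *m N).
  apply/smooth_germP; apply: smooth_at_entries => k j.
  rewrite (_ : (fun x => _) = fun x => x 0 0 * N 0 j + x 0 1 * N 1 j).
    by apply: smooth_at_add; apply: smooth_at_mul; [exact: smooth_at_coord|exact: smooth_at_cst|
      exact: smooth_at_coord|exact: smooth_at_cst].
  by apply/funext => x; rewrite mxE sum2 (ord1 k).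
move=> uM uP E; exists (fun x => x *m M), (fun=> P); split.
- split; [exact: sL|by rewrite mul0mx|exists (fun x => x *m invmx M)].
  split; [exact: sL|by rewrite mul0mx| |]; apply: filterE => x.
    by rewrite mulmxK.
  by rewrite mulmxKV.
- by split; [apply/smooth_germP; exact: smooth_at_cst|apply: filterE].
- exact: filterE.
Qed.

Definition iexp (s : bool) : K := if s then i else 1.

Lemma iexp2 s : iexp s ^+ 2 = (-1) ^+ s.
Proof. by case: s; rewrite /iexp ?ii // expr1n. Qed.

Lemma iexp_neq0 s : iexp s != 0.
Proof.
by case: s; rewrite /iexp ?oner_neq0 //; apply: contraNneq (oner_neq0 K) => i0;
  rewrite -[1]opprK -ii i0 expr0n oppr0.
Qed.

Lemma G_equiv_diagonal (a b c a' b' c' : K -> K -> K) (m n p s : K) :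
  m != 0 -> n != 0 -> p != 0 -> s != 0 ->
  (forall y z, a' y z = p ^+ 2 * a (m * y) (n * z)) ->
  (forall y z, b' y z = p * s * b (m * y) (n * z)) ->
  (forall y z, c' y z = s ^+ 2 * c (m * y) (n * z)) ->
  G_equiv (fun x => sym2 (a (x 0 0) (x 0 1)) (b (x 0 0) (x 0 1)) (c (x 0 0) (x 0 1)))
    (fun x => sym2 (a' (x 0 0) (x 0 1)) (b' (x 0 0) (x 0 1)) (c' (x 0 0) (x 0 1))).
Proof.
move=> m0 n0 p0 s0 Ea Eb Ec; apply: (@G_equiv_linear _ _ (mx2 m 0 0 n) (mx2 p 0 0 s)).
- by rewrite mx2_unit mul0r subr0 mulf_neq0.
- by rewrite mx2_unit mul0r subr0 mulf_neq0.
move=> x; rewrite congr_sym2 (_ : (x *m _) 0 0 = m * x 0 0); last first.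
  by rewrite mxE sum2 !mx2E mulr0 addr0 mulrC.
rewrite (_ : (x *m _) 0 1 = n * x 0 1); last by rewrite mxE sum2 !mx2E mulr0 add0r mulrC.
by rewrite Ea Eb Ec; congr sym2; ring.
Qed.

Lemma bruce_of_nf f : nf_range f -> nf_BN f <> None -> exists g : bruce_form,
  [/\ bruce_range g, Some (bruce_number g) = nf_BN f & G_equiv (nf_germ K f) (bruce_germ K g)].
Proof.
have i1 := iexp2; have i0 := iexp_neq0.
have n1 : 1 != 0 :> K by exact: oner_neq0.
have s2 (s : bool) : (-1) ^+ s * (-1) ^+ s = 1 :> K by case: s; rewrite ?expr1 ?expr0 ?mulrNN mulr1.
have s0 (s : bool) : (-1) ^+ s != 0 :> K by rewrite signr_eq0.
case: f => [||s l|l|s1 s2' l1 l2|s|s1 s2' l|s l|l|s] //= rg _.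
(* The coordinates are exchanged, and [iexp s] supplies a square root of the sign. *)
- exists (Bruce1 1 l); split=> //.
  apply: (@G_equiv_linear _ _ (mx2 0 (iexp s)^-1 1 0) (mx2 1 0 0 (iexp s))).
  + by rewrite mx2_unit mul0r sub0r oppr_eq0 mulr1 invr_eq0.
  + by rewrite mx2_unit mul0r subr0 mul1r.
  move=> x; rewrite /= congr_sym2 !mxE !sum2 !mx2E; congr sym2.
  + by rewrite expr1; ring.
  + by field.
  + by rewrite mulr0 add0r mulr1 i1 mulrA s2; ring.
- exists (Bruce1 l l); split=> //; first by split; [exact: ltnW|].
  have nz : 2 != 0 :> K by rewrite pnatr_eq0.
  (* A square root of [- i / 2]. The vectors [(1, i)] and [(i, 1)] are isotropic for the identity
     matrix, so the equal diagonal entries [x1] move off the diagonal and [x2^l] moves onto it. *)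
  pose p : K := (1 - i) / 2.
  have p2 : 2 * i * p ^+ 2 = 1.
    have -> : 2 * i * p ^+ 2 = (2 * i ^+ 1 - 4 * i ^+ 2 + 2 * i * i ^+ 2) / 4 by rewrite /p; field.
    by rewrite ii; field.
  apply: (@G_equiv_linear _ _ 1%:M (mx2 p (i * p) (i * p) p)); first exact: unitmx1.
    rewrite mx2_unit; apply: contraTneq (n1) => E; rewrite negbK -p2.
    have -> : 2 * i * p ^+ 2 = i * (p * p - i * p * (i * p)) + i * p ^+ 2 * (1 + i ^+ 2) by ring.
    by rewrite E ii; apply/eqP; ring.
  move=> x; rewrite /= mulmx1 congr_sym2; congr sym2.
  + transitivity (2 * i * p ^+ 2 * x 0 1 ^+ l + p ^+ 2 * (1 + i ^+ 2) * x 0 0); last by ring.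
    by rewrite p2 ii; ring.
  + transitivity (2 * i * p ^+ 2 * x 0 0 + p ^+ 2 * (1 + i ^+ 2) * x 0 1 ^+ l); last by ring.
    by rewrite p2 ii; ring.
  + transitivity (2 * i * p ^+ 2 * x 0 1 ^+ l + p ^+ 2 * (1 + i ^+ 2) * x 0 0); last by ring.
    by rewrite p2 ii; ring.
- exists (Bruce1 l1 l2); split=> //=; first by case/andP: rg; lia.
  apply: (@G_equiv_diagonal (fun y z => (-1) ^+ s1 * z ^+ l1) (fun y z => y) (fun y z => (-1) ^+ s2' * z ^+ l2)
    (fun y z => z ^+ l1) (fun y z => y) (fun y z => z ^+ l2) ((iexp s1)^-1 * (iexp s2')^-1) 1 (iexp s1) (iexp s2'));
    rewrite ?mulf_neq0 ?invr_eq0 //; move=> y z; rewrite ?i1 ?mulrA ?s2 ?mul1r //; field; by rewrite !i0.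
- exists Bruce5; split=> //=.
  (* [iexp s ^+ 3] is the inverse of [iexp s], so the off-diagonal entry is unchanged. *)
  apply: (@G_equiv_diagonal (fun y z => y) (fun y z => z ^+ 2) (fun y z => (-1) ^+ s * y ^+ 2)
    (fun y z => y) (fun y z => z ^+ 2) (fun y z => y ^+ 2) ((-1) ^+ s) 1 (iexp s) (iexp s ^+ 3));
    rewrite ?expf_neq0 //; move=> y z.
  + by rewrite i1 mulrA s2 mul1r.
  + by transitivity (iexp s ^+ 2 * iexp s ^+ 2 * z ^+ 2); [rewrite !i1 s2 mul1r|ring].
  + by rewrite -exprM mulnC exprM i1; transitivity (((-1) ^+ s * (-1) ^+ s) ^+ 3 * y ^+ 2); [rewrite s2; ring|ring].
- exists (Bruce2 l); split=> //=.
  apply: (@G_equiv_diagonal (fun y z => y) (fun y z => 0) (fun y z => (-1) ^+ s1 * z ^+ 2 + (-1) ^+ s2' * y ^+ l)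
    (fun y z => y) (fun y z => 0) (fun y z => z ^+ 2 + y ^+ l) 1 (iexp s1 * iexp s2') 1 (iexp s2'));
    rewrite ?mulf_neq0 //; move=> y z; rewrite ?expr1n ?mulr0 ?mul1r //.
  transitivity (iexp s2' ^+ 2 * ((-1) ^+ s1 * (iexp s1 ^+ 2 * iexp s2' ^+ 2) * z ^+ 2) + iexp s2' ^+ 2 * (-1) ^+ s2' * y ^+ l); last by ring.
  rewrite !i1 s2; transitivity (((-1) ^+ s1 * (-1) ^+ s1) * ((-1) ^+ s2' * (-1) ^+ s2') * z ^+ 2 + y ^+ l); last by ring.
  by rewrite !s2; ring.
- exists (Bruce3 l); split=> //=; first exact: ltnW.
  apply: (@G_equiv_diagonal (fun y z => y) (fun y z => 0) (fun y z => y * z + (-1) ^+ s * z ^+ l)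
    (fun y z => y) (fun y z => 0) (fun y z => y * z + z ^+ l) ((-1) ^+ s) 1 (iexp s) (iexp s)) => //; move=> y z.
  + by rewrite i1 mulrA s2 mul1r.
  + by rewrite mulr0.
  + rewrite i1 mul1r; transitivity (((-1) ^+ s * (-1) ^+ s) * (y * z + z ^+ l)); last by ring.
    by rewrite s2; ring.
- by exists (Bruce4 l); split=> //; apply: (@G_equiv_diagonal (fun y z => y) (fun y z => z ^+ l) (fun y z => y * z)
    (fun y z => y) (fun y z => z ^+ l) (fun y z => y * z) 1 1 1 1) => // y z; rewrite !mul1r ?expr1n ?mul1r.
- exists Bruce6; split=> //=.
  apply: (@G_equiv_diagonal (fun y z => y) (fun y z => 0) (fun y z => (-1) ^+ s * y ^+ 2 + z ^+ 3)
    (fun y z => y) (fun y z => 0) (fun y z => y ^+ 2 + z ^+ 3) 1 ((-1) ^+ s) 1 (iexp s)) => //; move=> y z.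
  + by rewrite expr1n !mul1r.
  + by rewrite mulr0.
  + rewrite i1 mul1r; transitivity (((-1) ^+ s * (-1) ^+ s) * y ^+ 2 + ((-1) ^+ s * (-1) ^+ s) ^+ 2 * z ^+ 3); last by ring.
    by rewrite s2; ring.
Qed.

Lemma det_translation_equiv A B : smooth_at 0 A -> A 0 = 0 -> G_equiv A B ->
  det_translation B -> det_translation A.
Proof.
move=> sA A0 /(G_equiv_det sA A0)[L [L' [k [[L'0 La] L1 L2 k0 E]]]] [v [v0 H]].
exists (L v); split.
  by apply: contraNneq v0 => Lv; rewrite -(L1 v) Lv L'0.
move=> w; have k20 : k ^+ 2 != 0 by rewrite expf_neq0.
have Lw : L (L' w + v) = w + L v by rewrite La L2.
have E1 := congr1 (fun y => k ^+ 2 * \det ('d A (0 : 'rV[K]_2) y)) Lw.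
have E2 := congr1 (fun y => k ^+ 2 * \det ('d A (0 : 'rV[K]_2) y)) (L2 w).
exact: (mulfI k20 (etrans (esym E1) (etrans (esym (E _)) (etrans (H (L' w)) (etrans (E _) E2))))).
Qed.

Lemma derive_coord0 (j : 'I_2) v : 'D_v (fun x : 'rV[K]_2 => x 0 j) 0 = v 0 j.
Proof.
have d : differentiable (fun x : 'rV[K]_2 => x) (0 : 'rV[K]_2) by exact: ex_diff.
have := derive_entry v 0 j d.
by rewrite derive_id => ->.
Qed.

(** In each family the last entry has no linear term, so [det (dA(0) v)] is minus a square that
    depends on [v 0 0] at most; [e] is the second basis vector. *)
Lemma det_translation_bruce g : bruce_range g -> det_translation (bruce_germ K g).
Proof.
have sc (j : 'I_2) : smooth_at 0 (fun x : 'rV[K]_2 => x 0 j) by exact: smooth_at_coord.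
have sp (j : 'I_2) n : smooth_at 0 (fun x : 'rV[K]_2 => x 0 j ^+ n) by exact: smooth_at_exp.
have s00 : smooth_at 0 (fun _ : 'rV[K]_2 => 0 : K) by exact: smooth_at_cst.
have s12 : smooth_at 0 (fun x : 'rV[K]_2 => x 0 0 * x 0 1) by exact: smooth_at_mul.
have d12 v : 'D_v (fun x : 'rV[K]_2 => x 0 0 * x 0 1) 0 = 0 by apply: derive0_mul => //; rewrite mxE.
have dD (f h : 'rV[K]_2 -> K) : smooth_at 0 f -> smooth_at 0 h -> (forall v, 'D_v f 0 = 0) ->
    (forall v, 'D_v h 0 = 0) -> forall v, 'D_v (fun x => f x + h x) 0 = 0.
  by move=> sf sh Df Dh v; rewrite derive0_add // Df Dh addr0.
have sD (f h : 'rV[K]_2 -> K) : smooth_at 0 f -> smooth_at 0 h -> smooth_at 0 (fun x => f x + h x).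
  exact: smooth_at_add.
pose e : 'rV[K]_2 := \row_j (j != 0)%:R.
have T (a b c : 'rV[K]_2 -> K) : smooth_at 0 a -> smooth_at 0 b -> smooth_at 0 c ->
    (forall v, 'D_v b 0 = v 0 0) \/ (forall v, 'D_v b 0 = 0) -> (forall v, 'D_v c 0 = 0) ->
    det_translation (fun x => sym2 (a x) (b x) (c x)).
  move=> sa sb sc' Db Dc; exists e; split.
    by apply/eqP => /rowP /(_ 1); rewrite !mxE => /eqP; rewrite oner_eq0.
  move=> w; have De v : \det ('d (fun x => sym2 (a x) (b x) (c x)) (0 : 'rV[K]_2) v) = - ('D_v b 0) ^+ 2.
    apply: etrans (congr1 determinant (diff_sym2 v sa sb sc')) _.
    by rewrite det_sym2 Dc mulr0 sub0r.
  apply: etrans (De _) (etrans _ (esym (De _))); congr (- _ ^+ 2).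
  by case: Db => Db; rewrite !Db // !mxE /= addr0.
have d0 v : 'D_v (fun _ : 'rV[K]_2 => 0 : K) 0 = 0 by exact: derive_cst.
have dp (j : 'I_2) n : (2 <= n)%N -> forall v, 'D_v (fun x : 'rV[K]_2 => x 0 j ^+ n) 0 = 0.
  by move=> n2 v; exact: derive0_pow.
case: g => [k l|k|k|k||] /= rg.
- exact: T (sp 1 k) (sc 0) (sp 1 l) (or_introl (derive_coord0 0)) (dp 1 l (proj2 rg)).
- exact: T (sc 0) s00 (sD _ _ (sp 1 _) (sp 0 k)) (or_intror d0) (dD _ _ (sp 1 2%N) (sp 0 k) (dp 1 2%N isT) (dp 0 k rg)).
- exact: T (sc 0) s00 (sD _ _ s12 (sp 1 k)) (or_intror d0) (dD _ _ s12 (sp 1 k) d12 (dp 1 k rg)).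
- exact: T (sc 0) (sp 1 k) s12 (or_intror (dp 1 k rg)) d12.
- exact: T (sc 0) (sp 1 2%N) (sp 0 2%N) (or_intror (dp 1 2%N isT)) (dp 0 2%N isT).
- exact: T (sc 0) s00 (sD _ _ (sp 0 2%N) (sp 1 3%N)) (or_intror d0) (dD _ _ (sp 0 2%N) (sp 1 3%N) (dp 0 2%N isT) (dp 1 3%N isT)).
Qed.

(** The forms [v1 v2] and [- v1^2 - v2^2] are nondegenerate: testing a translation at 0 and at the
    two basis vectors shows that it is zero. *)
Lemma nf12_not_bruce f g : nf_BN f = None -> bruce_range g -> ~ G_equiv (nf_germ K f) (bruce_germ K g).
Proof.
move=> fN rg Q; have sc (j : 'I_2) : smooth_at 0 (fun x : 'rV[K]_2 => x 0 j) by exact: smooth_at_coord.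
have s00 : smooth_at 0 (fun _ : 'rV[K]_2 => 0 : K) by exact: smooth_at_cst.
have sN : smooth_at 0 (fun x : 'rV[K]_2 => - x 0 0) by exact: smooth_at_opp.
have dN v : 'D_v (fun x : 'rV[K]_2 => - x 0 0) 0 = - v 0 0.
  by apply: etrans (deriveN (diff_derivable (smooth_at_differentiable (sc 0)))) _; rewrite derive_coord0.
pose vec (p q : K) : 'rV[K]_2 := \row_j (if j == 0 then p else q).
have V1 p q : vec p q 0 0 = p by rewrite mxE.
have V2 p q : vec p q 0 1 = q by rewrite mxE.
have V0 v : v 0 0 = 0 -> v 0 1 = 0 -> v = 0.
  by move=> v0 v1; apply/rowP; apply: I2P; rewrite mxE.
case: f fN Q => //= _ Q.
  have D v : \det ('d (nf_germ K NF1) (0 : 'rV[K]_2) v) = v 0 0 * v 0 1.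
    apply: etrans (congr1 determinant (diff_sym2 v (sc 0) s00 (sc 1))) _.
    by rewrite det_sym2 !derive_coord0 derive_cst expr0n subr0.
  have sA : smooth_at 0 (nf_germ K NF1) by exact: smooth_at_sym2.
  have A0 : nf_germ K NF1 0 = 0 by rewrite /nf_germ !mxE sym2_00.
  have [v [/negP v0 H]] := det_translation_equiv sA A0 Q (det_translation_bruce rg).
  have {}H w : (w 0 0 + v 0 0) * (w 0 1 + v 0 1) = w 0 0 * w 0 1.
    by have := etrans (esym (D _)) (etrans (H w) (D w)); rewrite !mxE.
  have := H (vec 0 0); have := H (vec 1 0); have := H (vec 0 1).
  rewrite !V1 !V2 !mul0r !mulr0 !add0r => H1 H2 H3.
  have E1 : v 0 0 = 0 by rewrite -[LHS]mulr1 -[RHS]H1 mulrDr H3 addr0.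
  have E2 : v 0 1 = 0 by rewrite -[LHS]mul1r -[RHS]H2 mulrDl H3 addr0.
  by apply: v0; apply/eqP; exact: V0.
have D v : \det ('d (nf_germ K NF2) (0 : 'rV[K]_2) v) = - v 0 0 ^+ 2 - v 0 1 ^+ 2.
  apply: etrans (congr1 determinant (diff_sym2 v (sc 0) (sc 1) sN)) _.
  by rewrite det_sym2 !derive_coord0 dN mulrN expr2.
have sA : smooth_at 0 (nf_germ K NF2) by exact: smooth_at_sym2.
have A0 : nf_germ K NF2 0 = 0 by rewrite /nf_germ !mxE oppr0 sym2_00.
have [v [/negP v0 H]] := det_translation_equiv sA A0 Q (det_translation_bruce rg).
have {}H w : - (w 0 0 + v 0 0) ^+ 2 - (w 0 1 + v 0 1) ^+ 2 = - w 0 0 ^+ 2 - w 0 1 ^+ 2.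
  by have := etrans (esym (D _)) (etrans (H w) (D w)); rewrite !mxE.
have := H (vec 0 0); have := H (vec 1 0); have := H (vec 0 1).
rewrite !V1 !V2 => H1 H2 H3.
have two (y : K) : 2 * y = 0 -> y = 0 by move=> /eqP; rewrite mulf_eq0 pnatr_eq0 => /eqP.
have E1 : v 0 0 = 0.
  apply: two; transitivity ((- (0 + v 0 0) ^+ 2 - (0 + v 0 1) ^+ 2) - (- (1 + v 0 0) ^+ 2 - (0 + v 0 1) ^+ 2) - 1); first by ring.
  by rewrite H2 H3; ring.
have E2 : v 0 1 = 0.
  apply: two; transitivity ((- (0 + v 0 0) ^+ 2 - (0 + v 0 1) ^+ 2) - (- (0 + v 0 0) ^+ 2 - (1 + v 0 1) ^+ 2) - 1); first by ring.
  by rewrite H1 H3; ring.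
by apply: v0; apply/eqP; exact: V0.
Qed.

End Complexification.

Theorem mainTheorem8 (R : realType) :
  [/\ (forall A : 'rV[R]_2 -> 'M[R]_2,
         sym_germ A -> A 0 = 0 -> (corank A <= 1)%N ->
         (exists d : nat, (d < 9)%N /\ Ge_codim A d) ->
         exists f : normal_form,
           [/\ nf_range f, (nf_cod f < 9)%N & G_equiv A (nf_germ R f)]),
      (forall f : normal_form, nf_range f ->
         [/\ sym_germ (nf_germ R f), nf_germ R f 0 = 0,
             Ge_codim (nf_germ R f) (nf_cod f) &
             corank (nf_germ R f) = nf_corank f]),
      (forall f g : normal_form, nf_range f -> nf_range g ->
         (G_equiv (nf_germ R f) (nf_germ R g) <-> nf_same_class f g)) &
      (forall f : normal_form, nf_range f -> BN_spec R f)].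
Proof.
split.
- exact: simple_of_codim.
- by move=> f rf; split; [exact: sym_germ_nf|exact: nf_germ0|exact: nf_codim|exact: corank_nf].
- exact: nf_equiv.
- move=> f rf; rewrite /BN_spec; case E: (nf_BN f) => [b|].
    have [|g [rg gn Q]] := @bruce_of_nf _ _ (sqr_i R) f rf; first by rewrite E.
    by exists g; split=> //; move: gn; rewrite E => -[].
  by move=> g; exact: nf12_not_bruce.
Qed.
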